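(* Let $V$ be a simple strongly graded-local unitary vertex operator superalgebra and consider the corresponding irreducible graded-local conformal net $\mathcal{A}_V$. Then for every quasi-primary vector $a\in V$, we have $Y_I(a,f)=Y(a,f)$ for all $I\in\mathcal{J}$ and all $f\in C^\infty_{p(a)}(S^1)$ with $\mathrm{supp}f\subset I$, where $Y_I(a,f)$ are the Fredenhagen–Jörß smeared vertex operators of $\mathcal{A}_V$. In particular, one can recover the VOSA structure on $V=\mathcal{H}^{\mathrm{fin}}$ from the graded-local conformal net $\mathcal{A}_V$.
   Context: **VOSA.** A vertex operator superalgebra (VOSA) $V=(V,\Omega,T,Y,\nu)$ consists of a complex vector superspace $V=V_{\bar 0}\oplus V_{\bar 1}$ (parity automorphism $\Gamma_V=1$ on $V_{\bar0}$, $-1$ on $V_{\bar 1}$; $p(a)$ denotes the parity of $a$), an even vector $\Omega$ (vacuum), an even endomorphism $T$, and a linear parity-preserving map $a\mapsto Y(a,z)=\sum_{n\in\mathbb{Z}}a_{(n)}z^{-n-1}\in \mathrm{End}(V)[[z,z^{-1}]]$ such that for all $a,b$: $a_{(n)}b=0$ for $n$ large; $[T,Y(a,z)]=\frac{d}{dz}Y(a,z)$; $Y(\Omega,z)=1_V$, $T\Omega=0$, $a_{(-1)}\Omega=a$; $(z-w)^N[Y(a,z),Y(b,w)]=0$ for $N$ large (graded commutator); together with an even vector $\nu$ (conformal vector) such that $L_n:=\nu_{(n+1)}$ satisfy the Virasoro relations with some central charge $c$, $L_{-1}=T$, $L_0$ is diagonalizable with eigenspaces $V_n=\ker(L_0-n)$,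 $V_{\bar0}=\bigoplus_{n\in\mathbb{Z}}V_n$, $V_{\bar1}=\bigoplus_{n\in\mathbb{Z}-\frac12}V_n$, $\dim V_n<\infty$, $V_n=0$ for $n$ sufficiently negative. A non-zero $a\in V_{d_a}$ is homogeneous of conformal weight $d_a$, and $a_n:=a_{(n+d_a-1)}$ for $n\in\mathbb{Z}-d_a$, $a_n:=0$ for the other $n\in\frac12\mathbb{Z}$; extended to all $a\in V$ by linearity. A homogeneous $a$ with $L_1a=0$ is quasi-primary. $V$ is simple if its only ideals ($T$-invariant subspaces $\mathscr{J}$ with $a_{(n)}\mathscr{J}\subseteq \mathscr{J}$ for all $a\in V,n\in\mathbb{Z}$) are $0$ and $V$. **Unitary VOSA.** A VOSA with a scalar product $(\cdot|\cdot)$ (positive-definite Hermitian, linear in the second variable), $(\Omega|\Omega)=1$, and an antilinear bijection $\theta$ of $V$ preserving $(n)$-products, $\Omega$, $\nu$, with $\theta^2=1$, such that $(Y(\theta(a),z)b|c)=(b|Y(e^{zL_1}(-1)^{2L_0^2+L_0}z^{-2L_0}a,z^{-1})c)$ for all $a,b,c\in V$. **Energy bounds and smeared vertex operators.** $\mathcal{H}$ is the Hilbert space completion of $V$. $V$ is energy-bounded if for every $a\in V$ there are $M,s,k\ge 0$ with $\|a_nb\|\le M(|n|+1)^s\|(L_0+1)^kb\|$ for all $n\in\frac12\mathbb{Z}$, $b\in V$. Let $\chi(e^{ix})=e^{ix/2}$ for $x\in(-\pi,\pi]$, $C^\infty_{\bar0}(S^1):=C^\infty(S^1)$, $C^\infty_{\bar1}(S^1):=\{\chi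 h: h\in C^\infty(S^1)\}$, $\widehat f_n=\frac1{2\pi}\int_{-\pi}^{\pi}f(e^{ix})e^{-inx}dx$. For $V$ energy-bounded, $a\in V_p$ and $f\in C^\infty_p(S^1)$, $Y(a,f)$ is the closure on $\mathcal{H}$ of the operator with domain $V$, $c\mapsto\sum_n\widehat f_na_nc$, the sum over $n\in\mathbb{Z}$ if $p=\bar0$ and over $n\in\mathbb{Z}-\frac12$ if $p=\bar1$. **The net and strong graded locality.** $\mathcal{J}$ is the set of open, connected, non-empty, non-dense subsets of $S^1$; $I'=S^1\setminus\overline I$. $W^*(\cdot)$ is the von Neumann algebra generated by a family of closed densely defined operators. For $V$ energy-bounded, $\mathcal{A}_V(I):=W^*(\{Y(a,f): a\in V_{\bar0}\cup V_{\bar1},\ f\in C^\infty_{p(a)}(S^1),\ \mathrm{supp} f\subset I\})$, $I\in\mathcal{J}$. Let $\Gamma$ be the extension of $\Gamma_V$ to $\mathcal{H}$ and $Z:=\frac{1-i\Gamma}{1-i}$. $V$ is strongly graded-local if it is energy-bounded and $\mathcal{A}_V(I')\subseteq Z\mathcal{A}_V(I)'Z^*$ for all $I\in\mathcal{J}$. For simple strongly graded-local $V$, $\mathcal{A}_V$ is an irreducible graded-local conformal net with vacuum $\Omega$, whose (unique) representation $U$ of the universal cover of the Möbius group has derived operators $L_{-1},L_0,L_1$, which are those of $V$ on $\mathcal{H}^{\mathrm{fin}}:=\bigoplus_{n\in\frac12\mathbb{Z}_{\ge0}}\ker(L_0-n1_{\mathcal{H}})=V$ (algebraic direct sum). **Fredenhagen–Jörß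 (FJ) smeared vertex operators.** Let $a$ be quasi-primary of conformal weight $d_a$. Put $a^n:=\frac{L_{-1}^na}{n!}$ for $n\in\mathbb{Z}_{\ge0}$ and, for $f\in C^\infty_{p(a)}(S^1)$, $a(f):=\sum_{n\ge0}\widehat f_{-n-d_a}a^n\in\mathcal{H}$ (convergent). For $I\in\mathcal{J}$ and $\mathrm{supp}f\subset I$, $Y_I(a,f)$ is the closure of the (closable) operator with domain $\mathcal{A}_V(I)'\Omega$ given by $A\Omega\mapsto A\,a(f)$, $A\in\mathcal{A}_V(I)'$ ($\Omega$ is cyclic and separating for $\mathcal{A}_V(I)$). *)

(* Defs.v *)
From HB Require Import structures.
From mathcomp Require Import all_boot all_order all_algebra.
From mathcomp Require Import all_classical all_reals all_analysis.
From mathcomp Require Import complex.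

Set Implicit Arguments.
Unset Strict Implicit.
Unset Printing Implicit Defensive.
Import Order.TTheory GRing.Theory Num.Theory.
Import numFieldNormedType.Exports.
Local Open Scope classical_set_scope.
Local Open Scope ring_scope.

(** Conventions.
    - Half-integers are encoded by their doubles: [D : int] stands for [D / 2].
      This applies to conformal weights, to the index [n] of the modes [a_n]
      and of the Fourier coefficients, but not to the index of [a_(n)].
    - Scalar products are the library's [{dot E for Num.conj}], which are linear
      in the FIRST variable; the scalar product [(x|y)], linear in [y], is
      [sprod d x y := d y x].
    - An unbounded operator is given by its graph.
    - Functions on the circle are functions [R[i] -> R[i]] of which only the
      values at points of modulus [1] are ever used. *)

Definition half (R : realType) (D : int) : R := D%:~R / 2.
Definition halfC (R : realType) (D : int) : R[i] := D%:~R / 2.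
Definition iodd (D : int) : bool := odd `|D|%N.

Definition sprod (R : realType) (E : lmodType R[i])
  (d : {dot E for (@Num.conj R[i])}) (x y : E) : R[i] := d y x.

(** The [Z/2]-grading of a vector superspace is given by its parity
    automorphism; [nprod a n b] is the product [a_(n) b]. *)
Record vosaData (R : realType) := VosaData {
  vcar :> lmodType R[i];
  Gam : {linear vcar -> vcar};
  vac : vcar;
  transl : {linear vcar -> vcar};
  nprod : vcar -> int -> {linear vcar -> vcar};
  nu : vcar }.

Arguments Gam {R v}.
Arguments vac {R v}.
Arguments transl {R v}.
Arguments nprod {R v}.
Arguments nu {R v}.

Section VosaDefs.
Context {R : realType} {V : vosaData R}.
Implicit Types (a b : V) (m n D : int) (p q : bool).

Definition parity p a : Prop := Gam a = (-1) ^+ p *: a.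

Definition scomm p q a m b n (c : V) : V :=
  nprod a m (nprod b n c) - (-1) ^+ (p && q) *: nprod b n (nprod a m c).

Definition Lop n (b : V) : V := nprod nu (n + 1) b.

Definition wt D a : Prop := Lop 0 a = halfC R D *: a.

Definition wt_seq (s : seq (int * V)) : Prop :=
  forall x, x \in s -> wt x.1 x.2.

Definition vsum (s : seq (int * V)) : V := \sum_(x <- s) x.2.

Definition homogeneous D a : Prop := a != 0 /\ wt D a.

Definition quasi_primary D a : Prop := homogeneous D a /\ Lop 1 a = 0.

(** The locality axiom [(z - w)^N [Y(a,z), Y(b,w)] = 0] is stated on the
    coefficient of [z^(-m-1) w^(-n-1)]. The grading axiom says
    that the even (odd) part is the sum of the eigenspaces of [L_0] with
    eigenvalue in [Z] (in [Z - 1/2]); such a sum is automatically direct, and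
    [L_0] is diagonalizable. *)
Record is_vosa : Prop := IsVosa {
  Gam_invol : involutive (@Gam R V);
  vac_even : parity false (vac : V);
  transl_even : forall p a, parity p a -> parity p (transl a);
  nprod_linear : forall n b, linear (fun a => nprod a n b);
  nprod_parity : forall p q a n b, parity p a -> parity q b ->
    parity (p (+) q) (nprod a n b);
  nprod_trunc : forall a b, exists N : int, forall n, N <= n -> nprod a n b = 0;
  transl_deriv : forall a n b,
    transl (nprod a n b) - nprod a n (transl b) = - (n%:~R *: nprod a (n - 1) b);
  nprod_vac : forall n b, nprod vac n b = if n == -1 then b else 0;
  transl_vac : transl (vac : V) = 0;
  nprod_creation : forall a, nprod a (-1) vac = a;
  locality : forall p q a b, parity p a -> parity q b ->
    exists N0 : nat, forall N : nat, (N0 <= N)%N -> forall m n c,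
      \sum_(j < N.+1) ((-1) ^+ j *+ 'C(N, j)) *:
        scomm p q a (m + N%:Z - j%:Z) b (n + j%:Z) c = 0;
  nu_even : parity false (nu : V);
  virasoro : exists cc : R[i], forall m n b,
    Lop m (Lop n b) - Lop n (Lop m b) =
      (m - n)%:~R *: Lop (m + n) b
      + (if m + n == 0 then cc / 12 * (m ^+ 3 - m)%:~R else 0) *: b;
  L_transl : forall b : V, Lop (-1) b = transl b;
  grading : forall p a, parity p a <->
    exists s, [/\ wt_seq s, (forall x, x \in s -> iodd x.1 = p) & a = vsum s];
  wt_findim : forall D, exists (k : nat) (e : 'I_k -> V), forall a, wt D a ->
    exists c : 'I_k -> R[i], a = \sum_i c i *: e i;
  wt_bounded_below : exists D0, forall D a, D < D0 -> wt D a -> a = 0 }.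

Definition simple_vosa : Prop :=
  forall J : set V,
    J 0 -> (forall (c : R[i]) a b, J a -> J b -> J (c *: a + b)) ->
    (forall a, J a -> J (transl a)) ->
    (forall a n b, J b -> J (nprod a n b)) ->
    J = [set 0] \/ J = setT.

(** [a_n] for [a] of weight [D/2] and [n = m/2]. *)
Definition hmode D a m (b : V) : V :=
  if iodd (m + D) then 0 else nprod a (((m + D) %/ 2)%Z - 1) b.

Definition wt_decomp a : seq (int * V) :=
  xget [::] [set s | wt_seq s /\ a = vsum s].

Definition mode a m (b : V) : V := \sum_(x <- wt_decomp a) hmode x.1 x.2 m b.

End VosaDefs.

Arguments is_vosa {R} V.
Arguments simple_vosa {R} V.

Record vosa (R : realType) := Vosa {
  vdata :> vosaData R;
  vosaP : is_vosa vdata }.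

Definition vosa_iso (R : realType) (V W : vosaData R) (phi : V -> W) : Prop :=
  [/\ linear phi, bijective phi &
    [/\ forall a, phi (Gam a) = Gam (phi a),
        phi vac = (vac : W),
        forall a, phi (transl a) = transl (phi a),
        forall a n b, phi (nprod a n b) = nprod (phi a) n (phi b) &
        phi nu = (nu : W)]].

(** Invariance, for [a] of weight [D/2], is the coefficient of [z^(-m-1)] in
    [(Y(theta(a),z)b|c) = (b|Y(e^(z L_1) (-1)^(2 L_0^2 + L_0) z^(-2 L_0) a, z^-1)c)],
    where [z] is a formal variable. On [a] the operator [2 L_0^2 + L_0] is the
    integer [D (D + 1) / 2]. The exponential is a finite sum since [L_1] is
    locally nilpotent. *)
Record is_unitary (R : realType) (V : vosaData R)
    (d : {dot V for (@Num.conj R[i])}) (theta : V -> V) : Prop := IsUnitary {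
  sprod_vac : sprod d vac vac = 1;
  theta_antilinear : forall (c : R[i]) a b,
    theta (c *: a + b) = c^* *: theta a + theta b;
  theta_invol : involutive theta;
  theta_nprod : forall a n b, theta (nprod a n b) = nprod (theta a) n (theta b);
  theta_vac : theta vac = vac;
  theta_nu : theta nu = nu;
  invariance : forall (D : int) (a : V), wt D a ->
    forall N : nat, iter N (Lop 1) a = 0 -> forall (m : int) (b c : V),
      sprod d (nprod (theta a) m b) c =
      \sum_(l < N) (-1) ^ ((D * (D + 1)) %/ 2)%Z / (l`!)%:R *
        sprod d b (nprod (iter l (Lop 1) a) (D - m - 2 - l%:Z) c) }.

Record unitaryVosa (R : realType) := UnitaryVosa {
  uvosa :> vosa R;
  vdot : {dot uvosa for (@Num.conj R[i])};
  theta : uvosa -> uvosa;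
  unitaryP : is_unitary vdot theta }.

Definition vnorm (R : realType) (V : unitaryVosa R) (a : V) : R :=
  Num.sqrt (complex.Re (sprod (vdot V) a a)).

(** [(L_0 + 1)^k], with [k] real, is computed on a decomposition of the vector
    into eigenvectors of [L_0]. *)
Definition energy_bounded (R : realType) (V : unitaryVosa R) : Prop :=
  forall a : V, exists M s k : R, [/\ 0 <= M, 0 <= s, 0 <= k &
    forall (m : int) (t : seq (int * V)), wt_seq t ->
      vnorm (mode a m (vsum t)) <=
      M * (`|half R m| + 1) `^ s *
        vnorm (\sum_(x <- t) (((half R x.1 + 1) `^ k)%:C)%C *: x.2)].

Record hilbert (R : realType) := Hilbert {
  hcar :> completeNormedModType R[i];
  hdot : {dot hcar for (@Num.conj R[i])};
  hnormE : forall x : hcar, `|x| ^+ 2 = hdot x x }.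

Section Operators.
Context {R : realType} {H : hilbert R}.
Implicit Types (A B : H -> H) (S M : set (H -> H)) (T : set (H * H)).

Definition bounded_op A : Prop := linear A /\ continuous A.

Definition adj A : H -> H :=
  xget A [set B | forall x y : H, sprod (hdot H) (A x) y = sprod (hdot H) x (B y)].

Definition commutant S : set (H -> H) :=
  [set B | bounded_op B /\ forall A, S A -> A \o B = B \o A].

Definition von_neumann M : Prop :=
  [/\ (forall A, M A -> bounded_op A),
      (forall A, M A -> M (adj A)) &
      commutant (commutant M) = M].

Definition affiliated T M : Prop :=
  forall B, commutant M B -> forall x y, T (x, y) -> T (B x, B y).

(** The von Neumann algebra generated by a family of closed operators: the
    smallest one to which they are all affiliated. *)
Definition Wstar (F : set (set (H * H))) : set (H -> H) :=
  [set B | forall M, von_neumann M -> (forall T, F T -> affiliated T M) -> M B].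

End Operators.

Definition conj_by (X Y : Type) (f : X -> Y) (g : Y -> X) (S : set (X -> X)) :
  set (Y -> Y) := [set f \o B \o g | B in S].

Section Circle.
Context {R : realType}.
Implicit Types (f h : R[i] -> R[i]) (I : set R[i]).

Definition circle : set R[i] := [set z | `|z| = 1].

Definition expi (x : R) : R[i] := (cos x +i* sin x)%C.

Definition clos I : set R[i] := closure (I : set (R[i])^o).

(** The set [J] of the open, connected, non-empty, non-dense subsets of the
    circle. *)
Definition interval_S1 I : Prop :=
  [/\ exists2 U : set (R[i])^o, open U & I = circle `&` U,
      connected (I : set (R[i])^o),
      I !=set0 &
      ~ (circle `<=` clos I)].

Definition compl_S1 I : set R[i] := circle `\` clos I.

Definition supp f : set R[i] := clos [set z | circle z /\ f z != 0].

Definition smooth_real (g : R -> R) : Prop :=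
  forall (n : nat) (x : R), derivable (derive1n n g) x 1.

Definition smooth_S1 f : Prop :=
  smooth_real (fun x => complex.Re (f (expi x))) /\
  smooth_real (fun x => complex.Im (f (expi x))).

(** [C^oo_p(S^1)]; the factor [expi (x / 2)] is [chi (e^(ix))]. *)
Definition smooth_par (p : bool) f : Prop :=
  if p then
    exists2 h, smooth_S1 h &
      forall x : R, - pi < x <= pi -> f (expi x) = expi (x / 2) * h (expi x)
  else smooth_S1 f.

(** The Fourier coefficient of index [m / 2]. *)
Definition fourier f (m : int) : R[i] :=
  let g x := f (expi x) * expi (- (half R m * x)) in
  (((2 * pi)^-1)%:C)%C *
  (Rintegral (@lebesgue_measure R) `[- pi, pi] (fun x => complex.Re (g x)) +i*
   Rintegral (@lebesgue_measure R) `[- pi, pi] (fun x => complex.Im (g x)))%C.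

End Circle.

Record completion (R : realType) (V : unitaryVosa R) := Completion {
  chil :> hilbert R;
  iota_ : {linear V -> chil};
  iota_isom : forall a b : V,
    sprod (hdot chil) (iota_ a) (iota_ b) = sprod (vdot V) a b;
  iota_dense : closure (range iota_) = setT }.

Section Net.
Context {R : realType} {V : unitaryVosa R} (H : completion V).
Implicit Types (a c : V) (f : R[i] -> R[i]) (I : set R[i]) (p : bool).

Local Notation iota := (iota_ H).

(** The sum over [n = m/2] in [Z] or [Z - 1/2] is taken as the limit of the
    partial sums over [- N <= m <= N] (it converges absolutely when [V] is
    energy-bounded). *)
Definition smear_partial p a f c (N : nat) : H :=
  \sum_(k < N.*2.+1 | iodd (k%:Z - N%:Z) == p)
    fourier f (k%:Z - N%:Z) *: iota (mode a (k%:Z - N%:Z) c).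

Definition smeared p a f : set (H * H) :=
  closure [set xy : H * H | exists c,
    xy.1 = iota c /\ smear_partial p a f c @ \oo --> xy.2].

Definition net I : set (H -> H) :=
  Wstar [set T | exists p a f, [/\ parity p a, smooth_par p f, supp f `<=` I &
    T = smeared p a f]].

Definition GamH : H -> H :=
  xget (fun x : H => x) [set G : H -> H | bounded_op G /\ forall a, G (iota a) = iota (Gam a)].

Definition Zop (x : H) : H := (1 - 'i%C)^-1 *: (x - 'i%C *: GamH x).

Definition strongly_graded_local : Prop :=
  energy_bounded V /\
  forall I, interval_S1 I ->
    net (compl_S1 I) `<=` conj_by Zop (adj Zop) (commutant (net I)).

Definition L0_graph : set (H * H) := closure [set (iota a, iota (Lop 0 a)) | a in setT].

Definition Hfin : set H :=
  [set x | exists s : seq (nat * H),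
    (forall y, y \in s -> L0_graph (y.2, halfC R y.1%:Z *: y.2)) /\
    x = \sum_(y <- s) y.2].

(** The vector [a(f)] (the series converges), for [a] of weight [D/2]. *)
Definition FJ_vector (D : int) a f : H :=
  limn (series (fun n : nat =>
    fourier f (- (2 * n)%:Z - D) *: iota ((n`!)%:R^-1 *: iter n (Lop (-1)) a))).

(** The Fredenhagen-Joerss smeared vertex operators of the net. *)
Definition FJ I (D : int) a f : set (H * H) :=
  closure [set (A (iota vac), A (FJ_vector D a f)) | A in commutant (net I)].

End Net.

Arguments smeared {R V} H p a f.
Arguments net {R V} H I.
Arguments strongly_graded_local {R V} H.
Arguments Hfin {R V} H.
Arguments FJ {R V} H I D a f.

(** Isomorphism of nets: a unitary [Phi], with inverse [Psi], matching the vacuum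
    vectors and the local algebras. The representation of the Moebius group is
    not mentioned since the net and its vacuum determine it. *)
Definition net_iso (R : realType) (V W : unitaryVosa R)
    (H : completion V) (K : completion W) (Phi : H -> K) (Psi : K -> H) : Prop :=
  [/\ linear Phi,
      (cancel Phi Psi /\ cancel Psi Phi),
      (forall x y : H, sprod (hdot K) (Phi x) (Phi y) = sprod (hdot H) x y),
      Phi (iota_ H vac) = iota_ K vac &
      forall I : set R[i], interval_S1 I -> net K I = conj_by Phi Psi (net H I)].

(* Main.v *)
(** The vectors [a^n] with [a] quasi-primary span [V], so it is enough to argue
    with Fourier series of these.

    The inclusion of [FJ] in the smeared field holds because the latter is
    affiliated to the local algebra and maps the vacuum to [a(f)]. Conversely,
    let [E] be the projection onto the closed subspace [FJ] of [H x H]. The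
    entries of [E] commute with the commutant of the algebra of [I], so by graded
    locality their conjugates by [Z] preserve the graph of every field [Y(b, g)]
    with [g] supported in the complement of [I]; applying [E] to the pair
    (vacuum, [a(f)]) of [FJ] then shows that [b(g)] is in the domain of [FJ]. If
    [(x, y)] is orthogonal to [FJ], the functional [c |-> (x|c) + (y|Y(a,f)c)]
    vanishes on all [b(g)], that is, a power series in [e^(it)] vanishes on an
    arc, so it vanishes identically and [FJ] is the whole graph.

    For the reconstruction, let [Phi] be an isomorphism of nets. For disjointly
    supported [f] and [g], twisted locality, applied to bounded operators of
    [A(I)] approximating [Y(a,f)] on the vacuum, relates [(Phi a(f)|b(g)^* )] to
    [(b(g)|Phi a(f)^* )]. With bumps concentrating at points this says that the
    matrix [c_nm] of [Phi] in the vectors [a^n], [b^m], continued to negative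
    indices by its counterpart for the adjoints, is polynomial along diagonals.
    The growth of the norms of [a^n] bounds the degree by the number of zeros,
    which forces [c_nm = 0] off the main diagonal or when the weights differ, and
    determines [c_nn] from [c_00]. Hence [Phi] maps [V] onto [W] and intertwines
    [L_(-1)], [L_0] and [L_1]; by the first part it carries smeared fields to
    smeared fields, hence modes to modes. *)
Require Import Defs.
From mathcomp Require Import all_boot all_order all_algebra.
From mathcomp Require Import all_classical all_reals all_analysis.
From mathcomp Require Import complex.
From mathcomp Require Import ring lra zify.

Set Implicit Arguments.
Unset Strict Implicit.
Unset Printing Implicit Defensive.
Import Order.TTheory GRing.Theory Num.Theory.
Import numFieldNormedType.Exports.
Local Open Scope classical_set_scope.
Local Open Scope ring_scope.


(** * Inner product spaces *)

(** An isomorphism of nets matches only vacua and algebras of bounded operators, while the fields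
    are unbounded and [Phi] is not known to respect the grading. Fields are therefore handled
    through the 2 x 2 matrix of the projection on their graph: its entries are bounded and lie in
    the commutants at hand, and the same matrix supplies the bounded approximations, so that no
    polar decomposition or functional calculus enters. The two sides of the twisted locality
    relation are one-sided double series, one over [n, m >= 0], the other over [n <= - Da],
    [m <= - Db]. They agree at separated points, so their difference is a kernel concentrated on the
    diagonal of the torus; this is why its coefficients are polynomial along diagonals. The zeros
    lie in the gap between [- D] and [0], whose length just suffices against the growth n^(D - 1) of
    the squared norm of [a^n]. In weight 0 there is no gap, but then [T a = 0]. The conformal vector
    needs an argument of its own: [phi] is compatible with all products and with L_(-1), L_0, L_1,
    yet [phi nu = nu] is not immediate from this. *)

Notation cabs := Normc.normc.

(** * Real-valued modulus of complex numbers *)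

Section ComplexModulus.
Context {R : realType}.
Implicit Types (a b c : R[i]) (x y : R).

Lemma cabsE c : `|c| = ((cabs c)%:C)%C.
Proof. by rewrite normc_def; case: c. Qed.

Lemma cabs_ge0 c : 0 <= cabs c.
Proof. by case: c => x y /=; rewrite sqrtr_ge0. Qed.

Lemma cabsM a b : cabs (a * b) = cabs a * cabs b.
Proof. exact: Normc.normcM. Qed.

Lemma cabsD a b : cabs (a + b) <= cabs a + cabs b.
Proof. by rewrite -lecR rmorphD/= -!cabsE; exact: ler_normD. Qed.

Lemma cabsN a : cabs (- a) = cabs a.
Proof. by apply: complexI; rewrite -!cabsE normrN. Qed.

Lemma cabsB a b : cabs (a - b) <= cabs a + cabs b.
Proof. by rewrite (le_trans (cabsD _ _))// cabsN. Qed.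

Lemma cabsV a : cabs a^-1 = (cabs a)^-1.
Proof. exact: Normc.normcV. Qed.

Lemma cabs0 : cabs (0 : R[i]) = 0. Proof. exact: Normc.normc0. Qed.

Lemma cabs1 : cabs (1 : R[i]) = 1. Proof. exact: Normc.normc1. Qed.

Lemma cabs_eq0 a : (cabs a == 0) = (a == 0).
Proof. by rewrite -(inj_eq (@complexI _)) -cabsE normr_eq0. Qed.

Lemma cabsX a n : cabs (a ^+ n) = cabs a ^+ n.
Proof. by elim: n => [|n IH]; rewrite ?cabs1// !exprS cabsM IH. Qed.

Lemma cabsR x : cabs (x%:C)%C = `|x|.
Proof. by rewrite /= expr0n /= addr0 sqrtr_sqr. Qed.

Lemma cabs_conj a : cabs (a^*) = cabs a.
Proof. by apply: complexI; rewrite -!cabsE norm_conjC. Qed.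

Lemma cabs_i : cabs ('i%C : R[i]) = 1.
Proof. by rewrite /= expr0n /= add0r expr1n sqrtr1. Qed.

Lemma cabs_sum I (r : seq I) (P : pred I) (F : I -> R[i]) :
  cabs (\sum_(i <- r | P i) F i) <= \sum_(i <- r | P i) cabs (F i).
Proof.
elim/big_ind2: _ => [|u x v y Hx Hy|//]; first by rewrite cabs0.
by rewrite (le_trans (cabsD _ _))// lerD.
Qed.

Lemma Re_le_cabs a : `|complex.Re a| <= cabs a.
Proof. by rewrite -lecR -cabsE; exact: normc_ge_Re. Qed.

Lemma cabs_le_ReIm a : cabs a <= `|complex.Re a| + `|complex.Im a|.
Proof.
case: a => x y; rewrite {1}[(x +i* y)%C]complexE (le_trans (cabsD _ _))//.
by rewrite cabsM cabs_i mul1r !cabsR.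
Qed.

Lemma mul_conj_cabs a : a * a^* = ((cabs a ^+ 2)%:C)%C.
Proof. by rewrite -normCK cabsE rmorphXn. Qed.

Lemma complex_nat n : (n%:R : R[i]) = ((n%:R)%:C)%C.
Proof. by rewrite rmorph_nat. Qed.

Lemma complex_int (k : int) : (k%:~R : R[i]) = ((k%:~R)%:C)%C.
Proof. by rewrite rmorph_int. Qed.

Lemma cabs_nat n : cabs (n%:R : R[i]) = n%:R.
Proof. by rewrite complex_nat cabsR ger0_norm. Qed.

Lemma conjCR x : ((x%:C)%C)^* = (x%:C)%C.
Proof. exact: conjc_real. Qed.

End ComplexModulus.

(** A predicate on a bare function, so that one theory serves [V], [H], the product [H * H] and the
    scalars [R[i]]. *)
Record is_ip (R : realType) (E : lmodType R[i]) (ip : E -> E -> R[i]) : Prop :=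
  IsIp {
  ipDr : forall x y z, ip x (y + z) = ip x y + ip x z;
  ipZr : forall c x y, ip x (c *: y) = c * ip x y;
  ipC : forall x y, ip y x = (ip x y)^*;
  ip_ge0 : forall x, 0 <= ip x x;
  ip_eq0 : forall x, ip x x = 0 -> x = 0 }.

Lemma sprod_is_ip (R : realType) (E : lmodType R[i])
  (d : {dot E for (@Num.conj R[i])}) : is_ip (sprod d).
Proof.
rewrite /sprod; split.
- by move=> x y z; rewrite linearDl.
- by move=> c x y; rewrite linearZl_LR.
- by move=> x y; rewrite hermC /= mul1r.
- by move=> x; exact: dnorm_ge0.
- by move=> x /eqP; rewrite dnorm_eq0 => /eqP.
Qed.

Definition ipnorm (R : realType) (E : lmodType R[i]) (ip : E -> E -> R[i]) (x : E) : R :=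
  Num.sqrt (complex.Re (ip x x)).

Section InnerProduct.
Context {R : realType} {E : lmodType R[i]} {ip : E -> E -> R[i]} (ipP : is_ip ip).
Implicit Types (x y z : E) (c : R[i]) (A : set E).
Local Notation nm := (ipnorm ip).

Lemma ip0r x : ip x 0 = 0.
Proof. by rewrite -(scale0r 0) (ipZr ipP) mul0r. Qed.
Lemma ip0l x : ip 0 x = 0.
Proof. by rewrite (ipC ipP) ip0r rmorph0. Qed.
Lemma ipDl x y z : ip (x + y) z = ip x z + ip y z.
Proof. by rewrite (ipC ipP) (ipDr ipP) rmorphD /= -!(ipC ipP). Qed.
Lemma ipZl c x y : ip (c *: x) y = c^* * ip x y.
Proof. by rewrite (ipC ipP) (ipZr ipP) rmorphM /= -(ipC ipP). Qed.
Lemma ipNr x y : ip x (- y) = - ip x y.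
Proof. by rewrite -scaleN1r (ipZr ipP) mulN1r. Qed.
Lemma ipNl x y : ip (- x) y = - ip x y.
Proof. by rewrite -scaleN1r ipZl rmorphN1 mulN1r. Qed.
Lemma ipBr x y z : ip x (y - z) = ip x y - ip x z.
Proof. by rewrite (ipDr ipP) ipNr. Qed.
Lemma ipBl x y z : ip (x - y) z = ip x z - ip y z.
Proof. by rewrite ipDl ipNl. Qed.
Lemma ip_sumr I (r : seq I) (P : pred I) (F : I -> E) x :
  ip x (\sum_(i <- r | P i) F i) = \sum_(i <- r | P i) ip x (F i).
Proof.
elim/big_ind2: _ => [|u a v b <- <-|//]; first by rewrite ip0r.
by rewrite (ipDr ipP).
Qed.
Lemma ip_suml I (r : seq I) (P : pred I) (F : I -> E) x :
  ip (\sum_(i <- r | P i) F i) x = \sum_(i <- r | P i) ip (F i) x.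
Proof.
elim/big_ind2: _ => [|u a v b <- <-|//]; first by rewrite ip0l.
by rewrite ipDl.
Qed.

Lemma ip_xx x : ip x x = ((nm x ^+ 2)%:C)%C.
Proof.
have := ip_ge0 ipP x; rewrite lecE => /andP[/eqP i0 r0].
rewrite /ipnorm sqr_sqrtr//.
by rewrite [LHS]complexE i0 raddf0 mulr0 addr0.
Qed.

Lemma nm_ge0 x : 0 <= nm x. Proof. exact: sqrtr_ge0. Qed.

Lemma nm_eq0 x : nm x = 0 -> x = 0.
Proof. by move=> x0; apply: (ip_eq0 ipP); rewrite ip_xx x0 expr0n. Qed.

Lemma nm0 : nm 0 = 0.
Proof. by rewrite /ipnorm ip0r sqrtr0. Qed.

Lemma nm_gt0 x : x != 0 -> 0 < nm x.
Proof.
move=> x0; rewrite lt_neqAle nm_ge0 andbT eq_sym.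
by apply: contraNneq x0 => /nm_eq0 ->.
Qed.

Lemma nmZ c x : nm (c *: x) = cabs c * nm x.
Proof.
apply/eqP; rewrite -(eqrXn2 (_ : 0 < 2)%N)// ?mulr_ge0 ?nm_ge0 ?cabs_ge0//.
apply/eqP/complexI; rewrite -ip_xx ipZl (ipZr ipP) ip_xx exprMn [in RHS]rmorphM /=.
by rewrite mulrA [c^* * c]mulrC mul_conj_cabs.
Qed.

Lemma nmN x : nm (- x) = nm x.
Proof. by rewrite -scaleN1r nmZ cabsN cabs1 mul1r. Qed.

Lemma nm_distC x y : nm (x - y) = nm (y - x).
Proof. by rewrite -nmN opprB. Qed.

Lemma cauchy_schwarz x y : cabs (ip x y) <= nm x * nm y.
Proof.
have [->|y0] := eqVneq y 0; first by rewrite ip0r cabs0 mulr_ge0 ?nm_ge0.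
(* [l *: y] is the projection of [x] on [y]; positivity of the square of [x - l *: y] is the
   inequality. *)
set l := ((nm y ^- 2)%:C)%C * ip y x.
have ny : nm y ^+ 2 != 0 by rewrite expf_neq0// gt_eqF// nm_gt0.
have H : ip y (x - l *: y) = 0.
  rewrite ipBr (ipZr ipP) ip_xx /l mulrAC -rmorphM /= mulVf// mul1r.
  exact: subrr.
have K : ip (x - l *: y) (x - l *: y) = ip x x - l * ip x y.
  by rewrite ipBl ipZl H mulr0 subr0 ipBr (ipZr ipP).
have := ip_ge0 ipP (x - l *: y); rewrite K ip_xx /l -mulrA (ipC ipP) .
rewrite [_^* * _]mulrC mul_conj_cabs -rmorphM -rmorphB /= ler0c subr_ge0.
rewrite mulrC ler_pdivrMr ?exprn_gt0 ?nm_gt0// -exprMn.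
by rewrite ler_pXn2r// nnegrE ?mulr_ge0 ?nm_ge0 ?cabs_ge0.
Qed.

Lemma nmD x y : nm (x + y) <= nm x + nm y.
Proof.
rewrite -(ler_pXn2r (_ : 0 < 2)%N)// ?nnegrE ?addr_ge0 ?nm_ge0//.
have -> : nm (x + y) ^+ 2 = complex.Re (ip (x + y) (x + y)) by rewrite ip_xx.
rewrite ipDl !(ipDr ipP) (ipC ipP x y) !ip_xx !raddfD /= sqrrD -!addrA lerD2l.
have H := cauchy_schwarz x y.
have := le_trans (Re_le_cabs _) H => H1.
have := cauchy_schwarz x y; rewrite -cabs_conj => /(le_trans (Re_le_cabs _)) H2.
apply: lerD; first exact: le_trans (ler_norm _) _.
by rewrite lerD2r; exact: le_trans (ler_norm _) _.
Qed.

Lemma nmB x y : nm (x - y) <= nm x + nm y.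
Proof. by rewrite (le_trans (nmD _ _))// nmN. Qed.

Lemma nm_trans x y z : nm (x - z) <= nm (x - y) + nm (y - z).
Proof. by rewrite (le_trans _ (nmD _ _))// addrA subrK. Qed.

Lemma nm_sum I (r : seq I) (P : pred I) (F : I -> E) :
  nm (\sum_(i <- r | P i) F i) <= \sum_(i <- r | P i) nm (F i).
Proof.
elim/big_ind2: _ => [|u x v y Hx Hy|//]; first by rewrite nm0.
by rewrite (le_trans (nmD _ _))// lerD.
Qed.

Lemma parallelogram x y :
  nm (x + y) ^+ 2 + nm (x - y) ^+ 2 = (nm x ^+ 2 + nm y ^+ 2) *+ 2.
Proof.
apply: complexI; rewrite rmorphMn !rmorphD /= -!ip_xx.
rewrite ipBl !ipBr ipDl !(ipDr ipP); ring.
Qed.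

Lemma pythagoras x y : ip x y = 0 -> nm (x + y) ^+ 2 = nm x ^+ 2 + nm y ^+ 2.
Proof.
move=> xy; apply: complexI; rewrite rmorphD /= -!ip_xx ipDl !(ipDr ipP).
by rewrite (ipC ipP x y) xy rmorph0 addr0 add0r.
Qed.

(** The norm of a [hilbert] takes values in [R[i]] and [V] carries no topology, so convergence and
    closure are restated with the real norm; on Hilbert spaces they are compared with the
    topological notions below. *)
Definition cvs (u : nat -> E) x :=
  forall e : R, 0 < e -> exists N, forall n, (N <= n)%N -> nm (x - u n) < e.

Definition ipcl A : set E :=
  [set x | forall e : R, 0 < e -> exists2 a, A a & nm (x - a) < e].

Definition subspace A : Prop :=
  A 0 /\ forall c x y, A x -> A y -> A (c *: x + y).

Definition ipcauchy (u : nat -> E) :=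
  forall e : R, 0 < e -> exists N, forall m n, (N <= m)%N -> (N <= n)%N ->
    nm (u m - u n) < e.

Definition ipcomplete := forall u, ipcauchy u -> exists x, cvs u x.

Lemma small_eq0 x : (forall e : R, 0 < e -> nm x <= e) -> x = 0.
Proof.
move=> H; apply/nm_eq0/eqP; rewrite eq_le nm_ge0 andbT.
by apply/ler_addgt0Pr => e e0; rewrite add0r H.
Qed.

Lemma cvs_unique u x y : cvs u x -> cvs u y -> x = y.
Proof.
move=> ux uy; apply/eqP; rewrite -subr_eq0; apply/eqP/small_eq0 => e e0.
have e2 : 0 < e / 2 by rewrite divr_gt0.
have [N HN] := ux _ e2; have [M HM] := uy _ e2.
rewrite (le_trans (nm_trans _ (u (maxn N M)) _))// [leRHS]splitr lerD//.
  by rewrite ltW// HN// leq_maxl.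
by rewrite nm_distC ltW// HM// leq_maxr.
Qed.

Lemma cvs_cst x : cvs (fun=> x) x.
Proof. by move=> e e0; exists 0%N => n _; rewrite subrr nm0. Qed.

Lemma cvsD u v x y : cvs u x -> cvs v y -> cvs (fun n => u n + v n) (x + y).
Proof.
move=> ux vy e e0; have e2 : 0 < e / 2 by rewrite divr_gt0.
have [N HN] := ux _ e2; have [M HM] := vy _ e2.
exists (maxn N M) => n; rewrite geq_max => /andP[Nn Mn].
rewrite opprD addrACA (le_lt_trans (nmD _ _))// [ltRHS]splitr ltrD ?HN ?HM//.
Qed.

Lemma cvsZ c u x : cvs u x -> cvs (fun n => c *: u n) (c *: x).
Proof.
move=> ux e e0.
have c1 : 0 < cabs c + 1 by rewrite ltr_wpDl// cabs_ge0.
have [N HN] := ux _ (divr_gt0 e0 c1); exists N => n Nn.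
rewrite -scalerBr nmZ (le_lt_trans (_ : _ <= (cabs c + 1) * nm (x - u n)))//.
  by rewrite ler_wpM2r ?nm_ge0// lerDl.
by rewrite mulrC -ltr_pdivlMr// HN.
Qed.

Lemma cvs_ext u v x : (forall n, u n = v n) -> cvs u x -> cvs v x.
Proof. by move=> uv H e /H[N HN]; exists N => n /HN; rewrite uv. Qed.

Lemma subset_ipcl A : A `<=` ipcl A.
Proof. by move=> x Ax e e0; exists x; rewrite // subrr nm0. Qed.

Lemma cvs_ipcl A u x : (forall n, A (u n)) -> cvs u x -> ipcl A x.
Proof. by move=> Au ux e /ux[N HN]; exists (u N) => //; exact: HN. Qed.

Lemma ipcl_seq A x : ipcl A x -> exists2 u, (forall n, A (u n)) & cvs u x.
Proof.
move=> H.
have /choice[u Hu] n : exists a, A a /\ nm (x - a) < n.+1%:R^-1.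
  have [|a Aa xa] := H (n.+1%:R^-1); first by rewrite invr_gt0.
  by exists a.
exists u => [n|e e0]; first by have [] := Hu n.
exists (Num.truncn e^-1) => n nN; have [_ /lt_trans] := Hu n; apply.
rewrite -[ltRHS]invrK ltf_pV2 ?posrE ?invr_gt0// (lt_le_trans (truncnS_gt _))//.
by rewrite ler_nat ltnS.
Qed.

Lemma ipcl_ipcl A : ipcl (ipcl A) `<=` ipcl A.
Proof.
move=> x H e e0; have e2 : 0 < e / 2 by rewrite divr_gt0.
have [y Hy xy] := H _ e2; have [a Aa ya] := Hy _ e2; exists a => //.
by rewrite (le_lt_trans (nm_trans _ y _))// [ltRHS]splitr ltrD.
Qed.

Lemma ipclS A B : A `<=` B -> ipcl A `<=` ipcl B.
Proof. by move=> AB x H e /H[a /AB Ba ?]; exists a. Qed.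

Lemma subspace_ipcl A : subspace A -> subspace (ipcl A).
Proof.
move=> [A0 AP]; split; first exact: subset_ipcl.
move=> c x y /ipcl_seq[u Au ux] /ipcl_seq[v Av vy].
apply: (@cvs_ipcl _ (fun n => c *: u n + v n)) => [n|]; first exact: AP.
exact: cvsD (cvsZ c ux) vy.
Qed.

Lemma subspaceD A : subspace A -> forall x y, A x -> A y -> A (x + y).
Proof. by move=> [_ AP] x y Ax Ay; rewrite -[x]scale1r; exact: AP. Qed.
Lemma subspaceZ A : subspace A -> forall c x, A x -> A (c *: x).
Proof. by move=> [A0 AP] c x Ax; rewrite -[_ *: _]addr0; exact: AP. Qed.
Lemma subspaceB A : subspace A -> forall x y, A x -> A y -> A (x - y).
Proof. by move=> [A0 AP] x y Ax Ay; rewrite addrC -scaleN1r; exact: AP. Qed.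

Lemma ip_cvs u x y : cvs u x -> (forall n, ip y (u n) = 0) -> ip y x = 0.
Proof.
move=> ux H; apply/eqP; rewrite -cabs_eq0 eq_le cabs_ge0 andbT.
apply/ler_addgt0Pr => e e0; rewrite add0r.
have y1 : 0 < nm y + 1 by rewrite ltr_wpDl// nm_ge0.
have [N HN] := ux _ (divr_gt0 e0 y1).
have -> : ip y x = ip y (x - u N) by rewrite ipBr H subr0.
rewrite (le_trans (cauchy_schwarz _ _))//.
rewrite (le_trans (_ : _ <= (nm y + 1) * nm (x - u N)))//.
  by rewrite ler_wpM2r ?nm_ge0// lerDl.
by rewrite mulrC -ler_pdivlMr// ltW// HN.
Qed.

Lemma ip_ipcl A x y : ipcl A x -> (forall a, A a -> ip y a = 0) -> ip y x = 0.
Proof. by move=> /ipcl_seq[u Au ux] H; apply: ip_cvs ux _ => n; exact: H. Qed.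

(** A sequence in [A] whose distances to [x] approach the infimum is Cauchy by the parallelogram
    law, since midpoints stay in [A]. Its limit is a nearest point, and a component of [x - y] along
    some [a] would give a nearer one. *)
Theorem projection A x : ipcomplete -> subspace A -> ipcl A `<=` A ->
  exists2 y, A y & forall a, A a -> ip a (x - y) = 0.
Proof.
move=> cE As Acl.
pose D := [set nm (x - a) ^+ 2 | a in A].
have D0 : D !=set0 by exists (nm (x - 0) ^+ 2), 0 => //; case: As.
have Dlb : lbound D 0 by move=> _ [a _ <-]; exact: sqr_ge0.
have Dinf : has_inf D by split => //; exists 0.
pose d := inf D.
have d_le a : A a -> d <= nm (x - a) ^+ 2.
  by move=> Aa; apply: ge_inf; [exists 0|exists a].
have near n : exists a, A a /\ nm (x - a) ^+ 2 < d + n.+1%:R^-1.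
  have [|_ [a Aa <-] ?] := @inf_adherent _ D n.+1%:R^-1 _ Dinf.
    by rewrite invr_gt0.
  by exists a.
have [u Hu] := choice near.
have key a b (e : R) : A a -> A b -> nm (x - a) ^+ 2 < d + e ->
    nm (x - b) ^+ 2 < d + e -> nm (a - b) ^+ 2 <= 4 * e.
  move=> Aa Ab Ha Hb.
  have := parallelogram (x - b) (x - a).
  have -> : x - b - (x - a) = a - b by rewrite opprB addrC addrA subrK.
  have -> : x - b + (x - a) = 2 *: (x - 2^-1 *: (a + b)).
    rewrite scalerBr scalerA divff ?pnatr_eq0// scale1r scaler_nat mulr2n.
    by rewrite addrACA -opprD [b + a]addrC.
  rewrite nmZ cabs_nat exprMn.
  have : d <= nm (x - 2^-1 *: (a + b)) ^+ 2.
    by apply: d_le; apply: subspaceZ => //; exact: subspaceD.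
  move: Ha Hb.
  move: (nm (x - a) ^+ 2) (nm (x - b) ^+ 2) (nm (x - 2^-1 *: (a + b)) ^+ 2)
    (nm (a - b) ^+ 2) => p q r s; lra.
have small (e : R) : 0 < e -> exists N, forall n, (N <= n)%N -> n.+1%:R^-1 < e.
  move=> e0; exists (Num.truncn e^-1) => n nN.
  rewrite -[ltRHS]invrK ltf_pV2 ?posrE ?invr_gt0//.
  by rewrite (lt_le_trans (truncnS_gt _))// ler_nat ltnS.
have [y uy] : exists y, cvs u y.
  apply: cE => e e0.
  have e4 : 0 < e ^+ 2 / 8 by rewrite divr_gt0// exprn_gt0.
  have [N HN] := small _ e4; exists N => m n Nm Nn.
  rewrite -(ltr_pXn2r (_ : 0 < 2)%N)// ?nnegrE ?nm_ge0 ?(ltW e0)//.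
  have [Am um] := Hu m; have [An un] := Hu n.
  rewrite (le_lt_trans (key _ _ (e ^+ 2 / 8) Am An _ _))//.
  - by rewrite (lt_trans um)// ltrD2l HN.
  - by rewrite (lt_trans un)// ltrD2l HN.
  - have := exprn_gt0 2 e0; lra.
have Ay : A y by apply/Acl/(cvs_ipcl _ uy) => n; case: (Hu n).
have yd : nm (x - y) ^+ 2 <= d.
  apply/ler_addgt0Pr => e e0.
  (* With [w] the distance from [x] to [y], the tolerance [k] is chosen so that k + 2 w k + k^2 is
     at most [e]. *)
  have [k k0 Hk] : exists2 k : R, 0 < k & forall r s : R, 0 <= r -> r <= nm (x - y) ->
      s ^+ 2 < d + k -> 0 <= s -> nm (x - y) <= s + k -> nm (x - y) ^+ 2 <= d + e.
    set w := nm (x - y); have w0 : 0 <= w by exact: nm_ge0.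
    exists (Num.min 1 (e / (2 * (w + 1) + 1))).
      rewrite lt_min ltr01 divr_gt0//; lra.
    set k := Num.min _ _.
    have k1 : k <= 1 by rewrite ge_min lexx.
    have k2 : k * (2 * (w + 1) + 1) <= e.
      rewrite -ler_pdivlMr; last lra.
      by rewrite ge_min lexx orbT.
    have k0 : 0 <= k by rewrite le_min ler01 divr_ge0//; lra.
    move=> _ s _ _ sk s0 wsk.
    have [sw|ws] := leP s w; last by nra.
    nra.
  have [N HN] := small _ k0; have [M HM] := uy _ k0.
  have [An un] := Hu (maxn N M).
  apply: (Hk 0 (nm (x - u (maxn N M)))); rewrite ?nm_ge0//.
    by rewrite (lt_trans un)// ltrD2l HN// leq_maxl.
  rewrite (le_trans (nm_trans _ (u (maxn N M)) _))// lerD2l ltW// nm_distC.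
  by rewrite HM// leq_maxr.
exists y => // a Aa.
have [->|a0] := eqVneq a 0; first by rewrite ip0l.
set w := x - y; set l := ((nm a ^- 2)%:C)%C * ip a w.
have na : nm a ^+ 2 != 0 by rewrite expf_neq0// gt_eqF// nm_gt0.
have H : ip a (w - l *: a) = 0.
  rewrite ipBr (ipZr ipP) ip_xx /l mulrAC -rmorphM /= mulVf// mul1r.
  exact: subrr.
have H' : ip (l *: a) (w - l *: a) = 0 by rewrite ipZl H mulr0.
have := pythagoras H'; rewrite addrCA subrr addr0 => K.
have : d <= nm (w - l *: a) ^+ 2.
  have -> : w - l *: a = x - (l *: a + y) by rewrite opprD [RHS]addrCA [RHS]addrC.
  by apply: d_le; case: As => _; apply.
move: K yd; rewrite -/w => -> /le_trans /[apply]; rewrite gerDr => K.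
have : nm (l *: a) = 0.
  by apply/eqP; rewrite -sqrf_eq0 eq_le K sqr_ge0.
rewrite nmZ => /eqP; rewrite mulf_eq0 [nm a == 0]gt_eqF ?nm_gt0// orbF.
rewrite cabs_eq0 mulf_eq0 => /orP[|/eqP//].
by rewrite -[0]/((0%:C)%C) (inj_eq (@complexI _)) invr_eq0 (negbTE na).
Qed.

Lemma subspace_ker (phi : E -> R[i]) (M : R) :
  (forall c x y, phi (c *: x + y) = c * phi x + phi y) ->
  (forall x, cabs (phi x) <= M * nm x) ->
  subspace [set x | phi x = 0] /\ ipcl [set x | phi x = 0] `<=` [set x | phi x = 0].
Proof.
move=> phiL phiM.
have phi0 : phi 0 = 0.
  have /= := phiL 1 0 0; rewrite scale1r addr0 mul1r => /(congr1 (fun t => t - phi 0)).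
  by rewrite subrr addrK.
split; first by split=> //= c x y x0 y0; rewrite phiL x0 y0 mulr0 addr0.
move=> x H /=; apply/eqP; rewrite -cabs_eq0 eq_le cabs_ge0 andbT.
apply/ler_addgt0Pr => e e0; rewrite add0r.
have M1 : 0 < `|M| + 1 by rewrite ltr_wpDl.
have [a /= a0 xa] := H _ (divr_gt0 e0 M1).
have -> : phi x = phi (x - a).
  by rewrite addrC -scaleN1r phiL a0 mulr0 add0r.
rewrite (le_trans (phiM _))// (le_trans (_ : _ <= (`|M| + 1) * nm (x - a)))//.
  by rewrite ler_wpM2r ?nm_ge0// (le_trans (ler_norm _))// lerDl.
by rewrite mulrC -ler_pdivlMr// ltW.
Qed.

(** The kernel is closed, so unless [phi] vanishes some [w] with [phi w] nonzero is orthogonal to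
    it, and [x - (phi x / phi w) *: w] lies in the kernel for every [x]. *)
Theorem riesz (phi : E -> R[i]) (M : R) : ipcomplete ->
  (forall c x y, phi (c *: x + y) = c * phi x + phi y) ->
  (forall x, cabs (phi x) <= M * nm x) -> exists y, forall x, phi x = ip y x.
Proof.
move=> cE phiL phiM; have [ks kc] := subspace_ker phiL phiM.
have [[z z0]|H] := pselect (exists z, phi z != 0); last first.
  exists 0 => x; rewrite ip0l; apply: contrapT => /eqP px; apply: H.
  by exists x.
have [p p0 Hp] := projection z cE ks kc.
set w := z - p.
have pw : phi w = phi z by rewrite /w addrC -scaleN1r phiL p0 mulr0 add0r.
have pw0 : phi w != 0 by rewrite pw.
have w0 : w != 0.
  by apply: contraNneq pw0 => ->; case: ks => ->.
exists ((phi w)^* / ((nm w ^+ 2)%:C)%C *: w) => x.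
have : ip w (x - (phi x / phi w) *: w) = 0.
  rewrite (ipC ipP) Hp ?rmorph0//=.
  by rewrite addrC -scaleNr phiL mulNr divfK// addNr.
rewrite ipBr (ipZr ipP) => /eqP; rewrite subr_eq0 => /eqP H.
rewrite ipZl H ip_xx rmorphM /= conjCK fmorphV/= conjCR.
set n := ((_ ^+ 2)%:C)%C; have n0 : n != 0.
  rewrite /n -[0]/((0%:C)%C) (inj_eq (@complexI _)).
  by rewrite expf_neq0// gt_eqF// nm_gt0.
by clearbody n; field; rewrite pw0 n0.
Qed.

End InnerProduct.

(** * The product space in which graphs live *)

Section ProductInnerProduct.
Context {R : realType} {E : lmodType R[i]} {ip : E -> E -> R[i]} (ipP : is_ip ip).
Local Notation nm := (ipnorm ip).

Definition ip2 (p q : (E * E)%type) : R[i] := ip p.1 q.1 + ip p.2 q.2.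

Lemma ip2P : is_ip ip2.
Proof.
rewrite /ip2; split.
- by move=> x y z; rewrite !(ipDr ipP) addrACA.
- by move=> c x y; rewrite !(ipZr ipP) mulrDr.
- by move=> x y; rewrite rmorphD /= -!(ipC ipP).
- by move=> x; rewrite addr_ge0// (ip_ge0 ipP).
- move=> [x y] /= /eqP; rewrite paddr_eq0 ?(ip_ge0 ipP)//.
  by move=> /andP[/eqP/(ip_eq0 ipP) -> /eqP/(ip_eq0 ipP) ->].
Qed.

Lemma nm2E p : ipnorm ip2 p ^+ 2 = nm p.1 ^+ 2 + nm p.2 ^+ 2.
Proof.
by apply: complexI; rewrite -(ip_xx ip2P) rmorphD /= -!(ip_xx ipP).
Qed.

Lemma nm2_1 p : nm p.1 <= ipnorm ip2 p.
Proof.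
rewrite -(ler_pXn2r (_ : 0 < 2)%N)// ?nnegrE ?nm_ge0// nm2E lerDl.
exact: sqr_ge0.
Qed.

Lemma nm2_2 p : nm p.2 <= ipnorm ip2 p.
Proof.
rewrite -(ler_pXn2r (_ : 0 < 2)%N)// ?nnegrE ?nm_ge0// nm2E lerDr.
exact: sqr_ge0.
Qed.

Lemma nm2_le p : ipnorm ip2 p <= nm p.1 + nm p.2.
Proof.
have := nm_ge0 (ip := ip) p.1; have := nm_ge0 (ip := ip) p.2 => a b.
rewrite -(ler_pXn2r (_ : 0 < 2)%N)// ?nnegrE ?nm_ge0 ?addr_ge0// nm2E.
nra.
Qed.

Lemma cvs2 (u : nat -> E * E) p :
  cvs (ip := ip2) u p <-> cvs (ip := ip) (fun n => (u n).1) p.1 /\ cvs (ip := ip) (fun n => (u n).2) p.2.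
Proof.
split=> [H|[H1 H2] e e0].
  by split=> e /H[N HN]; exists N => n /HN; apply: le_lt_trans;
    [exact: (nm2_1 (p - u n))|exact: (nm2_2 (p - u n))].
have e2 : 0 < e / 2 by rewrite divr_gt0.
have [N HN] := H1 _ e2; have [M HM] := H2 _ e2.
exists (maxn N M) => n; rewrite geq_max => /andP[Nn Mn].
rewrite (le_lt_trans (nm2_le _))// [ltRHS]splitr ltrD//; [exact: HN|exact: HM].
Qed.

Lemma ip2_complete : ipcomplete (ip := ip) -> ipcomplete (ip := ip2).
Proof.
move=> cE u Hu.
have [|x ux] := cE (fun n => (u n).1).
  move=> e /Hu[N HN]; exists N => m n Nm Nn; move: (HN m n Nm Nn).
  by apply: le_lt_trans; exact: (nm2_1 (u m - u n)).
have [|y uy] := cE (fun n => (u n).2).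
  move=> e /Hu[N HN]; exists N => m n Nm Nn; move: (HN m n Nm Nn).
  by apply: le_lt_trans; exact: (nm2_2 (u m - u n)).
by exists (x, y); apply/cvs2.
Qed.

End ProductInnerProduct.

Arguments ip2 {R E} ip p q.
Arguments cvs {R E} ip u x.
Arguments ipcl {R E} ip A.
Arguments ipcauchy {R E} ip u.
Arguments ipcomplete {R E} ip.
Arguments ip2P {R E ip} ipP.

(** * Orthogonal projections *)

Section OrthogonalProjection.
Context {R : realType} {E : lmodType R[i]} {ip : E -> E -> R[i]} (ipP : is_ip ip).
Local Notation nm := (ipnorm ip).
Variables (A : set E).
Hypotheses (As : subspace A) (Acl : ipcl ip A `<=` A).

Definition is_proj (P : E -> E) :=
  (forall x, A (P x)) /\ (forall x a, A a -> ip a (x - P x) = 0).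

Lemma ex_proj : ipcomplete ip -> exists P, is_proj P.
Proof.
move=> cE.
have /choice[P HP] x : exists y, A y /\ forall a, A a -> ip a (x - y) = 0.
  by have [y Ay Hy] := projection ipP x cE As Acl; exists y.
by exists P; split=> x; have [] := HP x.
Qed.

Variable P : E -> E.
Hypothesis HP : is_proj P.

Lemma proj_unique x y : A y -> (forall a, A a -> ip a (x - y) = 0) -> P x = y.
Proof.
move=> Ay Hy; apply/eqP; rewrite -subr_eq0; apply/eqP/(ip_eq0 ipP).
have AB : A (P x - y) by apply: subspaceB => //; case: HP.
have -> : ip (P x - y) (P x - y) = ip (P x - y) (x - y) - ip (P x - y) (x - P x).
  by rewrite -(ipBr ipP) opprB [x - y + _]addrC addrA subrK.
by rewrite Hy// HP.2// subrr.
Qed.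

Lemma proj_id x : A x -> P x = x.
Proof. by move=> Ax; apply: proj_unique => // a _; rewrite subrr (ip0r ipP). Qed.

Lemma proj_linear : linear P.
Proof.
move=> c x y; apply: proj_unique.
  by case: As => _; apply; exact: HP.1.
move=> a Aa; rewrite opprD addrACA -scalerBr (ipDr ipP) (ipZr ipP) !HP.2//.
by rewrite mulr0 addr0.
Qed.

Lemma proj_self_adjoint x y : ip (P x) y = ip x (P y).
Proof.
have : ip (P x) (y - P y) = 0 by apply: HP.2; exact: HP.1.
have : ip (x - P x) (P y) = 0.
  by rewrite (ipC ipP) HP.2 ?rmorph0//; exact: HP.1.
rewrite (ipBl ipP) (ipBr ipP) => /eqP; rewrite subr_eq0 => /eqP -> /eqP.
by rewrite subr_eq0 => /eqP.
Qed.

Lemma proj_nm x : nm (P x) <= nm x.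
Proof.
rewrite -(ler_pXn2r (_ : 0 < 2)%N)// ?nnegrE ?nm_ge0//.
have := pythagoras ipP (HP.2 x _ (HP.1 x)); rewrite addrC subrK => ->.
by rewrite lerDl sqr_ge0.
Qed.

(** Since the adjoint preserves [A], [B] preserves the orthogonal complement of [A] as well. The
    adjoint is an explicit map because this is applied on [H * H], where [adj] is not defined. *)
Lemma proj_comm (B B' : E -> E) : (forall x y, ip (B x) y = ip x (B' y)) ->
  (forall x y, B (x - y) = B x - B y) ->
  (forall x, A x -> A (B x)) -> (forall x, A x -> A (B' x)) ->
  forall x, P (B x) = B (P x).
Proof.
move=> adjB linB AB AB' x; apply: proj_unique; first by apply: AB; exact: HP.1.
move=> a Aa; rewrite -linB (ipC ipP) adjB (ipC ipP) conjCK.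
by apply: HP.2; exact: AB'.
Qed.

End OrthogonalProjection.

Section OrthogonalComplement.
Context {R : realType} {E : lmodType R[i]} {ip : E -> E -> R[i]} (ipP : is_ip ip).

(** If [y] is the projection of [x], then [x - y] is orthogonal to [A], hence to [x] by assumption,
    and also to [y]. *)
Lemma ipcl_orth (A : set E) : ipcomplete ip -> subspace A ->
  forall x, (forall y, (forall a, A a -> ip y a = 0) -> ip y x = 0) ->
  ipcl ip A x.
Proof.
move=> cE As x H.
have cs := subspace_ipcl ipP As.
have [y Ay Hy] := projection ipP x cE cs (@ipcl_ipcl _ _ _ ipP A).
suff -> : x = y by [].
apply/eqP; rewrite -subr_eq0; apply/eqP/(ip_eq0 ipP).
have H1 : ip (x - y) x = 0.
  apply: H => a Aa; rewrite (ipC ipP) Hy ?rmorph0//.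
  exact: subset_ipcl.
rewrite (ipBr ipP) H1 (ipC ipP y) Hy// rmorph0; exact: subrr.
Qed.

(** Gram-Schmidt by induction, for a family that need not be independent: [v] is the part of the
    last vector orthogonal to the others, and when it vanishes the last coefficient is taken to be
    0. *)
Lemma span_proj n (e : 'I_n -> E) (x : E) :
  exists c : 'I_n -> R[i], forall i, ip (e i) (x - \sum_j c j *: e j) = 0.
Proof.
elim: n e x => [|n IH] e x; first by exists (fun=> 0) => -[].
pose e' i := e (widen_ord (leqnSn n) i).
have [c Hc] := IH e' x; have [d Hd] := IH e' (e ord_max).
set v := e ord_max - \sum_j d j *: e' j in Hd.
set y := x - \sum_j c j *: e' j in Hc.
pose l := if ip v v == 0 then 0 else ip v y / ip v v.
have yl i : ip (e i) (y - l *: v) = 0.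
  have e'0 j : ip (e' j) (y - l *: v) = 0.
    by rewrite (ipBr ipP) (ipZr ipP) Hc Hd mulr0 subrr.
  have v0 : ip v (y - l *: v) = 0.
    rewrite (ipBr ipP) (ipZr ipP) /l; case: eqP => [vv0|/eqP vv].
      have -> : v = 0 by exact: (ip_eq0 ipP).
      by rewrite !(ip0l ipP) mulr0 subrr.
    by rewrite divfK// subrr.
  case: (unliftP ord_max i) => [j ->|->].
    rewrite (_ : lift _ _ = widen_ord (leqnSn n) j) ?e'0//.
    by apply: val_inj; rewrite /= /bump leqNgt ltn_ord.
  have -> : e ord_max = v + \sum_j d j *: e' j by rewrite subrK.
  rewrite (ipDl ipP) v0 add0r (ip_suml ipP) big1// => j _.
  by rewrite (ipZl ipP) e'0 mulr0.
exists (fun i => if unlift ord_max i is Some j then c j - l * d j else l) => i.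
rewrite -[RHS](yl i); congr (ip _ _).
rewrite big_ord_recr /= unlift_none.
under eq_bigr => j _.
  have -> : widen_ord (leqnSn n) j = lift ord_max j.
    by apply: val_inj; rewrite /= /bump leqNgt ltn_ord.
  rewrite liftK scalerBl -scalerA.
  have -> : e (lift ord_max j) = e' j.
    by congr e; apply: val_inj; rewrite /= /bump leqNgt ltn_ord.
  over.
rewrite sumrB -scaler_sumr /y /v scalerBr -!addrA; congr (_ + _).
by rewrite opprD; congr (_ - _); rewrite addrC.
Qed.

End OrthogonalComplement.

(** * Topology and bounded operators of a Hilbert space *)

Section HilbertTopology.
Context {R : realType} {H : hilbert R}.
Local Notation ip := (sprod (hdot H)).
Local Notation nm := (ipnorm ip).
Implicit Types (x y : H) (A : set H) (T : set (H * H)).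

Lemma hipP : is_ip ip. Proof. exact: sprod_is_ip. Qed.

Lemma hnm x : `|x| = ((nm x)%:C)%C.
Proof.
apply/eqP; rewrite -(eqrXn2 (_ : 0 < 2)%N)// ?ler0c ?nm_ge0//.
by rewrite hnormE -[hdot H x x]/(ip x x) (ip_xx hipP) rmorphXn.
Qed.

Lemma gt0_complex (e : R[i]) : 0 < e -> exists2 r : R, 0 < r & e = (r%:C)%C.
Proof.
rewrite ltcE /= => /andP[/eqP i0 r0]; exists (complex.Re e) => //.
by rewrite [LHS]complexE i0 raddf0 mulr0 addr0.
Qed.

Lemma ball_nm x (r : R) y : ball x ((r%:C)%C) y <-> nm (x - y) < r.
Proof. by rewrite -ball_normE /ball_ /= hnm ltcR. Qed.

Lemma closure_ipcl A : closure A = ipcl ip A.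
Proof.
apply/seteqP; split=> x Hx.
  move=> e e0; have [|a [Aa /ball_nm xa]] := Hx (ball x ((e%:C)%C)).
    by apply: nbhsx_ballx; rewrite ltcR.
  by exists a.
move=> B /nbhs_ballP[_ /gt0_complex[r r0 ->] HB].
by have [a Aa xa] := Hx _ r0; exists a; split=> //; apply: HB; exact/ball_nm.
Qed.

Lemma closure_ipcl2 T : closure T = ipcl (ip2 ip) T.
Proof.
apply/seteqP; split=> x Hx.
  move=> e e0; have [|a [Ta [xa1 xa2]]] := Hx (ball x (((e / 2)%:C)%C)).
    by apply: nbhsx_ballx; rewrite ltcR divr_gt0.
  move: xa1 xa2 => /ball_nm xa1 /ball_nm xa2; exists a => //.
  by rewrite (le_lt_trans (nm2_le hipP _))// [ltRHS]splitr ltrD.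
move=> B /nbhs_ballP[_ /gt0_complex[r r0 ->] HB].
have [a Ta xa] := Hx _ r0; exists a; split=> //; apply: HB; split; apply/ball_nm.
  exact: le_lt_trans (nm2_1 hipP (x - a)) xa.
exact: le_lt_trans (nm2_2 hipP (x - a)) xa.
Qed.

Lemma cvs_cvg (u : nat -> H) x : cvs ip u x <-> u @ \oo --> x.
Proof.
split=> [Hu|/cvgrPdist_lt Hu].
  apply/cvgrPdist_lt => e /gt0_complex[r r0 ->]; have [N HN] := Hu _ r0.
  by exists N => // n /= /HN; rewrite hnm ltcR.
move=> e e0; have [|N _ HN] := Hu (e%:C)%C; first by rewrite ltcR.
by exists N => n /HN; rewrite /= hnm ltcR.
Qed.

Lemma cvs_limn (u : nat -> H) x : cvs ip u x -> limn u = x.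
Proof. by move=> /cvs_cvg /cvg_lim; apply; exact: norm_hausdorff. Qed.

Lemma hilbert_complete : ipcomplete ip.
Proof.
move=> u Hu; suff /cvg_ex[x ux] : cvgn u by exists x; apply/cvs_cvg.
apply/cauchy_cvgP/cauchy_exP => e /gt0_complex[r r0 ->].
have [N HN] := Hu _ r0; exists (u N).
by exists N => // n /= Nn; apply/ball_nm/HN.
Qed.

Lemma linearB' (A : H -> H) : linear A -> forall x y, A (x - y) = A x - A y.
Proof. by move=> lA x y; rewrite addrC -scaleN1r lA scaleN1r addrC. Qed.

Lemma linear0' (A : H -> H) : linear A -> A 0 = 0.
Proof. by move=> lA; rewrite -[X in A X](subrr 0) linearB'// subrr. Qed.

Lemma linearD' (A : H -> H) : linear A -> forall x y, A (x + y) = A x + A y.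
Proof. by move=> lA x y; rewrite -[x]scale1r lA !scale1r. Qed.

Lemma linearZ' (A : H -> H) : linear A -> forall c x, A (c *: x) = c *: A x.
Proof. by move=> lA c x; rewrite -[c *: x]addr0 lA linear0'// addr0. Qed.

Lemma linearN' (A : H -> H) : linear A -> forall x, A (- x) = - A x.
Proof. by move=> lA x; rewrite -scaleN1r linearZ'// scaleN1r. Qed.

Lemma bounded_opP (A : H -> H) :
  bounded_op A <-> linear A /\ exists M : R, forall x, nm (A x) <= M * nm x.
Proof.
split=> [[lA cA]|[lA [M HM]]]; split=> //.
  have /cvgrPdist_lt /(_ 1 ltr01) := cA 0.
  move=> /nbhs_ballP[_ /gt0_complex[r r0 ->] Hr].
  have r2 : 0 < r / 2 by rewrite divr_gt0.
  exists ((r / 2)^-1) => x.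
  have [->|x0] := eqVneq x 0; first by rewrite linear0'// !nm0 ?mulr0//; exact: hipP.
  have nx := nm_gt0 hipP x0.
  have k0 : 0 < r / 2 / nm x by rewrite divr_gt0.
  have /Hr /= : ball 0 ((r%:C)%C) ((((r / 2 / nm x)%:C)%C) *: x).
    apply/ball_nm; rewrite sub0r (nmN hipP) (nmZ hipP) cabsR (ger0_norm (ltW k0)).
    by rewrite divfK ?gt_eqF// ltr_pdivrMr// ltr_pMr// ltr1n.
  rewrite linear0'// sub0r normrN hnm linearZ'//.
  rewrite ltcE /= => /andP[_]; rewrite (nmZ hipP) cabsR (ger0_norm (ltW k0)) mulrC -ltr_pdivlMr//.
  by move/ltW; rewrite mul1r !invf_div => /le_trans; apply; rewrite le_eqVlt; apply/orP; left; apply/eqP; field; rewrite gt_eqF.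
move=> x; apply/cvgrPdist_lt => e /gt0_complex[r r0 ->].
have M1 : 0 < `|M| + 1 by rewrite ltr_wpDl.
apply/nbhs_ballP; exists (((r / (`|M| + 1))%:C)%C) => /=.
  by rewrite ltcR divr_gt0.
move=> y /ball_nm; rewrite ltr_pdivlMr// => xy.
rewrite -linearB'// hnm ltcR (le_lt_trans (HM _))//.
rewrite (le_lt_trans _ xy)// mulrC ler_wpM2l ?nm_ge0//.
by rewrite (le_trans (ler_norm _))// lerDl.
Qed.

Lemma nondegenerate x y : (forall z, ip z x = ip z y) -> x = y.
Proof.
move=> Hxy; apply/eqP; rewrite -subr_eq0; apply/eqP/(ip_eq0 hipP).
by rewrite (ipBr hipP) Hxy subrr.
Qed.

Lemma adj_def (A B : H -> H) : (forall x y, ip (A x) y = ip x (B y)) -> adj A = B.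
Proof.
move=> AB; apply/funext => y; apply: nondegenerate => x.
have := @xgetPex _ A [set B | forall x y, ip (A x) y = ip x (B y)] (ex_intro _ B AB).
by rewrite -/(adj A) /= => <-; rewrite AB.
Qed.

Lemma ex_adjoint (A : H -> H) : bounded_op A -> exists B, forall x y, ip (A x) y = ip x (B y).
Proof.
move=> /bounded_opP[lA [M HM]].
suff /choice[B HB] y : exists z, forall x, ip (A x) y = ip x z by exists B => x y.
have [|x|z Hz] := @riesz _ _ _ hipP (fun x => ip y (A x)) (nm y * M) hilbert_complete.
- by move=> c x z; rewrite lA (ipDr hipP) (ipZr hipP).
- rewrite (le_trans (cauchy_schwarz hipP _ _))// -mulrA ler_wpM2l ?nm_ge0//.
- by exists z => x; rewrite (ipC hipP) Hz -(ipC hipP).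
Qed.

Lemma adjE (A : H -> H) : bounded_op A -> forall x y, ip (A x) y = ip x (adj A y).
Proof. by move=> /ex_adjoint[B HB] x y; rewrite (adj_def HB). Qed.

Lemma adjE' (A : H -> H) : bounded_op A -> forall x y, ip (adj A x) y = ip x (A y).
Proof. by move=> bA x y; rewrite (ipC hipP) -adjE// -(ipC hipP). Qed.

Lemma adj_bounded (A : H -> H) : bounded_op A -> bounded_op (adj A).
Proof.
move=> bA; have /bounded_opP[lA [M HM]] := bA; apply/bounded_opP; split.
  move=> c x y; apply: nondegenerate => z.
  by rewrite -adjE// !(ipDr hipP, ipZr hipP) -!adjE.
exists M => x; have [->|x0] := eqVneq (nm (adj A x)) 0.
  have [->|x0] := eqVneq x 0; first by rewrite (nm0 hipP) mulr0.
  by have := HM x; move/(le_trans (nm_ge0 _)).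
have np : 0 < nm (adj A x) by rewrite lt_neqAle eq_sym x0 nm_ge0.
rewrite -(ler_pM2l np) -expr2.
have -> : nm (adj A x) ^+ 2 = cabs (ip (adj A x) (adj A x)).
  by rewrite (ip_xx hipP) cabsR ger0_norm// sqr_ge0.
rewrite -adjE// (le_trans (cauchy_schwarz hipP _ _))// mulrCA mulrA.
by rewrite ler_wpM2r ?nm_ge0.
Qed.

Lemma bounded_id : bounded_op (@id H).
Proof. by apply/bounded_opP; split=> //; exists 1 => x; rewrite mul1r. Qed.

Lemma bounded_comp (A B : H -> H) : bounded_op A -> bounded_op B -> bounded_op (A \o B).
Proof.
move=> [lA cA] [lB cB]; split; first by move=> c x y /=; rewrite lB lA.
by move=> x; apply: continuous_comp; [exact: cB|exact: cA].
Qed.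

Lemma bounded_lin (A B : H -> H) (c d : R[i]) : bounded_op A -> bounded_op B ->
  bounded_op (fun x => c *: A x + d *: B x).
Proof.
move=> /bounded_opP[lA [M HM]] /bounded_opP[lB [N HN]]; apply/bounded_opP; split.
  move=> a x y; rewrite lA lB !scalerDr !scalerA [a * c]mulrC [a * d]mulrC.
  by rewrite addrACA.
exists (cabs c * M + cabs d * N) => x.
rewrite (le_trans (nmD hipP _ _))// !(nmZ hipP) mulrDl lerD// -mulrA.
  by rewrite ler_wpM2l ?cabs_ge0.
by rewrite ler_wpM2l ?cabs_ge0.
Qed.

Lemma bounded_cvs (A : H -> H) u x : bounded_op A -> cvs ip u x ->
  cvs ip (A \o u) (A x).
Proof.
move=> [lA cA] /cvs_cvg ux; apply/cvs_cvg.
exact: (cvg_comp _ _ ux (cA x)).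
Qed.

End HilbertTopology.

(** * Graphs of closed operators and commutants *)

Section GraphProjection.
Context {R : realType} {H : hilbert R}.
Local Notation ip := (sprod (hdot H)).
Local Notation nm := (ipnorm ip).
Implicit Types (x y : H) (A B : H -> H) (T Q : set (H * H)) (N S : set (H -> H)).

Definition closed_graph T := subspace T /\ ipcl (ip2 ip) T `<=` T.

Definition preserves B T := forall x y, T (x, y) -> T (B x, B y).

Definition star_closed S := (forall B, S B -> bounded_op B) /\ (forall B, S B -> S (adj B)).

Definition single_valued T := forall x y z, T (x, y) -> T (x, z) -> y = z.

(** Row [i], column [j] of an operator on [H * H]. For the projection on the graph of a closed
    operator these blocks form Stone's characteristic matrix. *)
Definition entry (i j : bool) (P : H * H -> H * H) x : H :=
  let p := P (if j then (0, x) else (x, 0)) in if i then p.2 else p.1.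

Arguments entry : simpl never.

Lemma closure_graph T : subspace T -> closed_graph (closure T).
Proof.
move=> Ts; rewrite closure_ipcl2; split; first exact/(subspace_ipcl (ip2P hipP)).
exact/(ipcl_ipcl (ip2P hipP)).
Qed.

Section Entries.
Variable T : set (H * H).
Hypothesis Tc : closed_graph T.
Variable P : H * H -> H * H.
Hypothesis HP : is_proj (ip := ip2 ip) T P.

Let lP : linear P := proj_linear (ip2P hipP) Tc.1 HP.

Lemma entriesE x y :
  P (x, y) = (entry false false P x + entry false true P y,
              entry true false P x + entry true true P y).
Proof.
have -> : (x, y) = 1 *: (x, 0) + (0, y) :> H * H.
  by rewrite scale1r; congr (_, _); rewrite /= ?addr0 ?add0r.
by rewrite lP scale1r [LHS]surjective_pairing.
Qed.

Lemma entry_nm i j x : nm (entry i j P x) <= nm x.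
Proof.
rewrite /entry; set p := if j then _ else _.
have px : ipnorm (ip2 ip) p <= nm x.
  apply: (le_trans (nm2_le hipP p)); rewrite /p; case: j {p} => /=.
    by rewrite (nm0 hipP) add0r.
  by rewrite (nm0 hipP) addr0.
apply: (le_trans _ px); apply: (le_trans _ (proj_nm (ip2P hipP) HP p)).
by case: i => /=; [exact: (nm2_2 hipP)|exact: (nm2_1 hipP)].
Qed.

Lemma entry_bounded i j : bounded_op (entry i j P).
Proof.
apply/bounded_opP; split.
  move=> c x y; rewrite /entry; case: j; case: i => /=.
  - by rewrite -[RHS]/((c *: P (0, x) + P (0, y)).2) -lP; congr (P _).2; congr (_, _); rewrite /= scaler0 addr0.
  - by rewrite -[RHS]/((c *: P (0, x) + P (0, y)).1) -lP; congr (P _).1; congr (_, _); rewrite /= scaler0 addr0.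
  - by rewrite -[RHS]/((c *: P (x, 0) + P (y, 0)).2) -lP; congr (P _).2; congr (_, _); rewrite /= scaler0 addr0.
  - by rewrite -[RHS]/((c *: P (x, 0) + P (y, 0)).1) -lP; congr (P _).1; congr (_, _); rewrite /= scaler0 addr0.
by exists 1 => x; rewrite mul1r entry_nm.
Qed.

Lemma entry_adj i j x y : ip (entry i j P x) y = ip x (entry j i P y).
Proof.
have := proj_self_adjoint (ip2P hipP) HP (if j then (0, x) else (x, 0))
  (if i then (0, y) else (y, 0)).
by rewrite /ip2 /entry; case: i; case: j => /=;
  rewrite !(ip0r hipP) !(ip0l hipP) ?addr0 ?add0r.
Qed.

(** For [B] in [N] the diagonal operator [(B, B)] and its adjoint preserve [T], hence it commutes
    with the projection on [T] and so with each block. *)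
Lemma entry_commutant N i j : star_closed N ->
  (forall B, N B -> preserves B T) -> commutant N (entry i j P).
Proof.
move=> [Nb Na] NT; split; first exact: entry_bounded.
move=> B NB; have bB := Nb _ NB; have lB : linear B by case: bB.
pose BB (p : H * H) := (B p.1, B p.2).
have BT C : N C -> forall p, T p -> T (C p.1, C p.2).
  by move=> NC [x y] /=; exact: NT.
have HB p : P (BB p) = BB (P p).
  apply: (@proj_comm _ _ _ (ip2P hipP) _ Tc.1 _ HP BB (fun p => (adj B p.1, adj B p.2))).
  - by move=> q r; rewrite /ip2 /= !adjE.
  - by move=> q r; rewrite /BB /= !linearB'.
  - exact: BT.
  - by apply: BT; exact: Na.
apply/funext => x /=; rewrite /entry.
have -> : (if j then (0, B x) else (B x, 0)) = BB (if j then (0, x) else (x, 0)).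
  by case: j; rewrite /BB /= linear0'.
by rewrite HB; case: i.
Qed.

Lemma preserves_entries B : bounded_op B -> (forall i j, B \o entry i j P = entry i j P \o B) ->
  preserves B T.
Proof.
move=> [lB _] HB x y Txy.
have HBe i j z : B (entry i j P z) = entry i j P (B z).
  by have /(congr1 (fun f => f z)) := HB i j.
have : P (x, y) = (x, y) by apply: (proj_id (ip2P hipP) Tc.1 HP).
rewrite entriesE => -[Hx Hy].
suff -> : (B x, B y) = P (B x, B y) by exact: HP.1.
by rewrite entriesE -!HBe -!linearD'// Hx Hy.
Qed.

(** Membership in [T] is the linear relation [P (x0, x1) = (x0, x1)] with bounded coefficients. Each
    block can be applied along [Q], so the same combinations of [w0] and [w1] are values of [Q] at
    [x0] and at [x1]. As [Q] is single-valued they are [w0] and [w1] again, so [P] fixes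
    [(w0, w1)]. *)
Lemma graph_exchange Q x0 x1 w0 w1 : subspace Q -> single_valued Q ->
  (forall i j, preserves (entry i j P) Q) ->
  Q (x0, w0) -> Q (x1, w1) -> T (x0, x1) -> T (w0, w1).
Proof.
move=> Qs Qf HQ Q0 Q1 Tx.
have : P (x0, x1) = (x0, x1) by apply: (proj_id (ip2P hipP) Tc.1 HP).
rewrite entriesE => -[E0 E1].
have K i : Q (entry i false P x0 + entry i true P x1,
              entry i false P w0 + entry i true P w1).
  exact: (subspaceD Qs (HQ i false _ _ Q0) (HQ i true _ _ Q1)).
have K0 := K false; have K1 := K true; rewrite E0 in K0; rewrite E1 in K1.
suff -> : (w0, w1) = P (w0, w1) by exact: HP.1.
by rewrite entriesE; congr (_, _); [exact: Qf Q0 K0|exact: Qf Q1 K1].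
Qed.

End Entries.

Lemma graph_proj T : closed_graph T -> exists P, is_proj (ip := ip2 ip) T P.
Proof.
move=> [Ts Tcl].
exact: (ex_proj (ip2P hipP) Ts Tcl (ip2_complete hipP hilbert_complete)).
Qed.

Lemma preserves_bicommutant T N B : closed_graph T -> star_closed N ->
  (forall C, N C -> preserves C T) -> commutant (commutant N) B -> preserves B T.
Proof.
move=> Tc Ns NT [bB HB]; have [P HP] := graph_proj Tc.
apply: (preserves_entries Tc HP bB) => i j; apply/esym/HB.
exact: (entry_commutant Tc HP i j Ns NT).
Qed.

Lemma commutant_star S : star_closed S -> star_closed (commutant S).
Proof.
move=> [Sb Sa]; split=> B [bB HB]//; split; first exact: adj_bounded.
move=> A SA; apply/funext => x; apply: nondegenerate => z /=.
have bA := Sb _ SA.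
have /(congr1 (fun f => f z)) /= := HB _ (Sa _ SA).
move=> E; rewrite -[LHS](adjE' bA) -[LHS](adjE bB) -[RHS](adjE bB) -E.
by rewrite (adjE' bA).
Qed.

Lemma commutant_comp S A B : commutant S A -> commutant S B -> commutant S (A \o B).
Proof.
move=> [bA HA] [bB HB]; split; first exact: bounded_comp.
move=> C SC; apply/funext => x /=.
have /(congr1 (fun f => f (B x))) /= -> := HA _ SC.
by have /(congr1 (fun f => f x)) /= -> := HB _ SC.
Qed.

Lemma commutant_id S : commutant S id.
Proof. by split=> //; exact: bounded_id. Qed.

Lemma commutant_lin S c A B : commutant S A -> commutant S B ->
  (forall C, S C -> linear C) -> commutant S (fun x => c *: A x + B x).
Proof.
move=> [bA HA] [bB HB] SC; split.
  have -> : (fun x => c *: A x + B x) = (fun x => c *: A x + 1 *: B x).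
    by apply/funext => x; rewrite scale1r.
  exact: bounded_lin.
move=> C C_; apply/funext => x /=; rewrite SC//.
have /(congr1 (fun f => f x)) /= -> := HA _ C_.
by have /(congr1 (fun f => f x)) /= -> := HB _ C_.
Qed.

Lemma von_neumann_all : von_neumann [set A : H -> H | bounded_op A].
Proof.
split=> //=; first by move=> A; exact: adj_bounded.
apply/seteqP; split=> [A [] //|A bA]; split=> // B [bB HB].
by apply/esym/HB.
Qed.

(** Commutation with the rank one operators [x |-> (u|x) v] is evaluated at [u]. *)
Lemma commutant_all B : commutant [set A : H -> H | bounded_op A] B ->
  exists c, forall x, B x = c *: x.
Proof.
move=> [[lB _] HB].
have [[u u0]|H0] := pselect (exists u : H, u != 0); last first.
  exists 0 => x; rewrite scale0r; have -> : x = 0; last exact: linear0'.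
  by apply: contrapT => /eqP x0; apply: H0; exists x.
have uu : ip u u != 0 by apply: contraNneq u0 => /(ip_eq0 hipP) ->.
exists (ip u (B u) / ip u u) => v.
have bA : bounded_op (fun x => ip u x *: v).
  apply/bounded_opP; split.
    by move=> c x y; rewrite (ipDr hipP) (ipZr hipP) scalerDl scalerA.
  exists (nm u * nm v) => x; rewrite (nmZ hipP) mulrAC ler_wpM2r ?nm_ge0//.
  exact: cauchy_schwarz hipP _ _.
have /(congr1 (fun f => f u)) /= := HB _ bA.
rewrite linearZ'// => /(congr1 (fun w => (ip u u)^-1 *: w)).
by rewrite !scalerA mulVf// scale1r mulrC => <-.
Qed.

(** The elements of the intersection [Wstar] are bounded because the algebra of all bounded
    operators is among those intersected: only scalars commute with it, and they preserve every
    subspace. *)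
Lemma Wstar_star (F : set (set (H * H))) : (forall T, F T -> subspace T) ->
  star_closed (Wstar F).
Proof.
move=> Fs; split=> A HA.
  apply: (HA _ von_neumann_all) => T FT B /commutant_all[c Hc] x y Txy.
  rewrite !Hc; exact: (subspaceZ (Fs _ FT) c Txy).
by move=> M vM HM; have [_ adjM _] := vM; apply: adjM; exact: HA.
Qed.

(** [N] is the union of the commutants of the algebras [M]. An operator commuting with [N] lies in
    each bicommutant of [M], which is [M], hence in [Wstar]. So the commutant of [Wstar] lies in the
    bicommutant of [N], which preserves [T] because [N] does. *)
Lemma Wstar_affiliated (F : set (set (H * H))) T : (forall T, F T -> closed_graph T) ->
  F T -> affiliated T (Wstar F).
Proof.
move=> Fc FT B HB.
pose N := [set C | exists M, [/\ von_neumann M, (forall T, F T -> affiliated T M) & commutant M C]].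
apply: (@preserves_bicommutant T N B); first exact: Fc.
- split=> C [M [vM HM cC]]; first by case: cC.
  exists M; split=> //; apply: (commutant_star _).2 => //.
  by case: vM.
- by move=> C [M [vM HM cC]]; exact: HM FT C cC.
case: HB => bB HB; split=> // A [bA HA]; apply: HB => M vM HM.
case: (vM) => _ _ <-; split=> // C cC; apply: HA.
by exists M.
Qed.

(** [(x, z)] is in the graph of the adjoint of [T]; as a relation it makes sense whether or not [T]
    is densely defined. *)
Definition adjoint_pair T x z := forall u v, T (u, v) -> ip v x = ip u z.

Lemma closed_graph_scale T (d : R[i]) : closed_graph T ->
  closed_graph [set p | T (p.1, d *: p.2)].
Proof.
move=> [[T0 Ts] Tcl]; split.
  split; first by rewrite /= scaler0.
  move=> c [x y] [x' y'] /= Tx Ty.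
  by rewrite scalerDr scalerA mulrC -scalerA; exact: (Ts c (x, d *: y) (x', d *: y')).
move=> p /(ipcl_seq)[u Hu /(cvs2 hipP)[H1 H2]].
apply: Tcl; apply: (@cvs_ipcl _ _ _ _ (fun n => ((u n).1, d *: (u n).2))) => //.
by apply/(cvs2 hipP); split=> //=; exact: (cvsZ hipP).
Qed.

(** The bounded operator [A] is a multiple of an off-diagonal entry of the
    projection on the graph of [d T], for [d] small. *)
Lemma regularisation T N x y z (e : R) : closed_graph T ->
  star_closed N -> (forall C, N C -> preserves C T) ->
  ipcl ip [set u | exists v, T (u, v)] = setT ->
  ipcl ip [set u | exists v, adjoint_pair T u v] = setT ->
  T (x, y) -> adjoint_pair T x z -> 0 < e ->
  exists A, [/\ commutant N A, nm (y - A x) < e & nm (z - adj A x) < e].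
Proof.
move=> Tc Ns NT dT dT' Txy axz e0.
(* [y0] approximates [y] in the domain of the adjoint, and [u0] approximates [z] in the domain of
   [T]. *)
have e2 : 0 < e / 2 by rewrite divr_gt0.
have Hy : ipcl ip [set u | exists v, adjoint_pair T u v] y by rewrite dT'.
have [y0 [z0 a0] yy0] := Hy _ e2.
have e4 : 0 < e / 4 by rewrite divr_gt0.
have Hz : ipcl ip [set u | exists v, T (u, v)] z by rewrite dT.
have [u0 [v0 Tuv] zu0] := Hz _ e4.
pose m := nm z0 + nm v0 + 1.
have m0 : 0 < m by rewrite ltr_wpDl// addr_ge0// nm_ge0.
(* At this scale [d *: z0] and [d *: v0] have norm at most [e / 4]. *)
pose d := e / 4 / m.
have d0 : 0 < d by rewrite !divr_gt0.
pose dC : R[i] := (d%:C)%C.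
have dC0 : dC != 0.
  by rewrite /dC -[0]/((0%:C)%C) (inj_eq (@complexI _)) gt_eqF.
have dCJ : (dC^-1)^* = dC^-1 by rewrite fmorphV /= (_ : dC^* = dC)//; exact: conjCR.
pose Td := [set p | T (p.1, dC^-1 *: p.2)].
have Tdc : closed_graph Td by exact: closed_graph_scale.
have [P HP] := graph_proj Tdc.
have NTd C : N C -> preserves C Td.
  move=> NC s t /= /(NT _ NC); rewrite linearZ'//.
  by have [/(_ _ NC)[]] := Ns.
(* The graph of the adjoint, rotated and rescaled, is orthogonal to the graph of [d T]. *)
have Padj s t : adjoint_pair T s t -> P (- (dC *: t), s) = 0.
  move=> ast; apply: (proj_unique (ip2P hipP) Tdc.1 HP); first exact: Tdc.1.1.
  move=> [u v] /= Tuv'; rewrite subr0 /ip2 /= (ipNr hipP) (ipZr hipP).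
  rewrite -(ast _ _ Tuv') (ipZl hipP) dCJ mulrA mulfV// mul1r.
  exact: addNr.
have Pg s t : T (s, t) -> P (s, dC *: t) = (s, dC *: t).
  move=> Tst; apply: (proj_id (ip2P hipP) Tdc.1 HP); rewrite /Td /=.
  by rewrite scalerA mulVf// scale1r.
have bE i j := entry_bounded Tdc HP i j.
have lE i j : linear (entry i j P) by case: (bE i j).
have nE i j s : nm (entry i j P s) <= nm s by exact: (entry_nm HP).
have cE i j : commutant N (entry i j P) by exact: (entry_commutant Tdc HP i j Ns NTd).
have dCc : cabs dC = d by rewrite cabsR ger0_norm// ltW.
have nd (s : H) : nm s <= m -> nm (dC *: s) <= e / 4.
  move=> sm; rewrite (nmZ hipP) dCc /d mulrAC ler_pdivrMr// ler_wpM2l//.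
  by rewrite ltW.
have NL C : N C -> linear C by case: Ns => + _ => /[apply] -[].
exists (fun s => dC^-1 *: entry true false P s + 0 *: s); split.
- have -> : (fun s => dC^-1 *: entry true false P s + 0 *: s) =
            (fun s => dC^-1 *: entry true false P s + (0 *: entry true false P s + 0 *: entry true false P s)).
    by apply/funext => s; rewrite !scale0r !addr0.
  apply: commutant_lin => //; apply: commutant_lin => //.
  have -> : (fun s => 0 *: entry true false P s) =
     (fun s => (-1) *: entry true false P s + entry true false P s).
    by apply/funext => s; rewrite scale0r scaleN1r addNr.
  exact: commutant_lin.
(* [y - A x] is the lower right entry at [y]. That entry contracts [y - y0], and at [y0] it equals
   the lower left entry at [d *: z0], which is small. *)
- rewrite scale0r addr0.
  have /(congr1 snd) := Pg _ _ Txy; rewrite (entriesE Tdc HP) /=.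
  move=> /(congr1 (fun s => dC^-1 *: s)).
  rewrite scalerDr (linearZ' (lE true true)) !scalerA mulVf// !scale1r => H1.
  rewrite -{1}H1 addrAC subrr add0r -[y](subrK y0) (linearD' (lE true true)).
  rewrite (le_lt_trans (nmD hipP _ _))// [ltRHS]splitr ltr_leD//.
    exact: le_lt_trans (nE _ _ _) yy0.
  have /(congr1 snd) := Padj _ _ a0; rewrite (entriesE Tdc HP) /= => /eqP.
  rewrite addrC addr_eq0 => /eqP ->.
  rewrite (linearN' (lE true false)) opprK.
  rewrite (le_trans (nE _ _ _))// (le_trans (nd _ _))//.
    by rewrite /m -addrA lerDl addr_ge0// nm_ge0.
  lra.
(* Likewise [adj A x] is the upper left entry at [z], and [u0] minus that entry at [u0] is the upper
   right entry at [d *: v0]. *)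
have -> : adj (fun s => dC^-1 *: entry true false P s + 0 *: s) =
          fun s => dC^-1 *: entry false true P s.
  apply: adj_def => s t; rewrite scale0r addr0 (ipZl hipP) (ipZr hipP).
  by rewrite (entry_adj HP) dCJ.
have /(congr1 fst) := Padj _ _ axz; rewrite (entriesE Tdc HP) /= => /eqP.
rewrite addrC addr_eq0 => /eqP ->.
rewrite (linearN' (lE false false)) opprK (linearZ' (lE false false)) scalerA mulVf//.
rewrite scale1r -{2}[z](subrK u0) (linearD' (lE false false)) opprD addrA addrAC.
have /(congr1 fst) := Pg _ _ Tuv; rewrite (entriesE Tdc HP) /= => H1.
have -> : entry false false P u0 = u0 - entry false true P (dC *: v0).
  by rewrite -[X in X - _]H1 addrK.
have -> : z - (u0 - entry false true P (dC *: v0)) - entry false false P (z - u0) =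
  (z - u0) - entry false false P (z - u0) + entry false true P (dC *: v0).
  by rewrite opprB addrA addrAC [in RHS]addrAC; congr (_ - _); rewrite addrAC.
rewrite (le_lt_trans (nmD hipP _ _))//.
have h1 : nm (entry false true P (dC *: v0)) <= e / 4.
  by apply: (le_trans (nE _ _ _)); apply: nd; rewrite /m addrAC lerDr addr_ge0 ?nm_ge0.
have h2 := nmB hipP (z - u0) (entry false false P (z - u0)).
have h3 := nE false false (z - u0); move: h1 h2 h3 zu0 e0; clear; lra.
Qed.

End GraphProjection.

(** * Vertex operator superalgebras *)

Lemma ioddP (m : int) : iodd m = false <-> exists k : int, m = 2 * k.
Proof.
rewrite /iodd; split=> [H|[k ->]]; last by rewrite abszM oddM.
by exists (m %/ 2)%Z; lia.
Qed.

Lemma iodd_double (k : int) : iodd (2 * k) = false.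
Proof. by apply/ioddP; exists k. Qed.

Lemma ioddD (m n : int) : iodd (m + n) = iodd m (+) iodd n.
Proof. rewrite /iodd; lia. Qed.

Section VosaAlgebra.
Context {R : realType} {V : vosaData R} (vp : is_vosa V).
Implicit Types (a b c : V) (D E m n : int).

Lemma LopD n a b : Lop n (a + b) = Lop n a + Lop n b.
Proof. by rewrite /Lop linearD. Qed.
Lemma LopZ n (x : R[i]) a : Lop n (x *: a) = x *: Lop n a.
Proof. by rewrite /Lop linearZ. Qed.
Lemma LopB n a b : Lop n (a - b) = Lop n a - Lop n b.
Proof. by rewrite /Lop linearB. Qed.
Lemma Lop0 n : Lop n (0 : V) = 0.
Proof. by rewrite /Lop linear0. Qed.

Lemma nprodDl n a a' b : nprod (a + a') n b = nprod a n b + nprod a' n b.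
Proof. by have := nprod_linear vp n b 1 a a'; rewrite !scale1r. Qed.
Lemma nprod0l n b : nprod (0 : V) n b = 0.
Proof.
have /eqP := nprodDl n 0 0 b; rewrite addr0. by rewrite -subr_eq subrr eq_sym => /eqP.
Qed.
Lemma nprodZl n (x : R[i]) a b : nprod (x *: a) n b = x *: nprod a n b.
Proof. by have := nprod_linear vp n b x a 0; rewrite nprod0l !addr0. Qed.
Lemma nprodBl n a a' b : nprod (a - a') n b = nprod a n b - nprod a' n b.
Proof. by rewrite -scaleN1r nprodDl nprodZl scaleN1r. Qed.

(** As [T] kills the vacuum, the commutator of [T] with [a_(n)] passes vanishing on the vacuum from
    [n] to [n - 1] as long as [n] is not 0; the truncation axiom starts the descent. *)
Lemma nprod_vac_ge0 a (k : nat) : nprod a k vac = 0.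
Proof.
have [N HN] := nprod_trunc vp a vac.
have H n : nprod a n vac = 0 -> n != 0 -> nprod a (n - 1) vac = 0.
  move=> a0 n0; have := transl_deriv vp a n vac.
  rewrite (transl_vac vp) a0 !linear0 addr0 => /esym/eqP.
  by rewrite oppr_eq0 scaler_eq0 intr_eq0 (negbTE n0) => /eqP.
suff {HN} K : forall j : nat, nprod a (k + j)%N vac = 0 -> nprod a k vac = 0.
  by apply: (K `|N|%N); apply: HN; lia.
elim=> [|j IH]; first by rewrite addn0.
rewrite addnS => /H -/(_ isT) K; apply: IH.
by rewrite -K; congr (nprod _ _ _); lia.
Qed.

(** The same commutator, followed towards negative indices from [a_(-1) vac = a]. *)
Lemma nprod_vac_neg a (k : nat) :
  nprod a (- (k.+1)%:Z) vac = (k`!%:R)^-1 *: iter k transl a.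
Proof.
elim: k => [|k IH]; first by rewrite (nprod_creation vp) fact0 invr1 scale1r.
have := transl_deriv vp a (- (k.+1)%:Z) vac.
rewrite (transl_vac vp) linear0 subr0 IH linearZ /= -scaleNr -intrN opprK.
rewrite (_ : - (k.+1)%:Z - 1 = - (k.+2)%:Z); last lia.
move=> /(congr1 (fun t => (k.+1%:R)^-1 *: t)); rewrite !scalerA.
rewrite mulVf ?pnatr_eq0// scale1r => <-.
by rewrite factS natrM invfM.
Qed.

Lemma Lop_vac n : - 1 <= n -> Lop n (vac : V) = 0.
Proof.
move=> n1; rewrite /Lop; case E: (n + 1) => [k|k]; last lia.
exact: nprod_vac_ge0.
Qed.

Lemma nuE : Lop (- 2) (vac : V) = nu.
Proof. by rewrite /Lop (nprod_creation vp). Qed.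

(** Away from [m + n = 0] there is no central term; for L_1 and L_(-1), treated next, it vanishes
    because m^3 - m does. *)
Lemma LopC m n b : m + n != 0 ->
  Lop m (Lop n b) = (m - n)%:~R *: Lop (m + n) b + Lop n (Lop m b).
Proof.
move=> mn; have [cc H] := virasoro vp; have := H m n b.
by rewrite (negbTE mn) scale0r addr0 => <-; rewrite subrK.
Qed.

Lemma LopC11 b : Lop 1 (Lop (- 1) b) = 2 *: Lop 0 b + Lop (- 1) (Lop 1 b).
Proof.
have [cc H] := virasoro vp; have := H 1 (- 1) b.
have -> : (if 1 + -1 == 0 :> int then cc / 12 * (1 ^+ 3 - 1)%:~R else 0) = 0 :> R[i].
  by rewrite expr1n subrr mulr0.
by rewrite scale0r addr0 => <-; rewrite subrK.
Qed.

Lemma wt_nu : wt 4 (nu : V).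
Proof.
rewrite /wt -nuE LopC// [X in _ + X = _](_ : _ = 0); last first.
  by rewrite Lop_vac// Lop0.
rewrite addr0 add0r; congr (_ *: _).
by rewrite /halfC; apply: (mulIf (_ : (2 : R[i]) != 0)); rewrite ?pnatr_eq0// divfK ?pnatr_eq0// -natrM.
Qed.

Lemma L1_nu : Lop 1 (nu : V) = 0.
Proof.
rewrite -nuE LopC// [X in _ + X = _](_ : _ = 0); last first.
  by rewrite Lop_vac// Lop0.
by rewrite addr0 Lop_vac// scaler0.
Qed.

Lemma wt0 D : wt D (0 : V). Proof. by rewrite /wt Lop0 scaler0. Qed.
Lemma wt_lin D (x : R[i]) a b : wt D a -> wt D b -> wt D (x *: a + b).
Proof.
rewrite /wt LopD LopZ => -> ->.
by rewrite scalerDr !scalerA mulrC.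
Qed.
Lemma wtZ D (x : R[i]) a : wt D a -> wt D (x *: a).
Proof. by move=> wa; rewrite -[_ *: _]addr0; apply: wt_lin => //; exact: wt0. Qed.
Lemma wtB D a b : wt D a -> wt D b -> wt D (a - b).
Proof. by move=> wa wb; rewrite addrC -scaleN1r; exact: wt_lin. Qed.
Lemma wt_sum D I (r : seq I) (P : pred I) (F : I -> V) :
  (forall i, P i -> wt D (F i)) -> wt D (\sum_(i <- r | P i) F i).
Proof.
move=> H; elim/big_ind: _ => [|a b wa wb|//]; first exact: wt0.
by rewrite -[a]scale1r; exact: wt_lin.
Qed.

Lemma wt_Lop D n a : wt D a -> wt (D - 2 * n) (Lop n a).
Proof.
rewrite /wt => wa; have [->|n0] := eqVneq n 0.
  by rewrite wa LopZ wa mulr0 subr0.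
rewrite LopC ?add0r// wa LopZ -scalerDl; congr (_ *: _).
rewrite /halfC rmorphB rmorphM rmorphN /= mulrBl addrC; congr (_ - _).
by rewrite mulrAC divff ?pnatr_eq0// mul1r.
Qed.

Lemma wt_transl D a (n : nat) : wt D a -> wt (D + 2 * n%:Z) (iter n transl a).
Proof.
move=> wa; elim: n => [|n IH]; first by rewrite mulr0 addr0.
rewrite iterS -(L_transl vp).
have := wt_Lop (- 1) IH; congr (wt _ _); lia.
Qed.

Lemma translE a : transl a = Lop (- 1) a. Proof. by rewrite (L_transl vp). Qed.

Lemma parity_split a : exists a0 a1, [/\ parity false a0, parity true a1 & a = a0 + a1].
Proof.
exists (2^-1 *: (a + Gam a)), (2^-1 *: (a - Gam a)); split.
- by rewrite /parity expr0 scale1r linearZ linearD /= (Gam_invol vp) [in RHS]addrC.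
- rewrite /parity expr1 scaleN1r linearZ linearB /= (Gam_invol vp) -scalerN.
  by rewrite opprB.
- rewrite -scalerDr (_ : a + Gam a + (a - Gam a) = 2 *: a).
    by rewrite scalerA mulVf ?scale1r// pnatr_eq0.
  by rewrite addrACA subrr addr0 scaler_nat mulr2n.
Qed.

Lemma ex_decomp a : exists s, wt_seq s /\ a = vsum s.
Proof.
have [a0 [a1 [/(grading vp)[s [ws _ ->]] /(grading vp)[t [wtt _ ->]] ->]]] := parity_split a.
exists (s ++ t); split; last by rewrite /vsum big_cat.
by move=> x; rewrite mem_cat => /orP[/ws|/wtt].
Qed.

Lemma wt_span (P : set V) : P 0 -> (forall a b, P a -> P b -> P (a + b)) ->
  (forall D a, wt D a -> P a) -> forall a, P a.
Proof.
move=> P0 PD Pw a; have [s [ws ->]] := ex_decomp a; rewrite /vsum big_seq.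
by elim/big_ind: _ => // x /ws; exact: Pw.
Qed.

Lemma wt_parity D a : wt D a -> parity (iodd D) a.
Proof.
move=> wa; apply/(grading vp); exists [:: (D, a)]; split.
- by move=> x; rewrite inE => /eqP ->.
- by move=> x; rewrite inE => /eqP ->.
- by rewrite /vsum big_seq1.
Qed.

Lemma parity_unique p q a : parity p a -> parity q a -> a != 0 -> p = q.
Proof.
rewrite /parity => -> H a0; case: p q H => -[]//; rewrite ?expr0 ?expr1 scaleN1r scale1r.
  by move=> /eqP; rewrite eq_sym -addr_eq0 -mulr2n -scaler_nat scaler_eq0 pnatr_eq0 (negbTE a0).
by move=> /eqP; rewrite -addr_eq0 -mulr2n -scaler_nat scaler_eq0 pnatr_eq0 (negbTE a0).
Qed.

(** [D] is twice the weight, so the 2 L_0 in the commutator of L_1 and L_(-1) acts by an integer,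
    and the successive commutators add up to (n + 1)(D + n). *)
Lemma L1_transl D a (n : nat) : wt D a -> Lop 1 a = 0 ->
  Lop 1 (iter n.+1 transl a) = (n.+1%:R * (D + n%:Z)%:~R) *: iter n transl a.
Proof.
move=> wa a1; elim: n => [|n IH].
  rewrite /= translE LopC11 a1 Lop0 addr0 wa scalerA addr0 mul1r; congr (_ *: _).
  by rewrite /halfC mulrC divfK ?pnatr_eq0.
rewrite iterS translE LopC11 IH (wt_transl n.+1 wa) LopZ -translE -iterS.
rewrite scalerA -scalerDl; congr (_ *: _).
rewrite /halfC mulrC divfK ?pnatr_eq0//.
have -> : (n.+2%:R : R[i]) = ((n.+2)%:Z)%:~R by [].
have -> : (n.+1%:R : R[i]) = ((n.+1)%:Z)%:~R by [].
rewrite -!intrM -intrD; congr (_%:~R); lia.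
Qed.

(** Both fields [(Ta)(z)] and [a(z)'] are local with respect to all fields and
    create the same states from the vacuum. *)
Lemma nprod_transl a n b : nprod (transl a) n b = - (n%:~R *: nprod a (n - 1) b).
Proof.
suff K p q a' b' n' : parity p a' -> parity q b' ->
    nprod (transl a') n' b' = - (n'%:~R *: nprod a' (n' - 1) b').
  have [a0 [a1 [p0 p1 ->]]] := parity_split a.
  have [b0 [b1 [q0 q1 ->]]] := parity_split b.
  rewrite [transl _]linearD !nprodDl ![nprod _ _ (b0 + b1)]linearD /=.
  rewrite (K _ _ _ _ _ p0 q0) (K _ _ _ _ _ p0 q1).
  by rewrite (K _ _ _ _ _ p1 q0) (K _ _ _ _ _ p1 q1) !scalerDr !opprD.
move=> {a b n} pa pb.
have [N1 HN1] := locality vp pa pb.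
have [N2 HN2] := locality vp (transl_even vp pa) pb.
have [M [PN1 MN1 MN2]] : exists M, [/\ (N1 <= M)%N, (N1 <= M.+1)%N & (N2 <= M.+1)%N].
  by exists (maxn N1 N2); rewrite leq_maxl !leqW ?leq_maxl ?leq_maxr.
pose D k (c : V) := nprod (transl a') k c + k%:~R *: nprod a' (k - 1) c.
have Dvac k : D k vac = 0.
  rewrite /D; case: k => [k|k].
    rewrite nprod_vac_ge0 add0r; case: k => [|k]; first by rewrite scale0r.
    by rewrite (_ : (k.+1)%:Z - 1 = k); [rewrite nprod_vac_ge0 scaler0|lia].
  rewrite NegzE nprod_vac_neg (_ : - (k.+1)%:Z - 1 = - (k.+2)%:Z); last lia.
  rewrite nprod_vac_neg intrN scaleNr scalerA -iterSr factS natrM invfM mulrA.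
  by rewrite divff ?pnatr_eq0// mul1r subrr.
have DD k (c d : V) (x : R[i]) : D k (x *: c + d) = x *: D k c + D k d.
  rewrite /D ![nprod _ _ (x *: c + d)]linearP /= !scalerDr !scalerA.
  by rewrite [x * k%:~R]mulrC addrACA.
have D0 k : D k 0 = 0 by rewrite /D !linear0 addr0.
pose C k l (c : V) := D k (nprod b' l c) - (-1) ^+ (p && q) *: nprod b' l (D k c).
have CE u l d : C u l d = scomm p q (transl a') u b' l d + u%:~R *: scomm p q a' (u - 1) b' l d.
  rewrite /C /D /scomm [nprod b' l (_ + _)]linearD [nprod b' l (_ *: _)]linearZ /=.
  rewrite !scalerBr !scalerDr !scalerA [u%:~R * _]mulrC.
  by rewrite opprD addrACA.
(* [D] is local with [b'] to order M + 1. In the part with [a'] the factor m + M + 1 - j splits: its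
   constant part multiplies the locality sum of order M + 1, and j C(M + 1, j) = (M + 1) C(M, j - 1)
   turns the rest into the sum of order M. *)
have loc m k c : \sum_(j < M.+2) ((-1) ^+ j *+ 'C(M.+1, j)) *: C (m + M.+1%:Z - j%:Z) (k + j%:Z) c = 0.
  pose w (j : nat) := ((-1) ^+ j *+ 'C(M.+1, j)) *: scomm p q a' (m - 1 + M.+1%:Z - j%:Z) b' (k + j%:Z) c.
  have S1 : \sum_(j < M.+2) w j = 0 := HN1 _ MN1 (m - 1) k c.
  have S2 := HN1 _ PN1 (m - 1) (k + 1) c.
  transitivity (\sum_(j < M.+2) ((m + M.+1%:Z)%:~R *: w j - j%:R *: w j)).
    transitivity (\sum_(j < M.+2) ((-1) ^+ j *+ 'C(M.+1, j)) *: ((m + M.+1%:Z - j%:Z)%:~R *: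
      scomm p q a' (m + M.+1%:Z - j%:Z - 1) b' (k + j%:Z) c)).
      transitivity (\sum_(j < M.+2) (((-1) ^+ j *+ 'C(M.+1, j)) *:
         scomm p q (transl a') (m + M.+1%:Z - j%:Z) b' (k + j%:Z) c +
        ((-1) ^+ j *+ 'C(M.+1, j)) *: ((m + M.+1%:Z - j%:Z)%:~R *:
         scomm p q a' (m + M.+1%:Z - j%:Z - 1) b' (k + j%:Z) c))).
        by apply: eq_bigr => j _; rewrite CE scalerDr.
      by rewrite big_split /= HN2// add0r.
    apply: eq_bigr => j _; rewrite /w -scalerBl !scalerA mulrC; congr (_ * _ *: scomm _ _ _ _ _ _ _).
      by rewrite rmorphB.
    lia.
  rewrite sumrB -scaler_sumr S1 scaler0 sub0r big_ord_recl scale0r add0r.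
  rewrite -[RHS](scaler0 _ (M.+1%:R)) -[in RHS]S2 scaler_sumr -sumrN.
  apply: eq_bigr => j _; rewrite lift0 /w !scalerA -scaleNr.
  rewrite (_ : m - 1 + M.+1%:Z - (j.+1)%:Z = m - 1 + M%:Z - j%:Z); last lia.
  rewrite (_ : k + (j.+1)%:Z = k + 1 + j%:Z); last lia.
  suff -> : - (j.+1%:R * ((-1) ^+ j.+1 *+ 'C(M.+1, j.+1))) =
      M.+1%:R * ((-1) ^+ j *+ 'C(M, j)) :> R[i] by [].
  rewrite exprS mulN1r mulNrn mulrN opprK -[_ *+ 'C(M.+1, _)]mulr_natr.
  by rewrite -[_ *+ 'C(M, _)]mulr_natr mulrCA [RHS]mulrCA -!natrM -mul_bin_diag.
(* On the vacuum, starting from [b'_(-1)], only the term [j = 0] survives: nonnegative modes of [b']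
   kill the vacuum, and so does every [D]. *)
have Db k : D k b' = 0.
  have := loc (k - M.+1%:Z) (- 1) vac; rewrite big_ord_recl big1 => [|i _].
    rewrite addr0 (_ : k - M.+1%:Z + M.+1%:Z - (ord0 : 'I_M.+2)%:Z = k); last by rewrite subrK subr0.
    rewrite bin0 expr0 mulr1n scale1r (_ : -1 + _ = - 1); last by rewrite addr0.
    by rewrite /C Dvac [nprod b' _ 0]linear0 scaler0 subr0 (nprod_creation vp).
  rewrite /C Dvac [nprod b' _ 0]linear0 scaler0 subr0 (_ : -1 + _ = i%:Z); last by rewrite lift0; lia.
  by rewrite nprod_vac_ge0 D0 scaler0.
by have /eqP := Db n'; rewrite /D addr_eq0 => /eqP.
Qed.

(** The equation expresses [f n] through the [N] values after it, so vanishing propagates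
    downwards. *)
Lemma diff_eq0 (N : nat) (f : int -> V) :
  (forall n, \sum_(j < N.+1) ((-1) ^+ j *+ 'C(N, j)) *: f (n + j%:Z) = 0) ->
  (forall n, 0 < n -> f n = 0) -> forall n, f n = 0.
Proof.
move=> Hf f0.
have K (k : nat) : forall n, - k%:Z < n -> f n = 0.
  elim: k => [|k IH] n; first by rewrite oppr0; exact: f0.
  have [nk _|kn nk] := ltP (- k%:Z) n; first exact: IH.
  have := Hf n; rewrite big_ord_recl big1 => [|i _].
    by rewrite !addr0 bin0 expr0 mulr1n scale1r.
  by rewrite lift0 IH ?scaler0//; lia.
by move=> n; apply: (K `|n|.+1); lia.
Qed.

(** [n |-> [w_(-n), nu_(n)] vac] is polynomial by locality; it is [- 2 n w] for
    [n > 0] but vanishes at [n = -1]. *)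
Lemma nu_unique (w : V) : parity false w -> wt 4 w -> Lop 1 w = 0 ->
  (forall b, nprod w 1 b = 0) ->
  (forall u : V, wt 0 u -> transl u = 0) ->
  (forall D (u : V), D < 0 -> wt D u -> u = 0) -> w = 0.
Proof.
move=> pw w4 w1 H1 T0 Wpos.
have [N HN] := locality vp pw (nu_even vp).
pose P n := scomm false false w (- n) nu n (vac : V).
have Ploc n : \sum_(j < N.+1) ((-1) ^+ j *+ 'C(N, j)) *: P (n + j%:Z) = 0.
  rewrite -[RHS](HN _ (leqnn N) (- n - N%:Z) n vac).
  apply: eq_bigr => j _; rewrite /P (_ : - (n + j%:Z) = - n - N%:Z + N%:Z - j%:Z)//.
  lia.
have F (k j : nat) : @Lop R V k.+1 (iter j.+1 (@transl R V) w) =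
    k.+2%:R *: Lop k (iter j (@transl R V) w) + @transl R V (Lop k.+1 (iter j (@transl R V) w)).
  rewrite iterS !translE; case: k => [|k]; first exact: LopC11.
  rewrite LopC//; congr (_ *: Lop _ _ + _).
  by rewrite (_ : (k.+2)%:Z - -1 = (k.+3)%:Z)//; lia.
have wF (k j : nat) : wt (4 + 2 * j%:Z - 2 * k%:Z) (Lop k (iter j (@transl R V) w)).
  exact/wt_Lop/wt_transl.
(* In [F], the first term vanishes by induction and the second is [T] of a vector of weight 0. *)
have F1 (j : nat) : Lop j.+1 (iter j (@transl R V) w) = 0.
  elim: j => [|j IH]; first exact: w1.
  rewrite F IH scaler0 add0r; apply: T0.
  by have := wF j.+2 j; rewrite (_ : 4 + _ - _ = 0)//; lia.
have F0 (j : nat) : Lop j (iter j (@transl R V) w) = (2 * j.+1`!%:R) *: w.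
  elim: j => [|j IH].
    rewrite /= w4 mulr1; congr (_ *: _); rewrite /halfC.
    by apply: (mulIf (_ : (2 : R[i]) != 0)); rewrite ?pnatr_eq0// divfK ?pnatr_eq0// -natrM.
  by rewrite F F1 [@transl R V 0]linear0 addr0 IH scalerA [in RHS]factS natrM mulrCA.
have Pn (k : nat) : P (k.+1)%:Z = - ((2 * k.+1%:R) *: w).
  rewrite /P /scomm expr0 scale1r nprod_vac_ge0 [nprod w _ 0]linear0 sub0r nprod_vac_neg.
  rewrite [nprod nu _ _]linearZ /= (_ : (k.+1)%:Z = k%:Z + 1); last lia.
  rewrite -/(Lop k _) F0 scalerA factS natrM; congr (- (_ *: _)).
  by field; rewrite pnatr_eq0 -lt0n fact_gt0.
have Pm : P (- 1) = 0.
  rewrite /P /scomm expr0 scale1r opprK H1 nprod_vac_ge0.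
  by rewrite [nprod nu _ 0]linear0 subr0.
(* The second difference of [P] vanishes for positive [n], where [P] is linear, hence everywhere by
   locality. At 0 it gives [P 0 = 0], and then at -1 it gives [P 1 = 0]. *)
pose Q n := P n - 2 *: P (n + 1) + P (n + 2).
have Q0 n : Q n = 0.
  apply: (@diff_eq0 N) => {n} [n|[n|//]].
    transitivity (\sum_(j < N.+1) (((-1) ^+ j *+ 'C(N, j)) *: P (n + j%:Z)
      - 2 *: (((-1) ^+ j *+ 'C(N, j)) *: P (n + 1 + j%:Z))
      + ((-1) ^+ j *+ 'C(N, j)) *: P (n + 2 + j%:Z))).
      apply: eq_bigr => j _; rewrite /Q (addrAC n j%:Z 1) (addrAC n j%:Z 2).
      by rewrite scalerDr scalerBr scalerA [_ * 2]mulrC -scalerA.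
    by rewrite big_split sumrB /= -scaler_sumr !Ploc scaler0 subr0 addr0.
  case: n => [//|n] _; rewrite /Q (_ : (n.+1)%:Z + 1 = (n.+2)%:Z); last lia.
  rewrite (_ : (n.+1)%:Z + 2 = (n.+3)%:Z); last lia.
  rewrite !Pn scalerN scalerA opprK -!scaleNr -!scalerDl.
  rewrite (_ : _ + _ = 0) ?scale0r//.
  rewrite -[n.+2%:R]natr1 -[n.+3%:R]natr1 -[n.+2%:R]natr1 /GRing.scale /=; ring.
have /eqP := Q0 (- 1); rewrite /Q Pm [-1 + 1]addNr (_ : -1 + 2 = 1)// sub0r.
have /eqP := Q0 0; rewrite /Q !add0r (Pn 0%N) (Pn 1%N) scalerN opprK scalerA.
rewrite -addrA mulr1 -scaleNr -scalerDl subrr scale0r addr0 => /eqP ->.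
rewrite scaler0 oppr0 add0r oppr_eq0 scaler_eq0 pnatr_eq0.
by move=> /eqP.
Qed.

End VosaAlgebra.

(** * Positivity and the decomposition into quasi-primary vectors *)

Section UnitaryVosa.
Context {R : realType} (V : unitaryVosa R).
Local Notation ip := (sprod (vdot V)).
Local Notation nm := (ipnorm ip).
Local Notation T := (@transl R V).
Local Notation th := (@theta R V).
Implicit Types (a b c : V) (D E m : int) (n : nat).

Lemma vipP : is_ip ip. Proof. exact: sprod_is_ip. Qed.
Let vp : is_vosa V := vosaP V.
Let up := unitaryP V.

(** Zero is allowed, unlike in [quasi_primary], because vectors such as [v - T u] below may
    vanish. *)
Definition quasi D a := wt D a /\ Lop 1 a = 0.

Definition sgn_adj D : R[i] := (-1) ^ ((D * (D + 1)) %/ 2)%Z.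

Lemma sgn_adj_sqr D : sgn_adj D * sgn_adj D = 1.
Proof. by rewrite /sgn_adj -expfzMl mulrNN mulr1 exp1rz. Qed.

Lemma qp_adj D a m b c : quasi D a ->
  ip (nprod (th a) m b) c = sgn_adj D * ip b (nprod a (D - m - 2) c).
Proof.
move=> [wa a1]; rewrite (invariance up wa (N := 1))// big_ord1 /= fact0 divr1.
by rewrite subr0.
Qed.

(** [nu] is quasi-primary, fixed by [theta] and of doubled weight 4, for which the sign in the
    invariance is (-1)^10. *)
Lemma L_adj m b c : ip (Lop m b) c = ip b (Lop (- m) c).
Proof.
have := @qp_adj 4 nu (m + 1) b c (conj (wt_nu vp) (L1_nu vp)).
rewrite (theta_nu up) /Lop => ->; rewrite /sgn_adj (_ : ((4 * (4 + 1)) %/ 2)%Z = 10%:Z)//.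
rewrite -exprnP -signr_odd expr0 mul1r; congr (ip _ (nprod _ _ _)); lia.
Qed.

Lemma T_adj b c : ip (T b) c = ip b (Lop 1 c).
Proof. by rewrite (translE vp) L_adj opprK. Qed.

Lemma halfC_inj : injective (halfC R).
Proof.
move=> D E /(congr1 (fun t => t * 2)); rewrite /halfC !divfK ?pnatr_eq0//.
by move=> /eqP; rewrite eqr_int => /eqP.
Qed.

Lemma halfC_conj D : (halfC R D)^* = halfC R D.
Proof. by rewrite /halfC rmorphM fmorphV rmorph_int rmorph_nat. Qed.

Lemma wt_orth D E a b : wt D a -> wt E b -> D != E -> ip a b = 0.
Proof.
move=> wa wb DE; have := L_adj 0 a b.
rewrite oppr0 wa wb (ipZl vipP) (ipZr vipP) halfC_conj => /eqP.
rewrite -subr_eq0 -mulrBl mulf_eq0 => /orP[|/eqP//].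
by rewrite subr_eq0 => /eqP /halfC_inj DE'; rewrite DE' eqxx in DE.
Qed.

Lemma ip_int_ge0 (k : int) a b : ip a a = k%:~R * ip b b -> b != 0 -> 0 <= k.
Proof.
move=> H b0; rewrite -(ler_int R).
have : (nm a ^+ 2 = k%:~R * nm b ^+ 2).
  apply: complexI; rewrite [in RHS]rmorphM /= -complex_int.
  by rewrite -!(ip_xx vipP) H.
have : 0 < nm b ^+ 2 by rewrite exprn_gt0// (nm_gt0 vipP).
by move=> b2 /(congr1 (fun t => t / nm b ^+ 2)); rewrite mulfK ?gt_eqF// => <-;
  rewrite divr_ge0// ?sqr_ge0// ltW.
Qed.

Lemma T_norm D a : wt D a -> Lop 1 a = 0 -> ip (T a) (T a) = D%:~R * ip a a.
Proof.
move=> wa a1; rewrite T_adj -[T a]/(iter 1 T a) (L1_transl vp 0 wa a1) (ipZr vipP).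
by rewrite addr0 mul1r.
Qed.

(** Repeated use of L_1 lowers the weight and must end, weights being bounded below, at a vector
    killed by L_1; there [(T a|T a) = D (a|a)] forces [D >= 0]. *)
Lemma wt_ge0 D a : wt D a -> a != 0 -> 0 <= D.
Proof.
have [D0 HD0] := wt_bounded_below vp.
suff K (k : nat) : forall D a, D < D0 + 2 * k%:Z -> wt D a -> a != 0 -> 0 <= D.
  by apply: (K `|D - D0|.+1); lia.
elim: k => [|k IH] {}D {}a Dk wa a0.
  by move: a0; rewrite (HD0 D a) ?eqxx//; lia.
have [a1|a1] := eqVneq (Lop 1 a) 0; first exact: ip_int_ge0 (T_norm wa a1) a0.
have := IH (D - 2 * 1) (Lop 1 a); move=> /(_ _ (wt_Lop vp 1 wa) a1) H.
by have := H ltac:(lia); lia.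
Qed.

Lemma wt_neg D a : D < 0 -> wt D a -> a = 0.
Proof. by move=> D0 wa; apply/eqP; apply: contraLR D0 => /(wt_ge0 wa); rewrite -leNgt. Qed.

Lemma wt0_T a : wt 0 a -> T a = 0.
Proof.
move=> wa; apply: (ip_eq0 vipP); rewrite (T_norm wa) ?mul0r//.
apply: (@wt_neg (0 - 2 * 1)) => //; exact: wt_Lop.
Qed.

(** Induction on the weight: if [L_1 T u = L_1 v], then [v - T u] is quasi-primary and [u] has
    smaller weight. Such a [u] exists because L_1 T is diagonal on the vectors [T^n a], with nonzero
    eigenvalues in positive weight. The induction is applied to subspaces other than [P]. *)
Lemma qp_span_wt E : forall P : set V, subspace P ->
  (forall D a n, quasi D a -> P (iter n T a)) -> forall v, wt E v -> P v.
Proof.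
have [k Ek] : exists k : nat, E < k%:Z by exists (`|E|.+1); lia.
elim/ltn_ind: k E Ek => k IH E Ek P Ps PT v wv.
(* Up to weight 1, [L_1 v] has weight at most 0: it vanishes in negative weight, and in weight 0
   because [T] kills it. *)
have [E0|E0] := leP E 2.
  suff v1 : Lop 1 v = 0 by exact: (PT E v 0%N).
  have w1 : wt (E - 2) (Lop 1 v) := wt_Lop vp 1 wv.
  have [E2|E2] := eqVneq E 2; last by apply: wt_neg w1; lia.
  apply: (ip_eq0 vipP); rewrite -T_adj wt0_T ?(ip0l vipP)//.
  by move: w1; rewrite E2.
have kE : E - 2 < (k - 2)%N%:Z by lia.
have kk : (k - 2 < k)%N by lia.
have w1 : wt (E - 2) (Lop 1 v) := wt_Lop vp 1 wv.
have [u [wu Hu]] : exists u, wt (E - 2) u /\ Lop 1 (T u) = Lop 1 v.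
  (* Solvability is weakened to equal pairings with the vectors of weight [E - 2]. This is linear in
     [w] and trivial in the other weights, so that it can be tested on all [T^n a]. *)
  pose Q' := [set w : V | exists w' u, [/\ wt (E - 2) u, Lop 1 (T u) = w' & forall x, wt (E - 2) x -> ip x w' = ip x w]].
  have Q's : subspace Q'.
    split.
      exists 0, 0; split=> //; first exact: wt0.
      by rewrite linear0 Lop0.
    move=> c x y [x' [ux [wx <- Hx]]] [y' [uy [wy <- Hy]]].
    exists (Lop 1 (T (c *: ux + uy))), (c *: ux + uy); split=> //; first exact: wt_lin.
    move=> z wz; rewrite linearP LopD LopZ !(ipDr vipP) !(ipZr vipP).
    by rewrite Hx ?Hy.
  have [|w' [u [wu Hw' Hw]]] := IH _ kk _ kE Q' Q's _ _ w1.
    move=> D a n [wa a1].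
    have [DE|DE] := eqVneq (D + 2 * n%:Z) (E - 2); last first.
      exists 0, 0; split=> //; first exact: wt0.
        by rewrite linear0 Lop0.
      move=> x wx; rewrite (ip0r vipP) (wt_orth wx (wt_transl vp n wa))// eq_sym.
      by [].
    have [D0|D0] := ltP D 0.
      have -> : iter n T a = 0.
        by rewrite (wt_neg D0 wa); elim: (n) => //= k' ->; exact: linear0.
      by case: Q's.
    have Dn : (n.+1%:R * (D + n%:Z)%:~R) != 0 :> R[i].
      rewrite mulf_neq0 ?pnatr_eq0// intr_eq0; lia.
    exists (iter n T a), ((n.+1%:R * (D + n%:Z)%:~R)^-1 *: iter n T a); split=> //.
      by apply: wtZ => //; rewrite -DE; exact: wt_transl.
    by rewrite linearZ LopZ -iterS (L1_transl vp n wa a1) scalerA mulVf// scale1r.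
  exists u; split=> //; rewrite Hw'.
  have ww' : wt (E - 2) w'.
    by rewrite -Hw'; have := wt_Lop vp 1 (wt_transl vp 1 wu); congr (wt _ _); lia.
  apply/eqP; rewrite -subr_eq0; apply/eqP/(ip_eq0 vipP).
  by rewrite (ipBr vipP) Hw ?subrr//; exact: wtB.
have -> : v = T u + (v - T u) by rewrite addrC subrK.
have wTu : wt E (T u).
  by have := wt_transl vp 1 wu; congr (wt _ _); lia.
apply: (subspaceD Ps).
  apply: (IH _ kk _ kE (fun x => P (T x))) => //.
    split; first by rewrite /= linear0; case: Ps.
    by move=> c x y /= Px Py; rewrite linearP; case: Ps => _; apply.
  by move=> D a n /(PT D a n.+1).
apply: (PT E (v - T u) 0%N); split; first exact: wtB.
by rewrite LopB Hu subrr.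
Qed.

Lemma qp_span (P : set V) : subspace P ->
  (forall D a n, quasi D a -> P (iter n T a)) -> forall v, P v.
Proof.
move=> Ps PT; apply: (wt_span vp); first by case: Ps.
  by move=> a b; exact: (subspaceD Ps).
by move=> D a; exact: qp_span_wt.
Qed.

Lemma theta0 : th 0 = 0.
Proof.
have := theta_antilinear up 1 0 0.
rewrite scale1r addr0 rmorph1 scale1r => /eqP.
by rewrite -subr_eq subrr eq_sym => /eqP.
Qed.

Lemma theta_Lop m a : th (Lop m a) = Lop m (th a).
Proof. by rewrite /Lop (theta_nprod up) (theta_nu up). Qed.

Lemma thetaZ (c : R[i]) a : th (c *: a) = c^* *: th a.
Proof. by have := theta_antilinear up c a 0; rewrite theta0 !addr0. Qed.

Lemma quasi_theta D a : quasi D a -> quasi D (th a).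
Proof.
move=> [wa a1]; split; last by rewrite -theta_Lop a1 theta0.
by rewrite /wt -theta_Lop wa thetaZ halfC_conj.
Qed.

Definition divT a n := (n`!%:R)^-1 *: iter n T a.

(** The binomial coefficient of [D + n - 1] over [n]; it is the squared norm of [a^n] relative to
    that of [a]. *)
Fixpoint poch D n : R := if n is n'.+1 then poch D n' * (D + n'%:Z)%:~R / n%:R else 1.

Lemma divT0 a : divT a 0 = a.
Proof. by rewrite /divT fact0 invr1 scale1r. Qed.

Lemma wt_divT D a n : wt D a -> wt (D + 2 * n%:Z) (divT a n).
Proof. by move=> wa; apply: wtZ; exact: wt_transl. Qed.

Lemma divTS a n : divT a n.+1 = (n.+1%:R)^-1 *: T (divT a n).
Proof. by rewrite /divT linearZ scalerA factS natrM invfM iterS. Qed.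

Lemma L1_divT D a n : quasi D a -> Lop 1 (divT a n.+1) = (D + n%:Z)%:~R *: divT a n.
Proof.
move=> [wa a1]; rewrite /divT LopZ (L1_transl vp n wa a1) !scalerA factS natrM.
congr (_ *: _); field.
by rewrite !pnatr_eq0 -lt0n fact_gt0 ?[1 + _]addrC ?natr1 ?pnatr_eq0.
Qed.

(** One [T] at a time is moved across as L_1, which lowers the index and produces the factor
    [D + n]. *)
Lemma gram D a b (m n : nat) : quasi D a -> Lop 1 b = 0 -> (n <= m)%N ->
  ip (divT b m) (divT a n) = if m == n then ((poch D n)%:C)%C * ip b a else 0.
Proof.
move=> qa b1; elim: n m => [|n IH] m.
  case: m => [|m] _; first by rewrite !divT0 mul1r.
  by rewrite divTS (ipZl vipP) T_adj divT0 (qa.2) (ip0r vipP) mulr0.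
case: m => [//|m]; rewrite ltnS => nm.
rewrite divTS (ipZl vipP) T_adj (L1_divT n qa) (ipZr vipP) IH// eqSS.
case: eqP => [->|_]; last by rewrite !mulr0.
rewrite fmorphV rmorph_nat !mulrA; congr (_ * _) => /=.
rewrite !rmorphM fmorphV /= -complex_int -complex_nat; ring.
Qed.

Lemma nm_divT D a n : quasi D a -> nm (divT a n) ^+ 2 = poch D n * nm a ^+ 2.
Proof.
move=> qa; apply: complexI; rewrite [in RHS]rmorphM /= -!(ip_xx vipP).
by rewrite (gram qa qa.2 (leqnn n)) eqxx.
Qed.

End UnitaryVosa.

(** * Modes and energy bounds *)

Section Modes.
Context {R : realType} (V : unitaryVosa R).
Local Notation ip := (sprod (vdot V)).
Local Notation nm := (ipnorm ip).
Local Notation T := (@transl R V).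
Local Notation th := (@theta R V).
Implicit Types (a b c : V) (D E m : int) (n : nat).
Let vp : is_vosa V := vosaP V.

Lemma sum_by_weight (s : seq (int * V)) (W : nmodType) (G : int * V -> W) :
  \sum_(x <- s) G x =
  \sum_(y <- undup [seq x.1 | x <- s]) \sum_(x <- s | x.1 == y) G x.
Proof.
under [RHS]eq_bigr do rewrite big_mkcond.
rewrite exchange_big /= big_seq [RHS]big_seq; apply: eq_bigr => x xs.
have xU : x.1 \in undup [seq x.1 | x <- s].
  by rewrite mem_undup; apply/mapP; exists x.
rewrite (bigD1_seq x.1)//= ?undup_uniq// eqxx big1 ?addr0// => y.
by rewrite eq_sym => /negbTE ->.
Qed.

(** [mode] uses an arbitrary decomposition into weight vectors. Grouped by weight, the components of
    weight other than [D] are orthogonal to the sum and to each other, hence vanish, so the choice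
    does not matter. *)
Lemma sum_wt_seq (s : seq (int * V)) (W : nmodType) (F : int -> V -> W) D :
  wt_seq s -> (forall E a b, F E (a + b) = F E a + F E b) -> (forall E, F E 0 = 0) ->
  wt D (vsum s) -> \sum_(x <- s) F x.1 x.2 = F D (vsum s).
Proof.
move=> ws FD F0 wD; pose U := undup [seq x.1 | x <- s].
pose v y := \sum_(x <- s | x.1 == y) x.2.
have wv y : wt y (v y).
  rewrite /v big_seq_cond; apply: wt_sum => x /andP[xs /eqP <-]; exact: ws.
have vs : vsum s = \sum_(y <- U) v y by rewrite /vsum (sum_by_weight s snd).
have v0 y : y \in U -> y != D -> v y = 0.
  move=> yU yD; apply: (ip_eq0 (vipP V)).
  rewrite -[RHS](wt_orth (wv y) wD yD) vs [in RHS](ip_sumr (vipP V)).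
  rewrite (bigD1_seq y)//= ?undup_uniq// big1 ?addr0// => z zy.
  by rewrite (wt_orth (wv y) (wv z))// eq_sym.
have FS y : \sum_(x <- s | x.1 == y) F x.1 x.2 = F y (v y).
  rewrite /v (big_morph (F y) (FD y) (F0 y)).
  by apply: eq_bigr => x /eqP ->.
rewrite (sum_by_weight s (fun x => F x.1 x.2)) vs.
under eq_bigr do rewrite FS.
have [DU|DU] := boolP (D \in U).
  rewrite !(bigD1_seq D)//= ?undup_uniq// big_seq_cond big1 => [|y /andP[yU yD]].
    rewrite addr0 [X in _ = F D (_ + X)]big_seq_cond [X in _ = F D (_ + X)]big1 ?addr0//.
    by move=> y /andP[yU yD]; rewrite v0.
  by rewrite v0// F0.
rewrite big_seq big1 => [|y yU]; last first.
  by rewrite v0 ?F0//; apply: contraNneq DU => <-.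
rewrite big_seq big1 ?F0// => y yU.
by rewrite v0//; apply: contraNneq DU => <-.
Qed.

Lemma hmodeD D m b a a' : hmode D (a + a') m b = hmode D a m b + hmode D a' m b.
Proof. by rewrite /hmode; case: ifP => _; rewrite ?addr0// nprodDl. Qed.

Lemma hmode0 D m b : hmode D 0 m b = 0.
Proof. by rewrite /hmode nprod0l// if_same. Qed.

Lemma modeE D a m b : wt D a -> mode a m b = hmode D a m b.
Proof.
move=> wa; have := @xgetPex _ [::] [set s : seq (int * V) | wt_seq s /\ a = vsum s]
  (ex_decomp vp a).
rewrite -/(wt_decomp a) /= => -[ws aE].
rewrite /mode (sum_wt_seq ws (F := fun E x => hmode E x m b) (D := D)) -?aE//.
  by move=> E x y; exact: hmodeD.
by move=> E; exact: hmode0.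
Qed.

Lemma hmodeP D a m (x : R[i]) b c : hmode D a m (x *: b + c) = x *: hmode D a m b + hmode D a m c.
Proof.
rewrite /hmode; case: ifP => _; first by rewrite scaler0 addr0.
by rewrite linearP.
Qed.

Lemma modeP a m (x : R[i]) b c : mode a m (x *: b + c) = x *: mode a m b + mode a m c.
Proof.
rewrite /mode scaler_sumr -big_split; apply: eq_bigr => y _; exact: hmodeP.
Qed.

Lemma hmode_adj D a m b c : quasi D a ->
  ip (hmode D (th a) m b) c = sgn_adj D * ip b (hmode D a (- m) c).
Proof.
move=> qa; rewrite /hmode.
have -> : iodd (- m + D) = iodd (m + D) by rewrite /iodd; lia.
case: ifP => [_|/ioddP[k mk]].
  by rewrite (ip0l (vipP V)) (ip0r (vipP V)) mulr0.
rewrite (qp_adj _ _ _ qa); congr (_ * ip _ (nprod _ _ _)); lia.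
Qed.

Lemma hmode_vac D a n : hmode D a (- (2 * n)%:Z - D) vac = divT a n.
Proof.
rewrite /hmode subrK (_ : iodd _ = false); last by rewrite /iodd; lia.
rewrite (_ : ((- (2 * n)%:Z) %/ 2)%Z - 1 = - (n.+1)%:Z); last lia.
exact: nprod_vac_neg.
Qed.

Lemma hmode_vac0 D a m : - D < m -> hmode D a m vac = 0.
Proof.
move=> Dm; rewrite /hmode; case: ifP => // /ioddP[k mk].
rewrite (_ : ((m + D) %/ 2)%Z - 1 = (`|k|.-1)%:Z); last lia.
exact: nprod_vac_ge0.
Qed.

Lemma le_powR_expn (x s : R) : 1 <= x -> 0 <= s -> x `^ s <= x ^+ (Num.truncn s).+1.
Proof.
move=> x1 s0; rewrite -powR_mulrn; last by rewrite (le_trans ler01).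
by apply: ler_powR => //; rewrite ltW// truncnS_gt.
Qed.

(** Natural exponents replace the real ones. The constants are uniform in the weight of [c], which
    is what lets fields act on infinite series of vectors. *)
Lemma energy_bound_wt (Veb : energy_bounded V) a :
  exists (C : R) (s k : nat), 0 <= C /\ forall m E c, wt E c ->
    nm (mode a m c) <= C * (`|m|.+1)%:R ^+ s * (`|E|.+1)%:R ^+ k * nm c.
Proof.
have [M [s [k [M0 s0 k0 HM]]]] := Veb a.
exists M, (Num.truncn s).+1, (Num.truncn k).+1; split=> // m E c wc.
have [->|c0] := eqVneq c 0.
  rewrite (nm0 (vipP V)) mulr0.
  have -> : mode a m 0 = 0.
    have := modeP a m 1 0 0; rewrite !scale1r addr0 => /eqP.
    by rewrite -subr_eq subrr eq_sym => /eqP.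
  by rewrite (nm0 (vipP V)).
have E0 := wt_ge0 wc c0.
have := HM m [:: (E, c)]; rewrite /vsum !big_seq1 => /(_ _)/le_trans; apply.
  by move=> x; rewrite inE => /eqP ->.
have e1 : 1 <= Defs.half R E + 1 by rewrite lerDr /Defs.half divr_ge0// ler0z.
rewrite -[vnorm _]/(nm _) (nmZ (vipP V)) cabsR [`|_ `^ k|]ger0_norm ?powR_ge0//.
rewrite mulrA ler_wpM2r ?nm_ge0//.
have m1 : `|Defs.half R m| + 1 <= (`|m|.+1)%:R :> R.
  rewrite -natr1 lerD2r /Defs.half normrM -intr_norm.
  rewrite (_ : (`|m|%:~R : R) = (`|m|%N)%:R); last by rewrite -abszE.
  rewrite ger0_norm ?invr_ge0//.
  by rewrite ler_piMr ?ler0n// invf_le1// ler1n.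
apply: ler_pM; rewrite ?mulr_ge0 ?powR_ge0//.
  rewrite ler_wpM2l//; apply: (le_trans (le_powR_expn _ s0)); first by rewrite lerDr.
  by apply: lerXn2r => //; rewrite nnegrE ?addr_ge0.
apply: (le_trans (le_powR_expn e1 k0)).
apply: lerXn2r; rewrite ?nnegrE ?(le_trans ler01)// ?ler1n//.
rewrite -natr1 lerD2r /Defs.half.
rewrite (_ : (E%:~R : R) = (`|E|%N)%:R); last by rewrite -{1}(gez0_abs E0).
by rewrite ler_piMr ?ler0n// invf_le1// ler1n.
Qed.

Lemma energy_bound (Veb : energy_bounded V) a c :
  exists (C : R) (s : nat), 0 <= C /\ forall m,
    nm (mode a m c) <= C * (`|m|.+1)%:R ^+ s.
Proof.
move: c; apply: (wt_span vp).
- exists 0, 0%N; split=> // m.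
  have -> : mode a m 0 = 0.
    have := modeP a m 1 0 0; rewrite !scale1r addr0 => /eqP.
    by rewrite -subr_eq subrr eq_sym => /eqP.
  by rewrite (nm0 (vipP V)) mul0r.
- move=> c c' [C [s [C0 HC]]] [C' [s' [C0' HC']]].
  exists (C + C'), (maxn s s'); split=> [|m]; first exact: addr_ge0.
  have := modeP a m 1 c c'; rewrite !scale1r => ->.
  rewrite (le_trans (nmD (vipP V) _ _))// mulrDl lerD//.
    rewrite (le_trans (HC m))// ler_wpM2l// ler_weXn2l ?ler1n// leq_maxl.
    by [].
  rewrite (le_trans (HC' m))// ler_wpM2l// ler_weXn2l ?ler1n// leq_maxr.
  by [].
- move=> E c wc; have [C [s [k [C0 HC]]]] := energy_bound_wt Veb a.
  exists (C * (`|E|.+1)%:R ^+ k * nm c), s; split.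
    by rewrite !mulr_ge0// ?nm_ge0// exprn_ge0.
  move=> m; rewrite (le_trans (HC m E c wc))// le_eqVlt; apply/orP; left.
  by apply/eqP; ring.
Qed.

End Modes.

(** * Fourier coefficients and bump functions *)

Section SmoothFunctions.
Context {R : realType}.
Implicit Types (f g : R -> R) (x y : R).

Lemma derive1nSr n f : derive1n n.+1 f = derive1n n (derive1 f).
Proof. by rewrite /derive1n iterSr. Qed.

Lemma smooth_derivable f x : smooth_real f -> derivable f x 1.
Proof. by move=> /(_ 0%N x). Qed.

Lemma smooth_derive1 f : smooth_real f -> smooth_real (derive1 f).
Proof. by move=> H n x; rewrite -derive1nSr; exact: H. Qed.

Lemma smooth_derive1n n f : smooth_real f -> smooth_real (derive1n n f).
Proof. by elim: n f => [//|n IH] f /smooth_derive1 /IH; rewrite -derive1nSr. Qed.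

(** Smoothness is proved by exhibiting a class stable under derivation, which avoids closed formulas
    for iterated derivatives. *)
Lemma smooth_coind (P : (R -> R) -> Prop) :
  (forall f, P f -> (forall x, derivable f x 1) /\ P (derive1 f)) ->
  forall f, P f -> smooth_real f.
Proof.
move=> HP f Pf n; elim: n f Pf => [|n IH] f /HP[df Pf'] x; first exact: df.
by rewrite derive1nSr; exact: IH.
Qed.

Lemma derivable_cont f x : derivable f x 1 -> {for x, continuous f}.
Proof. by move=> /derivable1_diffP /differentiable_continuous. Qed.

Lemma smooth_continuous f : smooth_real f -> continuous f.
Proof. by move=> sf x; apply: derivable_cont; exact: smooth_derivable. Qed.

Lemma is_derive1P f x df : is_derive x 1 f df -> derivable f x 1 /\ (derive1 f) x = df.
Proof. by case=> d <-; rewrite derive1E. Qed.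

Lemma derive1_funext f f' : (forall x, is_derive x 1 f (f' x)) ->
  (forall x, derivable f x 1) /\ (derive1 f) = f'.
Proof.
by move=> H; split=> [x|]; [|apply/funext => x]; have [] := is_derive1P (H x).
Qed.

Lemma smooth_is_derive f x : smooth_real f -> is_derive x 1 f ((derive1 f) x).
Proof. by move=> /smooth_derivable H; apply: DeriveDef => //; rewrite derive1E. Qed.

Lemma smooth_cst (c : R) : smooth_real (fun=> c).
Proof.
apply: (smooth_coind (P := fun f => exists c, f = fun=> c)); last by exists c.
move=> _ [d ->].
have [Hd ->] := @derive1_funext (fun=> d) (fun=> 0) (fun x => is_derive_cst d x 1).
by split=> //; exists 0.
Qed.

(** Products of smooth functions are not stable under derivation, but finite
    sums of products are. *)
Lemma smoothM f g : smooth_real f -> smooth_real g -> smooth_real (fun x => f x * g x).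
Proof.
move=> sf sg.
pose P h := exists s : seq ((R -> R) * (R -> R)),
  (forall p, List.In p s -> smooth_real p.1 /\ smooth_real p.2) /\
  h = fun x => \sum_(p <- s) p.1 x * p.2 x.
apply: (smooth_coind (P := P)); last first.
  exists [:: (f, g)]; split; first by move=> p [<-|[]].
  by apply/funext => x; rewrite big_seq1.
move=> h [s [Hs ->]].
have H x : is_derive x 1 (fun x => \sum_(p <- s) p.1 x * p.2 x)
  (\sum_(p <- flatten [seq [:: (p.1, (derive1 p.2)); (p.2, (derive1 p.1))] | p <- s]) p.1 x * p.2 x).
  elim: s Hs => [|p s IH] Hs.
    have -> : (fun x => \sum_(p <- [::]) p.1 x * p.2 x) = (fun=> 0 : R).
      by apply/funext => y; rewrite big_nil.
    by rewrite big_nil; exact: is_derive_cst.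
  have -> : (fun x => \sum_(p <- p :: s) p.1 x * p.2 x) =
     (fun x => p.1 x * p.2 x + \sum_(p <- s) p.1 x * p.2 x).
    by apply/funext => y; rewrite big_cons.
  rewrite /= !big_cons /= addrA; apply: is_deriveD; last first.
    by apply: IH => q qs; apply: Hs; right.
  have [s1 s2] := Hs p (or_introl erefl).
  by apply: is_deriveM; exact: smooth_is_derive.
have [Hd ->] := derive1_funext H.
split=> //; exists (flatten [seq [:: (p.1, (derive1 p.2)); (p.2, (derive1 p.1))] | p <- s]).
split; last exact: erefl.
elim: s Hs {Hd H h} => [|p s IH] Hs q /=; first by case.
case=> [<-|[<-|qs]].
- have [s1 s2] := Hs p (or_introl erefl).
  by split; [exact: s1|exact: smooth_derive1 s2].
- have [s1 s2] := Hs p (or_introl erefl).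
  by split; [exact: s2|exact: smooth_derive1 s1].
- by apply: IH qs => r rs; apply: Hs; right.
Qed.

Lemma smooth_affine f (a b c : R) : smooth_real f -> smooth_real (fun x => c * f (a * x + b)).
Proof.
move=> sf.
apply: (smooth_coind (P := fun h => exists c f, smooth_real f /\ h = fun x => c * f (a * x + b))); last by exists c, f.
move=> _ [{}c [{sf}f [sf ->]]].
have H x : is_derive x 1 (fun x => c * f (a * x + b)) ((c * a) * (derive1 f) (a * x + b)).
  have H : is_derive x 1 (fun y => a * y + b) a.
    apply: is_derive_eq; rewrite addr0; exact: mulr1.
  have H2 : is_derive x 1 (f \o (fun y => a * y + b)) (a * (derive1 f) (a * x + b)).
    by apply: is_derive_eq; [apply: is_derive1_comp; exact: smooth_is_derive|rewrite mulrC].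
  rewrite -mulrA.
  exact: (@is_deriveZ _ _ _ (f \o (fun y => a * y + b)) c).
have [Hd ->] := derive1_funext H.
split=> //; exists (c * a), (derive1 f); split=> //; exact: smooth_derive1.
Qed.

Lemma is_derive_sqr f (C : R) : (exists2 r : R, 0 < r & forall y, `|y| < r -> `|f y| <= C * y ^+ 2) ->
  is_derive (0 : R) 1 f 0.
Proof.
move=> [r r0 Hr].
have f0 : f 0 = 0.
  have := Hr 0; rewrite normr0 expr0n mulr0 => /(_ r0).
  by rewrite normr_le0 => /eqP.
have H : h^-1 *: (f (h *: 1 + 0) - f 0) @[h --> 0^'] --> (0 : R).
  apply/cvgrPdist_le => e e0.
  near=> h; rewrite f0 subr0 addr0 sub0r normrN.
  have hn0 : h != 0 by near: h; exact: nbhs_dnbhs_neq.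
  have -> : h *: 1 = h :> R by exact: mulr1.
  have hr : `|h| < Num.min r (e / (`|C| + 1)).
    near: h; apply: dnbhs0_lt; rewrite lt_min r0 divr_gt0// ltr_wpDl//.
  move: hr; rewrite lt_min => /andP[hr he].
  rewrite normrM normfV mulrC ler_pdivrMr ?normr_gt0//.
  rewrite (le_trans (Hr _ hr))// -real_normK ?num_real// expr2 mulrA.
  rewrite ler_wpM2r// (le_trans (_ : _ <= (`|C| + 1) * `|h|))//.
    by rewrite ler_wpM2r// (le_trans (ler_norm _))// lerDl.
  by rewrite mulrC -ler_pdivlMr ?ltr_wpDl// ltW.
apply: DeriveDef; first by apply/cvg_ex; exists 0.
by rewrite /derive; exact: cvg_lim.
Unshelve. all: by end_near.
Qed.

(** The polynomial factor in 1 / x makes the family stable under derivation: [q] becomes X^2 (q -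
    q'). *)
Definition flat (q : {poly R}) x : R := if 0 < x then q.[x^-1] * expR (- x^-1) else 0.

Lemma flat_bound q : exists C : R, forall y, `|y| < 1 -> `|flat q y| <= C * y ^+ 2.
Proof.
have [C [C0 HC]] : exists C : R, 0 <= C /\ forall s, 1 <= s -> `|q.[s]| <= C * s ^+ (size q).
  exists (\sum_(i < size q) `|q`_i|); split; first exact: sumr_ge0.
  move=> s s1; rewrite horner_coef mulr_suml (le_trans (ler_norm_sum _ _ _))//.
  apply: ler_sum => i _; rewrite normrM ler_wpM2l// normrX ger0_norm.
    by rewrite ler_weXn2l// ltnW.
  by rewrite (le_trans ler01).
exists (C * (size q).+2`!%:R) => y y1; rewrite /flat; case: ifPn => [y0|_]; last first.
  by rewrite normr0 mulr_ge0 ?sqr_ge0// mulr_ge0.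
have ys : 1 <= y^-1.
  by rewrite -invr1 lef_pV2 ?posrE// ltW// (le_lt_trans (ler_norm _)).
rewrite normrM [`|expR _|]ger0_norm ?expR_ge0// expRN.
rewrite ler_pdivrMr ?expR_gt0// (le_trans (HC _ ys))//.
rewrite -!mulrA ler_wpM2l//.
(* A single term of the exponential series, of degree [size q + 2], beats the polynomial and leaves
   y^2. *)
have := expR_ge1Dxn (size q).+1 (le_trans ler01 ys).
move=> /(le_trans _) - /(_ (y^-1 ^+ (size q).+2 / ((size q).+2)`!%:R)).
rewrite lerDr ler01 => /(_ isT) H.
have f0 : 0 < (size q).+2`!%:R * y ^+ 2 by rewrite mulr_gt0 ?exprn_gt0// ltr0n fact_gt0.
rewrite (_ : _ * (y * _) = ((size q).+2)`!%:R * y ^+ 2 * expR y^-1); last by rewrite expr2 !mulrA.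
rewrite (le_trans _ (ler_wpM2l (ltW f0) H))// le_eqVlt; apply/orP; left; apply/eqP.
rewrite !exprS !exprVn; field.
by rewrite gt_eqF//= expf_neq0 ?gt_eqF//= -natr1 ?pnatr_eq0 // -lt0n fact_gt0.
Qed.

Lemma smooth_flat q : smooth_real (flat q).
Proof.
apply: (smooth_coind (P := fun h => exists q, h = flat q)); last by exists q.
move=> _ [{}q ->].
suff H x : is_derive x 1 (flat q) (flat ('X^2 * (q - q^`())) x).
  have [Hd ->] := derive1_funext H.
  by split=> //; exists ('X^2 * (q - q^`())).
have [x0|x0|<-] := ltgtP 0 x.
- have H : is_derive x 1 (fun y => q.[y^-1] * expR (- y^-1)) (flat ('X^2 * (q - q^`())) x).
    have xn : x != 0 by rewrite gt_eqF.
    have dV : is_derive x 1 (fun y : R => y^-1) (- x ^- 2).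
      by apply: is_derive_eq; [apply: is_deriveV => //|rewrite /GRing.scale /= ?mulr1].
    have dq : is_derive x 1 (horner q \o (fun y : R => y^-1)) (q^`().[x^-1] * (- x ^- 2)).
      by apply: is_derive_eq.
    have dN : is_derive x 1 (fun y : R => - y^-1) (x ^- 2).
      by apply: is_derive_eq; rewrite opprK.
    have dE : is_derive x 1 (expR \o (fun y : R => - y^-1)) (expR (- x^-1) * (x ^- 2)).
      by apply: is_derive_eq.
    have H0 := is_deriveM dq dE.
    apply: (is_derive_eq H0).
    by rewrite /flat x0 /= !hornerE /GRing.scale /=; field.
  apply: near_eq_is_derive H; near=> y; rewrite /flat ifT//.
  by near: y; exact: lt_nbhsr.
- rewrite /flat [X in is_derive _ _ _ X]ifN -?leNgt ?ltW//.
  apply: (near_eq_is_derive _ (is_derive_cst 0 x 1)); near=> y.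
  by rewrite ifN// -leNgt ltW//; near: y; exact: lt_nbhsl.
- rewrite /flat [X in is_derive _ _ _ X]ifN ?ltxx//.
  have [C HC] := flat_bound q; apply: (is_derive_sqr (C := C)); by exists 1.
Unshelve. all: by end_near.
Qed.

End SmoothFunctions.

(** * Integrals of periodic functions over a period *)

Section PeriodicIntegrals.
Context {R : realType}.
Implicit Types (f g u v F : R -> R) (x y a b : R) (j : int).
Local Notation mu := (@lebesgue_measure R).
Local Notation tpi := (pi *+ 2 : R).

Lemma pi_pos : 0 < pi :> R. Proof. exact: pi_gt0. Qed.
Lemma tpi_gt0 : 0 < tpi. Proof. by rewrite pmulrn_lgt0// pi_gt0. Qed.

Lemma continuous_integrable f a b : continuous f -> mu.-integrable `[a, b] (EFin \o f).
Proof.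
move=> cf; apply: continuous_compact_integrable; first exact: segment_compact.
exact: continuous_subspaceT.
Qed.

Lemma Rintegral_FTC2 F f a b : a < b -> (forall x, is_derive x 1 F (f x)) ->
  continuous f -> Rintegral mu `[a, b] f = F b - F a.
Proof.
move=> ab dF cf; rewrite /Rintegral (@continuous_FTC2 _ f F)//.
- exact: continuous_subspaceT.
- have cF x : {for x, continuous F} by have [d _] := is_derive1P (dF x); exact: derivable_cont.
  split.
  + by move=> x _; have [] := is_derive1P (dF x).
  + by apply: cvg_at_right_filter; exact: cF.
  + by apply: cvg_at_left_filter; exact: cF.
- by move=> x _; have [_] := is_derive1P (dF x).
Qed.

Definition periodic_fun f := forall x, f (x + tpi) = f x.

Lemma periodic_int f x (k : int) : periodic_fun f -> f (x + tpi * k%:~R) = f x.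
Proof.
move=> pf.
have K (n : nat) y : f (y + tpi * n%:R) = f y.
  elim: n => [|n IH]; first by rewrite mulr0 addr0.
  by rewrite -natr1 mulrDr mulr1 addrA pf IH.
case: k => n; first exact: K.
have := K n.+1 (x - tpi * n.+1%:R); rewrite subrK => ->.
by rewrite NegzE rmorphN mulrN.
Qed.

Lemma periodic_derive1 f : (forall x, derivable f x 1) -> periodic_fun f ->
  periodic_fun (derive1 f).
Proof.
move=> df pf x.
have H : is_derive x 1 (f \o (fun y => y + tpi)) (derive1 f (x + tpi)).
  have dI : is_derive x 1 (fun y => y + tpi) (1 : R).
    by apply: is_derive_eq; rewrite addr0.
  apply: is_derive_eq; first apply: is_derive1_comp.
    by apply: DeriveDef; [exact: df|reflexivity].
  by rewrite mulr1 derive1E.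
have [_ <-] := is_derive1P H.
by congr (derive1 _ x); apply/funext => y; rewrite /= pf.
Qed.

Definition ang x : R := x - tpi * (Num.ceil ((x - pi) / tpi))%:~R.

Lemma angP x : - pi < ang x <= pi.
Proof.
have t0 := tpi_gt0.
have /andP[h1 h2] : (Num.ceil ((x - pi) / tpi) - 1)%:~R < (x - pi) / tpi <= (Num.ceil ((x - pi) / tpi))%:~R.
  exact: ceil_itv.
rewrite /ang; move: h1 h2; set c := Num.ceil _.
rewrite ltr_pdivlMr// ler_pdivrMr// rmorphB /= mulrBl mul1r => h1 h2.
have E : tpi = pi + pi by rewrite mulr2n.
by apply/andP; split; move: h1 h2 E; move: tpi => p; lra.
Qed.

Lemma ang_shift x : exists k : int, x = ang x + tpi * k%:~R.
Proof. by exists (Num.ceil ((x - pi) / tpi)); rewrite subrK. Qed.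

Lemma ang_unique x y (k : int) : - pi < y <= pi -> x = y + tpi * k%:~R -> ang x = y.
Proof.
move=> /andP[y1 y2] xy; have /andP[a1 a2] := angP x; have [l xl] := ang_shift x.
have E : ang x - y = tpi * (k - l)%:~R.
  by rewrite rmorphB /= mulrBr; move: xy; rewrite {1}xl; lra.
have t0 := tpi_gt0.
have h1 : (k - l)%:~R < 1 :> R.
  by rewrite -(ltr_pM2l t0) -E mulr1 mulr2n; lra.
have h2 : -1 < (k - l)%:~R :> R.
  by rewrite -(ltr_pM2l t0) -E mulrN1 mulr2n; lra.
have kl : k - l = 0.
  move: h1 h2; rewrite (_ : -1 = (-1)%:~R) // (_ : 1 = 1%:~R) // !ltr_int; lia.
by move: E; rewrite kl mulr0 => /eqP; rewrite subr_eq0 => /eqP.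
Qed.

Lemma ang_id x : - pi < x <= pi -> ang x = x.
Proof. by move=> hx; apply: (ang_unique (k := 0)) => //; rewrite mulr0 addr0. Qed.

Lemma ang_period x (k : int) : ang (x + tpi * k%:~R) = ang x.
Proof.
have [l xl] := ang_shift x; apply: (ang_unique (k := l + k)); first exact: angP.
by rewrite {1}xl rmorphD /= mulrDr addrA.
Qed.

Lemma ang_periodic : periodic_fun ang.
Proof. by move=> x; have := ang_period x 1; rewrite mulr1. Qed.

Lemma periodic_ang f x : periodic_fun f -> f x = f (ang x).
Proof. by move=> pf; have [k {1}->] := ang_shift x; rewrite periodic_int. Qed.

Lemma continuous_itv_bounded f a b : a <= b -> continuous f ->
  exists2 M, 0 <= M & forall x, a <= x <= b -> `|f x| <= M.
Proof.
move=> ab cf; have [|c _ Hc] := @EVT_max R (fun x => `|f x|) a b ab.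
  apply: continuous_subspaceT => x; apply: continuous_comp; first exact: cf.
  exact: norm_continuous.
by exists `|f c| => // x xab; apply: Hc; rewrite in_itv.
Qed.

Lemma periodic_bounded f : periodic_fun f -> continuous f ->
  exists2 M, 0 <= M & forall x, `|f x| <= M.
Proof.
move=> pf cf; have [|M M0 HM] := @continuous_itv_bounded f (- pi) pi _ cf.
  by have := pi_pos; lra.
exists M => // x; rewrite (periodic_ang x pf); apply: HM.
by have /andP[h ->] := angP x; rewrite ltW.
Qed.

Definition I2 f : R := Rintegral mu `[- pi, pi] f.

Lemma npi_lt_pi : - pi < pi :> R.
Proof. by have := pi_pos; lra. Qed.

Lemma I2D f g : continuous f -> continuous g -> I2 (fun x => f x + g x) = I2 f + I2 g.
Proof. by move=> cf cg; rewrite /I2 RintegralD//; exact: continuous_integrable. Qed.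

Lemma I2B f g : continuous f -> continuous g -> I2 (fun x => f x - g x) = I2 f - I2 g.
Proof. by move=> cf cg; rewrite /I2 RintegralB//; exact: continuous_integrable. Qed.

Lemma I2Z (c : R) f : continuous f -> I2 (fun x => c * f x) = c * I2 f.
Proof. by move=> cf; rewrite /I2 RintegralZl//; exact: continuous_integrable. Qed.

Lemma I2_le f g : continuous f -> continuous g ->
  (forall x, - pi <= x <= pi -> f x <= g x) -> I2 f <= I2 g.
Proof.
by move=> cf cg fg; apply: le_Rintegral => //; exact: continuous_integrable.
Qed.

Lemma cst_continuous' (c : R) : continuous (fun _ : R => c).
Proof. by move=> x; exact: cvg_cst. Qed.

Lemma I2_cst (c : R) : I2 (fun=> c) = tpi * c.
Proof.
have H x : is_derive x 1 (fun x => c * x) (c : R).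
  by apply: is_derive_eq; exact: mulr1.
rewrite /I2 (Rintegral_FTC2 npi_lt_pi H (cst_continuous' (c := c))).
by rewrite -mulrBr opprK mulr2n mulrC.
Qed.

Lemma I2_bound f M : continuous f -> (forall x, - pi <= x <= pi -> `|f x| <= M) ->
  `|I2 f| <= tpi * M.
Proof.
move=> cf fM; rewrite ler_norml -mulrN -!I2_cst.
apply/andP; split; apply: I2_le => //; try exact: cst_continuous';
  by move=> x /fM; rewrite ler_norml => /andP[].
Qed.

(** The end point [- pi] is negligible and has to be left out: there the expression of [chi] as
    [expi (x / 2)] fails. *)
Lemma I2_ext f g : (forall x, - pi < x <= pi -> f x = g x) -> continuous g -> I2 f = I2 g.
Proof.
move=> fg cg; rewrite /I2.
have gi : mu.-integrable `](- pi), pi] (EFin \o g).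
  apply: integrableS (continuous_integrable (- pi) pi cg) => //.
  exact: subset_itv_oc_cc.
have fi : mu.-integrable `](- pi), pi] (EFin \o f).
  apply: eq_integrable gi => // x; rewrite inE /= in_itv /= => hx.
  by rewrite fg.
rewrite -(Rintegral_itv_obnd_cbnd fi) -(Rintegral_itv_obnd_cbnd gi).
by apply: eq_Rintegral => x; rewrite inE /= in_itv /=; exact: fg.
Qed.

Lemma ex_primitive f a : continuous f -> exists F, forall x, a < x -> is_derive x 1 F (f x).
Proof.
move=> cf; exists (fun x => Rintegral mu `[a, x] f) => x ax.
have [|d1 d2] := @continuous_FTC1_closed R f a x (x + 1) _ (continuous_integrable _ _ cf) ax (cf x).
  by rewrite ltrDl.
by apply: DeriveDef; [exact: d1|exact: (eq_trans (esym (derive1E _ _)) d2)].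
Qed.

Lemma shift_continuous f c : continuous f -> continuous (fun x => f (x + c)).
Proof.
move=> cf x; apply: (@continuous_comp _ _ _ (fun x => x + c) f); last exact: cf.
by apply: cvgD; [exact: cvg_id|exact: cvg_cst].
Qed.

Lemma I2_shift f c : continuous f -> periodic_fun f -> I2 (fun x => f (x + c)) = I2 f.
Proof.
move=> cf pf.
(* Periodicity reduces to nonnegative shifts, for which a primitive to the right of [- pi - 1] is
   enough. *)
suff K d : 0 <= d -> I2 (fun x => f (x + d)) = I2 f.
  have [c0|c0] := leP 0 c; first exact: K.
  have [k ck] := ang_shift c.
  have /andP[a1 a2] := angP c.
  rewrite -(K (ang c + tpi)); last by rewrite mulr2n; have := pi_pos; lra.
  congr I2; apply/funext => x.
  rewrite -[RHS](periodic_int _ (k - 1) pf); congr f.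
  by rewrite {1}ck rmorphB /= mulrBr; lra.
move=> d0; have [->|dn] := eqVneq d 0.
  by congr I2; apply/funext => x; rewrite addr0.
have [F HF] := ex_primitive (- pi - 1) cf.
have p0 := pi_pos.
have cF x : - pi - 1 < x -> {for x, continuous F}.
  by move=> /HF /is_derive1P[d1 _]; exact: derivable_cont.
have dFs e x : - pi - 1 < x + e -> is_derive x 1 (F \o (fun y => y + e)) (f (x + e)).
  move=> xe; have dI : is_derive x 1 (fun y => y + e) (1 : R).
    by apply: is_derive_eq; rewrite addr0.
  have := HF _ xe => dF.
  by have := @is_derive1_comp R F (fun y => y + e) x _ _ dF dI; rewrite mulr1.
have int e : 0 <= e -> I2 (fun x => f (x + e)) = F (pi + e) - F (- pi + e).
  move=> e0; rewrite /I2 /Rintegral (@continuous_FTC2 _ (fun x => f (x + e)) (F \o (fun y => y + e))) ?npi_lt_pi//.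
  - by apply: continuous_subspaceT; exact: shift_continuous.
  - have cFe x : - pi <= x -> {for x, continuous (F \o (fun y => y + e))}.
      move=> xp; have [|d1 _] := @is_derive1P _ _ _ _ (dFs e x _); first lra.
      exact: derivable_cont.
    split.
    + move=> x; rewrite in_itv /= => /andP[x1 x2].
      by have [|d1 _] := @is_derive1P _ _ _ _ (dFs e x _); first lra.
    + by apply: cvg_at_right_filter; apply: cFe.
    + by apply: cvg_at_left_filter; apply: cFe; lra.
  - move=> x; rewrite in_itv /= => /andP[x1 x2].
    by have [|_ d2] := @is_derive1P _ _ _ _ (dFs e x _); first lra.
have dd : 0 < d by rewrite lt_neqAle eq_sym dn.
rewrite (int d d0) -[f in RHS](_ : (fun x => f (x + 0)) = f); last first.
  by apply/funext => x; rewrite addr0.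
rewrite (int 0)//.
(* The integral over a window of length 2 pi has zero derivative in the position of the window. *)
have G x : 0 <= x -> is_derive x 1 (fun y => F (y + pi) - F (y - pi)) 0.
  move=> x0; have h1 : is_derive x 1 (F \o (fun y => y - pi)) (f (x - pi)).
    by apply: (dFs (- pi) x); lra.
  have h2 : is_derive x 1 (F \o (fun y => y + pi)) (f (x + pi)).
    by apply: (dFs pi x); lra.
  have h3 := is_deriveB h2 h1; apply: (is_derive_eq h3).
  rewrite -[in X in X - _](subrK pi x) -addrA -mulr2n pf; exact: subrr.
have [||z _] := @MVT_segment _ (fun y => F (y + pi) - F (y - pi)) (fun=> 0) 0 d d0.
- by move=> x; rewrite in_itv /= => /andP[x0 _]; apply: G; exact: ltW.
- apply: derivable_within_continuous => x; rewrite in_itv /= => /andP[x0 _].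
  by have [] := is_derive1P (G x x0).
rewrite mul0r => /eqP; rewrite subr_eq0 => /eqP.
by rewrite !(addrC d) !(addrC 0).
Qed.

End PeriodicIntegrals.

(** * Fourier coefficients of smooth functions on the circle *)

Section CircleFourier.
Context {R : realType}.
Implicit Types (u v : R -> R) (x y t : R) (j m : int) (f h : R[i] -> R[i]).
Local Notation tpi := (pi *+ 2 : R).

Definition cosj j x : R := cos (j%:~R * x).
Definition sinj j x : R := sin (j%:~R * x).
Definition fcos j u : R := I2 (fun x => u x * cosj j x).
Definition fsin j u : R := I2 (fun x => u x * sinj j x).

Lemma mulc_is_derive (c x : R) : is_derive x 1 (fun y => c * y) c.
Proof. by apply: is_derive_eq; exact: mulr1. Qed.

Lemma cosj_is_derive j x : is_derive x 1 (cosj j) (- (j%:~R * sinj j x)).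
Proof.
have := @is_derive1_comp R cos (fun y => j%:~R * y) x _ _ (is_derive_cos _) (mulc_is_derive _ _).
by rewrite mulNr mulrC.
Qed.

Lemma sinj_is_derive j x : is_derive x 1 (sinj j) (j%:~R * cosj j x).
Proof.
have := @is_derive1_comp R sin (fun y => j%:~R * y) x _ _ (is_derive_sin _) (mulc_is_derive _ _).
by rewrite mulrC.
Qed.

Lemma cosj_cont j : continuous (cosj j).
Proof. by move=> x; have [d _] := is_derive1P (cosj_is_derive j x); exact: derivable_cont. Qed.
Lemma sinj_cont j : continuous (sinj j).
Proof. by move=> x; have [d _] := is_derive1P (sinj_is_derive j x); exact: derivable_cont. Qed.

Lemma contM u v : continuous u -> continuous v -> continuous (fun x => u x * v x).
Proof. by move=> cu cv x; apply: cvgM; [exact: cu|exact: cv]. Qed.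

Lemma cos_periodic : periodic_fun (@cos R).
Proof. by move=> x; rewrite cosD2pi. Qed.
Lemma sin_periodic : periodic_fun (@sin R).
Proof. by move=> x; rewrite sinD2pi. Qed.

Lemma cosj_periodic j : periodic_fun (cosj j).
Proof. by move=> x; rewrite /cosj mulrDr [_ * tpi]mulrC (periodic_int _ _ cos_periodic). Qed.
Lemma sinj_periodic j : periodic_fun (sinj j).
Proof. by move=> x; rewrite /sinj mulrDr [_ * tpi]mulrC (periodic_int _ _ sin_periodic). Qed.

Lemma cosj_le1 j x : `|cosj j x| <= 1. Proof. exact: cos_max. Qed.
Lemma sinj_le1 j x : `|sinj j x| <= 1. Proof. exact: sin_max. Qed.

Lemma I2_derive u : smooth_real u -> periodic_fun u -> forall w w' : R -> R,
  (forall x, is_derive x 1 w (w' x)) -> continuous w' -> periodic_fun w ->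
  I2 (fun x => derive1 u x * w x) = - I2 (fun x => u x * w' x).
Proof.
move=> su pu w w' dw cw' pw.
have cw : continuous w.
  by move=> x; have [d _] := is_derive1P (dw x); exact: derivable_cont.
have cu := smooth_continuous su; have cu' := smooth_continuous (smooth_derive1 su).
apply/eqP; rewrite -addr_eq0 -I2D; [|exact: contM..].
have H x : is_derive x 1 (u * w) (derive1 u x * w x + u x * w' x).
  apply: (is_derive_eq (is_deriveM (@smooth_is_derive R u x su) (dw x))).
  by rewrite addrC /GRing.scale /= [w x * _]mulrC.
rewrite /I2 (Rintegral_FTC2 npi_lt_pi H); last first.
  by move=> x; apply: cvgD; [exact: (contM cu' cw)|exact: (contM cu cw')].
have E z : (u * w) (z + tpi) = (u * w) z by rewrite -[LHS]/(u (z + tpi) * w (z + tpi)) pu pw.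
by rewrite -(E (- pi)) mulr2n addrA addNr add0r subrr.
Qed.

Lemma fcos_derive1 j u : smooth_real u -> periodic_fun u ->
  fcos j (derive1 u) = j%:~R * fsin j u.
Proof.
move=> su pu; have cu := smooth_continuous su.
rewrite /fcos (I2_derive su pu (cosj_is_derive j)); last exact: cosj_periodic.
  rewrite -mulN1r -I2Z /fsin; last by apply: contM => // x; apply: cvgN; apply: cvgM; [exact: cvg_cst|exact: sinj_cont].
  rewrite -I2Z; last by apply: contM => //; exact: sinj_cont.
  by congr I2; apply/funext => x; ring.
by move=> x; apply: cvgN; apply: cvgM; [exact: cvg_cst|exact: sinj_cont].
Qed.

Lemma fsin_derive1 j u : smooth_real u -> periodic_fun u ->
  fsin j (derive1 u) = - (j%:~R * fcos j u).
Proof.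
move=> su pu; have cu := smooth_continuous su.
rewrite /fsin (I2_derive su pu (sinj_is_derive j)); last exact: sinj_periodic.
  rewrite /fcos -I2Z; last by apply: contM => //; exact: cosj_cont.
  by congr (- I2 _); apply/funext => x; ring.
by move=> x; apply: cvgM; [exact: cvg_cst|exact: cosj_cont].
Qed.

(** Each integration by parts trades a factor [j] for a derivative. *)
Lemma fcossin_decay r j u M : smooth_real u -> periodic_fun u ->
  (forall x, `|derive1n r u x| <= M) ->
  `|fcos j u| * `|j%:~R| ^+ r <= tpi * M /\ `|fsin j u| * `|j%:~R| ^+ r <= tpi * M.
Proof.
elim: r u => [|r IH] u su pu HM.
  rewrite expr0 !mulr1; have cu := smooth_continuous su.
  split; apply: I2_bound.
  - by apply: contM => //; exact: cosj_cont.
  - by move=> x _; rewrite normrM (le_trans _ (HM x))// ler_piMr// cosj_le1.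
  - by apply: contM => //; exact: sinj_cont.
  - by move=> x _; rewrite normrM (le_trans _ (HM x))// ler_piMr// sinj_le1.
have [|H1 H2] := IH _ (smooth_derive1 su) (periodic_derive1 (fun x => @smooth_derivable R u x su) pu).
  by move=> x; rewrite -derive1nSr.
move: H1 H2; rewrite fcos_derive1// fsin_derive1// normrN !normrM => H1 H2.
by split; rewrite exprS mulrA [`|_| * `|j%:~R|]mulrC.
Qed.

Lemma fcos_shift j u t : continuous u -> periodic_fun u ->
  fcos j (fun x => u (x - t)) = cosj j t * fcos j u - sinj j t * fsin j u.
Proof.
move=> cu pu; rewrite /fcos /fsin.
rewrite -!I2Z; [|by apply: contM => //; do ?[exact: sinj_cont|exact: cosj_cont]..].
rewrite -I2B; first last.
- by apply: contM; [exact: cst_continuous'|apply: contM => //; exact: sinj_cont].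
- by apply: contM; [exact: cst_continuous'|apply: contM => //; exact: cosj_cont].
have -> : (fun x => cosj j t * (u x * cosj j x) - sinj j t * (u x * sinj j x)) =
          (fun x => u x * cosj j (x + t)).
  by apply/funext => x; rewrite /cosj /sinj mulrDr cosD; ring.
rewrite -[RHS](I2_shift (- t)).
- by congr I2; apply/funext => x; rewrite subrK.
- by apply: contM => //; apply: shift_continuous; exact: cosj_cont.
- by move=> x; rewrite pu addrAC cosj_periodic.
Qed.

Lemma fsin_shift j u t : continuous u -> periodic_fun u ->
  fsin j (fun x => u (x - t)) = cosj j t * fsin j u + sinj j t * fcos j u.
Proof.
move=> cu pu; rewrite /fcos /fsin.
rewrite -!I2Z; [|by apply: contM => //; do ?[exact: sinj_cont|exact: cosj_cont]..].
rewrite -I2D; first last.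
- by apply: contM; [exact: cst_continuous'|apply: contM => //; exact: cosj_cont].
- by apply: contM; [exact: cst_continuous'|apply: contM => //; exact: sinj_cont].
have -> : (fun x => cosj j t * (u x * sinj j x) + sinj j t * (u x * cosj j x)) =
          (fun x => u x * sinj j (x + t)).
  by apply/funext => x; rewrite /cosj /sinj mulrDr sinD; ring.
rewrite -[RHS](I2_shift (- t)).
- by congr I2; apply/funext => x; rewrite subrK.
- by apply: contM => //; apply: shift_continuous; exact: sinj_cont.
- by move=> x; rewrite pu addrAC sinj_periodic.
Qed.

Lemma expiD x y : expi (x + y) = expi x * expi y :> R[i].
Proof.
rewrite /expi cosD sinD; apply/eqP; rewrite eq_complex /= eqxx /=.
by rewrite addrC.
Qed.

Lemma expi0 : expi 0 = 1 :> R[i].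
Proof. by rewrite /expi cos0 sin0. Qed.

Lemma cabs_expi x : cabs (expi x) = 1.
Proof. by rewrite /expi /= cos2Dsin2 sqrtr1. Qed.

Lemma expi_conj x : (expi x)^* = expi (- x).
Proof. by rewrite /expi cosN sinN. Qed.

Lemma expi_neq0 x : expi x != 0.
Proof. by rewrite -cabs_eq0 cabs_expi oner_eq0. Qed.

Lemma expiX x (n : nat) : expi x ^+ n = expi (n%:R * x).
Proof.
elim: n => [|n IH]; first by rewrite mul0r expi0.
by rewrite exprS IH -expiD -natr1 mulrDl mul1r addrC.
Qed.

Lemma expi_period x (k : int) : expi (x + tpi * k%:~R) = expi x.
Proof.
by rewrite /expi (periodic_int _ _ cos_periodic) (periodic_int _ _ sin_periodic).
Qed.

Lemma expi_ang x : expi (ang x) = expi x.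
Proof. by have [k {2}->] := ang_shift x; rewrite expi_period. Qed.

Lemma expi_circle x : circle (expi x).
Proof. by rewrite /circle /= cabsE cabs_expi. Qed.

Lemma expi_eq1 x : - pi < x <= pi -> expi x = 1 -> x = 0.
Proof.
move=> /andP[x1 x2] [c1 _].
have : `|x| = 0.
  apply: (@cos_inj R); rewrite ?in_itv /= ?cos_norm ?cos0 ?lexx ?pi_ge0 ?normr_ge0//=.
  by rewrite ler_norml x2 ltW.
by move=> /eqP; rewrite normr_eq0 => /eqP.
Qed.

Lemma expi_inj x y : expi x = expi y -> exists k : int, x = y + tpi * k%:~R.
Proof.
move=> xy; have [k xk] := ang_shift (x - y).
exists k; have : ang (x - y) = 0.
  apply: expi_eq1; first exact: angP.
  by rewrite expi_ang expiD xy -expiD subrr expi0.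
by move=> a0; move: xk; rewrite a0 add0r => <-; rewrite addrC subrK.
Qed.

Lemma expi_inj_ang x y : expi x = expi y -> ang x = ang y.
Proof. by move=> /expi_inj[k ->]; rewrite ang_period. Qed.

Lemma circle_expi z : circle z -> exists x, z = expi x.
Proof.
case: z => a b; rewrite /circle /= cabsE => -[/(congr1 (fun t => t ^+ 2))].
rewrite sqr_sqrtr ?addr_ge0 ?sqr_ge0// expr1n => ab.
have a1 : -1 <= a <= 1.
  by rewrite -ler_norml -(ler_pXn2r (_ : 0 < 2)%N)// ?nnegrE// expr1n real_normK ?num_real// -ab lerDl sqr_ge0.
have sb : Num.sqrt (1 - a ^+ 2) = `|b| by rewrite -ab addrAC subrr add0r sqrtr_sqr.
have ca : cos (acos a) = a by rewrite acosK// in_itv.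
have [b0|b0] := leP 0 b.
  by exists (acos a); rewrite /expi ca sin_acos// sb ger0_norm.
by exists (- acos a); rewrite /expi cosN sinN ca sin_acos// sb ltr0_norm// opprK.
Qed.

Lemma expi_jx j x : expi (j%:~R * x) = (cosj j x +i* sinj j x)%C.
Proof. by []. Qed.

(** The Fourier coefficient of index [j] of the periodic function u + i v, in real terms. *)
Definition fpair j u v : R[i] :=
  ((tpi^-1)%:C)%C * ((fcos j u + fsin j v) +i* (fcos j v - fsin j u))%C.

(** The factor [expi (x / 2)] of an odd function cancels against the half-integral part of the
    index, so both parities lead to ordinary Fourier coefficients. *)
Lemma fourierE (p : bool) f u v j : continuous u -> continuous v ->
  (forall x, - pi < x <= pi ->
    f (expi x) = (if p then expi (x / 2) else 1) * (u x +i* v x)%C) ->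
  fourier f (2 * j + p%:Z) = fpair j u v.
Proof.
move=> cu cv fE; rewrite /fourier /fpair.
have gE x : - pi < x <= pi -> f (expi x) * expi (- (Defs.half R (2 * j + p%:Z) * x)) =
    ((u x * cosj j x + v x * sinj j x) +i* (v x * cosj j x - u x * sinj j x))%C.
  move=> hx; rewrite fE//.
  have -> : - (Defs.half R (2 * j + p%:Z) * x) = - (j%:~R * x) - (if p then x / 2 else 0).
    rewrite /Defs.half rmorphD rmorphM /=; case: (p) => /=; last by rewrite addr0 subr0; field.
    by field.
  rewrite expiD; set e := (if p then expi _ else _).
  have -> : expi (- (if p then x / 2 else 0)) = e^-1.
    rewrite /e; case: (p); last by rewrite oppr0 expi0 invr1.
    by rewrite -[LHS]mul1r -(mulVf (expi_neq0 (x / 2))) -mulrA -expiD subrr expi0 mulr1.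
  have e0 : e != 0 by rewrite /e; case: (p); rewrite ?oner_eq0 ?expi_neq0.
  rewrite [e * _]mulrC -mulrA [e * _]mulrC divfK//.
  rewrite -expi_conj expi_jx; apply/eqP; rewrite eq_complex /=; apply/andP; split; apply/eqP; ring.
have mC k (w : R -> R) : continuous w -> continuous (fun x => w x * cosj k x).
  by move=> cw; apply: contM => //; exact: cosj_cont.
have mS k (w : R -> R) : continuous w -> continuous (fun x => w x * sinj k x).
  by move=> cw; apply: contM => //; exact: sinj_cont.
rewrite mulr_natl; congr (_ * (_ +i* _)%C).
  rewrite /fcos /fsin -I2D; [|exact: mC|exact: mS].
  apply: I2_ext; first by move=> x hx; rewrite gE.
  by move=> x; apply: cvgD; [exact: mC|exact: mS].
rewrite /fcos /fsin -I2B; [|exact: mC|exact: mS].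
apply: I2_ext; first by move=> x hx; rewrite gE.
by move=> x; apply: cvgB; [exact: mC|exact: mS].
Qed.

Lemma smooth_parE (p : bool) f : smooth_par p f -> exists u v,
  [/\ smooth_real u /\ periodic_fun u, smooth_real v /\ periodic_fun v &
    forall x, - pi < x <= pi ->
      f (expi x) = (if p then expi (x / 2) else 1) * (u x +i* v x)%C].
Proof.
have per h : periodic_fun (fun x => complex.Re (h (expi x))) /\ periodic_fun (fun x => complex.Im (h (expi x))).
  by split=> x; have := expi_period x 1; rewrite mulr1 => ->.
have E (z : R[i]) : z = (complex.Re z +i* complex.Im z)%C by case: z.
case: p => [[h [s1 s2] fh]|[s1 s2]].
  exists (fun x => complex.Re (h (expi x))), (fun x => complex.Im (h (expi x))).
  have [p1 p2] := per h; split=> // x /fh ->; congr (_ * _); exact: E.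
exists (fun x => complex.Re (f (expi x))), (fun x => complex.Im (f (expi x))).
by have [p1 p2] := per f; split=> // x _; rewrite mul1r; exact: E.
Qed.

Lemma cabs_fpair j u v : cabs (fpair j u v) * tpi <=
  `|fcos j u| + `|fsin j v| + (`|fcos j v| + `|fsin j u|).
Proof.
rewrite /fpair cabsM cabsR ger0_norm ?invr_ge0 ?(ltW (@tpi_gt0 R))//.
rewrite mulrAC mulVf ?mul1r ?gt_eqF ?tpi_gt0// (le_trans (cabs_le_ReIm _))//=.
by rewrite lerD// ?ler_normD ?ler_normB.
Qed.

Lemma fpair_decay r j u v M M' : smooth_real u -> periodic_fun u -> smooth_real v ->
  periodic_fun v -> (forall x, `|derive1n r u x| <= M) -> (forall x, `|derive1n r v x| <= M') ->
  cabs (fpair j u v) * `|j%:~R| ^+ r <= 2 * (M + M').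
Proof.
move=> su pu sv pv H1 H2.
have [a1 a2] := fcossin_decay j su pu H1; have [b1 b2] := fcossin_decay j sv pv H2.
have t0 := @tpi_gt0 R.
rewrite -(ler_pM2r t0) mulrAC (le_trans (ler_wpM2r _ (cabs_fpair _ _ _)))//.
by rewrite !mulrDl; lra.
Qed.

Lemma smooth_periodic_bounded r u : smooth_real u -> periodic_fun u ->
  exists2 M, 0 <= M & forall x, `|derive1n r u x| <= M.
Proof.
move=> su pu; apply: periodic_bounded; last exact/smooth_continuous/smooth_derive1n.
elim: r u su pu => [//|r IH] u su pu x; rewrite derive1nSr.
apply: IH; first exact: smooth_derive1.
by apply: periodic_derive1 => // y; exact: smooth_derivable.
Qed.

Lemma fourier_decay (p : bool) f r : smooth_par p f ->
  exists2 C, 0 <= C & forall m, iodd m = p ->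
    cabs (fourier f m) * (`|m|.+1)%:R ^+ r <= C.
Proof.
move=> /smooth_parE[u [v [[su pu] [sv pv] fE]]].
have key q : exists2 C, 0 <= C & forall j, cabs (fourier f (2 * j + p%:Z)) * `|j%:~R| ^+ q <= C.
  have [M1 M10 H1] := smooth_periodic_bounded q su pu.
  have [M2 M20 H2] := smooth_periodic_bounded q sv pv.
  exists (2 * (M1 + M2)) => [|j]; first by rewrite mulr_ge0// addr_ge0.
  rewrite (fourierE j (smooth_continuous su) (smooth_continuous sv) fE).
  exact: fpair_decay.
have [C0 C00 H0] := key 0%N; have [C1 C10 H1] := key r.
(* |m| + 1 is at most 4 max(1, |j|); the bound of order 0 serves [j = 0] and that of order [r] the
   other [j]. *)
exists (4 ^+ r * (C0 + C1)) => [|m mp]; first by rewrite mulr_ge0 ?exprn_ge0 ?addr_ge0.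
have [j mj] : exists j, m = 2 * j + p%:Z.
  exists ((m - p%:Z) %/ 2)%Z; move: mp; rewrite /iodd; case: (p); lia.
have {}H0 := H0 j; have {}H1 := H1 j; rewrite -mj expr0 mulr1 in H0 H1.
have c0 := cabs_ge0 (fourier f m).
have jm : (`|m|.+1)%:R <= 4 * Num.max 1 `|j%:~R| :> R.
  have jn : `|j%:~R : R| = (`|j|%N)%:R by rewrite -intr_norm -abszE.
  have [j1|j1] := leqP 1 `|j|%N.
    have -> : Num.max 1 `|j%:~R : R| = `|j%:~R|.
      by apply/max_idPr; rewrite jn ler1n.
    by rewrite jn -natrM ler_nat mj; case: (p); lia.
  rewrite (_ : 4 * _ = 4 * Num.max 1 0); last by rewrite jn (_ : `|j|%N = 0%N)//; lia.
  rewrite (_ : Num.max 1 0 = 1 :> R); last by apply/max_idPl; rewrite ler01.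
  by rewrite mulr1 ler_nat mj; case: (p); lia.
rewrite (le_trans (ler_wpM2l c0 (_ : _ <= (4 * Num.max 1 `|j%:~R|) ^+ r)))//.
  by apply: lerXn2r; rewrite ?nnegrE ?mulr_ge0 ?le_max ?ler01.
rewrite exprMn mulrCA ler_wpM2l ?exprn_ge0//.
have [j1|j1] := leP 1 `|j%:~R : R|; first by rewrite (le_trans H1)// lerDr.
by rewrite expr1n mulr1 (le_trans H0)// lerDl.
Qed.

End CircleFourier.

(** * Periodic bumps of variable width *)

Section Bump.
Context {R : realType}.
Implicit Types (x y t e d : R) (psi : R -> R) (j : int).
Local Notation tpi := (pi *+ 2 : R).

Definition vanishing psi := forall y, 1 < `|y| -> psi y = 0.

Lemma vanishing_derive1 psi : vanishing psi -> vanishing (derive1 psi).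
Proof.
move=> v y y1.
have H : is_derive y 1 psi 0.
  apply: (near_eq_is_derive _ (is_derive_cst 0 y 1)); near=> z.
  rewrite v//; near: z.
  have : {for y, continuous (fun z : R => `|z|)} by exact: norm_continuous.
  by move=> /(_ _ (lt_nbhsr y1)).
by have [] := is_derive1P H.
Unshelve. all: by end_near.
Qed.

(** For [psi] vanishing outside [-1, 1] this lives on [-e, e] modulo the period; with [e < pi] the
    jump of [ang] falls outside the support, so smoothness is kept. *)
Definition squeezed e psi x := psi (ang x / e).

Lemma squeezed_is_derive e psi x : 0 < e < pi -> smooth_real psi -> vanishing psi ->
  is_derive x 1 (squeezed e psi) (e^-1 * squeezed e (derive1 psi) x).
Proof.
move=> /andP[e0 epi] sp vp; have [k xk] := ang_shift x.
have p0 := @pi_pos R; have E : tpi = pi + pi by rewrite mulr2n.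
have /andP[a1 a2] := angP x.
have [xpi|xpi] := eqVneq (ang x) pi.
  have v1 : 1 < `|ang x / e|.
    by rewrite xpi normrM normfV !gtr0_norm// ltr_pdivlMr// mul1r.
  rewrite [squeezed e (derive1 psi) x](vanishing_derive1 vp)// mulr0.
  apply: (near_eq_is_derive _ (is_derive_cst 0 x 1)); near=> z.
  have zx : `|x - z| < pi - e.
    by near: z; apply: (cvgr_dist_lt (fun x => x)) => //; rewrite subr_gt0.
  rewrite /squeezed vp// normrM normfV [`|e|]gtr0_norm// ltr_pdivlMr// mul1r.
  have [w wE] : exists w, w = z - tpi * k%:~R by eexists.
  have xw : x - z = pi - w by rewrite wE {1}xk xpi; lra.
  move: zx; rewrite xw ltr_norml => /andP[w1 w2].
  have [wpi|wpi] := leP w pi.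
    have -> : ang z = w.
      by apply: (ang_unique (k := k)); [apply/andP; split; lra|rewrite wE subrK].
    by rewrite gtr0_norm; lra.
  have -> : ang z = w - tpi.
    apply: (ang_unique (k := k + 1)); first by apply/andP; split; lra.
    by rewrite wE rmorphD /= mulrDr mulr1; lra.
  by rewrite ltr0_norm E; lra.
have api : ang x < pi by rewrite lt_neqAle xpi.
have H : is_derive x 1 (psi \o (fun z => e^-1 * z + (- (tpi * k%:~R) / e))) (e^-1 * squeezed e (derive1 psi) x).
  have dI : is_derive x 1 (fun z => e^-1 * z + (- (tpi * k%:~R) / e)) (e^-1).
    by apply: is_derive_eq; rewrite addr0; exact: mulr1.
  have := @is_derive1_comp R psi (fun z => e^-1 * z + (- (tpi * k%:~R) / e)) x _ _ (smooth_is_derive _ sp) dI.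
  have -> : e^-1 * x + (- (tpi * k%:~R) / e) = ang x / e by rewrite {1}xk; lra.
  by move=> h; apply: (is_derive_eq h); rewrite mulrC.
have [r [r0 r1 r2]] : exists r, [/\ 0 < r, r <= pi - ang x & r <= ang x + pi].
  exists (Num.min (pi - ang x) (ang x + pi)).
  by rewrite lt_min !ge_min !lexx orbT; split=> //; apply/andP; split; lra.
apply: (near_eq_is_derive _ H); near=> z.
rewrite /squeezed /=.
have -> : ang z = z - tpi * k%:~R; last by congr psi; lra.
apply: (ang_unique (k := k)); last by rewrite subrK.
have zx : `|x - z| < r.
  by near: z; apply: (cvgr_dist_lt (fun x => x)) => //; rewrite -subr_gt0 subr0.
have h : x - tpi * k%:~R = ang x by rewrite {1}xk addrK.
move: zx; rewrite ltr_norml => /andP[h1 h2].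
by apply/andP; split; lra.
Unshelve. all: by end_near.
Qed.

Lemma squeezed_smooth e psi r : 0 < e < pi -> smooth_real psi -> vanishing psi ->
  smooth_real (squeezed e psi) /\
  derive1n r (squeezed e psi) = fun x => e^-1 ^+ r * squeezed e (derive1n r psi) x.
Proof.
move=> ee sp vp.
have D c ps : smooth_real ps -> vanishing ps ->
    (forall x, derivable (fun x => c * squeezed e ps x) x 1) /\
    derive1 (fun x => c * squeezed e ps x) = fun x => c / e * squeezed e (derive1 ps) x.
  move=> s v; have H x : is_derive x 1 (fun x => c * squeezed e ps x) (c / e * squeezed e (derive1 ps) x).
    by have := @is_deriveZ _ _ _ (squeezed e ps) c x 1 _ (squeezed_is_derive x ee s v); rewrite /GRing.scale /= mulrA.
  exact: derive1_funext H.
split.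
  apply: (smooth_coind (P := fun h => exists c ps, [/\ smooth_real ps, vanishing ps & h = fun x => c * squeezed e ps x])); last first.
    by exists 1, psi; split=> //; apply/funext => x; rewrite mul1r.
  move=> _ [c [ps [s v ->]]]; have [Hd ->] := D c ps s v; split=> //.
  by exists (c / e), (derive1 ps); split=> //; [exact: smooth_derive1|exact: vanishing_derive1].
have vn q : vanishing (derive1n q psi).
  by elim: q => [//|q IH]; rewrite derive1nS; exact: vanishing_derive1.
elim: r => [|r IH]; first by apply/funext => x; rewrite expr0 mul1r.
rewrite derive1nS IH (D _ _ (smooth_derive1n sp) (vn r)).2.
by apply/funext => x; rewrite exprSr.
Qed.

Definition base_bump y : R := flat 1 (1 - y) * flat 1 (1 + y).

Lemma flat1_bound y : 0 <= flat 1 y <= 1.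
Proof.
rewrite /flat; case: ifPn => [y0|_]; last by rewrite lexx ler01.
by rewrite hornerE mul1r expR_ge0 -expR0 ler_expR oppr_le0 invr_ge0 ltW.
Qed.

Lemma base_bump_smooth : smooth_real base_bump.
Proof.
have s1 := @smooth_affine R _ (- 1) 1 1 (@smooth_flat R 1).
have s2 := @smooth_affine R _ 1 1 1 (@smooth_flat R 1).
have := smoothM s1 s2; congr smooth_real; apply/funext => x.
by rewrite /base_bump !mul1r mulN1r [- x + 1]addrC [x + 1]addrC.
Qed.

Lemma base_bump_bound y : 0 <= base_bump y <= 1.
Proof.
have /andP[a1 a2] := flat1_bound (1 - y); have /andP[b1 b2] := flat1_bound (1 + y).
by rewrite mulr_ge0//= mulr_ile1.
Qed.

Lemma base_bump_vanishing : vanishing base_bump.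
Proof.
move=> y; rewrite ltr_normr /base_bump /flat => /orP[y1|y1].
  by rewrite ifN ?mul0r// -leNgt; lra.
by rewrite [X in _ * X]ifN ?mulr0// -leNgt; lra.
Qed.

Lemma base_bump_half y : `|y| <= 1 / 2 -> expR (- 4) <= base_bump y.
Proof.
rewrite ler_norml => /andP[y1 y2].
have f z : 1 / 2 <= z -> expR (- 2) <= flat 1 z.
  move=> z1; have z0 : 0 < z by lra.
  rewrite /flat z0 hornerE mul1r ler_expR lerN2.
  by rewrite -[leRHS]invrK lef_pV2 ?posrE ?invr_gt0//; lra.
have -> : - 4 = - 2 + - 2 :> R by lra.
rewrite expRD ler_pM ?expR_ge0//; apply: f; lra.
Qed.

Definition ubump e := squeezed e base_bump.

Lemma ubump_smooth e : 0 < e < pi -> smooth_real (ubump e).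
Proof. by move=> ee; have [] := squeezed_smooth 0 ee base_bump_smooth base_bump_vanishing. Qed.

Lemma ubump_periodic e : periodic_fun (ubump e).
Proof. by move=> x; rewrite /ubump /squeezed ang_periodic. Qed.

Lemma ubump_derive_bound r : exists2 M : R, 0 <= M & forall e x, 0 < e < pi ->
  `|derive1n r (ubump e) x| <= M * e^-1 ^+ r.
Proof.
have vn q : vanishing (derive1n q base_bump).
  by elim: q => [|q IH]; [exact: base_bump_vanishing|rewrite derive1nS; exact: vanishing_derive1].
have [|M M0 HM] := @continuous_itv_bounded R (derive1n r base_bump) (- 1) 1 _ (smooth_continuous (smooth_derive1n base_bump_smooth)).
  lra.
exists M => // e x ee; have [_ ->] := squeezed_smooth r ee base_bump_smooth base_bump_vanishing.
have e0 : 0 <= e^-1 ^+ r by rewrite exprn_ge0// invr_ge0 ltW//; case/andP: ee.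
rewrite normrM ger0_norm// mulrC ler_wpM2r//.
have [y1|y1] := leP `|ang x / e| 1; first by apply: HM; rewrite -ler_norml.
by rewrite /squeezed vn// normr0.
Qed.

Lemma ubump_supp e x : 0 < e -> ubump e x != 0 -> `|ang x| <= e.
Proof.
move=> e0; apply: contraNT; rewrite -ltNge => h; apply/eqP/base_bump_vanishing.
by rewrite normrM normfV [`|e|]gtr0_norm// ltr_pdivlMr// mul1r.
Qed.

Definition bcoef e j : R[i] := fpair j (ubump e) (fun=> 0).

(** The coefficient of index 0, to which all the others are compared as [e] tends to 0. *)
Definition bmass e : R := tpi^-1 * I2 (ubump e).

Lemma fcos_cst0 j : fcos j (fun=> 0 : R) = 0.
Proof.
rewrite /fcos (_ : (fun x => 0 * cosj j x) = (fun=> 0)); first by rewrite I2_cst mulr0.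
by apply/funext => x; rewrite mul0r.
Qed.

Lemma fsin_cst0 j : fsin j (fun=> 0 : R) = 0.
Proof.
rewrite /fsin (_ : (fun x => 0 * sinj j x) = (fun=> 0)); first by rewrite I2_cst mulr0.
by apply/funext => x; rewrite mul0r.
Qed.

Lemma bcoef_decay r : exists2 M, 0 <= M & forall e j, 0 < e < pi ->
  cabs (bcoef e j) * `|j%:~R| ^+ r <= M * e^-1 ^+ r.
Proof.
have [M M0 HM] := ubump_derive_bound r; exists (2 * M); first by rewrite mulr_ge0.
move=> e j ee; rewrite -mulrA -[M * _]addr0.
apply: fpair_decay.
- exact: ubump_smooth.
- exact: ubump_periodic.
- exact: smooth_cst.
- by [].
- by move=> x; exact: HM.
- move=> x; rewrite (_ : derive1n r (fun=> 0) x = 0) ?normr0//.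
  elim: r x {M M0 HM} => [//|r IH] x; rewrite derive1nS.
  rewrite (_ : derive1n r (fun=> 0) = (fun=> 0)); last by apply/funext => y; exact: IH.
  by rewrite derive1_cst.
Qed.

Lemma ubump_cont e : 0 < e < pi -> continuous (ubump e).
Proof. by move=> ee; apply: smooth_continuous; exact: ubump_smooth. Qed.

(** The bump is at least [expR (- 4)] on half of its support, so the mass decays no faster than
    [e]. *)
Lemma bmass_ge : exists2 c : R, 0 < c & forall e, 0 < e < pi -> c * e <= bmass e.
Proof.
have t0 := @tpi_gt0 R.
exists (tpi^-1 * expR (- 4)) => [|e ee]; first by rewrite mulr_gt0 ?expR_gt0// invr_gt0.
have /andP[e0 epi] := ee; have p0 := @pi_pos R.
rewrite /bmass -mulrA ler_wpM2l ?invr_ge0 ?(ltW t0)//.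
have ic : (@lebesgue_measure R).-integrable `[- (e / 2), e / 2] (EFin \o (fun _ : R => expR (- 4))).
  by apply: continuous_integrable; exact: cst_continuous'.
have iu a b : (@lebesgue_measure R).-integrable `[a, b] (EFin \o ubump e).
  by apply: continuous_integrable; exact: ubump_cont.
have -> : expR (- 4) * e = Rintegral lebesgue_measure `[- (e / 2), e / 2] (fun=> expR (- 4)).
  have H x : is_derive x 1 (fun x => expR (- 4) * x) (expR (- 4) : R) by exact: mulc_is_derive.
  rewrite (Rintegral_FTC2 _ H); [|lra|exact: cst_continuous'].
  by lra.
apply: (@le_trans _ _ (Rintegral lebesgue_measure `[- (e / 2), e / 2] (ubump e))).
  apply: le_Rintegral => // x; rewrite /= in_itv /= => /andP[x1 x2].
  apply: base_bump_half; rewrite ang_id; last by apply/andP; split; lra.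
  rewrite normrM normfV [`|e|]gtr0_norm// ler_pdivrMr// ler_norml.
  by apply/andP; split; lra.
rewrite /I2 /Rintegral fine_le//.
- by apply: integrable_fin_num => //; exact: iu.
- by apply: integrable_fin_num => //; exact: iu.
apply: ge0_subset_integral => //.
- by case/integrableP: (iu (- pi) pi).
- by move=> x _; rewrite lee_fin; have /andP[] := base_bump_bound (ang x / e).
- by move=> x; rewrite /= !in_itv /= => /andP[x1 x2]; apply/andP; split; lra.
Qed.

Lemma abs_sin_le y : `|sin y| <= `|y| :> R.
Proof.
have K z : 0 <= z -> `|sin z| <= z :> R.
  move=> z0.
  have [|c _] := @MVT_segment R sin cos 0 z z0.
    by apply: continuous_subspaceT; exact: continuous_sin.
  rewrite sin0 !subr0 => ->; rewrite normrM [`|z|]ger0_norm//.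
  by rewrite ler_piMl// cos_max.
have [y0|y0] := leP 0 y; first by rewrite [`|y|]ger0_norm// K.
by rewrite [`|y|]ltr0_norm// -[y in sin y]opprK sinN normrN K// oppr_ge0 ltW.
Qed.

Lemma cos_near1 y : `|cos y - 1| <= `|y| :> R.
Proof.
have -> : cos y - 1 = - (sin (y / 2) ^+ 2 *+ 2).
  have -> : cos y = cos (y / 2 *+ 2) by congr cos; rewrite mulr2n; lra.
  by rewrite cos_mulr2n; have := cos2Dsin2 (y / 2); rewrite !mulr2n; lra.
rewrite normrN normrMn normrX.
have h1 := abs_sin_le (y / 2); have h2 := sin_max (y / 2).
have h3 : `|y / 2| *+ 2 = `|y|.
  by rewrite normrM [`|2^-1|]ger0_norm// mulr2n; lra.
have h4 : 0 <= `|sin (y / 2)| by [].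
rewrite -h3 ler_wMn2r// expr2; nra.
Qed.

(** On the support of the bump the character of index [j] differs from 1 by at most |j| e in its
    real and in its imaginary part. *)
Lemma bcoef_near e j : 0 < e < pi ->
  cabs (bcoef e j - ((bmass e)%:C)%C) <= 2 * `|j%:~R| * e * bmass e.
Proof.
move=> ee; have /andP[e0 epi] := ee.
have cu := ubump_cont ee.
have t0 := @tpi_gt0 R.
have -> : bcoef e j - ((bmass e)%:C)%C = ((tpi^-1)%:C)%C *
    ((fcos j (ubump e) - I2 (ubump e)) +i* (- fsin j (ubump e)))%C.
  rewrite /bcoef /fpair fcos_cst0 fsin_cst0 addr0 sub0r /bmass.
  by apply/eqP; rewrite eq_complex /=; apply/andP; split; apply/eqP; ring.
rewrite cabsM /bmass cabsR ger0_norm ?invr_ge0 ?(ltW t0)// mulrCA ler_wpM2l ?invr_ge0 ?(ltW t0)//.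
rewrite (le_trans (cabs_le_ReIm _))//= normrN.
have cc := contM cu (cosj_cont (j := j)); have cs := contM cu (sinj_cont (j := j)).
have j0 : 0 <= `|j%:~R : R| * e by rewrite mulr_ge0// ltW.
have key (w : R -> R) : continuous w -> (forall x, `|w x| <= `|j%:~R * x|) ->
    `|I2 (fun x => ubump e x * w x)| <= `|j%:~R| * e * I2 (ubump e).
  move=> cw Hw; rewrite -I2Z// ler_norml.
  have B x : - pi <= x <= pi -> `|ubump e x * w x| <= `|j%:~R| * e * ubump e x.
    move=> /andP[x1 x2]; have /andP[b0 b1] := base_bump_bound (ang x / e).
    rewrite normrM ger0_norm// mulrC.
    have [->|un] := eqVneq (ubump e x) 0; first by rewrite !mulr0.
    rewrite ler_wpM2r// (le_trans (Hw x))// normrM ler_wpM2l//.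
    have := ubump_supp e0 un.
    (* Within the period, [ang x] differs from [x] only at [- pi], and there only by sign. *)
    have [xpi|xpi] := eqVneq x (- pi).
      rewrite xpi (@ang_unique _ _ pi (- 1)); first by rewrite normrN.
        by have := @pi_pos R => p0; apply/andP; split; lra.
      by rewrite mulrN1 mulr2n; lra.
    by rewrite ang_id// x2 lt_neqAle eq_sym xpi x1.
  have cuw := contM cu cw.
  have cju : continuous (fun x => `|j%:~R| * e * ubump e x).
    by apply: contM => //; exact: cst_continuous'.
  apply/andP; split.
    rewrite -mulN1r -I2Z//; apply: I2_le => //.
      by apply: contM => //; exact: cst_continuous'.
    by move=> x /B; rewrite ler_norml mulN1r => /andP[].
  by apply: I2_le => // x /B; rewrite ler_norml => /andP[].
have E : fcos j (ubump e) - I2 (ubump e) = I2 (fun x => ubump e x * (cosj j x - 1)).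
  rewrite /fcos -I2B//; congr I2; apply/funext => x; ring.
rewrite E.
have H1 := key (fun x => cosj j x - 1) _ _.
have {}H1 := H1 ltac:(by move=> x; apply: cvgB; [exact: cosj_cont|exact: cvg_cst]).
have {}H1 := H1 ltac:(by move=> x; exact: cos_near1).
have H2 := key (sinj j) (sinj_cont (j := j)) (fun x => abs_sin_le _).
rewrite -/(fsin j (ubump e)) in H2; lra.
Qed.

End Bump.

(** * Bumps and arcs on the circle *)

Section CircleBump.
Context {R : realType}.
Implicit Types (x y t e d : R) (j : int) (z : R[i]) (p : bool).
Local Notation tpi := (pi *+ 2 : R).

(** The default 0 is met only outside the circle. *)
Definition arg z : R := ang (xget 0 [set x | expi x = z]).

Lemma arg_expi x : arg (expi x) = ang x.
Proof.
have := @xgetPex _ 0 [set y | expi y = expi x] (ex_intro _ x erefl).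
by rewrite /arg => /expi_inj_ang.
Qed.

Definition bump p e t z : R[i] :=
  (if p then expi (arg z / 2) else 1) * ((ubump e (arg z - t))%:C)%C.

Lemma bump_expi p e t x : - pi < x <= pi ->
  bump p e t (expi x) = (if p then expi (x / 2) else 1) * (ubump e (x - t) +i* 0)%C.
Proof. by move=> hx; rewrite /bump arg_expi ang_id. Qed.

Lemma ubump_arg e t x : ubump e (arg (expi x) - t) = ubump e (x - t).
Proof.
have [k xk] := ang_shift x; rewrite arg_expi -[LHS](periodic_int _ k (ubump_periodic e)).
by congr ubump; rewrite {2}xk; lra.
Qed.

Lemma ubump_shift_smooth e t : 0 < e < pi -> smooth_real (fun x => ubump e (x - t)).
Proof.
move=> ee; have := @smooth_affine R _ 1 (- t) 1 (ubump_smooth ee).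
by congr smooth_real; apply/funext => x; rewrite !mul1r.
Qed.

Lemma smooth_par_bump p e t : 0 < e < pi -> smooth_par p (bump p e t).
Proof.
move=> ee.
have S : smooth_S1 (fun z => ((ubump e (arg z - t))%:C)%C).
  split.
    rewrite [X in smooth_real X](_ : _ = fun x => ubump e (x - t)); first exact: ubump_shift_smooth.
    by apply/funext => x; rewrite /= ubump_arg.
  rewrite [X in smooth_real X](_ : _ = fun=> 0); first exact: smooth_cst.
  by apply/funext => x.
case: p => /=.
  exists (fun z => ((ubump e (arg z - t))%:C)%C) => // x hx.
  by rewrite bump_expi// ubump_arg.
by rewrite (_ : bump false e t = fun z => ((ubump e (arg z - t))%:C)%C)//; apply/funext => z; rewrite /bump mul1r.
Qed.

(** Rotating the bump multiplies each coefficient by a character of [t]; series smeared with rotated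
    bumps thereby become trigonometric series in [t]. *)
Lemma fourier_bump p e t j : 0 < e < pi ->
  fourier (bump p e t) (2 * j + p%:Z) = expi (- (j%:~R * t)) * bcoef e j.
Proof.
move=> ee; have cu := ubump_cont ee; have pu := ubump_periodic e.
rewrite (@fourierE _ p _ (fun x => ubump e (x - t)) (fun=> 0)); first last.
- by move=> x; exact: bump_expi.
- exact: cst_continuous'.
- exact: shift_continuous.
rewrite /bcoef /fpair fcos_cst0 fsin_cst0 fcos_shift// fsin_shift// -expi_conj expi_jx.
by apply/eqP; rewrite eq_complex /=; apply/andP; split; apply/eqP; ring.
Qed.

Lemma expi_lipschitz x y : cabs (expi x - expi y) <= 2 * `|x - y| :> R.
Proof.
have -> : expi x - expi y = expi y * (expi (x - y) - 1).
  by rewrite mulrBr mulr1 -expiD [y + _]addrC subrK.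
rewrite cabsM cabs_expi mul1r (le_trans (cabs_le_ReIm _))//=.
have := cos_near1 (x - y); have := abs_sin_le (x - y); rewrite subr0; lra.
Qed.

Lemma expi_continuous : continuous (expi : R -> (R[i])^o).
Proof.
move=> x; apply/cvgrPdist_lt => _ /gt0_complex[r r0 ->].
have r2 : 0 < r / 2 by rewrite divr_gt0.
near=> y; rewrite cabsE ltcR (le_lt_trans (expi_lipschitz _ _))//.
rewrite mulrC -ltr_pdivlMr//; near: y.
Unshelve. all: by end_near.
Qed.

Lemma expi_itv_closed a b : closed (expi @` `[a, b] : set (R[i])^o).
Proof.
apply: compact_closed; first exact: norm_hausdorff.
apply: continuous_compact; last exact: segment_compact.
by apply: continuous_subspaceT; exact: expi_continuous.
Qed.

Definition carc t d : set R[i] := expi @` `[t - d, t + d].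
Definition oarc t d : set R[i] := expi @` `]t - d, t + d[.

Lemma expi_near t x d : `|ang (x - t)| <= d -> carc t d (expi x).
Proof.
move=> h; exists (t + ang (x - t)).
  rewrite /= in_itv /=; move: h; rewrite ler_norml => /andP[h1 h2].
  by apply/andP; split; lra.
by rewrite expiD expi_ang -expiD addrC subrK.
Qed.

Lemma clos_sub (A B : set R[i]) : closed (B : set (R[i])^o) -> A `<=` B -> clos A `<=` B.
Proof.
move=> Bc AB z /(@closure_subset (R[i])^o A B AB).
by rewrite -(@closure_id (R[i])^o B).1.
Qed.

Lemma supp_bump p e t : 0 < e -> supp (bump p e t) `<=` carc t e.
Proof.
move=> e0; apply: clos_sub; first exact: expi_itv_closed.
move=> z [/circle_expi[x ->] /=]; rewrite /bump mulf_eq0 negb_or => /andP[_].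
rewrite -[0]/((0%:C)%C) (inj_eq (@complexI _)) ubump_arg => h.
by apply: expi_near; exact: ubump_supp h.
Qed.

Lemma interval_oarc t d : 0 < d < pi -> interval_S1 (oarc t d).
Proof.
move=> /andP[d0 dpi]; have E : tpi = pi + pi by rewrite mulr2n.
split.
(* The open arc is the circle minus the complementary closed arc, which is compact. *)
- exists (~` (expi @` `[t + d, t + tpi - d])).
    by apply: closed_openC; exact: expi_itv_closed.
  apply/seteqP; split=> [_ [x /= xt <-]|z [/circle_expi[x ->] h]].
    split; first exact: expi_circle.
    move=> [y /= yt] /esym/expi_inj[k xk].
    move: xt yt; rewrite !in_itv /= => /andP[x1 x2] /andP[y1 y2].
    have h1 : tpi * (-1)%:~R < tpi * k%:~R by rewrite mulrN1; lra.
    have h2 : tpi * k%:~R < tpi * 0%:~R by rewrite mulr0; lra.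
    by move: h1 h2; rewrite !ltr_pM2l ?tpi_gt0// !ltr_int; lia.
  have [ad|ad] := ltP `|ang (x - t)| d.
    exists (t + ang (x - t)); last by rewrite expiD expi_ang -expiD addrC subrK.
    rewrite /= in_itv /=; move: ad; rewrite ltr_norml => /andP[h1 h2].
    by apply/andP; split; lra.
  exfalso; apply: h; have /andP[a1 a2] := angP (x - t).
  have [a0|a0] := leP 0 (ang (x - t)).
    rewrite ger0_norm// in ad.
    exists (t + ang (x - t)); last by rewrite expiD expi_ang -expiD addrC subrK.
    by rewrite /= in_itv /=; apply/andP; split; lra.
  rewrite ltr0_norm// in ad.
  exists (t + ang (x - t) + tpi * 1%:~R); last first.
    by rewrite expi_period expiD expi_ang -expiD addrC subrK.
  by rewrite /= in_itv /= mulr1; apply/andP; split; lra.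
- apply: connected_continuous_connected.
    by apply/connected_intervalP; exact: interval_is_interval.
  by apply: continuous_subspaceT; exact: expi_continuous.
- by exists (expi t), t => //=; rewrite in_itv /=; apply/andP; split; lra.
- move=> H; have [] := clos_sub (B := carc t d) _ _ (H _ (expi_circle (t + pi))).
  + exact: expi_itv_closed.
  + by move=> _ [x /= xt <-]; exists x => //=; move: xt; rewrite !in_itv /= => /andP[/ltW -> /ltW ->].
  + move=> x /=; rewrite in_itv /= => /andP[x1 x2] /expi_inj[k xk].
    have h1 : tpi * (-1)%:~R < tpi * k%:~R by rewrite mulrN1; lra.
    have h2 : tpi * k%:~R < tpi * 0%:~R by rewrite mulr0; lra.
    by move: h1 h2; rewrite !ltr_pM2l ?tpi_gt0// !ltr_int; lia.
Qed.

Lemma carc_oarc t e d : e < d -> carc t e `<=` oarc t d.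
Proof.
move=> ed _ [x /= xt <-]; exists x => //=; move: xt; rewrite !in_itv /= => /andP[x1 x2].
by apply/andP; split; lra.
Qed.

Lemma clos_oarc t d : clos (oarc t d) `<=` carc t d.
Proof.
apply: clos_sub; first exact: expi_itv_closed.
by move=> _ [x /= xt <-]; exists x => //=; move: xt; rewrite !in_itv /= => /andP[/ltW -> /ltW ->].
Qed.

Lemma carc_compl t t' e d : e + d < `|ang (t' - t)| -> carc t' e `<=` compl_S1 (oarc t d).
Proof.
move=> ed _ [x /= xt <-]; split; first exact: expi_circle.
move=> /clos_oarc[y /= yt] /expi_inj[k yx].
have [l tl] := ang_shift (t' - t).
move: xt yt; rewrite !in_itv /= => /andP[x1 x2] /andP[y1 y2].
have E : tpi = pi + pi by rewrite mulr2n.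
have /andP[a1 a2] := angP (t' - t).
have ap : `|ang (t' - t)| <= pi by rewrite ler_norml a2 ltW.
have : ang (t' - t) = (t' - x) + (y - t).
  apply: (ang_unique (k := - k)); last by rewrite rmorphN mulrN yx; lra.
  by apply/andP; split; lra.
by move=> aE; move: ed; rewrite aE lter_normr => /orP[]; lra.
Qed.

Lemma compl_S1_arc (I : set R[i]) : interval_S1 I ->
  exists t0 d, 0 < d /\ forall t e, `|t - t0| < d -> e <= d -> carc t e `<=` compl_S1 I.
Proof.
move=> [_ _ _ nd].
have [z [cz nz]] : exists z, circle z /\ ~ clos I z.
  by apply: contrapT => H; apply: nd => z cz; apply: contrapT => nz; apply: H; exists z.
have [t0 zt] := circle_expi cz.
have O : open (~` (closure (I : set (R[i])^o)) : set (R[i])^o).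
  by apply: closed_openC; exact: closed_closure.
have : nbhs (expi t0 : (R[i])^o) (~` (closure (I : set (R[i])^o))).
  by apply: open_nbhs_nbhs; split; [exact: O|rewrite -zt].
move=> /nbhs_ballP[_ /gt0_complex[r r0 ->] Hr].
(* [expi] is 2-Lipschitz and the angles differ by at most 2 r / 5, so the points stay within 4 r / 5
   of [expi t0]. *)
exists t0, (r / 5); split; first by rewrite divr_gt0.
move=> t e tt er _ [x /= xt <-]; split; first exact: expi_circle.
apply: Hr; rewrite -ball_normE /= cabsE ltcR (le_lt_trans (expi_lipschitz _ _))//.
have : `|t0 - x| <= 2 * (r / 5).
  move: tt xt; rewrite in_itv /= ltr_norml ler_norml => /andP[h1 h2] /andP[h3 h4].
  by apply/andP; split; lra.
lra.
Qed.

End CircleBump.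

(** * Uniqueness for trigonometric series *)

Section TrigSums.
Context {R : realType}.
Implicit Types (t d : R) (n N M L : nat) (j : int).
Local Notation tpi := (pi *+ 2 : R).

Definition grid M (k : nat) : R := tpi * k%:R / M%:R.

Lemma expi_grid M j (k : nat) : expi (j%:~R * grid M k) = expi (j%:~R * grid M 1) ^+ k :> R[i].
Proof. by rewrite expiX /grid; congr expi; rewrite mulr1 mulrCA; ring. Qed.

(** Averages over [M]-th roots of unity take the place of integrals in extracting coefficients; they
    are exact for frequencies below [M]. *)
Lemma grid_sum M j : (0 < M)%N -> (j == 0) || (`|j| < M)%N ->
  (M%:R)^-1 * \sum_(k < M) expi (j%:~R * grid M k) = (j == 0)%:R :> R[i].
Proof.
move=> M0; have Mn : M%:R != 0 :> R[i] by rewrite pnatr_eq0 -lt0n.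
have MR : M%:R != 0 :> R by rewrite pnatr_eq0 -lt0n.
have [->|j0 /= jM] := eqVneq j 0.
  move=> _; under eq_bigr do rewrite mul0r expi0.
  by rewrite sumr_const card_ord mulVf.
set z : R[i] := expi (j%:~R * grid M 1).
have zM : z ^+ M = 1.
  rewrite /z -expi_grid (_ : j%:~R * grid M M = 0 + tpi * j%:~R) ?expi_period ?expi0//.
  by rewrite /grid add0r; field.
have z1 : z != 1.
  apply/eqP => zE; have [k] : exists k : int, j%:~R * grid M 1 = 0 + tpi * k%:~R.
    by apply: expi_inj; rewrite expi0.
  rewrite add0r /grid mulr1 => E.
  have : (j%:~R : R) = (k * M%:Z)%:~R.
    have t0 := @tpi_gt0 R.
    rewrite intrM; apply: (mulfI (_ : tpi / M%:R != 0)).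
      by rewrite mulf_neq0 ?gt_eqF ?invr_gt0 ?ltr0n.
    by rewrite mulrC E; field.
  move=> /eqP; rewrite eqr_int => /eqP jk.
  have [k0|k0] := eqVneq k 0; first by rewrite jk k0 mul0r eqxx in j0.
  by have := jM; rewrite jk abszM /= ltnNge leq_pmull// absz_gt0.
under eq_bigr do rewrite expi_grid -/z.
have : (z - 1) * \sum_(i < M) z ^+ i = 0 by rewrite -subrX1 zM subrr.
by move=> /eqP; rewrite mulf_eq0 subr_eq0 (negbTE z1) /= => /eqP ->; rewrite mulr0.
Qed.

(** Telescoping, as (n + 1)^(-2) is at most 1 / n - 1 / (n + 1). *)
Lemma sum_inv_sqr N K : (0 < N)%N -> \sum_(N <= n < N + K) (n.+1%:R ^- 2 : R) <= N%:R^-1.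
Proof.
move=> N0; suff : \sum_(N <= n < N + K) (n.+1%:R ^- 2 : R) <= N%:R^-1 - (N + K)%:R^-1.
  by move=> /le_trans; apply; rewrite gerBl invr_ge0.
elim: K => [|K IH]; first by rewrite addn0 big_geq// subrr.
rewrite addnS big_nat_recr ?leq_addr//= (le_trans (lerD IH (lexx _)))//.
have k0 : 0 < (N + K)%:R :> R by rewrite ltr0n addn_gt0 N0.
rewrite -lerBrDl [leRHS](_ : _ = (N + K)%:R^-1 - (N + K).+1%:R^-1); last by ring.
rewrite -natr1; move: k0; move: (N + K)%:R => x x0.
have x1 : 0 < x + 1 by rewrite addr_gt0.
rewrite -subr_ge0 (_ : _ - _ = (x * (x + 1) ^+ 2)^-1); last by field; rewrite !gt_eqF.
by rewrite invr_ge0 mulr_ge0 ?exprn_ge0 ?ltW.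
Qed.

Section Vector.
Context {E : lmodType R[i]} {ip : E -> E -> R[i]} (ipP : is_ip ip).
Local Notation nm := (ipnorm ip).

Lemma tail_bound (v : nat -> E) (C : R) N N' : 0 <= C ->
  (forall n, nm (v n) * n.+1%:R ^+ 2 <= C) -> (0 < N <= N')%N ->
  nm (\sum_(N <= n < N') v n) <= C / N%:R.
Proof.
move=> C0 Hv /andP[N0 NN']; rewrite (le_trans (nm_sum ipP _ _ _))//.
rewrite (le_trans (_ : _ <= \sum_(N <= n < N') C * n.+1%:R ^- 2))//.
  apply: ler_sum => n _; rewrite ler_pdivlMr ?exprn_gt0 ?ltr0n//.
by rewrite -mulr_sumr ler_wpM2l// -(subnKC NN') sum_inv_sqr.
Qed.

Lemma series_cauchy (v : nat -> E) (C : R) : 0 <= C ->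
  (forall n, nm (v n) * n.+1%:R ^+ 2 <= C) ->
  ipcauchy ip (fun N => \sum_(0 <= n < N) v n).
Proof.
move=> C0 Hv e e0; exists (Num.truncn (C / e)).+1.
have K m n : ((Num.truncn (C / e)).+1 <= n)%N -> (n <= m)%N ->
    nm (\sum_(0 <= i < m) v i - \sum_(0 <= i < n) v i) < e.
  move=> Nn nm'; rewrite (big_cat_nat (leq0n n) nm')//= addrAC subrr add0r.
  have n0 : (0 < n)%N by apply: leq_trans Nn.
  rewrite (le_lt_trans (tail_bound C0 Hv _))// ?n0//.
  rewrite ltr_pdivrMr ?ltr0n// mulrC -ltr_pdivrMr//.
  by rewrite (lt_le_trans (truncnS_gt _))// ler_nat.
move=> m n Nm Nn; have [mn|/ltnW mn] := leqP n m; first exact: K.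
by rewrite (nm_distC ipP) K.
Qed.

Lemma series_tail (v : nat -> E) (C : R) x N : 0 <= C ->
  (forall n, nm (v n) * n.+1%:R ^+ 2 <= C) -> (0 < N)%N ->
  cvs ip (fun N => \sum_(0 <= n < N) v n) x ->
  nm (x - \sum_(0 <= n < N) v n) <= C / N%:R.
Proof.
move=> C0 Hv N0 Hx; apply/ler_addgt0Pr => e e0.
have [N1 HN1] := Hx _ e0.
rewrite (le_trans (nm_trans ipP _ (\sum_(0 <= n < maxn N N1) v n) _))// addrC lerD//.
  rewrite (big_cat_nat (leq0n N) (leq_maxl N N1))//= addrAC subrr add0r.
  by apply: tail_bound => //; rewrite N0 leq_maxl.
by rewrite ltW// HN1// leq_maxr.
Qed.

Definition ssum N (w : int -> E) : E := \sum_(k < N.*2.+1) w (k%:Z - N%:Z).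

Definition spair (w : int -> E) n : E := if n is n'.+1 then w n%:Z + w (- n%:Z) else w 0.

Lemma ssum_series N w : ssum N w = \sum_(0 <= n < N.+1) spair w n.
Proof.
rewrite /ssum; elim: N => [|N IH].
  by rewrite big_ord_recl big_ord0 big_nat1 addr0 subrr.
rewrite big_nat_recr//= -IH doubleS big_ord_recl big_ord_recr /= addrCA.
congr (_ + _).
  apply: eq_bigr => i _; congr w; rewrite /= /fintype.bump leq0n; lia.
by rewrite addrC; congr (w _ + w _); rewrite /= ?/fintype.bump ?leq0n; lia.
Qed.

Lemma ssum_cond N (p : pred int) (w : int -> E) :
  \sum_(k < N.*2.+1 | p (k%:Z - N%:Z)) w (k%:Z - N%:Z) = ssum N (fun m => if p m then w m else 0).
Proof. by rewrite /ssum big_mkcond. Qed.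

Lemma spair_bound (w : int -> E) (C : R) : 0 <= C ->
  (forall m, nm (w m) * (`|m|.+1)%:R ^+ 2 <= C) ->
  forall n, nm (spair w n) * n.+1%:R ^+ 2 <= 2 * C.
Proof.
move=> C0 Hw [|n] /=.
  by rewrite (le_trans (Hw 0))// ler_peMl// ler1n.
rewrite mulr2n mulrDl mul1r.
by rewrite (le_trans (ler_wpM2r _ (nmD ipP _ _)))// ?exprn_ge0// mulrDl lerD//.
Qed.

(** [jj] turns the doubled indices that occur into integral frequencies. Averaging a partial sum of
    order [N] against the frequency of [m0] isolates [w m0], which is therefore bounded by a tail of
    order 1 / N. *)
Lemma ssum_unique (w : int -> E) (jj : int -> int) (C : R) : 0 <= C ->
  (forall m, nm (w m) * (`|m|.+1)%:R ^+ 2 <= C) ->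
  (forall m, w m != 0 -> (`|jj m| <= `|m|)%N) ->
  (forall m m', w m != 0 -> w m' != 0 -> jj m = jj m' -> m = m') ->
  (forall t, cvs ip (fun N => ssum N (fun m => expi (- ((jj m)%:~R * t)) *: w m)) 0) ->
  forall m, w m = 0.
Proof.
move=> C0 Hw jjb jji H m0; apply: contrapT => /eqP wm0.
pose W t m := expi (- ((jj m)%:~R * t)) *: w m.
have HW t m : nm (W t m) * (`|m|.+1)%:R ^+ 2 <= C.
  by rewrite /W (nmZ ipP) cabs_expi mul1r.
(* Frequencies of terms up to order [N] differ by at most 2 N, which is less than [M]. *)
have key N : (`|m0| <= N)%N -> (0 < N)%N -> nm (w m0) <= 2 * C / N.+1%:R.
  move=> mN N0; pose M := (N.*2).+1.
  have tailt t : nm (ssum N (W t)) <= 2 * C / N.+1%:R.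
    have := series_tail (x := 0) (mulr_ge0 (ler0n _ 2) C0) (spair_bound C0 (HW t)) (ltn0Sn N) _.
    rewrite sub0r (nmN ipP) -ssum_series; apply.
    move=> e e0; have [N1 HN1] := H t e e0; exists N1.+1 => -[//|n] n1.
    by rewrite -ssum_series; exact: HN1.
  have E0 : w m0 = (M%:R)^-1 *: \sum_(k < M) expi ((jj m0)%:~R * grid M k) *: ssum N (W (grid M k)).
    rewrite /ssum; under eq_bigr do rewrite scaler_sumr.
    rewrite exchange_big scaler_sumr /=.
    transitivity (\sum_(i < N.*2.+1) ((i%:Z - N%:Z == m0)%:R : R[i]) *: w (i%:Z - N%:Z)).
      have km : (absz (m0 + N%:Z)%R < N.*2.+1)%N by lia.
      rewrite (bigD1 (Ordinal km))//= big1 => [|i ik].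
        rewrite (_ : (absz (m0 + N%:Z))%:Z - N%:Z = m0); last lia.
        by rewrite eqxx scale1r addr0.
      case: eqP => [im|]; rewrite ?scale0r//; exfalso.
      by move: ik; rewrite -val_eqE /=; apply/negP; rewrite negbK; apply/eqP; lia.
    apply: eq_bigr => i _; set m := i%:Z - N%:Z.
    have [wm|wm] := eqVneq (w m) 0.
      by rewrite wm scaler0 big1 ?scaler0// => k _; rewrite /W wm !scaler0.
    rewrite /W; under eq_bigr do rewrite scalerA -expiD -mulrBl -rmorphB.
    rewrite -scaler_suml scalerA; congr (_ *: _).
    have -> : (m == m0) = (jj m0 - jj m == 0).
      by rewrite subr_eq0; apply/eqP/eqP => [->//|/(jji _ _ wm0 wm) ->].
    apply/esym/grid_sum => //; have := jjb _ wm; have := jjb _ wm0.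
    have := ltn_ord i; rewrite /M /m; case: eqVneq => //= _; lia.
  rewrite {1}E0 (nmZ ipP) cabsV cabs_nat.
  have Mp : 0 < M%:R :> R by rewrite ltr0n.
  rewrite mulrC ler_pdivrMr// (le_trans (nm_sum ipP _ _ _))//.
  rewrite (le_trans (_ : _ <= \sum_(k < M) 2 * C / N.+1%:R))//.
    by apply: ler_sum => k _; rewrite (nmZ ipP) cabs_expi mul1r.
  by rewrite sumr_const card_ord mulr_natr lexx.
have wp := nm_gt0 ipP wm0.
pose N := maxn (maxn `|m0| 1) (Num.truncn (2 * C / nm (w m0))).
have := key N; rewrite /N !leq_max leqnn !orbT => /(_ isT isT).
rewrite -/N ler_pdivlMr ?ltr0n// mulrC -ler_pdivlMr// leNgt => /negP; apply.
rewrite (lt_le_trans (truncnS_gt _))// ler_nat ltnS leq_maxr//.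
Qed.

End Vector.

(** The constant coefficient is the mean of the polynomial over roots of unity of large order. *)
Lemma poly0_le_circle (q : {poly R[i]}) (B : R) :
  (forall t, cabs q.[expi t] <= B) -> cabs q`_0 <= B.
Proof.
move=> HB; pose M := (size q).+1.
have E : q`_0 = (M%:R)^-1 * \sum_(k < M) q.[expi (grid M k)].
  under eq_bigr do rewrite horner_coef.
  rewrite exchange_big mulr_sumr /=.
  transitivity (\sum_(i < size q) q`_i * ((i == 0 :> nat)%:R : R[i])).
    case sq : (size q) => [|s].
      by rewrite big_ord0 nth_default// sq.
    rewrite big_ord_recl big1 ?addr0 ?mulr1// => i _.
    by rewrite lift0 mulr0.
  apply: eq_bigr => i _; rewrite -mulr_sumr mulrCA; congr (_ * _).
  under eq_bigr do rewrite expiX.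
  have := @grid_sum M i isT; rewrite -[(i%:Z == 0)]/(i == 0 :> nat).
  move=> -> //; apply/orP; right; rewrite /M ltnS; exact: ltnW (ltn_ord i).
have Mp : 0 < M%:R :> R by rewrite ltr0n.
rewrite E cabsM cabsV cabs_nat mulrC ler_pdivrMr// (le_trans (cabs_sum _ _ _))//.
rewrite (le_trans (_ : _ <= \sum_(k < M) B))//; first by apply: ler_sum.
by rewrite sumr_const card_ord mulr_natr lexx.
Qed.

(** Turns the scalars into an inner product space, so that the lemmas on series of vectors cover
    numerical series. *)
Definition ipc (x y : (R[i])^o) : R[i] := x^* * y.

Lemma ipcP : is_ip ipc.
Proof.
rewrite /ipc; split.
- by move=> x y z; rewrite mulrDr.
- by move=> c x y; rewrite mulrCA.
- by move=> x y; rewrite rmorphM /= conjCK mulrC.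
- by move=> x; rewrite mulrC -normCK exprn_ge0.
- by move=> x /eqP; rewrite mulf_eq0 conjC_eq0 orbb => /eqP.
Qed.

Lemma nm_ipc (x : R[i]) : ipnorm ipc x = cabs x.
Proof. by rewrite /ipnorm /ipc mulrC mul_conj_cabs /= sqrtr_sqr ger0_norm ?cabs_ge0. Qed.

Lemma cabs_sum_bound (c : nat -> R[i]) (C : R) N : 0 <= C ->
  (forall n, cabs (c n) * n.+1%:R ^+ 2 <= C) -> \sum_(0 <= n < N) cabs (c n) <= 2 * C.
Proof.
move=> C0 Hc; case: N => [|N]; first by rewrite big_geq// mulr_ge0.
have H n : cabs (c n) <= C * n.+1%:R ^- 2 by rewrite ler_pdivlMr ?exprn_gt0 ?ltr0n.
rewrite (le_trans (ler_sum _ (fun n _ => H n)))// -mulr_sumr mulrC ler_wpM2r//.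
rewrite big_nat_recl// expr1n invr1 (_ : 2 = 1 + 1)// lerD2l.
rewrite (_ : \sum_(0 <= i < N) _ = \sum_(1 <= i < 1 + N) i.+1%:R ^- 2); last first.
  by rewrite [RHS]big_add1.
by rewrite (le_trans (sum_inv_sqr N (ltn0Sn 0)))// invr1.
Qed.

(** Rotating the arc around the circle, a product of rotated copies of the
    function vanishes on the whole circle. *)
Lemma one_sided_unique0 (c : nat -> R[i]) (C t0 d : R) : 0 <= C -> 0 < d ->
  (forall n, cabs (c n) * n.+1%:R ^+ 2 <= C) ->
  (forall t, `|t - t0| < d -> forall N, (0 < N)%N ->
     cabs (\sum_(0 <= n < N) c n * expi (n%:R * t)) <= C / N%:R) ->
  c 0%N = 0.
Proof.
move=> C0 d0 Hc H; have p0 := @tpi_gt0 R.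
(* Rotations by multiples of 2 pi / M, which is less than [d], bring every point into the arc. *)
pose M := (Num.truncn (tpi / d)).+1.
have Md : tpi / M%:R < d.
  rewrite ltr_pdivrMr ?ltr0n// mulrC -ltr_pdivrMr// /M; exact: truncnS_gt.
have Mp : 0 < M%:R :> R by rewrite ltr0n.
have grid_near t : exists j : 'I_M, exists k : int, `|t + grid M j + tpi * k%:~R - t0| < d.
  have [y [k [y0 y2 Ey]]] : exists y, exists k : int, [/\ 0 <= y, y < tpi & t0 - t = y + tpi * k%:~R].
    have [k tk] := ang_shift (t0 - t); have /andP[a1 a2] := angP (t0 - t).
    have E : tpi = pi + pi by rewrite mulr2n.
    have pp := @pi_pos R.
    have [a0|a0] := leP 0 (ang (t0 - t)).
      by exists (ang (t0 - t)), k; split=> //; lra.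
    exists (ang (t0 - t) + tpi), (k - 1); split; [lra|lra|].
    by rewrite {1}tk rmorphB /= mulrBr mulr1; ring.
  have yM : 0 <= y * M%:R / tpi by rewrite !mulr_ge0// ?invr_ge0 ltW.
  have /andP[j1 j2] := truncn_itv yM.
  have jM : (Num.truncn (y * M%:R / tpi) < M)%N.
    rewrite -(ltr_nat R) (le_lt_trans j1)// ltr_pdivrMr// mulrC.
    by rewrite ltr_pM2l.
  exists (Ordinal jM), k; rewrite /grid /=.
  move: j1 j2; set j := Num.truncn _; rewrite ler_pdivlMr// ltr_pdivrMr// => j1 j2.
  have -> : t + tpi * j%:R / M%:R + tpi * k%:~R - t0 = - (y - tpi * j%:R / M%:R) by lra.
  rewrite normrN ger0_norm ?subr_ge0 ?ler_pdivrMr//; last by rewrite mulrC.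
  rewrite ltrBlDr (lt_le_trans _ (_ : tpi / M%:R + tpi * j%:R / M%:R <= _))//; last by rewrite lerD2r ltW.
  rewrite -mulrDl ltr_pdivlMr// (lt_le_trans j2)// -natr1 mulrDl mul1r addrC.
  by rewrite [j%:R * _]mulrC.
pose p N : {poly R[i]} := \poly_(i < N) c i.
pose P N := \prod_(j < M) (p N \Po (expi (grid M j) *: 'X)).
have pE N t : (p N).[expi t] = \sum_(0 <= n < N) c n * expi (n%:R * t).
  by rewrite horner_poly big_mkord; apply: eq_bigr => i _; rewrite expiX.
have PE N t : (P N).[expi t] = \prod_(j < M) (p N).[expi (t + grid M j)].
  rewrite horner_prod; apply: eq_bigr => j _.
  by rewrite horner_comp hornerZ hornerX -expiD addrC.
have bd N t : cabs (p N).[expi t] <= 2 * C + 1.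
  rewrite pE (le_trans (cabs_sum _ _ _))//.
  under eq_bigr do rewrite cabsM cabs_expi mulr1.
  by rewrite (le_trans (cabs_sum_bound _ C0 Hc))// lerDl.
have B1 : 1 <= 2 * C + 1 by rewrite lerDr mulr_ge0.
have cabs_prod (I : Type) (r : seq I) (F : I -> R[i]) :
    cabs (\prod_(i <- r) F i) = \prod_(i <- r) cabs (F i).
  by elim/big_ind2: _ => [|x a y b <- <-|//]; rewrite ?cabs1 ?cabsM.
(* At each point one factor of [P N] is at most [C / N] and the others are at most 2 C + 1, while
   the constant term of the product is [c 0 ^+ M]. *)
have HP N : (0 < N)%N -> cabs (c 0%N) ^+ M <= (2 * C + 1) ^+ M * C / N%:R.
  move=> N0; have -> : cabs (c 0%N) ^+ M = cabs (P N)`_0.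
    rewrite -horner_coef0 horner_prod cabs_prod -[X in _ ^+ X]card_ord -prodr_const.
    apply: eq_bigr => j _; rewrite horner_comp hornerZ hornerX mulr0 horner_coef0.
    by rewrite coef_poly N0.
  apply: poly0_le_circle => t; rewrite PE cabs_prod.
  have [j [k tjk]] := grid_near t.
  rewrite (bigD1 j)//= mulrC -mulrA; apply: ler_pM => //.
  - by apply: prodr_ge0 => i _; exact: cabs_ge0.
  - exact: cabs_ge0.
  - rewrite (le_trans (_ : _ <= \prod_(i < M | i != j) (2 * C + 1)))//.
      by apply: ler_prod => i _; rewrite cabs_ge0 bd.
    rewrite prodr_const; apply: ler_weXn2l => //.
    by rewrite (leq_trans (max_card _))// card_ord.
  - by rewrite -(expi_period _ k) pE; exact: H.
apply/eqP; rewrite -cabs_eq0; apply/eqP.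
apply: contrapT => /eqP c0.
have cp : 0 < cabs (c 0%N) ^+ M by rewrite exprn_gt0// lt_neqAle eq_sym c0 cabs_ge0.
pose Q := (2 * C + 1) ^+ M * C / cabs (c 0%N) ^+ M.
have := HP (Num.truncn Q).+1 isT; rewrite ler_pdivlMr ?ltr0n// mulrC -ler_pdivlMr//.
by rewrite leNgt truncnS_gt.
Qed.

(** Once [c 0] vanishes, dividing the series by [expi t] shifts the coefficients. *)
Lemma one_sided_unique (c : nat -> R[i]) (C t0 d : R) : 0 <= C -> 0 < d ->
  (forall n, cabs (c n) * n.+1%:R ^+ 2 <= C) ->
  (forall t, `|t - t0| < d ->
     cvs ipc (fun N => \sum_(0 <= n < N) c n * expi (n%:R * t)) 0) ->
  forall n, c n = 0.
Proof.
move=> C0 d0 Hc H n; elim: n c Hc H => [|n IH] c Hc H.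
  apply: (one_sided_unique0 C0 d0 Hc (t0 := t0)) => t /H Ht N N0.
  have := series_tail ipcP C0 _ N0 Ht; rewrite sub0r (nmN ipcP) nm_ipc; apply.
  by move=> k; rewrite nm_ipc cabsM cabs_expi mulr1.
have c0 : c 0%N = 0.
  apply: (one_sided_unique0 C0 d0 Hc (t0 := t0)) => t /H Ht N N0.
  have := series_tail ipcP C0 _ N0 Ht; rewrite sub0r (nmN ipcP) nm_ipc; apply.
  by move=> k; rewrite nm_ipc cabsM cabs_expi mulr1.
apply: (IH (fun n => c n.+1)).
  move=> k; apply: le_trans (Hc k.+1); rewrite ler_wpM2l ?cabs_ge0//.
  by apply: lerXn2r; rewrite ?nnegrE// ler_nat.
move=> t /H Ht e e0; have [N HN] := Ht e e0; exists N => k Nk.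
have := HN k.+1 (leqW Nk); rewrite !sub0r !(nmN ipcP) !nm_ipc big_nat_recl// c0 mul0r add0r.
suff -> : \sum_(0 <= i < k) c i.+1 * expi (i.+1%:R * t) =
   expi t * \sum_(0 <= i < k) c i.+1 * expi (i%:R * t).
  by rewrite cabsM cabs_expi mul1r.
rewrite mulr_sumr; apply: eq_bigr => i _.
by rewrite -natr1 mulrDl mul1r expiD mulrA mulrC.
Qed.

End TrigSums.

(** * Double trigonometric series concentrated near the diagonal *)

Section TwoVariables.
Context {R : realType}.
Implicit Types (t e : R) (n m s : int) (N L M : nat).
Local Notation tpi := (pi *+ 2 : R).

Lemma grid1 (w : int -> R[i]) L n s : (`|n| <= L)%N -> `|s|%N = 1%N ->
  (((4 * L).+1)%:R)^-1 * \sum_(a < (4 * L).+1)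
    ((\sum_(k < L.*2.+1) w (k%:Z - L%:Z) * expi ((s * (k%:Z - L%:Z))%:~R * grid (4 * L).+1 a))
     * expi (- ((s * n)%:~R * grid (4 * L).+1 a))) = w n.
Proof.
move=> nL s1.
under eq_bigr do rewrite mulr_suml.
rewrite exchange_big mulr_sumr /=.
have nk : (absz (n + L%:Z)%R < L.*2.+1)%N by lia.
rewrite (bigD1 (Ordinal nk))//= [X in _ + X]big1 => [|k kn].
  rewrite (_ : (absz (n + L%:Z))%:Z - L%:Z = n); last lia.
  rewrite addr0; under eq_bigr do rewrite -mulrA -expiD subrr expi0 mulr1.
  by rewrite sumr_const card_ord -[w n *+ _]mulr_natl mulrA mulVf ?mul1r// pnatr_eq0.
under eq_bigr do rewrite -mulrA -expiD -mulrBl -rmorphB -mulrBr.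
rewrite -mulr_sumr mulrCA grid_sum//.
  rewrite [X in X%:R](_ : _ = 0%N) ?mulr0//; apply/eqP; rewrite eqb0.
  rewrite mulf_eq0 negb_or; apply/andP; split; first by apply: contra_eq_neq s1 => ->.
  apply: contraNneq kn => kn; rewrite -val_eqE /=; apply/eqP; lia.
by apply/orP; right; rewrite abszM s1 mul1n; have := ltn_ord k; lia.
Qed.

(** The two variables enter with opposite signs, so that multiplication by a power of
    [expi (t' - t)] shifts both indices together. *)
Definition dsum L (A : int -> int -> R[i]) t t' : R[i] :=
  \sum_(k < L.*2.+1) \sum_(l < L.*2.+1)
    A (k%:Z - L%:Z) (l%:Z - L%:Z) * expi ((k%:Z - L%:Z)%:~R * t - (l%:Z - L%:Z)%:~R * t').

Lemma grid2 (A : int -> int -> R[i]) L n m : (`|n| <= L)%N -> (`|m| <= L)%N ->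
  let M := (4 * L).+1 in
  (M%:R)^-1 * \sum_(a < M) (M%:R)^-1 * \sum_(b < M)
     (dsum L A (grid M a) (grid M b) * expi (- (n%:~R * grid M a) + m%:~R * grid M b)) = A n m.
Proof.
move=> nL mL M; rewrite -[RHS](grid1 (A ^~ m) nL (s := 1))// -/M.
congr (_ * _); apply: eq_bigr => a _; rewrite mul1r.
rewrite -(grid1 (fun l => \sum_(k < L.*2.+1) A (k%:Z - L%:Z) l * expi ((1 * (k%:Z - L%:Z))%:~R * grid M a)) mL (s := -1))// -/M.
rewrite -mulrA mulr_suml; congr (_ * _); apply: eq_bigr => b _.
rewrite [expi (- (n%:~R * _) + _)]expiD mulrA mulrAC; congr (_ * _).
rewrite [in RHS]mulN1r rmorphN mulNr opprK.
congr (_ * _); rewrite /dsum exchange_big /=; apply: eq_bigr => l _.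
rewrite mulr_suml; apply: eq_bigr => k _.
by rewrite expiD mulrA mul1r mulN1r rmorphN mulNr.
Qed.

Lemma cabs_avg M (F : 'I_M -> R[i]) (B : R) : (0 < M)%N -> (forall k, cabs (F k) <= B) ->
  cabs ((M%:R)^-1 * \sum_(k < M) F k) <= B.
Proof.
move=> M0 HF; have Mp : 0 < M%:R :> R by rewrite ltr0n.
rewrite cabsM cabsV cabs_nat mulrC ler_pdivrMr// (le_trans (cabs_sum _ _ _))//.
rewrite (le_trans (_ : _ <= \sum_(k < M) B))//; first by apply: ler_sum.
by rewrite sumr_const card_ord mulr_natr lexx.
Qed.

Lemma one_sub_expi t : cabs (1 - expi t) <= 2 * `|ang t|.
Proof.
rewrite -(expi_ang t) -expi0 (le_trans (expi_lipschitz _ _))//.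
by rewrite sub0r normrN.
Qed.

(** The series is multiplied by [(1 - expi (t' - t)) ^+ N]. On coefficients this takes the [N]-th
    difference along the diagonal; on values each power gains [4 e] where [S] lives. *)
Lemma two_var_bound (A : int -> int -> R[i]) (S : nat -> R -> R -> R[i]) (B e : R) N :
  0 <= B -> 0 <= e ->
  (forall h : R, 0 < h -> exists L0, forall L, (L0 <= L)%N -> forall t t',
     cabs (S L t t' - dsum L A t t') <= h) ->
  (forall L t t', S L t t' != 0 -> `|ang (t' - t)| <= 2 * e) ->
  (forall L t t', cabs (S L t t') <= B) ->
  forall n m, cabs (\sum_(i < N.+1) ((-1) ^+ i *+ 'C(N, i)) * A (n + i%:Z) (m + i%:Z)) <=
    B * (4 * e) ^+ N.
Proof.
move=> B0 e0 HL Se SB n m; apply/ler_addgt0Pr => h h0.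
(* The multiplier is at most [2 ^+ N] everywhere, so this accuracy leaves an error [h]. *)
have h2 : 0 < h / 2 ^+ N by rewrite divr_gt0// exprn_gt0.
have [L0 {}HL] := HL _ h2.
pose L := (L0 + `|n| + `|m| + N)%N; pose M := (4 * L).+1.
have L0L : (L0 <= L)%N by rewrite /L; lia.
pose G t t' := \sum_(i < N.+1) ((-1) ^+ i *+ 'C(N, i)) *
  expi (- ((n + i%:Z)%:~R * t) + (m + i%:Z)%:~R * t') : R[i].
have GE t t' : G t t' = expi (- (n%:~R * t) + m%:~R * t') * (1 - expi (t' - t)) ^+ N.
  rewrite exprBn mulr_sumr; apply: eq_bigr => i _.
  rewrite expr1n mulr1 mulrnAl mulrnAr; congr (_ *+ _).
  rewrite mulrCA; congr (_ * _); rewrite expiX -expiD; congr expi.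
  by rewrite !rmorphD /= !mulrDl opprD; ring.
have -> : \sum_(i < N.+1) ((-1) ^+ i *+ 'C(N, i)) * A (n + i%:Z) (m + i%:Z) =
   (M%:R)^-1 * \sum_(a < M) (M%:R)^-1 * \sum_(b < M)
     (dsum L A (grid M a) (grid M b) * G (grid M a) (grid M b)).
  transitivity (\sum_(i < N.+1) ((-1) ^+ i *+ 'C(N, i)) * ((M%:R)^-1 * \sum_(a < M) (M%:R)^-1 *
     \sum_(b < M) (dsum L A (grid M a) (grid M b) *
       expi (- ((n + i%:Z)%:~R * grid M a) + (m + i%:Z)%:~R * grid M b)))).
    apply: eq_bigr => i _; have iN := ltn_ord i.
    by rewrite -(@grid2 A L (n + i%:Z) (m + i%:Z)); [|rewrite /L; lia|rewrite /L; lia].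
  under eq_bigr => i _ do rewrite mulrCA mulr_sumr.
  rewrite -mulr_sumr exchange_big /=; congr (_ * _); apply: eq_bigr => a _.
  under eq_bigr => i _ do rewrite mulrCA mulr_sumr.
  rewrite -mulr_sumr exchange_big /=; congr (_ * _); apply: eq_bigr => b _.
  by rewrite /G mulr_sumr; apply: eq_bigr => i _; rewrite mulrCA.
apply: cabs_avg => // a; apply: cabs_avg => // b.
set t := grid M a; set t' := grid M b.
rewrite GE !cabsM cabs_expi mul1r cabsX.
have w2 : cabs (1 - expi (t' - t)) <= 2.
  by rewrite (le_trans (cabsB _ _))// cabs1 cabs_expi.
have -> : dsum L A t t' = S L t t' - (S L t t' - dsum L A t t') by rewrite subKr.
rewrite (le_trans (ler_wpM2r _ (cabsB _ _)))// ?exprn_ge0 ?cabs_ge0// mulrDl lerD//.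
  have [->|S0] := eqVneq (S L t t') 0.
    by rewrite cabs0 mul0r mulr_ge0 ?exprn_ge0 ?mulr_ge0.
  apply: ler_pM => //; rewrite ?exprn_ge0 ?cabs_ge0//.
  apply: lerXn2r; rewrite ?nnegrE ?cabs_ge0//.
    by have := Se _ _ _ S0; have := normr_ge0 (ang (t' - t)); lra.
  by rewrite (le_trans (one_sub_expi _))//; have := Se _ _ _ S0; lra.
rewrite (le_trans (ler_pM (cabs_ge0 _) _ (HL _ L0L t t') (_ : _ <= 2 ^+ N)))//.
- by rewrite exprn_ge0 ?cabs_ge0.
- by apply: lerXn2r; rewrite ?nnegrE ?cabs_ge0.
- by rewrite divfK// expf_neq0// pnatr_eq0.
Qed.

End TwoVariables.

(** * Finite differences and polynomial sequences *)

Section DifferenceEquations.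
Context {R : realType}.
Implicit Types (f : int -> R[i]) (N : nat) (p : {poly R[i]}).

(** The binomial polynomial of X over [k]. *)
Definition falling (k : nat) : {poly R[i]} := (k`!%:R)^-1 *: \prod_(i < k) ('X - (i%:R)%:P).

Lemma fallingS k (x : R[i]) : (falling k.+1).[x + 1] - (falling k.+1).[x] = (falling k).[x].
Proof.
rewrite /falling !hornerZ !horner_prod.
have E : \prod_(i < k.+1) ('X - (i%:R)%:P).[x + 1] = (x + 1) * \prod_(i < k) ('X - (i%:R)%:P).[x].
  rewrite big_ord_recl !hornerE subr0; congr (_ * _); apply: eq_bigr => i _.
  by rewrite lift0 !hornerE -natr1; ring.
have E2 : \prod_(i < k.+1) ('X - (i%:R)%:P).[x] = \prod_(i < k) ('X - (i%:R)%:P).[x] * (x - k%:R).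
  by rewrite big_ord_recr /= hornerXsubC.
rewrite E E2 factS natrM; set P := \prod_(i < k) _; rewrite -mulrBr.
have -> : (x + 1) * P - P * (x - k%:R) = k.+1%:R * P by rewrite -natr1; ring.
rewrite mulrA; congr (_ * _); field.
by rewrite !pnatr_eq0 -lt0n fact_gt0 ?[1 + _]addrC ?natr1 ?pnatr_eq0.
Qed.

Definition dif N f n : R[i] := \sum_(i < N.+1) ((-1) ^+ i *+ 'C(N, i)) * f (n + i%:Z).

Lemma difS N f n : dif N.+1 f n = dif N (fun n => f n - f (n + 1)) n.
Proof.
rewrite /dif; under [RHS]eq_bigr do rewrite mulrBr.
rewrite sumrB big_ord_recl /= bin0 expr0 mulr1n mul1r addr0.
under eq_bigr => i _.
  rewrite /fintype.bump leq0n add1n binS mulrnDr mulrDl exprS mulN1r.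
  over.
rewrite big_split /= addrA; congr (_ + _).
  rewrite [RHS]big_ord_recl bin0 expr0 mulr1n mul1r addr0; congr (_ + _).
  rewrite big_ord_recr /= bin_small// mulr0n mul0r addr0.
  by apply: eq_bigr => i _; rewrite /fintype.bump leq0n add1n exprS mulN1r.
rewrite -sumrN; apply: eq_bigr => i _; rewrite mulNrn mulNr; congr (- (_ * f _)); lia.
Qed.

(** Newton's interpolation: the induction expands the difference of [f], raising the binomial
    indices gives a discrete primitive [F], and [f - F] is constant. *)
Lemma dif_newton N f : (forall n, dif N f n = 0) ->
  exists c : nat -> R[i], forall n, f n = \sum_(k < N) c k * (falling k).[n%:~R].
Proof.
elim: N f => [|N IH] f Hf.
  exists (fun=> 0) => n; rewrite big_ord0; have := Hf n.
  by rewrite /dif big_ord_recl big_ord0 bin0 expr0 mulr1n mul1r !addr0.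
have [|c Hc] := IH (fun n => f n - f (n + 1)); first by move=> n; rewrite -difS.
pose F (n : int) := - \sum_(k < N) c k * (falling k.+1).[n%:~R].
have HF n : F n - F (n + 1) = f n - f (n + 1).
  rewrite Hc /F opprK addrC -sumrB; apply: eq_bigr => k _.
  by rewrite -mulrBr rmorphD /= fallingS.
have cst n : f n - F n = f 0 - F 0.
  have st m : f m - F m = f (m + 1) - F (m + 1).
    by have := HF m => /eqP; rewrite subr_eq addrAC => /eqP E; rewrite -[X in _ - X](subrK (F (m + 1))) HF; ring.
  case: n => n.
    elim: n => [//|n <-]; rewrite [RHS]st; congr (f _ - F _); lia.
  rewrite NegzE; elim: n => [|n <-].
    by rewrite (st (- 1%:Z)) addNr.
  by rewrite (st (- n.+2%:Z)); congr (f _ - F _); lia.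
exists (fun k => if k is k'.+1 then - c k' else f 0 - F 0) => n.
rewrite big_ord_recl /= /falling big_ord0 fact0 invr1 scale1r hornerC mulr1.
rewrite -[f n](subrK (F n)) cst; congr (_ + _); rewrite /F -sumrN.
by apply: eq_bigr => k _; rewrite mulNr.
Qed.

Lemma dif_poly N f : (forall n, dif N f n = 0) -> exists p, forall n, f n = p.[n%:~R].
Proof.
move=> /dif_newton[c Hc]; exists (\sum_(k < N) c k *: falling k) => n.
by rewrite Hc [RHS]horner_sum; apply: eq_bigr => k _; rewrite [RHS]hornerZ.
Qed.

(** Stated for squares because the bounds come from squared norms, whose growth exponents may be
    odd. *)
Lemma poly_growth p (C : R) K : 0 <= C ->
  (forall n : nat, cabs p.[n%:R] ^+ 2 <= C * n.+1%:R ^+ K) -> (2 * (size p).-1 <= K)%N.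
Proof.
move=> C0 Hp; have [->|p0] := eqVneq p 0; first by rewrite size_poly0.
set d := (size p).-1; rewrite leqNgt; apply/negP => Kd.
pose a := cabs (lead_coef p).
have a0 : 0 < a by rewrite lt_neqAle eq_sym cabs_eq0 lead_coef_eq0 p0 cabs_ge0.
pose S := \sum_(i < d) cabs p`_i.
have S0 : 0 <= S by apply: sumr_ge0 => i _; exact: cabs_ge0.
have low n : 0 < n%:R :> R -> 2 * S <= a * n%:R -> a / 2 * n%:R ^+ d <= cabs p.[n%:R].
  move=> n0 Sn.
  have sp : size p = d.+1 by rewrite /d prednK// size_poly_gt0.
  rewrite horner_coef sp big_ord_recr /= addrC.
  have -> : p`_d = lead_coef p by [].
  set r := \sum_(i < d) _.
  have rS : cabs r * n%:R <= S * n%:R ^+ d.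
    rewrite /r /S (le_trans (ler_wpM2r _ (cabs_sum _ _ _)))// !mulr_suml.
    apply: ler_sum => i _; rewrite cabsM cabsX cabs_nat -mulrA -exprSr.
    rewrite ler_wpM2l ?cabs_ge0// ler_weXn2l//.
    by rewrite ler1n; move: n0; rewrite ltr0n.
  have : a * n%:R ^+ d <= cabs (lead_coef p * n%:R ^+ d + r) + cabs r.
    rewrite -[leLHS](_ : cabs (lead_coef p * n%:R ^+ d) = _); last by rewrite cabsM cabsX cabs_nat.
    by rewrite -{1}[lead_coef p * _](addrK r) cabsB.
  have : cabs r <= a / 2 * n%:R ^+ d.
    rewrite -(ler_pM2r n0) (le_trans rS)// mulrAC ler_wpM2r ?exprn_ge0//; lra.
  lra.
(* The first summand makes the leading monomial dominate, the second contradicts the growth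
   bound. *)
pose n := (Num.truncn (2 * S / a + 4 * C * 2 ^+ K / a ^+ 2)).+1.
have nlt : 2 * S / a + 4 * C * 2 ^+ K / a ^+ 2 < n%:R by exact: truncnS_gt.
have q1 : 0 <= 2 * S / a by rewrite divr_ge0 ?mulr_ge0// ltW.
have q2 : 0 <= 4 * C * 2 ^+ K / a ^+ 2 by rewrite !mulr_ge0 ?invr_ge0 ?exprn_ge0// ltW.
have n0 : 0 < n%:R :> R by rewrite ltr0n.
have H : a / 2 * n%:R ^+ d <= cabs p.[n%:R].
  by apply: low => //; rewrite [a * _]mulrC -ler_pdivrMr//; move: q1 q2 nlt; lra.
have h1 : (a / 2 * n%:R ^+ d) ^+ 2 <= C * n.+1%:R ^+ K.
  apply: le_trans (Hp n); apply: lerXn2r; rewrite ?nnegrE ?cabs_ge0//.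
  by rewrite mulr_ge0 ?exprn_ge0// divr_ge0// ltW.
have h2 : n.+1%:R ^+ K <= 2 ^+ K * n%:R ^+ K :> R.
  by rewrite -exprMn; apply: lerXn2r; rewrite ?nnegrE// -natrM ler_nat /n; lia.
have h3 : n%:R ^+ K * n%:R <= n%:R ^+ d ^+ 2 :> R.
  by rewrite -exprSr -exprM ler_weXn2l ?ler1n// mulnC.
have nK : 0 < n%:R ^+ K :> R by rewrite exprn_gt0.
have h4 : a ^+ 2 / 4 * (n%:R ^+ K * n%:R) <= C * 2 ^+ K * n%:R ^+ K.
  apply: (@le_trans _ _ ((a / 2 * n%:R ^+ d) ^+ 2)).
    rewrite exprMn; apply: ler_pM => //; rewrite ?mulr_ge0 ?invr_ge0 ?exprn_ge0 ?(ltW a0)//.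
    by rewrite exprMn ler_wpM2l ?exprn_ge0 ?(ltW a0)//; lra.
  by rewrite (le_trans h1)// -mulrA ler_wpM2l.
have h5 : n%:R <= 4 * C * 2 ^+ K / a ^+ 2.
  rewrite ler_pdivlMr ?exprn_gt0// -(ler_pM2r nK).
  by move: h4; set x := n%:R ^+ K; set z := 2 ^+ K; clearbody x z; lra.
lra.
Qed.

(** The growth limits the degree to K / 2, and there are more zeros than that. *)
Lemma dif_zero N f (C : R) K (Z : seq int) : 0 <= C -> (forall n, dif N f n = 0) ->
  (forall n : nat, cabs (f n) ^+ 2 <= C * n.+1%:R ^+ K) ->
  uniq Z -> (forall z, z \in Z -> f z = 0) -> (K < 2 * size Z)%N -> forall n, f n = 0.
Proof.
move=> C0 /dif_poly[p pE] Hf Zu Z0 KZ n.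
suff p0 : p = 0 by rewrite pE p0 horner0.
apply/eqP; apply: contraTT KZ => p0; rewrite -leqNgt.
have : (2 * (size p).-1 <= K)%N.
  by apply: (poly_growth C0) => k; rewrite -[k%:R]/(k%:Z%:~R) -pE.
apply: leq_trans; rewrite leq_mul2l /= -ltnS prednK ?size_poly_gt0//.
rewrite -(size_map (fun z : int => z%:~R : R[i])); apply: max_poly_roots => //.
  by apply/allP => _ /mapP[z zZ ->]; rewrite rootE -pE Z0.
by rewrite map_inj_uniq// => x y /eqP; rewrite eqr_int => /eqP.
Qed.

End DifferenceEquations.

(** * From vanishing at separated points to difference equations *)

Section LocalityDifference.
Context {R : realType}.
Implicit Types (t e : R) (n m j : int) (N L : nat).
Local Notation tpi := (pi *+ 2 : R).

Lemma zsumS (E : nmodType) (w : int -> E) L :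
  \sum_(k < L.+1.*2.+1) w (k%:Z - L.+1%:Z) =
  w (- L.+1%:Z) + (\sum_(k < L.*2.+1) w (k%:Z - L%:Z) + w L.+1%:Z).
Proof.
rewrite doubleS big_ord_recl big_ord_recr /=; congr (_ + (_ + _)).
- by congr w; lia.
- by apply: eq_bigr => k _; congr w; rewrite /fintype.bump; lia.
- by congr w; rewrite /fintype.bump; lia.
Qed.

Lemma zsum_widen (E : nmodType) (w : int -> E) L L' : (L <= L')%N ->
  \sum_(k < L.*2.+1) w (k%:Z - L%:Z) =
  \sum_(k < L'.*2.+1) (if (`|(k%:Z - L'%:Z)%R| <= L)%N then w (k%:Z - L'%:Z) else 0).
Proof.
elim: L' => [|L' IH]; first by rewrite leqn0 => /eqP->; rewrite !big_ord1.
rewrite leq_eqVlt => /orP[/eqP->|LL].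
  by apply: eq_bigr => k _; rewrite ifT//; have := ltn_ord k; lia.
rewrite (@zsumS _ (fun m => if (`|m| <= L)%N then w m else 0)) -IH//.
by rewrite !ifF ?add0r ?addr0//; apply/negbTE; lia.
Qed.

Lemma zsum_inv_sqr L : \sum_(k < L.*2.+1) ((`|(k%:Z - L%:Z)%R|.+1)%:R ^- 2 : R) <= 3.
Proof.
apply: (@le_trans _ _ (3 - 2 / L.+1%:R)); last by rewrite gerBl divr_ge0.
elim: L => [|L IH]; first by rewrite big_ord1 subrr absz0 mulr1n expr1n invr1; lra.
rewrite (@zsumS _ (fun m => (`|m|.+1)%:R ^- 2)) abszN -[`|L.+1%:Z|%N]/(L.+1).
suff : 2 * L.+2%:R ^- 2 <= 2 / L.+1%:R - 2 / L.+2%:R :> R.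
  move: IH; move: (\sum_(k < _) _).
  set x := L.+2%:R ^- 2; set y := 2 / L.+1%:R; set z := 2 / L.+2%:R.
  clearbody x y z => w; lra.
have -> : 2 / L.+1%:R - 2 / L.+2%:R = 2 / (L.+1%:R * L.+2%:R) :> R.
  have : 0 < L.+1%:R :> R by rewrite ltr0n.
  rewrite -[L.+2%:R]natr1; move: (L.+1%:R) => x x0.
  by field; apply/andP; split; apply: lt0r_neq0; lra.
rewrite ler_wpM2l// lef_pV2 ?posrE ?exprn_gt0 ?mulr_gt0 ?ltr0n//.
by rewrite expr2 ler_wpM2r// ler_nat.
Qed.

(** Of the three powers in each variable, two make the sum converge, with total at most 3 in each
    variable; the remaining one, in the variable beyond [L], gives 1 / (L + 1). *)
Lemma dsum_tail (A : int -> int -> R[i]) (K : R) L L' t t' : 0 <= K -> (L <= L')%N ->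
  (forall n m, cabs (A n m) * (`|n|.+1)%:R ^+ 3 * (`|m|.+1)%:R ^+ 3 <= K) ->
  cabs (dsum L' A t t' - dsum L A t t') <= 9 * K / L.+1%:R.
Proof.
move=> K0 LL HA.
pose F n m := A n m * expi (n%:~R * t - m%:~R * t').
rewrite {2}/dsum (@zsum_widen _ (fun n => \sum_(l < L.*2.+1) F n (l%:Z - L%:Z)) _ _ LL).
rewrite /dsum -sumrB.
have L0 : 0 < L.+1%:R :> R by rewrite ltr0n.
pose u n : R := (`|n|.+1)%:R ^- 2.
have u0 n : 0 <= u n by rewrite invr_ge0 exprn_ge0.
have bnd n m : (L < `|n|)%N || (L < `|m|)%N -> cabs (F n m) <= K / L.+1%:R * u n * u m.
  move=> nm; rewrite cabsM cabs_expi mulr1 /u.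
  have xn : 0 < (`|n|.+1)%:R :> R by rewrite ltr0n.
  have xm : 0 < (`|m|.+1)%:R :> R by rewrite ltr0n.
  rewrite -mulrA -invfM -mulrA -invfM ler_pdivlMr ?mulr_gt0 ?exprn_gt0//.
  apply: le_trans (HA n m); rewrite -mulrA ler_wpM2l ?cabs_ge0//.
  have -> (x y : R) : x ^+ 3 * y ^+ 3 = x * y * (x ^+ 2 * y ^+ 2) by ring.
  rewrite ler_wpM2r ?mulr_ge0 ?exprn_ge0//.
  by rewrite -natrM ler_nat; case/orP: nm => nm; nia.
have -> : 9 * K / L.+1%:R = K / L.+1%:R * 3 * 3 by ring.
have KL : 0 <= K / L.+1%:R by rewrite divr_ge0.
apply: (@le_trans _ _ (\sum_(k < L'.*2.+1) K / L.+1%:R * u (k%:Z - L'%:Z) * 3)).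
  rewrite (le_trans (cabs_sum _ _ _))//; apply: ler_sum => k _.
  set n := (k%:Z - L'%:Z).
  apply: (@le_trans _ _ (\sum_(l < L'.*2.+1) K / L.+1%:R * u n * u (l%:Z - L'%:Z))).
    case: ifPn => nL.
      rewrite (@zsum_widen _ (fun l => F n l) _ _ LL) -sumrB.
      rewrite (le_trans (cabs_sum _ _ _))//; apply: ler_sum => l _.
      case: ifPn => lL; first by rewrite -/(F n _) subrr cabs0 !mulr_ge0.
      by rewrite subr0; apply: bnd; rewrite orbC ltnNge lL.
    rewrite subr0 (le_trans (cabs_sum _ _ _))//; apply: ler_sum => l _.
    by apply: bnd; rewrite ltnNge nL.
  by rewrite -mulr_sumr ler_wpM2l ?mulr_ge0//; exact: zsum_inv_sqr.
by rewrite -mulr_suml -mulr_sumr ler_wpM2r// ler_wpM2l//; exact: zsum_inv_sqr.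
Qed.

Lemma dsum_bound (A : int -> int -> R[i]) (K : R) L t t' : 0 <= K ->
  (forall n m, cabs (A n m) * (`|n|.+1)%:R ^+ 3 * (`|m|.+1)%:R ^+ 3 <= K) ->
  cabs (dsum L A t t') <= 10 * K.
Proof.
move=> K0 HA; rewrite -[dsum _ _ _ _](subrK (dsum 0 A t t')) (le_trans (cabsD _ _))//.
have : cabs (dsum 0 A t t') <= K.
  rewrite /dsum !big_ord1 cabsM cabs_expi mulr1.
  by have := HA 0 0; rewrite absz0 !expr1n !mulr1.
have := dsum_tail t t' K0 (leq0n L) HA; rewrite divr1; lra.
Qed.

Lemma dsum_vanish_bound (A : int -> int -> R[i]) (K e : R) N : 0 <= K -> 0 <= e ->
  (forall n m, cabs (A n m) * (`|n|.+1)%:R ^+ 3 * (`|m|.+1)%:R ^+ 3 <= K) ->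
  (forall t t', 2 * e < `|ang (t' - t)| -> forall h : R, 0 < h ->
     exists L0, forall L, (L0 <= L)%N -> cabs (dsum L A t t') <= h) ->
  forall n m, cabs (dif N (fun i => A (n + i) (m + i)) 0) <= 10 * K * (4 * e) ^+ N.
Proof.
move=> K0 e0 HA Hv n m.
pose S L t t' := if `|ang (t' - t)| <= 2 * e then dsum L A t t' else 0.
rewrite /dif; under eq_bigr do rewrite add0r.
apply: (@two_var_bound _ A S) => //.
- by rewrite mulr_ge0.
(* At separated points the square sums tend to 0, but at a rate depending on the points; the tail
   bound makes the rate uniform. *)
- move=> h h0; exists (Num.truncn (9 * K / h)).+1 => L L0 t t'.
  rewrite /S; case: ifPn => [_|]; first by rewrite subrr cabs0 ltW.
  rewrite -ltNge => /Hv {}Hv; rewrite sub0r cabsN.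
  apply/ler_addgt0Pr => r r0; have [L1 HL1] := Hv _ r0.
  pose M := (L + L1)%N.
  have -> : dsum L A t t' = dsum M A t t' - (dsum M A t t' - dsum L A t t') by rewrite subKr.
  rewrite (le_trans (cabsB _ _))// addrC lerD//; last by apply: HL1; rewrite leq_addl.
  rewrite (le_trans (dsum_tail t t' K0 (leq_addr L1 L) HA))//.
  rewrite ler_pdivrMr ?ltr0n// [h * _]mulrC -ler_pdivrMr// ltW// (lt_le_trans (truncnS_gt _))//.
  by rewrite ler_nat (leq_trans L0).
- by move=> L t t'; rewrite /S; case: ifP => //; rewrite eqxx.
- by move=> L t t'; rewrite /S; case: ifP => _; [exact: dsum_bound|rewrite cabs0 mulr_ge0].
Qed.

Lemma bcoef_decay1 r : exists2 M : R, 0 <= M & forall e j, 0 < e < pi ->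
  cabs (bcoef e j) * (`|j|.+1)%:R ^+ r <= M * e^-1 ^+ r.
Proof.
have [M0 M00 HM0] := @bcoef_decay R 0; have [M Mp HM] := @bcoef_decay R r.
exists (2 ^+ r * (M0 * pi ^+ r + M)).
  by rewrite mulr_ge0 ?exprn_ge0 ?addr_ge0 ?mulr_ge0 ?exprn_ge0// ltW// pi_pos.
move=> e j ee; have /andP[e0 epi] := ee.
have p1 : 1 <= pi ^+ r * e^-1 ^+ r by rewrite -exprMn exprn_ege1// ler_pdivlMr// mul1r ltW.
have h1 : cabs (bcoef e j) <= M0 by have := HM0 e j ee; rewrite !expr0 !mulr1.
have h2 := HM e j ee.
have h3 : (`|j|.+1)%:R ^+ r <= 2 ^+ r * (1 + `|j%:~R| ^+ r) :> R.
  rewrite -intr_norm -abszE.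
  case: (absz j) => [|k].
    rewrite expr1n (le_trans (_ : 1 <= 2 ^+ r))// ?exprn_ege1 ?ler1n//.
    by rewrite ler_peMr ?exprn_ge0// lerDl exprn_ge0.
  apply: (@le_trans _ _ (2 ^+ r * k.+1%:R ^+ r)).
    by rewrite -exprMn lerXn2r ?nnegrE// -natrM ler_nat; lia.
  by rewrite ler_wpM2l ?exprn_ge0// lerDr.
rewrite (le_trans (ler_wpM2l (cabs_ge0 _) h3))// mulrCA -mulrA ler_wpM2l ?exprn_ge0//.
rewrite mulrDr mulr1 mulrDl lerD// -mulrA (le_trans h1)// -{1}[M0]mulr1 ler_wpM2l//.
Qed.

Lemma bcoef_decay_shift r (al : int) : exists2 M : R, 0 <= M & forall e n, 0 < e < pi ->
  cabs (bcoef e (- (n + al))) * (`|n|.+1)%:R ^+ r <= M * e^-1 ^+ r.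
Proof.
have [M M0 HM] := bcoef_decay1 r; exists ((`|al|.+1)%:R ^+ r * M).
  by rewrite mulr_ge0 ?exprn_ge0.
move=> e n ee; rewrite -mulrA; apply: le_trans (ler_wpM2l _ (HM e (- (n + al)) ee)); last first.
  by rewrite exprn_ge0.
rewrite mulrCA ler_wpM2l ?cabs_ge0// -exprMn lerXn2r ?nnegrE ?mulr_ge0// -natrM ler_nat.
by rewrite abszN; nia.
Qed.

Lemma cabs_prod_near (x y : R[i]) (b d : R) : 0 <= b -> 0 <= d -> d <= 1 ->
  cabs (x - (b%:C)%C) <= d * b -> cabs (y - (b%:C)%C) <= d * b ->
  cabs (x * y - ((b ^+ 2)%:C)%C) <= 3 * d * b ^+ 2.
Proof.
move=> b0 d0 d1 hx hy.
have -> : x * y - ((b ^+ 2)%:C)%C = (x - (b%:C)%C) * (y - (b%:C)%C) +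
   (b%:C)%C * (x - (b%:C)%C) + (b%:C)%C * (y - (b%:C)%C).
  by rewrite [in LHS]rmorphXn /=; ring.
rewrite (le_trans (cabsD _ _))// (le_trans (lerD (cabsD _ _) (lexx _)))// !cabsM !cabsR ger0_norm//.
have h : cabs (x - (b%:C)%C) * cabs (y - (b%:C)%C) <= (d * b) * (d * b).
  by apply: ler_pM; rewrite ?cabs_ge0.
have h1 := ler_wpM2l b0 hx; have h2 := ler_wpM2l b0 hy.
have h3 : d * b * (d * b) <= d * b ^+ 2.
  by rewrite mulrACA expr2 ler_wpM2r ?mulr_ge0// ler_piMr.
by move: h h1 h2 h3; rewrite expr2; lra.
Qed.

Lemma mul_decay (k x y u v u3 v3 C M M' z : R) :
  0 <= k -> 0 <= x -> 0 <= y -> 0 <= u -> 0 <= v -> 0 <= u3 -> 0 <= v3 -> 0 <= C ->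
  k <= C * u * v -> x * (u * u3) <= M * z -> y * (v * v3) <= M' * z ->
  k * (x * y) * u3 * v3 <= C * M * M' * (z * z).
Proof.
move=> k0 x0 y0 u0 v0 u30 v30 C0 h1 h2 h3.
apply: (@le_trans _ _ (C * ((x * (u * u3)) * (y * (v * v3))))).
  have -> : k * (x * y) * u3 * v3 = k * (x * y * u3 * v3) by ring.
  have -> : C * ((x * (u * u3)) * (y * (v * v3))) = C * u * v * (x * y * u3 * v3) by ring.
  by rewrite ler_wpM2r ?mulr_ge0.
rewrite -!mulrA ler_wpM2l//.
have -> : M * (M' * (z * z)) = (M * z) * (M' * z) by ring.
have -> : x * (u * (u3 * (y * (v * v3)))) = x * (u * u3) * (y * (v * v3)) by ring.
by apply: ler_pM; rewrite ?mulr_ge0.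
Qed.

(* Bumps concentrating at two points turn the vanishing of the kernel away
   from the diagonal into a vanishing finite difference of its coefficients. *)
Lemma bump_locality (ka : int -> int -> R[i]) (C e0 : R) s (al be : int) : 0 <= C -> 0 < e0 ->
  (forall n m, cabs (ka n m) <= C * (`|n|.+1)%:R ^+ s * (`|m|.+1)%:R ^+ s) ->
  (forall e, 0 < e < e0 -> forall t t', 2 * e < `|ang (t' - t)| ->
   forall h : R, 0 < h -> exists L0, forall L, (L0 <= L)%N ->
     cabs (dsum L (fun n m => ka n m * (bcoef e (- (n + al)) * bcoef e (m + be)))
       t t') <= h) ->
  exists N, forall n m, dif N (fun i => ka (n + i) (m + i)) 0 = 0.
Proof.
(* Decay of order [r] absorbs the growth [s] of [ka] and leaves the cubic decay required by
   [dsum_vanish_bound]. *)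
move=> C0 e00 Hka Hv; pose r := (s + 3)%N.
have [M M0 HM] := bcoef_decay_shift r al.
have [M' M'0 HM'] := bcoef_decay_shift r (- be).
have [c c0 Hc] := @bmass_ge R.
(* The decay of the two bumps costs e^(- 2 r) and the difference gains e^N. There remains e^3, which
   still tends to 0 after division by the squared mass, of order at least e^2. *)
pose N := (r + r + 3)%N; exists N => n m.
pose Dn := \sum_(i < N.+1) ('C(N, i))%:R *
  (cabs (ka (n + i%:Z) (m + i%:Z)) * (3 * (2 * (`|((n + i%:Z + al)%:~R : R)| + `|((m + i%:Z + be)%:~R : R)|)))).
pose X := dif N (fun i => ka (n + i) (m + i)) 0.
pose Q := 10 * (C * M * M') * 4 ^+ N.
have D0 : 0 <= Dn by apply: sumr_ge0 => i _; rewrite !mulr_ge0 ?addr_ge0 ?cabs_ge0.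
have Q0 : 0 <= Q by rewrite !mulr_ge0// exprn_ge0.
pose W := \sum_(i < N.+1) (2 * (`|((n + i%:Z + al)%:~R : R)| + `|((m + i%:Z + be)%:~R : R)|)).
have W0 : 0 <= W by apply: sumr_ge0 => i _; rewrite mulr_ge0 ?addr_ge0.
have key e : 0 < e < e0 -> e < 1 -> W * e <= 1 -> cabs X <= (Dn + Q / c ^+ 2) * e.
  move=> /[dup] ee /andP[ep ee0] e1 We.
  have epi : 0 < e < pi by rewrite ep (lt_trans e1)//; have := @pi_gt0 R; have := @pi_ge2 R; lra.
  pose b := bmass e; have cb : c * e <= b by exact: Hc.
  have b0 : 0 < b by apply: lt_le_trans cb; rewrite mulr_gt0.
  pose A n m := ka n m * (bcoef e (- (n + al)) * bcoef e (m + be)).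
  have HA n' m' : cabs (A n' m') * (`|n'|.+1)%:R ^+ 3 * (`|m'|.+1)%:R ^+ 3 <= C * M * M' * e^-1 ^+ (r + r).
    rewrite /A; set x := bcoef _ _; set y := bcoef e _.
    have hx : cabs x * (`|n'|.+1%:R ^+ s * `|n'|.+1%:R ^+ 3) <= M * e^-1 ^+ r.
      by rewrite -exprD; exact: HM.
    have hy : cabs y * (`|m'|.+1%:R ^+ s * `|m'|.+1%:R ^+ 3) <= M' * e^-1 ^+ r.
      have := HM' e (- m') epi; rewrite abszN (_ : - (- m' + - be) = m' + be); last by ring.
      by rewrite -exprD.
    rewrite cabsM [cabs (x * _)]cabsM exprD.
    by apply: (mul_decay _ _ _ _ _ _ _ _ _ hx hy); rewrite ?cabs_ge0 ?exprn_ge0.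
  have K0 : 0 <= C * M * M' * e^-1 ^+ (r + r).
    by rewrite !mulr_ge0// exprn_ge0// invr_ge0 ltW.
  have h1 : cabs (dif N (fun i => A (n + i) (m + i)) 0) <= Q * e ^+ 3.
    rewrite (le_trans (dsum_vanish_bound N K0 (ltW ep) HA (Hv e ee) n m))//.
    have -> : e^-1 ^+ (r + r) = (e ^+ (r + r))^-1 by rewrite exprVn.
    have -> : (4 * e) ^+ N = 4 ^+ N * (e ^+ (r + r) * e ^+ 3) by rewrite exprMn -exprD.
    rewrite /Q le_eqVlt; apply/orP; left; apply/eqP.
    have : e ^+ (r + r) != 0 by rewrite expf_neq0// gt_eqF.
    by move: (e ^+ (r + r)) (4 ^+ _) => z w z0; field.
  (* Replacing both bump coefficients by the mass [b] causes a relative error of order [e]. *)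
  have h2 : cabs (((b ^+ 2)%:C)%C * X - dif N (fun i => A (n + i) (m + i)) 0) <= Dn * e * b ^+ 2.
    rewrite /X /dif mulr_sumr -sumrB (le_trans (cabs_sum _ _ _))// /Dn !mulr_suml.
    apply: ler_sum => i _; rewrite add0r /A.
    set q := `|((n + i%:Z + al)%:~R : R)| + `|((m + i%:Z + be)%:~R : R)|.
    have qW : 2 * q <= W.
      rewrite /W (bigD1 i)//= lerDl; apply: sumr_ge0 => j _.
      by rewrite mulr_ge0 ?addr_ge0.
    have d0 : 0 <= 2 * q * e by rewrite !mulr_ge0 ?addr_ge0// ltW.
    have hx : cabs (bcoef e (- (n + i%:Z + al)) - (b%:C)%C) <= 2 * q * e * b.
      apply: (le_trans (bcoef_near _ epi)); rewrite -/b rmorphN normrN.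
      by rewrite ler_wpM2r ?(ltW b0)// ler_wpM2r ?(ltW ep)// ler_wpM2l// lerDl.
    have hy : cabs (bcoef e (m + i%:Z + be) - (b%:C)%C) <= 2 * q * e * b.
      apply: (le_trans (bcoef_near _ epi)); rewrite -/b.
      by rewrite ler_wpM2r ?(ltW b0)// ler_wpM2r ?(ltW ep)// ler_wpM2l// lerDr.
    move: (bcoef e (- (n + i%:Z + al))) (bcoef e (m + i%:Z + be)) hx hy => x y hx hy; clearbody q.
    move: (ka _ _) => k.
    rewrite [X in cabs X](_ : _ =
      - ((-1) ^+ i * ('C(N, i)%:R * (k * (x * y - ((b ^+ 2)%:C)%C))))); last first.
      rewrite -[(-1) ^+ i *+ _]mulr_natr.
      by move: ((-1) ^+ i) ('C(N, i)%:R) => u v; ring.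
    rewrite cabsN cabsM cabsX cabsN cabs1 expr1n mul1r cabsM cabs_nat -!mulrA ler_wpM2l//.
    rewrite cabsM ler_wpM2l ?cabs_ge0//.
    rewrite (_ : 3 * (2 * (q * (e * b ^+ 2))) = 3 * (2 * q * e) * b ^+ 2); last by ring.
    apply: (cabs_prod_near (ltW b0) d0 _ hx hy).
    by rewrite (le_trans _ We)// ler_wpM2r// ltW.
  have h3 : cabs X * b ^+ 2 <= (Dn * e + Q / c ^+ 2 * e) * b ^+ 2.
    have -> : cabs X * b ^+ 2 = cabs (((b ^+ 2)%:C)%C * X).
      by rewrite cabsM cabsR ger0_norm ?exprn_ge0 ?(ltW b0)// mulrC.
    rewrite -[_ * X](subrK (dif N (fun i => A (n + i) (m + i)) 0)) (le_trans (cabsD _ _))//.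
    rewrite mulrDl lerD// (le_trans h1)//.
    have -> : Q * e ^+ 3 = Q / c ^+ 2 * e * (c * e) ^+ 2 by field; rewrite gt_eqF.
    rewrite ler_wpM2l//; first by rewrite mulr_ge0 ?divr_ge0 ?exprn_ge0 ?(ltW ep) ?(ltW c0).
    by apply: lerXn2r => //; rewrite nnegrE ?(ltW b0)// mulr_ge0 ?(ltW ep) ?(ltW c0).
  by rewrite mulrDl; rewrite ler_pM2r ?exprn_gt0 in h3.
apply/eqP; rewrite -cabs_eq0 eq_le cabs_ge0 andbT -/X; apply/ler_addgt0Pr => h h0; rewrite add0r.
pose G := Dn + Q / c ^+ 2.
have G0 : 0 <= G by rewrite addr_ge0 ?divr_ge0 ?exprn_ge0 ?(ltW c0).
pose e := Num.min (e0 / 2) (Num.min (2^-1) (Num.min ((W + 1)^-1) (h / (G + 1)))).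
have W1 : 0 < W + 1 by rewrite ltr_wpDl.
have G1 : 0 < G + 1 by rewrite ltr_wpDl.
have ep : 0 < e by rewrite !lt_min invr_gt0 invr_gt0 W1 ltr0n !divr_gt0.
have ele z : z \in [:: e0 / 2; 2^-1; (W + 1)^-1; h / (G + 1)] -> e <= z.
  by rewrite !inE /e => /or4P[] /eqP ->; rewrite !ge_min lexx ?orbT.
have e1 : e <= e0 / 2 by apply: ele; rewrite !inE eqxx.
have e2 : e <= 2^-1 by apply: ele; rewrite !inE eqxx ?orbT.
have e3 : e <= (W + 1)^-1 by apply: ele; rewrite !inE eqxx ?orbT.
have e4 : e <= h / (G + 1) by apply: ele; rewrite !inE eqxx ?orbT.
apply: (@le_trans _ _ (G * e)).
  apply: key; [rewrite ep /=; lra|lra|].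
  rewrite (le_trans (ler_wpM2l W0 e3))// ler_pdivrMr// mul1r; lra.
rewrite (le_trans (ler_wpM2l G0 e4))// mulrA ler_pdivrMr// mulrC ler_wpM2l ?(ltW h0)//; lra.
Qed.

(** By [bcoef_near] the coefficient cannot vanish once 2 |j| e is less than 1. *)
Lemma bcoef_neq0 j (d : R) : 0 < d -> exists e : R, [/\ 0 < e < pi, e <= d & bcoef e j != 0].
Proof.
move=> d0; pose h := `|(j%:~R : R)|.
have h0 : 0 <= h by exact: normr_ge0.
pose e := Num.min d (Num.min (2^-1) ((2 * h + 1)^-1 / 2)).
have h1 : 0 < 2 * h + 1 by rewrite ltr_wpDl// mulr_ge0.
have ep : 0 < e by rewrite !lt_min d0 invr_gt0 ltr0n /= divr_gt0// invr_gt0.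
have e1 : e <= 2^-1 by rewrite /e !ge_min lexx ?orbT.
have e2 : e <= (2 * h + 1)^-1 / 2 by rewrite /e !ge_min lexx ?orbT.
have ee : 0 < e < pi by rewrite ep /=; have := @pi_ge2 R; lra.
exists e; split => //; first by rewrite /e ge_min lexx.
apply/eqP => b0; have [c c0 /(_ e ee) cb] := @bmass_ge R.
have b1 : 0 < bmass e by apply: lt_le_trans cb; rewrite mulr_gt0.
have := bcoef_near j ee; rewrite b0 sub0r cabsN cabsR (gtr0_norm b1) -/h => le.
have : 2 * h * e < 1.
  have : (2 * h + 1) * e <= 2^-1 by rewrite mulrC -ler_pdivlMr// mulrC.
  by rewrite mulrDl mul1r; lra.
by move=> lt; move: le; rewrite leNgt -[X in _ < X]mul1r ltr_pM2r// lt.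
Qed.

End LocalityDifference.

(** * Smeared vertex operators *)

Section Sequences.
Context {R : realType} {E : lmodType R[i]} {ip : E -> E -> R[i]} (ipP : is_ip ip).
Local Notation nm := (ipnorm ip).
Implicit Types (u : nat -> E) (w : int -> E) (C : R).

Lemma cvs_sub u x (k : nat -> nat) : (forall n, (n <= k n)%N) -> cvs ip u x -> cvs ip (u \o k) x.
Proof.
move=> kn ux e /ux[N HN]; exists N => n Nn; apply: HN; exact: leq_trans (kn n).
Qed.

Lemma cvs_bound u x C : cvs ip u x -> (forall n, nm (u n) <= C) -> nm x <= C.
Proof.
move=> ux uC; apply/ler_addgt0Pr => e /ux[N /(_ N (leqnn N)) h].
rewrite -[x](subrK (u N)) (le_trans (nmD ipP _ _))// addrC lerD//; exact: ltW.
Qed.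

Lemma ip_cvs2 u v x y : cvs ip u x -> cvs ip v y ->
  cvs (@ipc R) (fun n => ip (u n) (v n)) (ip x y).
Proof.
move=> ux vy e e0.
pose M := nm x + 1 + nm y; have M1 : 0 < M.
  by rewrite /M -addrA ltr_wpDl ?nm_ge0// ltr_wpDr ?nm_ge0.
have h0 : 0 < e / (M + M) by rewrite divr_gt0// addr_gt0.
have [N1 H1] := ux _ h0; have [N2 H2] := vy _ h0; have [N3 H3] := ux _ (@ltr01 R).
exists (N1 + N2 + N3)%N => n nN; rewrite nm_ipc.
have {}H1 := H1 n ltac:(lia); have {}H2 := H2 n ltac:(lia); have {}H3 := H3 n ltac:(lia).
have -> : ip x y - ip (u n) (v n) = ip (x - u n) y + ip (u n) (y - v n).
  by rewrite (ipBl ipP) (ipBr ipP) addrA subrK.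
have un : nm (u n) <= M.
  rewrite -[u n](subKr x) (le_trans (nmB ipP _ _))// /M -addrA lerD2l.
  by rewrite (le_trans (ltW H3))// lerDl nm_ge0.
have yM : nm y <= M by rewrite /M lerDr addr_ge0 ?nm_ge0.
rewrite (le_lt_trans (cabsD _ _))//.
rewrite (le_lt_trans (lerD (cauchy_schwarz ipP _ _) (cauchy_schwarz ipP _ _)))//.
have eE : e = e / (M + M) * M + M * (e / (M + M)) by rewrite [M * _]mulrC -mulrDr divfK// lt0r_neq0// addr_gt0.
rewrite [ltRHS]eE; apply: ltr_leD.
  rewrite (le_lt_trans (ler_wpM2l (nm_ge0 _) yM))// ltr_pM2r//.
by apply: ler_pM; rewrite ?nm_ge0// ltW.
Qed.

Lemma ssum_cvs w C : ipcomplete ip -> 0 <= C ->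
  (forall m, nm (w m) * (`|m|.+1)%:R ^+ 2 <= C) ->
  exists2 x, cvs ip (fun N => ssum N w) x & nm x <= 3 * C.
Proof.
move=> cpl C0 wC; have wC2 := spair_bound ipP C0 wC.
have C20 : 0 <= 2 * C by rewrite mulr_ge0.
have [x xu] := cpl _ (series_cauchy ipP C20 wC2).
have xs : cvs ip (fun N => ssum N w) x.
  by apply: cvs_ext (cvs_sub (k := S) (fun n => leqnSn n) xu) => N /=; rewrite ssum_series.
exists x => //; apply: (cvs_bound xs) => N; rewrite /ssum (le_trans (nm_sum ipP _ _ _))//.
apply: (@le_trans _ _ (\sum_(k < N.*2.+1) C * ((`|(k%:Z - N%:Z)%R|.+1)%:R ^- 2))).
  apply: ler_sum => k _; rewrite -ler_pdivrMr ?invr_gt0 ?exprn_gt0 ?ltr0n//.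
  by rewrite invrK.
by rewrite -mulr_sumr mulrC ler_wpM2r// zsum_inv_sqr.
Qed.

Lemma ssum_opp N w : ssum N (fun m => w (- m)) = ssum N w.
Proof.
rewrite /ssum (reindex_inj rev_ord_inj) /=; apply: eq_bigr => k _; congr w.
by have := ltn_ord k; lia.
Qed.

(** On the vacuum only the indices - D - 2 n survive, so a symmetric sum of order D + 2 M is a
    one-sided sum. *)
Lemma ssum_lower w (D : nat) M : (forall m : int, - D%:Z < m -> w m = 0) ->
  (forall m, iodd m != iodd D -> w m = 0) ->
  ssum (D + M.*2) w = \sum_(0 <= n < M.+1) w (- (2 * n)%:Z - D%:Z).
Proof.
move=> w0 wp; elim: M => [|M IH].
  rewrite addn0 big_nat1 /ssum big_ord_recl big1 => [|k _].
    by rewrite addr0; congr w; lia.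
  by apply: w0; rewrite lift0; lia.
rewrite big_nat_recr//= -IH /ssum doubleS !addnS !zsumS.
rewrite !(w0 (_.+1)%:Z) ?addr0; [|lia|lia].
rewrite addrC (wp (- (D + M.*2).+1%:Z)); last first.
  rewrite (_ : - (D + M.*2).+1%:Z = D%:Z + 2 * (- D%:Z - M%:Z) - 1); last lia.
  by rewrite !ioddD iodd_double; case: (iodd D).
by rewrite add0r; congr (_ + w _); lia.
Qed.

End Sequences.

Section Smeared.
Context {R : realType} {V : unitaryVosa R} (H : completion V) (Veb : energy_bounded V).
Local Notation iota := (iota_ H).
Local Notation ip := (sprod (hdot H)).
Local Notation nm := (ipnorm ip).
Local Notation vip := (sprod (vdot V)).
Local Notation vnm := (ipnorm vip).
Local Notation th := (@theta R V).
Implicit Types (a b c : V) (D E m : int) (n N : nat) (f g : R[i] -> R[i]) (p q : bool) (x y z : H).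
Let vp : is_vosa V := vosaP V.
Let hp : is_ip ip := hipP.

Lemma iota_ip a b : ip (iota a) (iota b) = vip a b.
Proof. exact: iota_isom. Qed.

Lemma iota_nm a : nm (iota a) = vnm a.
Proof. by rewrite /ipnorm iota_ip. Qed.

Lemma iota_ipcl x : ipcl ip (range iota) x.
Proof. by rewrite -closure_ipcl iota_dense. Qed.

Lemma iota_ext x y : (forall c, ip x (iota c) = ip y (iota c)) -> x = y.
Proof.
move=> h; apply/eqP; rewrite -subr_eq0; apply/eqP; apply: (nm_eq0 hp).
have : ip (x - y) (x - y) = 0.
  apply: (ip_ipcl hp (iota_ipcl (x - y))) => _ [c _ <-].
  by rewrite (ipBl hp) h subrr.
by rewrite (ip_xx hp) => /(congr1 (@complex.Re R)) /= /eqP; rewrite sqrf_eq0 => /eqP.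
Qed.

Lemma bounded_ext (A B : H -> H) : bounded_op A -> bounded_op B ->
  (forall c, A (iota c) = B (iota c)) -> A =1 B.
Proof.
move=> bA bB h x; have [u uI ux] := ipcl_seq (iota_ipcl x).
apply: (cvs_unique hp (bounded_cvs bA ux)); apply: cvs_ext (bounded_cvs bB ux) => n /=.
by have [c _ <-] := uI n; rewrite h.
Qed.

Lemma growth_shift D n k : ((`|(D + (2 * n)%:Z)%R|.+1)%:R : R) ^+ k <= (`|D|.+2)%:R ^+ k * n.+1%:R ^+ k.
Proof. by rewrite -exprMn lerXn2r ?nnegrE ?mulr_ge0// -natrM ler_nat; nia. Qed.

Lemma divT_growth D a : quasi D a -> exists (C : R) (k : nat), 0 <= C /\
  forall n, vnm (divT a n) <= C * n.+1%:R ^+ k.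
Proof.
move=> [wa _]; have [C [s [C0 HC]]] := energy_bound Veb a vac.
exists (C * (`|D|.+2)%:R ^+ s), s; split=> [|n]; first by rewrite mulr_ge0 ?exprn_ge0.
rewrite -(hmode_vac D) -modeE// (le_trans (HC _))// -mulrA ler_wpM2l//.
rewrite (le_trans _ (growth_shift D n s))// lerXn2r ?nnegrE// ler_nat; lia.
Qed.

Definition smterm p a f c m : H :=
  if iodd m == p then fourier f m *: iota (mode a m c) else 0.

Lemma smear_ssum p a f c N : smear_partial H p a f c N = ssum N (smterm p a f c).
Proof.
exact: (ssum_cond N (fun m => iodd m == p) (fun m => fourier f m *: iota (mode a m c))).
Qed.

(** Fourier decay of order [s + 2] pays for the energy bound and leaves a summable series, uniformly
    over [c] up to its weight and norm. *)
Lemma smterm_decay p a f : smooth_par p f -> exists (C : R) (k : nat), 0 <= C /\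
  forall E c, wt E c -> forall m, nm (smterm p a f c m) * (`|m|.+1)%:R ^+ 2 <= C * (`|E|.+1)%:R ^+ k * vnm c.
Proof.
move=> sf; have [C [s [k [C0 HC]]]] := energy_bound_wt Veb a.
have [F F0 HF] := @fourier_decay R p f (s + 2) sf; exists (F * C), k; split=> [|E c wc m].
  by rewrite mulr_ge0.
rewrite /smterm; case: eqP => [mp|_]; last by rewrite (nm0 hp) mul0r !mulr_ge0 ?exprn_ge0 ?nm_ge0.
rewrite (nmZ hp) iota_nm.
have h1 := HF m mp; have h2 := HC m E c wc; rewrite exprD in h1.
have v0 : 0 <= (`|E|.+1)%:R ^+ k * vnm c by rewrite mulr_ge0 ?exprn_ge0 ?nm_ge0.
move: h1 h2 v0 (cabs_ge0 (fourier f m)) (nm_ge0 (ip := vip) (mode a m c)).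
set u := _ ^+ s; set w := _ ^+ 2; set v := _ ^+ k.
have u0 : 0 <= u by rewrite exprn_ge0.
have w0 : 0 <= w by rewrite exprn_ge0.
move: (cabs _) (vnm (mode _ _ _)) (vnm c) => x y z h1 h2 v0 x0 y0.
apply: (@le_trans _ _ (x * (C * u * v * z) * w)); first by rewrite ler_wpM2r// ler_wpM2l.
have -> : x * (C * u * v * z) * w = x * (u * w) * (C * (v * z)) by ring.
have -> : F * C * v * z = F * (C * (v * z)) by ring.
by rewrite ler_wpM2r// mulr_ge0.
Qed.

Lemma smterm_lin p a f (k : R[i]) c c' m :
  smterm p a f (k *: c + c') m = k *: smterm p a f c m + smterm p a f c' m.
Proof.
rewrite /smterm; case: ifP => _; last by rewrite scaler0 addr0.
by rewrite modeP linearP scalerDr !scalerA mulrC.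
Qed.

Lemma smear_lin p a f (k : R[i]) c c' N :
  smear_partial H p a f (k *: c + c') N = k *: smear_partial H p a f c N + smear_partial H p a f c' N.
Proof.
rewrite !smear_ssum /ssum scaler_sumr -big_split /=; apply: eq_bigr => i _; exact: smterm_lin.
Qed.

Lemma smeared_subspace p a f : subspace [set xy : H * H | exists c,
    xy.1 = iota c /\ smear_partial H p a f c @ \oo --> xy.2].
Proof.
split=> [|k x y [c [xc /cvs_cvg xl]] [d [yd /cvs_cvg yl]]].
  exists 0; split; first by rewrite /= linear0.
  apply/cvs_cvg; apply: cvs_ext (cvs_cst hp 0) => N.
  have := smear_lin p a f 0 0 0 N; rewrite scaler0 addr0 scale0r add0r => E.
  by have := smear_lin p a f (-1) 0 0 N; rewrite scaler0 addr0 scaleN1r addNr.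
exists (k *: c + d); split; first by rewrite /= xc yd linearP.
apply/cvs_cvg; apply: cvs_ext (cvsD hp (cvsZ hp k xl) yl) => N /=.
by rewrite smear_lin.
Qed.

Lemma smeared_closed p a f : closed_graph (smeared H p a f).
Proof. exact/closure_graph/smeared_subspace. Qed.

Lemma smeared_iota p a f c x : cvs ip (fun N => ssum N (smterm p a f c)) x ->
  smeared H p a f (iota c, x).
Proof.
move=> h; apply: subset_closure; exists c; split => //=; apply/cvs_cvg.
by apply: cvs_ext h => N; rewrite smear_ssum.
Qed.

Lemma smeared_wt p a f : smooth_par p f -> exists (C : R) (k : nat), 0 <= C /\
  forall E c, wt E c -> exists x, [/\ cvs ip (fun N => ssum N (smterm p a f c)) x,
    smeared H p a f (iota c, x) & nm x <= C * (`|E|.+1)%:R ^+ k * vnm c].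
Proof.
move=> /(smterm_decay a)[C [k [C0 HC]]]; exists (3 * C), k; split=> [|E c wc].
  by rewrite mulr_ge0.
have B0 : 0 <= C * (`|E|.+1)%:R ^+ k * vnm c by rewrite !mulr_ge0 ?exprn_ge0 ?nm_ge0.
have [x xl xb] := ssum_cvs hp hilbert_complete B0 (HC E c wc).
by exists x; split => //; [exact: smeared_iota|rewrite -!mulrA in xb *].
Qed.

Lemma smeared_ex p a f c : smooth_par p f -> exists x,
  cvs ip (fun N => ssum N (smterm p a f c)) x /\ smeared H p a f (iota c, x).
Proof.
move=> sf; have [C [k [C0 HC]]] := smeared_wt a sf.
suff [x h] : exists x, cvs ip (fun N => ssum N (smterm p a f c)) x.
  by exists x; split => //; exact: smeared_iota.
apply: (wt_span vp (P := [set c | exists x, cvs ip (fun N => ssum N (smterm p a f c)) x])) => /=.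
- exists 0; apply: cvs_ext (cvs_cst hp 0) => N; rewrite -smear_ssum.
  have := smear_lin p a f (-1) 0 0 N; rewrite scaler0 addr0 scaleN1r addNr => ->//.
- move=> b d [x xl] [y yl]; exists (x + y); apply: cvs_ext (cvsD hp xl yl) => N.
  by rewrite -!smear_ssum -[b in RHS]scale1r smear_lin scale1r.
- by move=> D b /HC[x [xl _ _]]; exists x.
Qed.

(** The graph of the adjoint is a rotated orthogonal complement, which makes it insensitive to
    closing [T]. *)
Lemma adjoint_pairE (T : set (H * H)) x z :
  adjoint_pair T x z <-> forall r, T r -> ip2 ip (z, - x) r = 0.
Proof.
split=> h.
  move=> [u v] /h E; rewrite /ip2 /= (ipNl hp).
  by rewrite (ipC hp u) -E -(ipC hp) subrr.
move=> u v /h; rewrite /ip2 /= (ipNl hp) => /eqP; rewrite subr_eq0 => /eqP E.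
by rewrite (ipC hp x) -E -(ipC hp).
Qed.

Lemma adjoint_pair_closure (T : set (H * H)) x z : adjoint_pair T x z -> adjoint_pair (closure T) x z.
Proof.
move=> /adjoint_pairE h; apply/adjoint_pairE => q; rewrite closure_ipcl2 => qT.
exact: (ip_ipcl (ip2P hp) qT).
Qed.

(** The formal adjoint given by invariance: coefficients conjugated, modes reversed, [a] replaced by
    [theta a] with a sign. *)
Definition adjterm p D a f c m : H :=
  if iodd m == p then ((fourier f m)^* * sgn_adj D) *: iota (mode (th a) (- m) c) else 0.

Lemma smeared_adj_term p D a f c c' N : quasi D a ->
  ip (ssum N (smterm p a f c')) (iota c) = ip (iota c') (ssum N (adjterm p D a f c)).
Proof.
move=> qa; have wa := qa.1; have [wta _] := quasi_theta qa.
rewrite /ssum (ip_suml hp) (ip_sumr hp); apply: eq_bigr => k _.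
rewrite /smterm /adjterm; case: ifP => _; last by rewrite (ip0l hp) (ip0r hp).
rewrite (ipZl hp) (ipZr hp) !iota_ip (modeE _ _ wa) (modeE _ _ wta) -mulrA; congr (_ * _).
have := hmode_adj (k%:Z - N%:Z) c' c (quasi_theta qa); rewrite (theta_invol (unitaryP V)).
by [].
Qed.

Lemma smeared_adj p D a f c z : quasi D a ->
  cvs ip (fun N => ssum N (adjterm p D a f c)) z -> adjoint_pair (smeared H p a f) (iota c) z.
Proof.
move=> qa zl; apply: adjoint_pair_closure => u v /= [c' [-> /cvs_cvg vl]].
apply: (cvs_unique ipcP (ip_cvs2 hp vl (cvs_cst hp (iota c)))).
apply: cvs_ext (ip_cvs2 hp (cvs_cst hp (iota c')) zl) => N.
by rewrite smear_ssum (smeared_adj_term p f c c' N qa).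
Qed.

Lemma adjterm_cvs p D a f c : quasi D a -> smooth_par p f ->
  exists z, cvs ip (fun N => ssum N (adjterm p D a f c)) z.
Proof.
move=> qa sf; have [C [s [C0 HC]]] := energy_bound Veb (th a) c.
have [F F0 HF] := @fourier_decay R p f (s + 2) sf.
have B0 : 0 <= F * cabs (sgn_adj D : R[i]) * C by rewrite !mulr_ge0 ?cabs_ge0.
have [|z zl _] := ssum_cvs hp hilbert_complete B0 (w := adjterm p D a f c); last by exists z.
move=> m; rewrite /adjterm; case: eqP => [mp|_]; last by rewrite (nm0 hp) mul0r.
rewrite (nmZ hp) iota_nm cabsM cabs_conj.
have h1 := HF m mp; have h2 := HC (- m); rewrite exprD in h1; rewrite abszN in h2.
move: h1 h2 (cabs_ge0 (fourier f m)) (nm_ge0 (ip := vip) (mode (th a) (- m) c)) (cabs_ge0 (sgn_adj D : R[i])).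
set u := _ ^+ s; set w := _ ^+ 2.
have u0 : 0 <= u by rewrite exprn_ge0.
have w0 : 0 <= w by rewrite exprn_ge0.
move: (cabs (fourier f m)) (cabs (sgn_adj D)) (vnm _) => x y z h1 h2 x0 z0 y0.
apply: (@le_trans _ _ (x * y * (C * u) * w)).
  by rewrite ler_wpM2r// ler_wpM2l// mulr_ge0.
have -> : x * y * (C * u) * w = x * (u * w) * (y * C) by ring.
by rewrite -[F * y * C]mulrA ler_wpM2r ?mulr_ge0.
Qed.

(** Closability: the adjoint is defined on the dense subspace [V]. *)
Lemma smeared_single p D a f : quasi D a -> smooth_par p f -> single_valued (smeared H p a f).
Proof.
move=> qa sf x y z xy xz; apply: iota_ext => c.
have [w wl] := adjterm_cvs c qa sf; have wa := smeared_adj qa wl.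
by rewrite (wa _ _ xy) (wa _ _ xz).
Qed.

Lemma dom_dense p a f : smooth_par p f ->
  ipcl ip [set u | exists v, smeared H p a f (u, v)] = setT.
Proof.
move=> sf; apply/seteqP; split=> // x _.
apply: ipclS (iota_ipcl x) => _ [c _ <-].
by have [y [_ h]] := smeared_ex a c sf; exists y.
Qed.

Lemma adj_dom_dense p D a f : quasi D a -> smooth_par p f ->
  ipcl ip [set u | exists v, adjoint_pair (smeared H p a f) u v] = setT.
Proof.
move=> qa sf; apply/seteqP; split=> // x _.
apply: ipclS (iota_ipcl x) => _ [c _ <-].
by have [y h] := adjterm_cvs c qa sf; exists y; apply: (smeared_adj qa h).
Qed.

End Smeared.

(** * Series with rapidly decreasing coefficients *)

Section RapidSeries.
Context {R : realType} {E : lmodType R[i]} {ip : E -> E -> R[i]} (ipP : is_ip ip).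
Local Notation nm := (ipnorm ip).

Definition rapid (u : nat -> R[i]) := forall r, exists2 C : R, 0 <= C &
  forall n, cabs (u n) * n.+1%:R ^+ r <= C.

Lemma rapid_growth u (y : nat -> E) (C : R) k : rapid u -> 0 <= C ->
  (forall n, nm (y n) <= C * n.+1%:R ^+ k) ->
  exists2 B : R, 0 <= B & forall n, nm (u n *: y n) * n.+1%:R ^+ 2 <= B.
Proof.
move=> ru C0 yC; have [M M0 HM] := ru (k + 2)%N; exists (M * C) => [|n]; first by rewrite mulr_ge0.
rewrite (nmZ ipP); have h1 := HM n; have h2 := yC n; rewrite exprD in h1.
apply: (@le_trans _ _ (cabs (u n) * (C * n.+1%:R ^+ k) * n.+1%:R ^+ 2)).
  by rewrite ler_wpM2r ?exprn_ge0// ler_wpM2l ?cabs_ge0.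
have -> (x v w : R) : x * (C * v) * w = x * (v * w) * C by ring.
by rewrite ler_wpM2r.
Qed.

Lemma rapid_cvs u (y : nat -> E) (C : R) k : ipcomplete ip -> rapid u -> 0 <= C ->
  (forall n, nm (y n) <= C * n.+1%:R ^+ k) ->
  exists x, cvs ip (fun N => \sum_(0 <= n < N) u n *: y n) x.
Proof.
move=> cpl ru C0 /(rapid_growth ru C0)[B B0 HB].
exact: cpl _ (series_cauchy ipP B0 HB).
Qed.

End RapidSeries.

Section RapidFourier.
Context {R : realType}.
Implicit Types (D : int) (f : R[i] -> R[i]).

Lemma rapid_fourier (p : bool) D f (mm : nat -> int) : smooth_par p f ->
  (forall n, iodd (mm n) = p) -> (forall n, (n <= `|D| + `|mm n|)%N) -> rapid (fun n => fourier f (mm n)).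
Proof.
move=> sf mp mb r; have [C C0 HC] := fourier_decay r sf.
exists ((`|D|.+1)%:R ^+ r * C) => [|n]; first by rewrite mulr_ge0 ?exprn_ge0.
apply: le_trans (ler_wpM2l _ (HC (mm n) (mp n))); last by rewrite exprn_ge0.
rewrite mulrCA ler_wpM2l ?cabs_ge0// -exprMn lerXn2r ?nnegrE ?mulr_ge0// -natrM ler_nat.
by have := mb n; nia.
Qed.

Lemma rapid_neg D f : smooth_par (iodd D) f -> rapid (fun n => fourier f (- (2 * n)%:Z - D)).
Proof.
move=> sf; apply: (rapid_fourier (D := D) sf) => n; last by lia.
rewrite (_ : - (2 * n)%:Z - D = 2 * (- n%:Z - D) + D); last by lia.
by rewrite ioddD iodd_double.
Qed.

Lemma rapid_pos D f (k : R[i]) : smooth_par (iodd D) f ->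
  rapid (fun n => (fourier f ((2 * n)%:Z + D))^* * k).
Proof.
move=> sf r.
have [||C C0 HC] := @rapid_fourier (iodd D) D f (fun n => (2 * n)%:Z + D) sf _ _ r.
- by move=> n; rewrite PoszM ioddD iodd_double.
- by move=> n; lia.
exists (C * cabs k) => [|n]; first by rewrite mulr_ge0 ?cabs_ge0.
by rewrite cabsM cabs_conj mulrAC ler_wpM2r ?cabs_ge0.
Qed.

End RapidFourier.

(** * Fields on the vacuum, the twist [Z], and the easy inclusion *)

Section FredenhagenJoerss.
Context {R : realType} {V : unitaryVosa R} (H : completion V) (Veb : energy_bounded V).
Local Notation iota := (iota_ H).
Local Notation ip := (sprod (hdot H)).
Local Notation nm := (ipnorm ip).
Local Notation vip := (sprod (vdot V)).
Local Notation th := (@theta R V).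
Implicit Types (a b c : V) (D E m : int) (n N : nat) (f g : R[i] -> R[i]) (p q : bool) (x y z : H).
Let vp : is_vosa V := vosaP V.
Let hp : is_ip ip := hipP.

Definition dser a (u : nat -> R[i]) N : H := \sum_(0 <= n < N) u n *: iota (divT a n).

Lemma dser_cvs D a u : quasi D a -> rapid u -> exists x, cvs ip (dser a u) x.
Proof.
move=> qa ru; have [C [k [C0 HC]]] := divT_growth Veb qa.
by apply: (rapid_cvs hp hilbert_complete ru C0 (k := k)) => n; rewrite iota_nm.
Qed.

Lemma FJ_vector_cvs D a f : quasi D a -> smooth_par (iodd D) f ->
  cvs ip (dser a (fun n => fourier f (- (2 * n)%:Z - D))) (FJ_vector H D a f).
Proof.
move=> qa sf; have [x xl] := dser_cvs qa (rapid_neg sf).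
suff -> : FJ_vector H D a f = x by [].
rewrite /FJ_vector; apply: cvs_limn; apply: cvs_ext xl => N.
rewrite /dser /series /=; apply: eq_bigr => n _; rewrite /divT.
by congr (_ *: iota (_ *: _)); elim: n => //= n ->; rewrite (translE vp).
Qed.

(** Along the subsequence D + 2 M the symmetric partial sums on the vacuum are the partial sums of
    the series of [FJ_vector]. *)
Lemma smeared_vac D a f : 0 <= D -> quasi D a -> smooth_par (iodd D) f ->
  smeared H (iodd D) a f (iota vac, FJ_vector H D a f).
Proof.
case: D => [D _|//] qa sf; have [x [xl xs]] := smeared_ex H Veb a vac sf.
suff <- : x = FJ_vector H D a f by [].
apply: (cvs_unique hp (u := dser a (fun n => fourier f (- (2 * n)%:Z - D%:Z)) \o S)); last first.
  exact: cvs_sub (fun n => leqnSn n) (FJ_vector_cvs qa sf).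
apply: cvs_ext (cvs_sub (k := fun M => (D + M.*2)%N) _ xl) => [M /=|n]; last by lia.
rewrite (ssum_lower (D := D)) /dser.
- apply: eq_bigr => n _; rewrite /smterm ifT ?(modeE _ _ qa.1) ?hmode_vac//.
  rewrite (_ : - (2 * n)%:Z - D%:Z = 2 * (- n%:Z - D%:Z) + D%:Z); last by lia.
  by rewrite ioddD iodd_double.
- by move=> m mD; rewrite /smterm; case: ifP => // _; rewrite (modeE _ _ qa.1) hmode_vac0// linear0 scaler0.
- by move=> m /negbTE h; rewrite /smterm h.
Qed.

Lemma adjoint_vac D a f z : 0 <= D -> quasi D a -> smooth_par (iodd D) f ->
  cvs ip (dser (th a) (fun n => (fourier f ((2 * n)%:Z + D))^* * sgn_adj D)) z ->
  adjoint_pair (smeared H (iodd D) a f) (iota vac) z.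
Proof.
case: D => [D _|//] qa sf zl; have qta := quasi_theta qa.
have [x xl] := adjterm_cvs H Veb vac qa sf.
suff <- : x = z by exact: smeared_adj xl.
apply: (cvs_unique hp (u := dser (th a) (fun n => (fourier f ((2 * n)%:Z + D%:Z))^* * sgn_adj D) \o S)); last first.
  exact: cvs_sub (fun n => leqnSn n) zl.
apply: cvs_ext (cvs_sub (k := fun M => (D + M.*2)%N) _ xl) => [M /=|n]; last by lia.
rewrite -ssum_opp (ssum_lower (D := D)) /dser.
- apply: eq_bigr => n _; rewrite /adjterm opprB opprK.
  rewrite (_ : D%:Z + (2 * n)%:Z = (2 * n)%:Z + D%:Z); last by rewrite addrC.
  rewrite ifT; last by rewrite PoszM ioddD iodd_double.
  by rewrite (modeE _ _ qta.1) opprD hmode_vac.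
- move=> m mD; rewrite /adjterm; case: ifP => // _.
  by rewrite opprK (modeE _ _ qta.1) hmode_vac0// linear0 scaler0.
- move=> m h; rewrite /adjterm ifF//; apply/negbTE; apply: contra h => /eqP <-.
  by rewrite /iodd abszN.
Qed.

Lemma smeared_divT p D a f E b : quasi D a -> smooth_par p f -> quasi E b ->
  exists (y : nat -> H) (C : R) (k : nat), [/\ 0 <= C,
    (forall n, nm (y n) <= C * n.+1%:R ^+ k) &
    (forall n, smeared H p a f (iota (divT b n), y n))].
Proof.
move=> qa sf qb; have [C [k [C0 HC]]] := smeared_wt H Veb a sf.
have [B [l [B0 HB]]] := divT_growth Veb qb.
have /choice[y Hy] n := HC _ _ (wt_divT n qb.1).
exists y, (C * (`|E|.+2)%:R ^+ k * B), (k + l)%N; split.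
- by rewrite !mulr_ge0 ?exprn_ge0.
- move=> n; have [_ _ h] := Hy n; rewrite (le_trans h)//.
  have -> : C * (`|E|.+2)%:R ^+ k * B * n.+1%:R ^+ (k + l) =
    C * ((`|E|.+2)%:R ^+ k * n.+1%:R ^+ k) * (B * n.+1%:R ^+ l) by rewrite exprD; ring.
  apply: ler_pM => //; rewrite ?mulr_ge0 ?exprn_ge0 ?nm_ge0// ler_wpM2l//.
  by have := @growth_shift R E n k; rewrite PoszM.
- by move=> n; have [] := Hy n.
Qed.

Lemma smeared_dser p a f b u (y : nat -> H) (C : R) k x : rapid u -> 0 <= C ->
  (forall n, nm (y n) <= C * n.+1%:R ^+ k) ->
  (forall n, smeared H p a f (iota (divT b n), y n)) ->
  cvs ip (dser b u) x ->
  exists2 w, cvs ip (fun N => \sum_(0 <= n < N) u n *: y n) w & smeared H p a f (x, w).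
Proof.
move=> ru C0 yC ys xl; have [w wl] := rapid_cvs hp hilbert_complete ru C0 yC.
exists w => //; have [ss sc] := smeared_closed H p a f; apply: sc.
apply: (cvs_ipcl (u := fun N => (dser b u N, \sum_(0 <= n < N) u n *: y n))); last first.
  by apply/(cvs2 hp); split.
move=> N; elim: N => [|N IH]; first by rewrite /dser !big_nil; exact: ss.1.
have := subspaceD ss IH (subspaceZ ss (u N) (ys N)).
by rewrite /dser !big_nat_recr.
Qed.

Lemma even_odd_orth a b : parity false a -> parity true b -> vip a b = 0.
Proof.
move=> /(grading vp)[s [ws so ->]] /(grading vp)[t [wt' to ->]].
rewrite /vsum (ip_suml (vipP V)) big_seq big1// => x xs.
rewrite (ip_sumr (vipP V)) big_seq big1// => y yt; apply: (wt_orth (ws x xs) (wt' y yt)).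
by apply/eqP => e; have := so x xs; rewrite e to.
Qed.

Lemma Gam_adj a b : vip (Gam a) b = vip a (Gam b).
Proof.
have [a0 [a1 [A0 A1 ->]]] := parity_split vp a; have [b0 [b1 [B0 B1 ->]]] := parity_split vp b.
rewrite !linearD /= A0 A1 B0 B1 expr0 expr1 !scale1r !scaleN1r.
rewrite !(ipDl (vipP V)) !(ipDr (vipP V)) (ipNl (vipP V)) !(ipNr (vipP V)) !(ipNl (vipP V)).
by rewrite (even_odd_orth A0 B1) (ipC (vipP V) b0 a1) (even_odd_orth B0 A1) rmorph0 !oppr0.
Qed.

(** The parity operator is 2 P - 1, with [P] the projection on the closure of the even part. *)
Lemma ex_GamH : exists G : H -> H, bounded_op G /\ forall a, G (iota a) = iota (Gam a).
Proof.
pose A := ipcl ip [set iota a | a in [set a | parity false a]].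
have As : subspace [set iota a | a in [set a | parity false a]].
  split=> [|k _ _ [a pa <-] [b pb <-]].
    by exists 0; rewrite ?linear0//= /parity linear0 scaler0.
  by exists (k *: a + b); rewrite ?linearP//= /parity linearP pa pb expr0 !scale1r.
have As' := subspace_ipcl hp As.
have [P HP] := ex_proj hp As' (ipcl_ipcl hp (A := _)) hilbert_complete.
have bP : bounded_op P.
  have lP := proj_linear hp As' HP.
  apply/bounded_opP; split; first exact: lP.
  exists 1 => x; rewrite mul1r.
  exact: (proj_nm hp HP x).
exists (fun x => 2 *: P x + (-1) *: id x); split; first exact: bounded_lin bP bounded_id.
move=> a; have [a0 [a1 [A0 A1 ->]]] := parity_split vp a.
have -> : P (iota (a0 + a1)) = iota a0.
  apply: (proj_unique hp As' HP); first by apply: subset_ipcl => //; exists a0.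
  move=> y Ay; rewrite linearD /= addrAC subrr add0r (ipC hp).
  rewrite (ip_ipcl hp Ay) ?rmorph0// => _ [b pb <-].
  by rewrite iota_ip (ipC (vipP V)) (even_odd_orth pb A1) rmorph0.
rewrite !linearD /= A0 A1 expr0 expr1 scale1r scaleN1r linearN !scaleN1r /=.
by rewrite scaler_nat mulr2n addrA addrK.
Qed.

Lemma GamH_bounded : bounded_op (@GamH R V H).
Proof. by have [] := xgetPex (fun x : H => x) ex_GamH. Qed.

Lemma GamH_iota a : GamH (iota a) = iota (Gam a).
Proof. by have [_ h] := xgetPex (fun x : H => x) ex_GamH; exact: h. Qed.

Lemma GamH_adj x y : ip (GamH x) y = ip x (GamH y).
Proof.
rewrite (adjE GamH_bounded); congr (ip x _).
apply: bounded_ext y => [||c]; [exact: adj_bounded GamH_bounded|exact: GamH_bounded|].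
apply: iota_ext => d.
by rewrite (adjE' GamH_bounded) !GamH_iota !iota_ip Gam_adj.
Qed.

Lemma GamH_invol x : GamH (GamH x) = x.
Proof.
have := @bounded_ext _ _ H (@GamH R V H \o @GamH R V H) id.
apply; [exact: bounded_comp GamH_bounded GamH_bounded|exact: bounded_id|].
by move=> c /=; rewrite !GamH_iota (Gam_invol vp).
Qed.

Lemma conj_i : ('i%C : R[i])^* = - 'i%C.
Proof. by rewrite complexiE conjCi. Qed.

Lemma mul_ii : 'i%C * 'i%C = -1 :> R[i].
Proof. by rewrite complexiE -expr2 sqrCi. Qed.

Definition Zad x : H := ((1 - 'i%C)^-1)^* *: (x + 'i%C *: GamH x).

Lemma Zop_lin : Zop (H := H) = fun x => (1 - 'i%C)^-1 *: id x + (- ((1 - 'i%C)^-1 * 'i%C)) *: GamH x.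
Proof. by apply/funext => x; rewrite /Zop scalerBr scaleNr scalerA. Qed.

Lemma Zop_bounded : bounded_op (Zop (H := H)).
Proof. by rewrite Zop_lin; exact: bounded_lin bounded_id GamH_bounded. Qed.

Lemma adj_Zop : adj (Zop (H := H)) = Zad.
Proof.
apply: adj_def => x y; rewrite /Zop /Zad (ipZl hp) (ipZr hp) (ipBl hp) (ipDr hp) (ipZl hp) (ipZr hp).
by rewrite conj_i mulNr opprK GamH_adj.
Qed.

Lemma oneBi : (1 - 'i%C : R[i])^-1 * ((1 - 'i%C)^-1)^* * 2 = 1.
Proof.
have CB (x y : R[i]) : (x - y)^* = x^* - y^* by exact: rmorphB.
have CV (x : R[i]) : (x^-1)^* = (x^*)^-1 by exact: fmorphV.
have C1 : (1 : R[i])^* = 1 by exact: rmorph1.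
rewrite CV CB C1 conj_i opprK -invfM.
have -> : (1 - 'i%C) * (1 + 'i%C) = 2 :> R[i].
  have -> : (1 - 'i%C) * (1 + 'i%C) = 1 - 'i%C * 'i%C :> R[i] by ring.
  by rewrite mul_ii opprK -mulr2n.
by rewrite mulVf// pnatr_eq0.
Qed.

Lemma ZopK x : Zop (Zad x) = x.
Proof.
have lG := GamH_bounded.1; rewrite /Zop /Zad (linearZ' lG) (linearD' lG) (linearZ' lG) GamH_invol.
have E : x + 'i%C *: GamH x - 'i%C *: (GamH x + 'i%C *: x) = 2 *: x.
  by rewrite ['i%C *: (_ + _)]scalerDr scalerA mul_ii scaleN1r opprD opprK addrA addrK -mulr2n scaler_nat.
rewrite ['i%C *: (_ *: _)]scalerA ['i%C * _]mulrC -scalerA -scalerBr E.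
transitivity (((1 - 'i%C)^-1 * ((1 - 'i%C)^-1)^* * 2) *: x); last by rewrite oneBi scale1r.
by rewrite !scalerA; congr (_ *: x); ring.
Qed.

Lemma ZadK x : Zad (Zop x) = x.
Proof.
have lG := GamH_bounded.1; rewrite /Zop /Zad (linearZ' lG) (linearB' lG) (linearZ' lG) GamH_invol.
have E : x - 'i%C *: GamH x + 'i%C *: (GamH x - 'i%C *: x) = 2 *: x.
  by rewrite ['i%C *: (_ - _)]scalerBr scalerA mul_ii scaleN1r opprK addrA subrK -mulr2n scaler_nat.
rewrite ['i%C *: (_ *: _)]scalerA ['i%C * _]mulrC -scalerA -scalerDr E.
transitivity (((1 - 'i%C)^-1 * ((1 - 'i%C)^-1)^* * 2) *: x); last by rewrite oneBi scale1r.
by rewrite !scalerA; congr (_ *: x); ring.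
Qed.

(** The eigenvalue of [Z] on vectors of parity [p]: (1 + i) / (1 - i) = i. *)
Definition zeta p : R[i] := if p then 'i%C else 1.

Lemma zeta_neq0 p : zeta p != 0.
Proof.
case: p; rewrite ?oner_neq0//=; apply/eqP => E; have := mul_ii; rewrite /zeta in E.
by rewrite E mul0r => /eqP; rewrite eq_sym oppr_eq0 oner_eq0.
Qed.

Lemma Zop_par p x : GamH x = (-1) ^+ p *: x -> Zop x = zeta p *: x.
Proof.
have h : 1 - 'i%C != 0 :> R[i].
  by apply/eqP => h; have := oneBi; rewrite h invr0 mul0r mul0r => /eqP; rewrite eq_sym oner_eq0.
move=> E; rewrite /Zop E.
have -> : x - 'i%C *: ((-1) ^+ p *: x) = (1 - 'i%C * (-1) ^+ p) *: x by rewrite scalerBl scale1r scalerA.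
rewrite scalerA; congr (_ *: x).
apply: (mulfI h); rewrite mulrA mulfV// mul1r; case: p {E}; rewrite /zeta /= ?expr0 ?mulr1//.
by rewrite expr1 mulrN1 opprK mulrBl mul1r mul_ii opprK addrC.
Qed.

Lemma dser_par D a u x : wt D a -> cvs ip (dser a u) x -> GamH x = (-1) ^+ (iodd D) *: x.
Proof.
move=> wa xl; apply: (cvs_unique hp (bounded_cvs GamH_bounded xl)).
apply: cvs_ext (cvsZ hp _ xl) => N /=; rewrite /dser scaler_sumr.
elim: N => [|N IH]; first by rewrite !big_nil (linear0' GamH_bounded.1).
rewrite !big_nat_recr//= (linearD' GamH_bounded.1) -IH (linearZ' GamH_bounded.1) GamH_iota.
have -> : Gam (divT a N) = (-1) ^+ iodd D *: divT a N.
  have := wt_parity vp (wt_divT N wa); rewrite ioddD iodd_double addbF => ->//.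
have -> : iota ((-1) ^+ iodd D *: divT a N) = (-1) ^+ iodd D *: iota (divT a N) by exact: linearZ.
by rewrite !scalerA [u N * _]mulrC.
Qed.

Lemma net_star I : star_closed (net H I).
Proof. by apply: Wstar_star => T [p [a [f [_ _ _ ->]]]]; have [] := smeared_closed H p a f. Qed.

Lemma net_affiliated I p a f B : parity p a -> smooth_par p f -> supp f `<=` I ->
  commutant (net H I) B -> preserves B (smeared H p a f).
Proof.
move=> pa sf fI; apply: Wstar_affiliated; last by exists p, a, f.
by move=> T [p' [a' [f' [_ _ _ ->]]]]; exact: smeared_closed.
Qed.

Lemma comm_net_star I : star_closed (commutant (net H I)).
Proof. exact/commutant_star/net_star. Qed.

Lemma FJ_closed I D a f : closed_graph (FJ H I D a f).
Proof.
apply: closure_graph; split=> [|k _ _ [A AC <-] [B BC <-]].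
  have lN C : net H I C -> linear C by move=> /(net_star I).1[].
  have h := commutant_lin (-1) (commutant_id (net H I)) (commutant_id (net H I)) lN.
  by exists (fun x => (-1) *: id x + id x) => //=; rewrite !scaleN1r !addNr.
have lN C : net H I C -> linear C by move=> /(net_star I).1[].
by exists (fun x => k *: A x + B x); [exact: commutant_lin|].
Qed.

Lemma FJ_preserved I D a f B : commutant (net H I) B -> preserves B (FJ H I D a f).
Proof.
move=> BC x y; rewrite /FJ closure_ipcl2 => /ipcl_seq[u uF /(cvs2 hp)[/= ux uy]].
apply: (cvs_ipcl (u := fun n => (B (u n).1, B (u n).2))); last first.
  by apply/(cvs2 hp); split; exact: bounded_cvs BC.1 _.
by move=> n; have [A AC <-] := uF n; exists (B \o A) => //; exact: commutant_comp.
Qed.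

Lemma FJ_sub_smeared I D a f : 0 <= D -> quasi D a -> smooth_par (iodd D) f -> supp f `<=` I ->
  FJ H I D a f `<=` smeared H (iodd D) a f.
Proof.
move=> D0 qa sf fI; rewrite /FJ closure_ipcl2; apply: subset_trans (smeared_closed H _ a f).2.
apply: ipclS => _ [A AC <-].
exact: (net_affiliated (wt_parity vp qa.1) sf fI AC (smeared_vac D0 qa sf)).
Qed.

End FredenhagenJoerss.

(** * Equality of the two kinds of fields *)

Section SmearedIsFJ.
Context {R : realType} {V : unitaryVosa R} (H : completion V) (Vsgl : strongly_graded_local H).
Local Notation iota := (iota_ H).
Local Notation ip := (sprod (hdot H)).
Local Notation nm := (ipnorm ip).
Local Notation Z := (Zop (H := H)).
Local Notation th := (@theta R V).
Implicit Types (a b c : V) (D E : int) (n m N : nat) (f g : R[i] -> R[i]) (p q : bool) (x y z : H).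
Let vp : is_vosa V := vosaP V.
Let hp : is_ip ip := hipP.
Let Veb : energy_bounded V := Vsgl.1.

Lemma ex_half D : exists k : int, D + (iodd D)%:Z = 2 * k.
Proof. by apply/ioddP; rewrite ioddD; case: (iodd D). Qed.

(** Graded locality writes the elements of the complementary algebra as [Z]-conjugates of elements
    of the commutant, and [B] commutes with the latter. *)
Lemma twisted_comm I B : interval_S1 I -> commutant (commutant (net H I)) B ->
  commutant (net H (compl_S1 I)) (Z \o B \o adj Z).
Proof.
move=> iI [bB HB]; have bZ := @Zop_bounded R V H; split.
  by apply: bounded_comp; [exact: bounded_comp|exact: adj_bounded].
move=> A /(Vsgl.2 I iI)[A' A'C <-]; apply/funext => x /=.
have K y : adj Z (Z y) = y by rewrite adj_Zop ZadK.
rewrite !K; congr (Z _); have := HB _ A'C => /(congr1 (fun F => F (adj Z x))) /= ->.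
by [].
Qed.

Section Interval.
Variables (I : set R[i]) (D : int) (a : V) (f : R[i] -> R[i]).
Hypotheses (iI : interval_S1 I) (D0 : 0 <= D) (qa : quasi D a)
  (sf : smooth_par (iodd D) f) (fI : supp f `<=` I).

Lemma FJ_dom E b g : 0 <= E -> quasi E b -> smooth_par (iodd E) g -> supp g `<=` compl_S1 I ->
  exists w, FJ H I D a f (FJ_vector H E b g, w).
Proof.
move=> E0 qb sg gI; have Tc := FJ_closed H I D a f.
have [P HP] := graph_proj Tc.
have eC i j : commutant (commutant (net H I)) (entry i j P).
  apply: (entry_commutant Tc HP i j (@comm_net_star R V H I)) => B BC.
  exact: FJ_preserved.
have bZ := @Zop_bounded R V H; have lZ := bZ.1.
have ZK y : adj Z (Z y) = y by rewrite adj_Zop ZadK.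
have KZ y : Z (adj Z y) = y by rewrite adj_Zop ZopK.
pose Tb := smeared H (iodd E) b g.
(* The graph of [Y(b, g)] conjugated by [Z], so that the entries of [P] themselves preserve it. *)
pose Q := [set q : H * H | Tb (Z q.1, Z q.2)].
have [sTb _] := smeared_closed H (iodd E) b g.
have sQ : subspace Q.
  split=> [|k u v Qu Qv]; rewrite /Q /=; first by rewrite (linear0' lZ); exact: sTb.1.
  by rewrite !lZ; exact: (sTb.2 k _ _ Qu Qv).
have fQ : single_valued Q.
  move=> u v w h1 h2; rewrite -(ZK v) -(ZK w); congr (adj Z _).
  exact: (smeared_single Veb qb sg h1 h2).
have eQ i j : preserves (entry i j P) Q.
  move=> u v Quv.
  have := net_affiliated (wt_parity vp qb.1) sg gI (twisted_comm iI (eC i j)) Quv.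
  by rewrite /= !ZK.
have Fpar y : GamH y = (-1) ^+ (iodd D) *: y -> Z y = @zeta R (iodd D) *: y.
  exact: Zop_par.
have pa := Fpar _ (dser_par qa.1 (FJ_vector_cvs H Veb qa sf)).
(* [a(f)] is in the domain of [Y(b, g)], being a rapidly convergent series of the [a^n]. *)
have [y [C [k [C0 yC ys]]]] := smeared_divT H Veb qb sg qa.
have [w0 w0l w0s] := smeared_dser (rapid_neg sf) C0 yC ys (FJ_vector_cvs H Veb qa sf).
have Q0 : Q (iota vac, adj Z (FJ_vector H E b g)).
  rewrite /Q /= KZ (Zop_par (p := false)) ?scale1r.
    exact: smeared_vac.
  by rewrite GamH_iota (vac_even vp) expr0 !scale1r.
have Q1 : Q (FJ_vector H D a f, adj Z (@zeta R (iodd D) *: w0)).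
  by rewrite /Q /= KZ pa; exact: (subspaceZ sTb _ w0s).
have TF : FJ H I D a f (iota vac, FJ_vector H D a f).
  by apply: subset_closure; exists id => //; exact: commutant_id.
have FQ := graph_exchange Tc HP sQ fQ eQ Q0 Q1 TF.
have pb := dser_par qb.1 (FJ_vector_cvs H Veb qb sg).
(* Vectors of definite parity are eigenvectors of [Z], so the twist contributes only a scalar,
   divided out at the end. *)
have ab : adj Z (FJ_vector H E b g) = (@zeta R (iodd E))^-1 *: FJ_vector H E b g.
  rewrite -[RHS]ZK; congr (adj Z _); rewrite (linearZ' lZ) (Zop_par pb) scalerA.
  by rewrite mulVf ?zeta_neq0// scale1r.
rewrite ab in FQ.
have FQ' := subspaceZ Tc.1 (@zeta R (iodd E)) FQ.
exists (@zeta R (iodd E) *: adj Z (@zeta R (iodd D) *: w0)).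
rewrite (_ : (FJ_vector H E b g, _) = @zeta R (iodd E) *:
  ((@zeta R (iodd E))^-1 *: FJ_vector H E b g, adj Z (@zeta R (iodd D) *: w0)))//.
by congr (_, _); rewrite /= scalerA mulfV ?zeta_neq0// scale1r.
Qed.

(** For [g] a bump at [t], orthogonality at [b(g)] says that a power series in [expi t] with
    coefficients [bcoef e (j m) * L m] vanishes on an arc. One-sided uniqueness kills every
    coefficient, and [e] can be chosen with [bcoef e (j n)] nonzero. *)
Lemma FJ_orth_divT (r : H * H) E b n z : (forall s, FJ H I D a f s -> ip2 ip r s = 0) ->
  0 <= E -> quasi E b -> smeared H (iodd D) a f (iota (divT b n), z) ->
  ip2 ip r (iota (divT b n), z) = 0.
Proof.
move=> rF E0 qb nz; have [t0 [d [d0 Hd]]] := compl_S1_arc iI.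
have [y [C [k [C0 yC ys]]]] := smeared_divT H Veb qa sf qb.
have -> : z = y n by exact: (smeared_single Veb qa sf nz (ys n)).
have [be beE] := ex_half E.
have [B [l [B0 HB]]] := divT_growth Veb qb.
pose L n := ip2 ip r (iota (divT b n), y n).
have LC m : cabs (L m) <= (ipnorm (ip2 ip) r * (B + C)) * m.+1%:R ^+ (k + l).
  rewrite (le_trans (cauchy_schwarz (ip2P hp) _ _))// -mulrA ler_wpM2l ?nm_ge0//.
  rewrite (le_trans (nm2_le hp _))//= iota_nm mulrDl lerD//.
    by rewrite (le_trans (HB m))// ler_wpM2l// ler_weXn2l ?ler1n// leq_addl.
  by rewrite (le_trans (yC m))// ler_wpM2l// ler_weXn2l ?ler1n// leq_addr.
pose j m : int := - (m%:Z + be).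
have jE m : - (2 * m)%:Z - E = 2 * j m + (iodd E)%:Z by rewrite /j; lia.
have Fu (t e : R) m : 0 < e < pi -> fourier (bump (iodd E) e t) (- (2 * m)%:Z - E) =
    expi (be%:~R * t) * (bcoef e (j m) * expi (m%:R * t)).
  move=> ee; rewrite jE fourier_bump//; move: (bcoef _ _) => w.
  rewrite mulrCA -expiD mulrC; congr (_ * expi _).
  by rewrite /j rmorphN rmorphD /= mulNr opprK mulrDl addrC.
have key e : 0 < e < pi -> e <= d -> forall m, bcoef e (j m) * L m = 0.
  move=> ee ed.
  have sb t : smooth_par (iodd E) (bump (iodd E) e t) by exact: smooth_par_bump.
  have ip2r := ip2P hp.
  have LC0 : 0 <= ipnorm (ip2 ip) r * (B + C) by rewrite mulr_ge0 ?nm_ge0 ?addr_ge0.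
  have LC' m : ipnorm (@ipc R) (L m) <= ipnorm (ip2 ip) r * (B + C) * m.+1%:R ^+ (k + l).
    by rewrite nm_ipc.
  have [M M0 HM] := rapid_growth (@ipcP R) (rapid_neg (sb t0)) LC0 LC'.
  apply: (one_sided_unique (C := M) (t0 := t0) (d := d)) => //.
    move=> m; have := HM m; rewrite nm_ipc Fu// -[_ *: _]/(_ * _) !cabsM !cabs_expi mul1r mulr1.
    by [].
  move=> t tt0.
  have gI : supp (bump (iodd E) e t) `<=` compl_S1 I.
    have /andP[e0 _] := ee; move=> z' /(supp_bump e0); exact: Hd.
  have [w FJw] := FJ_dom E0 qb (sb t) gI.
  have bl := FJ_vector_cvs H Veb qb (sb t).
  have [w' wl ws] := smeared_dser (rapid_neg (sb t)) C0 yC ys bl.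
  have ww : w = w'.
    apply: (smeared_single Veb qa sf _ ws); exact: (@FJ_sub_smeared _ _ H Veb I D a f D0 qa sf fI _ FJw).
  have lim0 : cvs (@ipc R) (fun N => \sum_(0 <= m < N) fourier (bump (iodd E) e t) (- (2 * m)%:Z - E) * L m) 0.
    have r0 := rF _ FJw; rewrite ww in r0.
    have bw : cvs (ip2 ip) (fun N => (dser H b (fun m => fourier (bump (iodd E) e t) (- (2 * m)%:Z - E)) N,
       \sum_(0 <= m < N) fourier (bump (iodd E) e t) (- (2 * m)%:Z - E) *: y m))
       (FJ_vector H E b (bump (iodd E) e t), w') by apply/(cvs2 hp); split.
    have := ip_cvs2 ip2r (cvs_cst ip2r r) bw; rewrite r0.
    apply: cvs_ext => N; rewrite /ip2 /= /dser !(ip_sumr hp) -big_split; apply: eq_bigr => m _ /=.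
    by rewrite !(ipZr hp) -mulrDr.
  have := cvsZ (@ipcP R) (expi (- (be%:~R * t))) lim0; rewrite scaler0.
  apply: cvs_ext => N; rewrite -[_ *: _]/(_ * _) mulr_sumr; apply: eq_bigr => m _.
  rewrite Fu//; move: (bcoef e _) (L m) => u v.
  by rewrite !mulrA -expiD addNr expi0 mul1r mulrAC.
have [e [ee ed /eqP en0]] := bcoef_neq0 (j n) d0.
have := key e ee ed n => /eqP; rewrite mulf_eq0 => /orP[/eqP//|/eqP h']; exact: h'.
Qed.

Lemma smeared_sub_FJ : smeared H (iodd D) a f `<=` FJ H I D a f.
Proof.
have [sF cF] := FJ_closed H I D a f; have ip2r := ip2P hp.
suff key r : (forall s, FJ H I D a f s -> ip2 ip r s = 0) ->
    forall c z, smeared H (iodd D) a f (iota c, z) -> ip2 ip r (iota c, z) = 0.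
  move=> q qs; apply: cF.
  apply: (ipcl_orth ip2r (ip2_complete hp hilbert_complete) sF) => r rF.
  move: qs; rewrite /smeared closure_ipcl2 => qs; apply: (ip_ipcl ip2r qs) => -[u v] /= [c [uc vl]].
  by rewrite uc; apply: key => //; apply: subset_closure; exists c.
move=> rF c; have [ss _] := smeared_closed H (iodd D) a f.
pose P := [set c | forall z, smeared H (iodd D) a f (iota c, z) -> ip2 ip r (iota c, z) = 0].
have P0 : P 0.
  move=> z; rewrite linear0 => zs; rewrite (smeared_single Veb qa sf zs ss.1).
  by rewrite -[(0, 0)]/(0 : H * H) (ip0r ip2r).
have Psub : subspace P.
  split=> // k u v Pu Pv z zs.
  have [x [_ xs]] := smeared_ex H Veb a u sf; have [y [_ ys]] := smeared_ex H Veb a v sf.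
  have E : (iota (k *: u + v), z) = k *: (iota u, x) + (iota v, y) :> H * H.
    rewrite linearP; congr (_, _); apply: (smeared_single Veb qa sf zs).
    by have := ss.2 k _ _ xs ys; rewrite linearP.
  by rewrite E (ipDr ip2r) (ipZr ip2r) Pu// Pv// mulr0 addr0.
suff Pc : P c by exact: Pc.
apply: (qp_span Psub) => E b n qb.
have -> : iter n (@transl R V) b = n`!%:R *: divT b n.
  by rewrite /divT scalerA mulfV ?scale1r// pnatr_eq0 -lt0n fact_gt0.
apply: (subspaceZ Psub) => z zs.
have [E0|E0] := lerP 0 E; first exact: (FJ_orth_divT rF E0 qb zs).
have b0 : divT b n = 0.
  rewrite (wt_neg E0 qb.1) /divT; apply/eqP; rewrite scaler_eq0; apply/orP; right; apply/eqP.
  by elim: n {zs} => //= n ->; rewrite linear0.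
by rewrite b0 in zs *; exact: P0.
Qed.

Theorem FJ_smeared : FJ H I D a f = smeared H (iodd D) a f.
Proof. by apply/seteqP; split; [exact: FJ_sub_smeared|exact: smeared_sub_FJ]. Qed.

End Interval.
End SmearedIsFJ.

(** * Kernels that are polynomial along diagonals *)

Section Kernels.
Context {R : realType}.
Implicit Types (ka : int -> int -> R[i]) (n m i s : int) (N : nat) (C : R).

Definition dif_free ka N := forall n m, dif N (fun i => ka (n + i) (m + i)) 0 = 0.

Lemma dif_line ka N n0 m0 : dif_free ka N -> forall k, dif N (fun i => ka (n0 + i) (m0 + i)) k = 0.
Proof.
move=> Hd k; rewrite -[RHS](Hd (n0 + k) (m0 + k)) /dif; apply: eq_bigr => j _.
by rewrite !add0r !addrA.
Qed.

Lemma dif_free_tr ka N : dif_free ka N -> dif_free (fun n m => ka m n) N.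
Proof. by move=> h n m; exact: h. Qed.

(** For weight [0]: a polynomial supported at one point vanishes. *)
Lemma kernel_zero ka N : dif_free ka N -> (forall n m, n != 0 -> ka n m = 0) -> forall m, ka 0 m = 0.
Proof.
move=> Hd k0 m; pose f i := ka (0 + i) (m + i).
rewrite -[m]addr0 -[X in ka X _]addr0.
apply: (@dif_zero _ N f (cabs (f 0) ^+ 2) 0 [:: 1]) => //.
- by rewrite exprn_ge0 ?cabs_ge0.
- exact: dif_line.
- move=> [|n]; rewrite expr0 mulr1//.
  by rewrite /f k0 ?cabs0 ?expr0n/= ?exprn_ge0 ?cabs_ge0// add0r.
- by move=> z; rewrite inE => /eqP ->; rewrite /f k0.
Qed.

(** Between the two quadrants that carry the kernel, each diagonal crosses a gap, which provides its
    zeros. *)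
Definition kernel_supp ka (Da Db : nat) := forall n m,
  ~~ ((0 <= n) && (0 <= m)) -> ~~ ((n <= - Da%:Z) && (m <= - Db%:Z)) -> ka n m = 0.

Definition kernel_growth ka (Da Db : nat) C := forall n m : nat,
  cabs (ka n m) ^+ 2 <= C * n.+1%:R ^+ Da.-1 * m.+1%:R ^+ Db.-1.

(** The diagonal [n - m = s] is a polynomial of degree at most [(Da + Db) / 2 - 1]
    with [max (Da + s) Db - 1] zeros at negative integers. *)
Lemma kernel_offdiag1 ka N (Da Db : nat) C (m s : nat) : 0 <= C -> dif_free ka N ->
  kernel_supp ka Da Db -> kernel_growth ka Da Db C -> (0 < Da)%N -> (0 < Db)%N ->
  (0 < s)%N || (Da != Db) -> ka (m + s)%N m = 0.
Proof.
move=> C0 Hd Hs Hg Da0 Db0 sD; pose f i := ka (s%:Z + i) (0 + i).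
rewrite (_ : ka _ _ = f m); last by rewrite /f add0r; congr ka; lia.
pose Z := [seq - (k.+1)%:Z | k <- seq.iota 0 (maxn (Da + s) Db).-1].
apply: (@dif_zero _ N f (C * s.+1%:R ^+ Da.-1) (Da.-1 + Db.-1) Z).
- by rewrite mulr_ge0 ?exprn_ge0.
- exact: dif_line.
- move=> n; rewrite /f add0r; have := Hg (s + n)%N n => /le_trans; apply.
  rewrite -!mulrA ler_wpM2l// exprD mulrA ler_wpM2r ?exprn_ge0//.
  by rewrite -exprMn lerXn2r ?nnegrE ?mulr_ge0// -natrM ler_nat; nia.
- by rewrite map_inj_uniq ?iota_uniq// => x y /eqP; rewrite eqr_opp => /eqP[].
- move=> z /mapP[k kl ->]; move: kl; rewrite mem_iota add0n => /andP[_ kl]; apply: Hs; lia.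
- by rewrite size_map size_iota; case/orP: sD => h; [lia|move/eqP in h; lia].
Qed.

(** Exchanging the variables reduces to [m <= n]. *)
Lemma kernel_offdiag ka N (Da Db : nat) C (n m : nat) : 0 <= C -> dif_free ka N ->
  kernel_supp ka Da Db -> kernel_growth ka Da Db C -> (0 < Da)%N -> (0 < Db)%N ->
  (n != m) || (Da != Db) -> ka n m = 0.
Proof.
move=> C0 Hd Hs Hg Da0 Db0 nm; case: (leqP m n) => h.
  have -> : n = (m + (n - m))%N by lia.
  apply: (@kernel_offdiag1 ka N Da Db C m (n - m) C0 Hd Hs Hg Da0 Db0).
  by case/orP: nm => [nm|->]; rewrite ?orbT// subn_gt0 ltn_neqAle eq_sym nm h.
have -> : m = (n + (m - n))%N by lia.
apply: (@kernel_offdiag1 (fun n m => ka m n) N Db Da C n (m - n)) => //.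
- by move=> i j h1 h2; apply: Hs; rewrite andbC.
- by move=> i j; have := Hg j i; rewrite mulrAC.
- by rewrite subn_gt0 h.
Qed.

(** The polynomial on the main diagonal has degree at most D - 1 and vanishes at -1, ..., 1 - D. It
    is thus fixed by its value at 0, and the binomial polynomial [poch D] has the same zeros. *)
Lemma kernel_diag ka N (D : nat) C : 0 <= C -> dif_free ka N ->
  kernel_supp ka D D -> kernel_growth ka D D C -> (0 < D)%N ->
  forall n : nat, ka n n = ((@poch R D n)%:C)%C * ka 0 0.
Proof.
move=> C0 Hd Hs Hg; case: D Hs Hg => // D Hs Hg _ n.
pose f i := ka (0 + i) (0 + i).
have [p pE] := dif_poly (dif_line 0 0 Hd); rewrite -/f in pE.
pose rs : seq R[i] := [seq - (j.+1)%:R | j <- seq.iota 0 D].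
pose q := \prod_(z <- rs) ('X - z%:P).
have qE (x : R[i]) : q.[x] = \prod_(0 <= j < D) (x + j.+1%:R).
  rewrite horner_prod /rs big_map /index_iota subn0; apply: eq_bigr => j _.
  by rewrite hornerXsubC opprK.
have sp : (size p <= D.+1)%N.
  have := @poly_growth _ p C (D + D) C0 _; rewrite mul2n -addnn => /(_ _) h.
  have : ((size p).-1 + (size p).-1 <= D + D)%N.
    apply: h => k; rewrite -[k%:R]/(k%:Z%:~R) -pE /f !add0r (le_trans (Hg k k))//=.
    by rewrite exprD mulrA.
  by case: (size p) => [|k] //=; lia.
have q0 : q.[0] != 0.
  rewrite qE prodf_seq_neq0; apply/allP => j _ /=; rewrite add0r pnatr_eq0//.
(* [h] vanishes at 0 and at all roots of [q], one root more than its degree allows. *)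
pose h := q.[0] *: p - p.[0] *: q.
have h0 : h = 0.
  apply/eqP; apply: contraT => hn.
  have sh : (size h <= D.+1)%N.
    rewrite (leq_trans (size_polyD _ _))// geq_max size_polyN.
    rewrite (leq_trans (size_scale_leq _ _))//= (leq_trans (size_scale_leq _ _))//.
    by rewrite size_prod_XsubC size_map size_iota.
  suff : (size (0%R :: rs) < size h)%N.
    by rewrite /= size_map size_iota => /leq_trans/(_ sh); rewrite ltnn.
  apply: max_poly_roots => //.
    apply/allP => z; rewrite inE => /orP[/eqP ->|zr].
      by rewrite rootE /h hornerD hornerN !hornerZ mulrC subrr.
    have qz : q.[z] = 0 by apply/eqP; rewrite -rootE root_prod_XsubC.
    rewrite rootE /h hornerD hornerN !hornerZ qz mulr0 subr0.
    case/mapP: zr => j; rewrite mem_iota add0n => /andP[_ jD] ->.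
    rewrite (_ : - j.+1%:R = (- (j.+1)%:Z)%:~R); last by rewrite rmorphN.
    by rewrite -pE /f !add0r Hs ?mulr0//; lia.
  rewrite /= map_inj_uniq ?iota_uniq ?andbT//.
    by apply/mapP => -[j _ /eqP]; rewrite eq_sym oppr_eq0 pnatr_eq0.
  by move=> i j /oppr_inj/eqP; rewrite eqr_nat => /eqP[].
have key : q.[0] * p.[n%:R] = p.[0] * q.[n%:R].
  by have := congr1 (fun r : {poly R[i]} => r.[n%:R]) h0;
    rewrite /h hornerD hornerN !hornerZ horner0 => /eqP; rewrite subr_eq0 => /eqP.
have qn k : q.[k%:R] = q.[0] * ((@poch R D.+1%:Z k)%:C)%C.
  elim: k => [|k IH]; first by rewrite mulr1.
  have k0 : k.+1%:R != 0 :> R[i] by rewrite pnatr_eq0.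
  apply: (mulIf k0).
  have -> : q.[k.+1%:R] * k.+1%:R = q.[k%:R] * (k + D.+1)%:R.
    rewrite !qE; transitivity (\prod_(0 <= j < D.+1) ((k + j.+1)%:R : R[i])).
      rewrite big_nat_recl// mulrC addn1; congr (_ * _).
      by apply: eq_bigr => j _; rewrite -natrD; congr (_%:R); lia.
    rewrite big_nat_recr//=; congr (_ * _).
    by apply: eq_bigr => j _; rewrite -natrD.
  have E : @poch R D.+1%:Z k.+1 * k.+1%:R = @poch R D.+1%:Z k * (k + D.+1)%:R.
    by rewrite /= divfK ?pnatr_eq0// addnC.
  rewrite IH -!mulrA; congr (_ * _).
  by rewrite (complex_nat (k + D.+1)) (complex_nat k.+1) -!rmorphM E.
have e1 : ka n n = p.[n%:R] by rewrite -[n%:R]/(n%:Z%:~R) -pE /f !add0r.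
have e0 : ka 0 0 = p.[0] by rewrite -[0 in RHS]/(0%:~R) -pE /f !add0r.
apply: (mulfI q0); rewrite e1 e0 key qn; ring.
Qed.

End Kernels.

(** * Vectors of finite energy *)

Section FiniteEnergy.
Context {R : realType} {V : unitaryVosa R} (H : completion V).
Local Notation iota := (iota_ H).
Local Notation ip := (sprod (hdot H)).
Local Notation vip := (sprod (vdot V)).
Implicit Types (a b c u v : V) (D E : int) (x y z : H).
Let vp : is_vosa V := vosaP V.
Let hp : is_ip ip := hipP.

Lemma weight_split D v : exists v', wt D v' /\ exists s,
  [/\ wt_seq s, (forall q, q \in s -> q.1 != D) & v = v' + vsum s].
Proof.
have [s [ws ->]] := ex_decomp vp v.
exists (\sum_(x <- s | x.1 == D) x.2); split.
  rewrite big_seq_cond; apply: wt_sum => x /andP[xs /eqP <-]; exact: ws.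
exists [seq x <- s | x.1 != D]; split.
- by move=> x; rewrite mem_filter => /andP[_ /ws].
- by move=> x; rewrite mem_filter => /andP[].
- by rewrite /vsum big_filter (bigID (fun q => q.1 == D)).
Qed.

(** The vectors [e i] whose span contains the weight space need not have weight [D] themselves, so
    the projection of [x] on their span is cut down to its component of weight [D]. *)
Lemma fin_weight D x : (forall E v, E != D -> wt E v -> ip x (iota v) = 0) ->
  exists2 u, wt D u & x = iota u.
Proof.
move=> xo; have [k [e He]] := wt_findim vp D.
have [c Hc] := span_proj hp (fun i => iota (e i)) x.
have [u [wu [s [ws sD uE]]]] := weight_split D (\sum_i c i *: e i).
exists u => //; apply: iota_ext => v.
have [v' [wv [t [wt' tD ->]]]] := weight_split D v.
have h1 : ip x (iota (vsum t)) = 0.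
  rewrite /vsum raddf_sum (ip_sumr hp) big_seq big1// => y yt.
  by apply: (xo y.1); [exact: tD|exact: wt'].
have h2 : vip u (vsum t) = 0.
  rewrite /vsum (ip_sumr (vipP V)) big_seq big1// => y yt.
  by apply: (wt_orth wu (wt' y yt)); rewrite eq_sym; exact: tD.
have h3 : vip (vsum s) v' = 0.
  rewrite /vsum (ip_suml (vipP V)) big_seq big1// => y ys.
  by apply: (wt_orth (ws y ys) wv); exact: sD.
rewrite raddfD !(ipDr hp) h1 !iota_ip h2 !addr0.
have [d dE] := He v' wv; rewrite dE in h3 *.
have -> : u = \sum_i c i *: e i - vsum s by rewrite uE addrK.
rewrite (ipBl (vipP V)) h3 subr0 -(iota_ip H).
apply/eqP; rewrite -subr_eq0 -(ipBl hp) (ipC hp) conjC_eq0; apply/eqP.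
have iE (c' : 'I_k -> R[i]) : iota (\sum_i c' i *: e i) = \sum_i c' i *: iota (e i).
  by rewrite raddf_sum; apply: eq_bigr => i _; exact: linearZ.
rewrite -[LHS]/(ip (iota (\sum_i d i *: e i)) (x - iota (\sum_i c i *: e i))) (iE d) (iE c) (ip_suml hp) big1// => i _.
by rewrite (ipZl hp) Hc mulr0.
Qed.

(** The symmetry of L_0 passes to the closure of its graph, so different eigenvalues give orthogonal
    vectors. *)
Lemma L0_graph_orth D E x v : L0_graph (x, halfC R D *: x) -> wt E v -> E != D -> ip x (iota v) = 0.
Proof.
move=> xg wv ED.
have ap : adjoint_pair (L0_graph (H := H)) (iota v) (iota (Lop 0 v)).
  apply: adjoint_pair_closure => _ _ [a _ [<- <-]].
  by rewrite !iota_ip L_adj oppr0.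
have := ap _ _ xg; rewrite (ipZl hp) halfC_conj wv linearZ /= (ipZr hp) => /eqP.
rewrite -subr_eq0 -mulrBl mulf_eq0 => /orP[|/eqP//].
by rewrite subr_eq0 => /eqP /halfC_inj DE; rewrite DE eqxx in ED.
Qed.

Theorem range_iota : range iota = Hfin H.
Proof.
apply/seteqP; split=> [_ [v _ <-]|_ [s [sH ->]]].
  have [s [ws ->]] := ex_decomp vp v.
  exists [seq (`|q.1|%N, iota q.2) | q <- s]; split; last first.
    by rewrite big_map /vsum raddf_sum.
  move=> _ /mapP[x xs ->] /=; have wx := ws x xs.
  apply: subset_closure; exists x.2 => //; congr (_, _).
  have [x0|x0] := lerP 0 x.1.
    by rewrite gez0_abs// wx linearZ.
  by rewrite (wt_neg x0 wx) Lop0 linear0 scaler0.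
elim: s sH => [|y s IH] sH.
  by exists 0 => //; rewrite big_nil linear0.
have [|v _ vE] := IH; first by move=> z zs; apply: sH; rewrite inE zs orbT.
have [u _ uE] : exists2 u, wt y.1%:Z u & y.2 = iota u.
  apply: fin_weight => E w Ey wE.
  by apply: (L0_graph_orth _ wE Ey); apply: sH; rewrite inE eqxx.
by exists (u + v) => //; rewrite big_cons uE -vE raddfD.
Qed.

End FiniteEnergy.

(** * Isomorphisms of nets *)

Section NetIsomorphism.
Context {R : realType} {V W : unitaryVosa R} {H : completion V} {K : completion W}.
Variables (Phi : H -> K) (Psi : K -> H).
Hypotheses (iso : net_iso Phi Psi) (Hsgl : strongly_graded_local H) (Ksgl : strongly_graded_local K).
Local Notation iH := (iota_ H).
Local Notation iK := (iota_ K).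
Local Notation ip := (sprod (hdot H)).
Local Notation kip := (sprod (hdot K)).
Local Notation nm := (ipnorm kip).
Local Notation Z := (Zop (H := K)).
Local Notation thV := (@theta R V).
Local Notation thW := (@theta R W).
Implicit Types (a : V) (b : W) (n m k l N : nat) (x y z : K) (f g : R[i] -> R[i]).
Let hp : is_ip ip := hipP.
Let kp : is_ip kip := hipP.
Let Heb : energy_bounded V := Hsgl.1.
Let Keb : energy_bounded W := Ksgl.1.
Let lPhi : linear Phi. Proof. by case: iso. Qed.

Lemma PhiK u : Psi (Phi u) = u. Proof. by case: iso => _ [h _] _ _ _; exact: h. Qed.
Lemma PsiK x : Phi (Psi x) = x. Proof. by case: iso => _ [_ h] _ _ _; exact: h. Qed.
Lemma Phi_ip u v : kip (Phi u) (Phi v) = ip u v. Proof. by case: iso. Qed.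
Lemma Phi_vac : Phi (iH vac) = iK vac. Proof. by case: iso. Qed.
Lemma Phi_nm u : nm (Phi u) = ipnorm ip u. Proof. by rewrite /ipnorm Phi_ip. Qed.

Lemma PhiD u v : Phi (u + v) = Phi u + Phi v.
Proof. by have := lPhi 1 u v; rewrite !scale1r. Qed.

Lemma Phi0 : Phi 0 = 0.
Proof. by have := PhiD 0 0; rewrite addr0 => /eqP; rewrite eq_sym -subr_eq0 addrK => /eqP. Qed.

Lemma PhiZ (c : R[i]) u : Phi (c *: u) = c *: Phi u.
Proof. by have := lPhi c u 0; rewrite Phi0 !addr0. Qed.

Lemma Psi_lin : linear Psi.
Proof. by move=> c x y; rewrite -[RHS]PhiK lPhi !PsiK. Qed.

Lemma Psi_ip x y : ip (Psi x) (Psi y) = kip x y.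
Proof. by rewrite -Phi_ip !PsiK. Qed.

Lemma Phi_cvs u v : cvs ip u v -> cvs kip (Phi \o u) (Phi v).
Proof.
move=> uv e /uv[N HN]; exists N => n /HN h; rewrite /=.
by rewrite -scaleN1r -PhiZ -PhiD scaleN1r Phi_nm.
Qed.

Lemma conj_bounded (A : H -> H) : bounded_op A -> bounded_op (Phi \o A \o Psi).
Proof.
move=> /bounded_opP[lA [M HM]]; apply/bounded_opP; split=> [c x y|].
  by rewrite /= Psi_lin lA lPhi.
exists M => x /=; rewrite Phi_nm (le_trans (HM _))// le_eqVlt.
by rewrite -Phi_nm PsiK eqxx.
Qed.

Lemma conj_bounded' (A : K -> K) : bounded_op A -> bounded_op (Psi \o A \o Phi).
Proof.
move=> /bounded_opP[lA [M HM]]; apply/bounded_opP; split=> [c x y|].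
  by rewrite /= lPhi lA Psi_lin.
exists M => x /=; rewrite -Phi_nm PsiK (le_trans (HM _))//.
by rewrite Phi_nm.
Qed.

Section Interval.
Variables (I : set R[i]) (iI : interval_S1 I).

Lemma net_conj A : net K I A <-> exists2 B, net H I B & A = Phi \o B \o Psi.
Proof.
have -> : net K I = conj_by Phi Psi (net H I) by case: iso => _ _ _ _ h; exact: h.
by split=> [[B HB <-]|[B HB ->]]; exists B.
Qed.

Lemma comm_conj B : commutant (net H I) B -> commutant (net K I) (Phi \o B \o Psi).
Proof.
move=> [bB HB]; split; first exact: conj_bounded.
move=> A /net_conj[C HC ->]; apply/funext => x /=; rewrite !PhiK; congr (Phi _).
by have := HB _ HC => /(congr1 (fun F => F (Psi x))).
Qed.

Lemma comm_conj' B : commutant (net K I) B -> commutant (net H I) (Psi \o B \o Phi).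
Proof.
move=> [bB HB]; split; first exact: conj_bounded'.
move=> A HA; apply/funext => u /=.
have HA' : net K I (Phi \o A \o Psi) by apply/net_conj; exists A.
have := HB _ HA' => /(congr1 (fun F => F (Phi u))) /=; rewrite PhiK => <-.
by rewrite PhiK.
Qed.

(** These fields are built from the commutant of the local algebra, the vacuum and the vector
    [a(f)], and [Phi] matches all three. *)
Lemma FJ_transport D a (a' : W) f u v :
  (forall n, Phi (iH (divT a n)) = iK (divT a' n)) ->
  quasi D a -> quasi D a' -> smooth_par (iodd D) f ->
  FJ H I D a f (u, v) -> FJ K I D a' f (Phi u, Phi v).
Proof.
move=> aa qa qa' sf.
have fE : Phi (FJ_vector H D a f) = FJ_vector K D a' f.
  apply: (cvs_unique kp (Phi_cvs (FJ_vector_cvs H Heb qa sf))).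
  apply: cvs_ext (FJ_vector_cvs K Keb qa' sf) => N; rewrite /= /dser.
  elim: N => [|N IH]; first by rewrite !big_nil Phi0.
  by rewrite !big_nat_recr//= IH PhiD PhiZ aa.
rewrite /FJ !closure_ipcl2 => /ipcl_seq[w wF /(cvs2 hp)[/= wu wv]].
apply: (cvs_ipcl (u := fun N => (Phi (w N).1, Phi (w N).2))); last first.
  by apply/(cvs2 kp); split; exact: Phi_cvs.
move=> N; have [A AC <-] := wF N; exists (Phi \o A \o Psi); first exact: comm_conj.
by rewrite /= -Phi_vac -fE !PhiK.
Qed.

End Interval.

Lemma zeta_sqr (q : bool) : @zeta R q * @zeta R q = (-1) ^+ q.
Proof. by case: q; rewrite /zeta /= ?mul_ii ?mulr1. Qed.

Lemma zeta_conj (q : bool) : (@zeta R q)^* = (@zeta R q)^-1.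
Proof.
apply: (mulIf (@zeta_neq0 R q)); rewrite mulVf ?zeta_neq0//.
case: q; rewrite /zeta; last by rewrite rmorph1 mulr1.
by rewrite conj_i mulNr mul_ii opprK.
Qed.

Lemma adjZ_par (p : bool) x : GamH x = (-1) ^+ p *: x -> adj Z x = (@zeta R p)^-1 *: x.
Proof.
move=> hx; rewrite adj_Zop -[RHS]ZadK; congr Zad.
rewrite (linearZ' (@Zop_bounded _ _ K).1) (Zop_par hx) scalerA.
by rewrite mulVf ?zeta_neq0// scale1r.
Qed.

Lemma adjZ_vac : adj Z (iK vac) = iK vac.
Proof.
rewrite (adjZ_par (p := false)) /zeta ?invr1 ?scale1r//.
by rewrite GamH_iota (vac_even (vosaP W)) expr0 !scale1r.
Qed.

(** The transported field [X] is affiliated to the algebra of [I] on [K], so bounded operators [A]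
    of its bicommutant approximate [X] and its adjoint on the vacuum. Conjugated by [Z], each [A]
    preserves the graph of [Y(b, g)], which gives the relation for [A]; then pass to the limit. *)
Lemma local_relation Da Db a b f g t d as_ bs :
  0 <= Da -> 0 <= Db -> quasi Da a -> quasi Db b -> interval_S1 (oarc t d) ->
  smooth_par (iodd Da) f -> smooth_par (iodd Db) g ->
  supp f `<=` oarc t d -> supp g `<=` compl_S1 (oarc t d) ->
  cvs ip (dser H (thV a) (fun n => (fourier f ((2 * n)%:Z + Da))^* * sgn_adj Da)) as_ ->
  cvs kip (dser K (thW b) (fun n => (fourier g ((2 * n)%:Z + Db))^* * sgn_adj Db)) bs ->
  kip (Phi (FJ_vector H Da a f)) bs =
  (-1) ^+ (iodd Db) * kip (FJ_vector K Db b g) (Phi as_).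
Proof.
move=> Da0 Db0 qa qb iI sf sg fI gI asl bsl.
set I := oarc t d in iI fI gI.
pose X : set (K * K) := [set q | smeared H (iodd Da) a f (Psi q.1, Psi q.2)].
have [sS cS] := smeared_closed H (iodd Da) a f.
have Psi_cvs u v : cvs kip u v -> cvs ip (Psi \o u) (Psi v).
  move=> uv e /uv[N HN]; exists N => n /HN h; rewrite /= -Phi_nm.
  by rewrite -[Psi v - _](_ : Psi (v - u n) = _) ?PsiK// -scaleN1r addrC Psi_lin scaleN1r addrC.
have Psi0 : Psi 0 = 0 by rewrite -Phi0 PhiK.
have Xc : closed_graph X.
  split.
    split=> [|c q r Xq Xr]; rewrite /X /=; first by rewrite Psi0; exact: sS.1.
    by rewrite !Psi_lin; exact: (sS.2 c _ _ Xq Xr).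
  move=> [u v] /ipcl_seq[w wX /(cvs2 kp)[/= wu wv]]; rewrite /X /=; apply: cS.
  apply: (cvs_ipcl (u := fun N => (Psi (w N).1, Psi (w N).2))); first exact: wX.
  by apply/(cvs2 hp); split; exact: Psi_cvs.
have XN C : commutant (net K I) C -> preserves C X.
  move=> /(comm_conj' iI) hC u v Xuv.
  have := net_affiliated (wt_parity (vosaP V) qa.1) sf fI hC Xuv.
  by rewrite /X /= !PsiK.
have dens (A : set H) (B : set K) : ipcl ip A = setT -> (forall u, A u -> B (Phi u)) -> ipcl kip B = setT.
  move=> hA AB; apply/seteqP; split=> // x _.
  have : ipcl ip A (Psi x) by rewrite hA.
  move=> h e /h[u Au ux]; exists (Phi u); first exact: AB.
  by rewrite -[x]PsiK -scaleN1r -PhiZ -PhiD scaleN1r Phi_nm.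
have Xd : ipcl kip [set u | exists v, X (u, v)] = setT.
  apply: (dens _ _ (dom_dense H Heb a sf)) => u [v uv]; exists (Phi v).
  by rewrite /X /= !PhiK.
have Xa (u z : H) : adjoint_pair (smeared H (iodd Da) a f) u z -> adjoint_pair X (Phi u) (Phi z).
  by move=> h v w /h; rewrite -!Phi_ip !PsiK.
have Xad : ipcl kip [set u | exists v, adjoint_pair X u v] = setT.
  by apply: (dens _ _ (adj_dom_dense H Heb qa sf)) => u [v uv]; exists (Phi v); exact: Xa.
have X1 : X (iK vac, Phi (FJ_vector H Da a f)).
  by rewrite /X /= -Phi_vac !PhiK; exact: smeared_vac.
have X2 : adjoint_pair X (iK vac) (Phi as_).
  by rewrite -Phi_vac; apply: Xa; exact: adjoint_vac.
have bZ := @Zop_bounded _ _ K; have baZ := adj_bounded bZ.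
have b2 : adjoint_pair (smeared K (iodd Db) b g) (iK vac) bs by exact: adjoint_vac.
have b1 : smeared K (iodd Db) b g (iK vac, FJ_vector K Db b g) by exact: smeared_vac.
have bpar := dser_par qb.1 (FJ_vector_cvs K Keb qb sg).
have bspar := dser_par (quasi_theta qb).1 bsl.
set y := Phi (FJ_vector H Da a f); set z := Phi as_; set bg := FJ_vector K Db b g.
(* Both vectors coming from [b] have its parity, so each [adj Z] contributes the inverse of [zeta];
   collected on one side they give the square of [zeta], which is the sign. *)
suff E : kip (adj Z bg) z = kip y (adj Z bs).
  move: E; rewrite (adjZ_par bpar) (adjZ_par bspar) (ipZl kp) (ipZr kp) => E.
  apply: (mulfI (x := (@zeta R (iodd Db))^-1)); first by rewrite invr_eq0 zeta_neq0.
  rewrite -E -zeta_conj conjCK mulrA -zeta_sqr zeta_conj mulrA mulVf ?zeta_neq0// mul1r.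
  by [].
apply/eqP; rewrite -subr_eq0 -cabs_eq0 eq_le cabs_ge0 andbT; apply/ler_addgt0Pr => e e0.
(* The factor multiplying the approximation errors, made positive. *)
pose M := nm (adj Z bg) + nm (adj Z bs) + 1.
have M0 : 0 < M by rewrite ltr_wpDl// addr_ge0 ?nm_ge0.
have [A [AC Ay Az]] := regularisation Xc (@comm_net_star _ _ K I) XN Xd Xad X1 X2 (divr_gt0 e0 M0).
have bA : bounded_op A := AC.1.
(* The conjugate of [A] moves the pair (vacuum, [b(g)]) along the graph of [Y(b, g)], and the new
   pair is tested against the adjoint at the vacuum. *)
have := net_affiliated (wt_parity (vosaP W) qb.1) sg gI (twisted_comm Ksgl iI AC) b1.
rewrite /= adjZ_vac => /b2.
move=> E0; have E : kip (adj Z bg) (adj A (iK vac)) = kip (A (iK vac)) (adj Z bs).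
  by rewrite -(adjE bA) -(adjE bZ) -E0 (adjE bZ) adjZ_vac.
have -> : kip (adj Z bg) z - kip y (adj Z bs) =
  kip (adj Z bg) (z - adj A (iK vac)) - kip (y - A (iK vac)) (adj Z bs).
  by rewrite (ipBr kp) (ipBl kp) E; ring.
rewrite add0r (le_trans (cabsB _ _))//.
rewrite (le_trans (lerD (cauchy_schwarz kp _ _) (cauchy_schwarz kp _ _)))//.
have h1 : nm (adj Z bg) * nm (z - adj A (iK vac)) <= nm (adj Z bg) * (e / M).
  by rewrite ler_wpM2l ?nm_ge0// ltW.
have h2 : nm (y - A (iK vac)) * nm (adj Z bs) <= nm (adj Z bs) * (e / M).
  by rewrite mulrC ler_wpM2l ?nm_ge0// ltW.
have h3 : M * (e / M) = e by rewrite mulrC divfK// lt0r_neq0.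
have eM : 0 <= e / M by rewrite divr_ge0 ?ltW.
by rewrite -[leRHS]h3 /M !mulrDl mul1r; lra.
Qed.

End NetIsomorphism.

(** * Growth of the norms and one-sided sums *)

Section PochGrowth.
Context {R : realType}.
Local Notation poch := (@poch R).

Lemma pochS (D n : nat) : poch D.+2%:Z n * D.+1%:R = poch D.+1%:Z n * (D.+1 + n)%:R.
Proof.
elim: n => [|n IH]; first by rewrite addn0.
have n0 : n.+1%:R != 0 :> R by rewrite pnatr_eq0.
rewrite /=; have -> : (D.+2%:Z + n%:Z)%:~R = (D.+1 + n.+1)%:R :> R by rewrite addnS -addSn.
have -> : (D.+1%:Z + n%:Z)%:~R = (D.+1 + n)%:R :> R by [].
by rewrite mulrAC [_ * _ * D.+1%:R]mulrAC IH; ring.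
Qed.

Lemma poch_ge0 (D n : nat) : 0 <= poch D%:Z n.
Proof. by elim: n => [|n IH] //=; rewrite divr_ge0 ?mulr_ge0. Qed.

(** Each increase of [D] multiplies by (D + 1 + n) / (D + 1), which is at most n + 1. *)
Lemma poch_growth (D n : nat) : poch D.+1%:Z n <= n.+1%:R ^+ D.
Proof.
elim: D => [|D IH].
  rewrite expr0; elim: n => [|n IH] //=.
  by rewrite (_ : (1%:Z + n%:Z)%:~R = n.+1%:R :> R)// mulfK ?pnatr_eq0.
have D0 : 0 < D.+1%:R :> R by rewrite ltr0n.
rewrite -(ler_pM2r D0) pochS exprSr -mulrA; apply: ler_pM => //; first exact: poch_ge0.
by rewrite -natrM ler_nat; nia.
Qed.

Lemma poch0 n : poch 0 n.+1 = 0.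
Proof. by elim: n => [|n IH]; [rewrite /= addr0 mulr0 mul0r|rewrite [LHS]/= -/(poch 0 n.+1) IH !mul0r]. Qed.

Lemma zsum_pos (E : nmodType) (w : int -> E) L : (forall m, m < 0 -> w m = 0) ->
  \sum_(k < L.*2.+1) w (k%:Z - L%:Z) = \sum_(0 <= n < L.+1) w n%:Z.
Proof.
move=> w0; elim: L => [|L IH]; first by rewrite big_ord1 big_nat1 subr0.
by rewrite zsumS w0 ?add0r// IH [RHS]big_nat_recr.
Qed.

(** When the window does not reach [- D], the truncated subtraction makes the right-hand sum empty,
    as it should be. *)
Lemma zsum_neg (E : nmodType) (w : int -> E) (D L : nat) : (forall m, - D%:Z < m -> w m = 0) ->
  \sum_(k < L.*2.+1) w (k%:Z - L%:Z) = \sum_(0 <= n < (L.+1 - D)%N) w (- n%:Z - D%:Z).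
Proof.
move=> w0; elim: L => [|L IH].
  rewrite big_ord1 subr0; case: D w0 => [|D] w0.
    by rewrite subn0 big_nat1 subr0.
  by rewrite subSS sub0n big_nil w0.
rewrite zsumS (w0 L.+1%:Z) ?addr0 ?IH; last by lia.
have [DL|DL] := leqP D L.+1.
  rewrite (subSn DL) big_nat_recr//= addrC; congr (_ + w _); lia.
rewrite w0; last by lia.
by rewrite add0r; congr (\sum_(0 <= n < _) _); lia.
Qed.

Lemma cvs_shift (E : lmodType R[i]) (ip : E -> E -> R[i]) (u : nat -> E) (x : E) (D : nat) :
  cvs ip u x -> cvs ip (fun L => u (L.+1 - D)%N) x.
Proof.
by move=> ux r /ux[N HN]; exists (N + D)%N => n nN; apply: HN; lia.
Qed.

Lemma conj_pos (x y s c : R[i]) : (s * c)^* * (x * y) = ((x^*) * (y^* * s) * c)^*.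
Proof. by rewrite !rmorphM /= !conjCK; ring. Qed.

Lemma conj_neg (u x y s c : R[i]) : u * (s * c^*)^* * (x * y) = u * ((x^* * s)^* * y * c).
Proof. by rewrite !rmorphM /= !conjCK; ring. Qed.

End PochGrowth.

(** * Matrix elements of [Phi] between the vectors [a^n] and [b^m] *)

Section MatrixElements.
Context {R : realType} {V W : unitaryVosa R} {H : completion V} {K : completion W}.
Variables (Phi : H -> K) (Psi : K -> H).
Hypotheses (iso : net_iso Phi Psi) (Hsgl : strongly_graded_local H) (Ksgl : strongly_graded_local K).
Local Notation iH := (iota_ H).
Local Notation iK := (iota_ K).
Local Notation ip := (sprod (hdot H)).
Local Notation kip := (sprod (hdot K)).
Local Notation nm := (ipnorm kip).
Local Notation thV := (@theta R V).
Local Notation thW := (@theta R W).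
Implicit Types (a : V) (b : W) (n m k l N : nat) (x y z : K) (f g : R[i] -> R[i]).
Let hp : is_ip ip := hipP.
Let kp : is_ip kip := hipP.
Let Heb : energy_bounded V := Hsgl.1.
Let Keb : energy_bounded W := Ksgl.1.

Lemma Phi_dser a b u w N M : kip (Phi (dser H a u N)) (dser K b w M) =
  \sum_(0 <= n < N) \sum_(0 <= m < M) (u n)^* * w m * kip (Phi (iH (divT a n))) (iK (divT b m)).
Proof.
have -> : Phi (dser H a u N) = \sum_(0 <= n < N) u n *: Phi (iH (divT a n)).
  rewrite /dser; elim: N => [|N IH]; first by rewrite !big_nil (Phi0 iso).
  by rewrite !big_nat_recr//= (PhiD iso) (PhiZ iso) IH.
rewrite (ip_suml kp); apply: eq_bigr => n _; rewrite /dser (ip_sumr kp).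
by apply: eq_bigr => m _; rewrite (ipZl kp) (ipZr kp) mulrA.
Qed.

Section Kernel.
Variables (Da Db : nat) (a : V) (b : W).
Hypotheses (qa : quasi Da a) (qb : quasi Db b).

(** Both sides of [local_relation] are antilinear in [f] and in [g]. Their conjugates are linear in
    the Fourier coefficients, and [cpos] and [cneg] are the resulting matrices. *)
Definition cpos n m := (sgn_adj Db * kip (Phi (iH (divT a n))) (iK (divT (thW b) m)))^*.
Definition cneg k l := (-1) ^+ (iodd Db) *
  (sgn_adj Da * kip (iK (divT b l)) (Phi (iH (divT (thV a) k))))^*.

(** The index [n] stands for the coefficient of [f] of index [- n - Da / 2], and
    [m] for that of [g] of index [m + Db / 2]: nonnegative indices come from the
    vectors [a(f)], [b(g)^*], the others from [a(f)^*], [b(g)]. *)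
Definition kernel (n m : int) : R[i] :=
  (if (0 <= n) && (0 <= m) then cpos `|n|%N `|m|%N else 0) -
  (if (n <= - Da%:Z) && (m <= - Db%:Z) then cneg `|(n + Da%:Z)%R|%N `|(m + Db%:Z)%R|%N else 0).

Lemma kernel_bound : exists (C : R) (s : nat), 0 <= C /\
  forall n m : int, cabs (kernel n m) <= C * (`|n|.+1)%:R ^+ s * (`|m|.+1)%:R ^+ s.
Proof.
have [C1 [s1 [C10 H1]]] := divT_growth Heb qa.
have [C2 [s2 [C20 H2]]] := divT_growth Keb (quasi_theta qb).
have [C3 [s3 [C30 H3]]] := divT_growth Keb qb.
have [C4 [s4 [C40 H4]]] := divT_growth Heb (quasi_theta qa).
pose s := (s1 + s2 + s3 + s4)%N.
pose A := cabs (sgn_adj Db : R[i]) * (C1 * C2).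
pose B := cabs (sgn_adj Da : R[i]) * (C3 * C4) * ((Da.+1)%:R ^+ s * (Db.+1)%:R ^+ s).
have A0 : 0 <= A by rewrite !mulr_ge0 ?cabs_ge0.
have B0 : 0 <= B by rewrite !mulr_ge0 ?cabs_ge0 ?exprn_ge0.
have pw i (r : nat) : (r <= s)%N -> (i.+1)%:R ^+ r <= (i.+1)%:R ^+ s :> R.
  by move=> rs; rewrite ler_weXn2l ?ler1n.
have cs (u v : K) (M1 M2 : R) : nm u <= M1 -> nm v <= M2 -> cabs (kip u v) <= M1 * M2.
  move=> h1 h2; rewrite (le_trans (cauchy_schwarz kp _ _))//.
  by apply: ler_pM; rewrite ?nm_ge0.
exists (A + B), s; split=> [|n m]; first by rewrite addr_ge0.
rewrite /kernel (le_trans (cabsB _ _))// -!mulrA mulrDl lerD//.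
  case: ifP => _; last by rewrite cabs0 mulr_ge0// mulr_ge0 ?exprn_ge0.
  rewrite /cpos cabs_conj cabsM /A -!mulrA ler_wpM2l ?cabs_ge0//.
  have -> (x y u v : R) : x * (y * (u * v)) = (x * u) * (y * v) by ring.
  apply: cs; rewrite ?(Phi_nm iso) iota_nm.
    by rewrite (le_trans (H1 _))// ler_wpM2l// pw// /s; lia.
  by rewrite (le_trans (H2 _))// ler_wpM2l// pw// /s; lia.
case: ifP => _; last by rewrite cabs0 mulr_ge0// mulr_ge0 ?exprn_ge0.
rewrite /cneg cabsM cabsX cabsN cabs1 expr1n mul1r cabs_conj cabsM /B -!mulrA ler_wpM2l ?cabs_ge0//.
have -> (x y u v w z : R) : x * (y * (u * (v * (w * z)))) = (x * (v * z)) * (y * (u * w)) by ring.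
have sh i (D : nat) r : (r <= s)%N -> ((`|(i + D%:Z)%R|.+1)%:R : R) ^+ r <= D.+1%:R ^+ s * (`|i|.+1)%:R ^+ s.
  move=> rs; rewrite (le_trans (pw _ _ rs))// -exprMn lerXn2r ?nnegrE ?mulr_ge0// -natrM ler_nat; nia.
apply: cs; rewrite ?(Phi_nm iso) iota_nm.
  by rewrite (le_trans (H3 _))// ler_wpM2l// sh// /s; lia.
by rewrite (le_trans (H4 _))// ler_wpM2l// sh// /s; lia.
Qed.

(** On the second quadrant [n = - k - Da] and [m = - l - Db], whence the shorter truncations
    there. *)
Lemma square_sum f g L (F := fun n : int => fourier f (- (2 * n) - Da%:Z))
    (G := fun m : int => fourier g (2 * m + Db%:Z)) :
  \sum_(k < L.*2.+1) \sum_(l < L.*2.+1)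
    kernel (k%:Z - L%:Z) (l%:Z - L%:Z) * (F (k%:Z - L%:Z) * G (l%:Z - L%:Z)) =
  (kip (Phi (dser H a (fun n => fourier f (- (2 * n)%:Z - Da%:Z)) L.+1))
       (dser K (thW b) (fun n => (fourier g ((2 * n)%:Z + Db%:Z))^* * sgn_adj Db) L.+1))^* -
  (-1) ^+ (iodd Db) *
    (kip (dser K b (fun n => fourier g (- (2 * n)%:Z - Db%:Z)) (L.+1 - Db))
       (Phi (dser H (thV a) (fun n => (fourier f ((2 * n)%:Z + Da%:Z))^* * sgn_adj Da) (L.+1 - Da))))^*.
Proof.
pose w1 (n m : int) := (if (0 <= n) && (0 <= m) then cpos `|n|%N `|m|%N else 0) * (F n * G m).
pose w2 (n m : int) := (if (n <= - Da%:Z) && (m <= - Db%:Z) then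
   cneg `|(n + Da%:Z)%R|%N `|(m + Db%:Z)%R|%N else 0) * (F n * G m).
under eq_bigr do (under eq_bigr do rewrite /kernel mulrBl; rewrite sumrB); rewrite sumrB.
congr (_ - _).
  rewrite (@zsum_pos _ (fun n : int => \sum_(l < L.*2.+1) w1 n (l%:Z - L%:Z))); last first.
    by move=> n n0; rewrite big1// => l _; rewrite /w1 leNgt n0 mul0r.
  rewrite Phi_dser rmorph_sum; apply: eq_bigr => n _.
  rewrite (@zsum_pos _ (w1 n%:Z)); last by move=> m m0; rewrite /w1 [0 <= m]leNgt m0 andbF mul0r.
  rewrite rmorph_sum; apply: eq_bigr => m _; rewrite /w1 /= /cpos /F /G -!PoszM.
  exact: conj_pos.
rewrite (@zsum_neg _ (fun n : int => \sum_(l < L.*2.+1) w2 n (l%:Z - L%:Z)) Da); last first.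
  by move=> n n0; rewrite big1// => l _; rewrite /w2 leNgt n0 mul0r.
rewrite (ipC kp) Phi_dser conjCK mulr_sumr; apply: eq_bigr => k _.
rewrite (@zsum_neg _ (w2 (- k%:Z - Da%:Z)) Db); last first.
  by move=> m m0; rewrite /w2 [m <= _]leNgt m0 andbF mul0r.
rewrite mulr_sumr; apply: eq_bigr => l _; rewrite /w2 ifT; last by lia.
rewrite (_ : `|(- k%:Z - Da%:Z + Da%:Z)%R|%N = k); last by lia.
rewrite (_ : `|(- l%:Z - Db%:Z + Db%:Z)%R|%N = l); last by lia.
rewrite /cneg /F /G (_ : - (2 * (- k%:Z - Da%:Z)) - Da%:Z = (2 * k)%:Z + Da%:Z); last by lia.
rewrite (_ : 2 * (- l%:Z - Db%:Z) + Db%:Z = - (2 * l)%:Z - Db%:Z); last by lia.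
rewrite (ipC kp (Phi (iH (divT (thV a) k))) (iK (divT b l))).
exact: conj_neg.
Qed.

(** With bumps at separated points, [local_relation] makes the square sums tend to 0; up to phases
    in [t] and [t'] they are the sums in [bump_locality]. *)
Lemma kernel_dif_free : exists N, dif_free kernel N.
Proof.
have [C [s [C0 HC]]] := kernel_bound.
have [al alE] := @ex_half Da; have [be' beE'] := @ex_half Db.
pose be := be' - (iodd Db)%:Z; have beE : Db%:Z = 2 * be + (iodd Db)%:Z by rewrite /be; lia.
apply: (@bump_locality R kernel C 1 s al be C0 ltr01 HC) => e /andP[e0 e1] t t' ett h h0.
have p2 := @pi_ge2 R; have ee : 0 < e < pi by rewrite e0 /=; lra.
(* Half the angular distance exceeds [e], so the arc of radius [d] about [t] contains the first bump
   and misses the second. *)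
pose d := `|ang (t' - t)| / 2.
have ed : e < d by rewrite /d; lra.
have dpi : 0 < d < pi.
  have /andP[a1 a2] := @angP R (t' - t).
  have : `|ang (t' - t)| <= pi by rewrite ler_norml a2 ltW.
  by rewrite (lt_trans e0 ed) /d; have := @pi_gt0 R; lra.
pose f := bump (iodd Da) e t; pose g := bump (iodd Db) e t'.
have sf : smooth_par (iodd Da) f by exact: smooth_par_bump.
have sg : smooth_par (iodd Db) g by exact: smooth_par_bump.
have fI : supp f `<=` oarc t d by move=> z /(supp_bump e0); exact: carc_oarc.
have gI : supp g `<=` compl_S1 (oarc t d).
  by move=> z /(supp_bump e0); apply: carc_compl; rewrite /d; lra.
have [as_ asl] := dser_cvs H Heb (quasi_theta qa) (rapid_pos (sgn_adj Da) sf).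
have [bs bsl] := dser_cvs K Keb (quasi_theta qb) (rapid_pos (sgn_adj Db) sg).
have rel := local_relation iso Hsgl Ksgl (le0z_nat Da) (le0z_nat Db) qa qb (interval_oarc t dpi) sf sg fI gI asl bsl.
pose S1 L := kip (Phi (dser H a (fun n => fourier f (- (2 * n)%:Z - Da%:Z)) L.+1))
       (dser K (thW b) (fun n => (fourier g ((2 * n)%:Z + Db%:Z))^* * sgn_adj Db) L.+1).
pose S2 L := kip (dser K b (fun n => fourier g (- (2 * n)%:Z - Db%:Z)) (L.+1 - Db))
       (Phi (dser H (thV a) (fun n => (fourier f ((2 * n)%:Z + Da%:Z))^* * sgn_adj Da) (L.+1 - Da))).
have l1 : cvs (@ipc R) S1 (kip (Phi (FJ_vector H Da a f)) bs).
  apply: (ip_cvs2 kp); last exact: (cvs_sub (k := S) (fun n => leqnSn n) bsl).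
  exact: (cvs_sub (k := S) (fun n => leqnSn n) (Phi_cvs iso (FJ_vector_cvs H Heb qa sf))).
have l2 : cvs (@ipc R) S2 (kip (FJ_vector K Db b g) (Phi as_)).
  apply: (ip_cvs2 kp); first exact: (cvs_shift Db (FJ_vector_cvs K Keb qb sg)).
  exact: (cvs_shift Da (Phi_cvs iso asl)).
have := cvsD (@ipcP R) l1 (cvsZ (@ipcP R) (- (-1) ^+ (iodd Db)) l2).
have -> : kip (Phi (FJ_vector H Da a f)) bs + (- (-1) ^+ iodd Db) *: (kip (FJ_vector K Db b g) (Phi as_) : (R[i])^o) = 0.
  by rewrite rel -[_ *: _]/(_ * _) mulNr subrr.
move=> /(_ h h0)[L0 HL]; exists L0 => L /HL; rewrite nm_ipc sub0r cabsN => hL.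
apply: (le_trans _ (ltW hL)); rewrite le_eqVlt; apply/orP; left; apply/eqP.
have F (n : int) : fourier f (- (2 * n) - Da%:Z) = expi (al%:~R * t) * (bcoef e (- (n + al)) * expi (n%:~R * t)).
  rewrite (_ : - (2 * n) - Da%:Z = 2 * (- (n + al)) + (iodd Da)%:Z); last by clear -alE; lia.
  rewrite fourier_bump//; move: (bcoef _ _) => w.
  rewrite mulrCA -expiD mulrC; congr (_ * expi _).
  by rewrite rmorphN rmorphD /= mulNr opprK mulrDl addrC.
have G (m : int) : fourier g (2 * m + Db%:Z) = expi (- (be%:~R * t')) * (bcoef e (m + be) * expi (- (m%:~R * t'))).
  rewrite (_ : 2 * m + Db%:Z = 2 * (m + be) + (iodd Db)%:Z); last first.
    by move: beE; clearbody be; clear; lia.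
  rewrite fourier_bump//; move: (bcoef _ _) => w.
  rewrite mulrCA -expiD mulrC; congr (_ * expi _).
  by rewrite rmorphD /= mulrDl opprD addrC.
transitivity (cabs (expi (al%:~R * t) * expi (- (be%:~R * t')) * dsum L
  (fun n m : int => kernel n m * (bcoef e (- (n + al)) * bcoef e (m + be))) t t')).
  by rewrite !cabsM !cabs_expi !mul1r.
rewrite -[RHS]cabs_conj; congr cabs.
have -> : (S1 L + (- (-1) ^+ iodd Db) *: (S2 L : (R[i])^o))^* =
   (S1 L)^* - (-1) ^+ iodd Db * (S2 L)^*.
  rewrite -[_ *: _]/(_ * _) rmorphD /= rmorphM /= rmorphN /= rmorphXn /= rmorphN rmorph1 mulNr.
  by [].
rewrite -square_sum /dsum mulr_sumr; apply: eq_bigr => k _; rewrite mulr_sumr; apply: eq_bigr => l _.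
rewrite F G expiD; move: (bcoef _ _) (bcoef _ _) (kernel _ _) => u v w; ring.
Qed.

End Kernel.
End MatrixElements.

(** * The isomorphism restricted to finite energy vectors *)

Section Intertwining.
Context {R : realType}.

Lemma divT_wt0 (V : unitaryVosa R) (a : V) n : wt 0 a -> divT a n.+1 = 0.
Proof.
move=> wa; rewrite /divT iterSr (wt0_T wa).
suff -> : iter n (@transl R V) 0 = 0 by rewrite scaler0.
by elim: n => //= n ->; rewrite linear0.
Qed.

Lemma divT_zero (V : unitaryVosa R) n : divT (0 : V) n = 0.
Proof.
suff E : iter n (@transl R V) 0 = 0 by rewrite /divT E scaler0.
by elim: n => //= n ->; rewrite linear0.
Qed.

Lemma iter_divT (V : unitaryVosa R) (a : V) n : iter n (@transl R V) a = n`!%:R *: divT a n.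
Proof. by rewrite /divT scalerA mulfV ?scale1r// pnatr_eq0 -lt0n fact_gt0. Qed.

Lemma gram_full (V : unitaryVosa R) D E (a b : V) n m : quasi D a -> quasi E b ->
  sprod (vdot V) (divT a n) (divT b m) =
  if (n == m) && (D == E) then ((@poch R D n)%:C)%C * sprod (vdot V) a b else 0.
Proof.
move=> qa qb; have [h|h] := leqP m n.
  rewrite (gram qb qa.2 h); case: eqP => [->|//] /=.
  case: eqP => [->//|/eqP DE]; by rewrite (wt_orth qa.1 qb.1 DE) mulr0.
rewrite (ipC (vipP V)) (gram qa qb.2 (ltnW h)) ifF ?rmorph0; last by rewrite eq_sym ltn_eqF.
by rewrite ltn_eqF.
Qed.

Context {V W : unitaryVosa R} {H : completion V} {K : completion W}.
Variables (Phi : H -> K) (Psi : K -> H).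
Hypotheses (iso : net_iso Phi Psi) (Hsgl : strongly_graded_local H) (Ksgl : strongly_graded_local K).
Local Notation iH := (iota_ H).
Local Notation iK := (iota_ K).
Local Notation ip := (sprod (hdot H)).
Local Notation kip := (sprod (hdot K)).
Local Notation wip := (sprod (vdot W)).
Local Notation nm := (ipnorm kip).
Local Notation thW := (@theta R W).
Local Notation TV := (@transl R V).
Local Notation TW := (@transl R W).
Implicit Types (a v : V) (b w : W) (n m k l N : nat) (x y z : K) (f g : R[i] -> R[i]).
Let hp : is_ip ip := hipP.
Let kp : is_ip kip := hipP.
Let Heb : energy_bounded V := Hsgl.1.
Let Keb : energy_bounded W := Ksgl.1.

Lemma sgn_neq0 (D : int) : sgn_adj D != 0 :> R[i].
Proof. by apply/eqP => h; have := @sgn_adj_sqr R D; rewrite h mul0r => /eqP; rewrite eq_sym oner_eq0. Qed.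

(** The kernel is taken for [theta b], because [cpos] pairs with [theta] of its last argument.
    Weight 0 is treated apart: there [a^n = 0] for positive [n], so the kernel lives on one line and
    [kernel_zero] replaces the count of zeros. *)
Lemma matrix_nat (Da Db : nat) a b n m : quasi Da a -> quasi Db b ->
  kip (Phi (iH (divT a n))) (iK (divT b m)) =
  if (n == m) && (Da == Db) then ((@poch R Da n)%:C)%C * kip (Phi (iH a)) (iK b) else 0.
Proof.
move=> qa qb; have qtb := quasi_theta qb.
have thK (u : W) : thW (thW u) = u by exact: (theta_invol (unitaryP W)).
pose ka := kernel Phi Da Db a (thW b).
have [N kN] : exists N, dif_free ka N by apply: (kernel_dif_free iso Hsgl Ksgl qa qtb).
have Phi_zero : Phi (iH 0) = 0 by rewrite linear0 (Phi0 iso).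
have cposE i j : cpos Phi Db a (thW b) i j = 0 -> kip (Phi (iH (divT a i))) (iK (divT b j)) = 0.
  rewrite /cpos thK => /eqP; rewrite conjC_eq0 mulf_eq0 (negbTE (sgn_neq0 _)) /=.
  by move/eqP.
case: Da Db qa qb qtb @ka kN cposE => [|Da] [|Db] qa qb qtb ka kN cposE.
- case: n => [|n]; last by rewrite (divT_wt0 _ qa.1) Phi_zero (ip0l kp) poch0 mul0r if_same.
  case: m => [|m]; last by rewrite (divT_wt0 _ qb.1) linear0 (ip0r kp).
  by rewrite !divT0 mul1r.
- rewrite andbF; case: n => [|n]; last by rewrite (divT_wt0 _ qa.1) Phi_zero (ip0l kp).
  apply: cposE; rewrite -[RHS](kernel_zero kN _ m) /ka /kernel /=.
    by rewrite subr0.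
  move=> i j; rewrite /kernel /cpos /cneg => i0.
  case: i i0 => [[|i]//|i] _; rewrite /= ?addr0.
    by rewrite (divT_wt0 _ qa.1) Phi_zero (ip0l kp) mulr0 rmorph0; case: ifP; rewrite subrr.
  rewrite (divT_wt0 _ (quasi_theta qa).1) Phi_zero (ip0r kp) mulr0 rmorph0 mulr0.
  by case: ifP; rewrite subrr.
- rewrite andbF; case: m => [|m]; last by rewrite (divT_wt0 _ qb.1) linear0 (ip0r kp).
  apply: cposE; rewrite -[RHS](kernel_zero (dif_free_tr kN) _ n) /ka /kernel /=.
    by rewrite subr0.
  move=> j i; rewrite /kernel /cpos /cneg => j0.
  case: j j0 => [[|j]//|j] _; rewrite /= ?addr0 ?andbF ?andbT.
    rewrite thK (divT_wt0 _ qb.1) linear0 (ip0r kp) mulr0 rmorph0.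
    by case: ifP; rewrite ?sub0r ?oppr0.
  rewrite (divT_wt0 _ qtb.1) linear0 (ip0l kp) mulr0 rmorph0 mulr0.
  by case: ifP; rewrite subrr.
have kE (i j : nat) : ka i j = cpos Phi Db.+1 a (thW b) i j by rewrite /ka /kernel /= subr0.
(* The constant of the Cauchy-Schwarz bound once the norms of [a^n] and [b^m] are expressed by
   [poch]. *)
pose C := cabs (sgn_adj Db.+1 : R[i]) ^+ 2 * (ipnorm (sprod (vdot V)) a ^+ 2 * ipnorm wip b ^+ 2).
have C0 : 0 <= C by rewrite !mulr_ge0 ?exprn_ge0 ?cabs_ge0 ?nm_ge0.
have ks : kernel_supp ka Da.+1 Db.+1.
  by move=> i j h1 h2; rewrite /ka /kernel (negbTE h1) (negbTE h2) subrr.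
have kg : kernel_growth ka Da.+1 Db.+1 C.
  move=> i j; rewrite kE /cpos thK cabs_conj cabsM exprMn /C /=.
  have -> (s c u v x y : R) : (s ^+ 2 * c ^+ 2 <= s ^+ 2 * (u * v) * x * y) =
      (s ^+ 2 * c ^+ 2 <= s ^+ 2 * ((x * u) * (y * v))) by congr (_ <= _); ring.
  rewrite ler_wpM2l ?exprn_ge0 ?cabs_ge0//.
  apply: (@le_trans _ _ ((nm (Phi (iH (divT a i))) * nm (iK (divT b j))) ^+ 2)).
    by apply: lerXn2r; rewrite ?nnegrE ?mulr_ge0 ?cabs_ge0 ?nm_ge0//; exact: cauchy_schwarz.
  rewrite exprMn (Phi_nm iso) !iota_nm (nm_divT _ qa) (nm_divT _ qb).
  have p1 := @poch_growth R Da i; have p2 := @poch_growth R Db j.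
  have q1 := @poch_ge0 R Da.+1 i; have q2 := @poch_ge0 R Db.+1 j.
  by apply: ler_pM; rewrite ?mulr_ge0 ?exprn_ge0 ?nm_ge0// ler_wpM2r ?exprn_ge0 ?nm_ge0.
case: ifPn => [/andP[/eqP <- /eqP [DE]]|nm'].
  move: ks kg; rewrite -DE => ks kg.
  have := kernel_diag C0 kN ks kg (ltn0Sn _) n; rewrite !kE /cpos thK !divT0.
  move=> /(congr1 (fun c => c^*)); rewrite conjCK rmorphM /= conjCR conjCK mulrCA.
  by move/(mulfI (sgn_neq0 _)).
apply: cposE; rewrite -kE; apply: (kernel_offdiag C0 kN ks kg) => //.
by rewrite -negb_and.
Qed.

Lemma matrix D E a b n m : quasi D a -> quasi E b ->
  kip (Phi (iH (divT a n))) (iK (divT b m)) =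
  if (n == m) && (D == E) then ((@poch R D n)%:C)%C * kip (Phi (iH a)) (iK b) else 0.
Proof.
have Phi_zero : Phi (iH 0) = 0 by rewrite linear0 (Phi0 iso).
case: D => [D|D] qa; last first.
  by rewrite (wt_neg _ qa.1)// divT_zero Phi_zero !(ip0l kp) mulr0 if_same.
case: E => [E|E] qb; last first.
  by rewrite [b](wt_neg _ qb.1)// divT_zero linear0 (ip0r kp) andbF.
exact: matrix_nat.
Qed.

Lemma Phi_divT D a n : quasi D a ->
  exists2 w, wt (D + 2 * n%:Z) w & Phi (iH (divT a n)) = iK w.
Proof.
move=> qa; set x := Phi _; set D' := D + 2 * n%:Z; apply: fin_weight => E v ED wv.
(* [v'] stands for the component of weight [D'] of [v], in a form that is linear in [v] and can be
   tested on the [b^m]. For [v] of another weight [v'] is orthogonal to itself, hence 0. *)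
pose Q (v : W) := exists v' : W, [/\ wt D' v', kip x (iK (v - v')) = 0 &
  forall u, wt D' u -> wip u (v - v') = 0].
have wp := vosaP W.
have Qs : subspace Q.
  split=> [|c u u' [v1 [w1 x1 o1]] [v2 [w2 x2 o2]]].
    exists 0; split; [exact: wt0|by rewrite subr0 linear0 (ip0r kp)|].
    by move=> u _; rewrite subr0 (ip0r (vipP W)).
  have E' : c *: u + u' - (c *: v1 + v2) = c *: (u - v1) + (u' - v2).
    by rewrite scalerBr opprD addrACA.
  exists (c *: v1 + v2); split.
  - exact: wt_lin.
  - by rewrite E' linearP (ipDr kp) (ipZr kp) x1 x2 mulr0 addr0.
  - by move=> t wt_t; rewrite E' (ipDr (vipP W)) (ipZr (vipP W)) o1// o2// mulr0 addr0.
have : Q v.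
  apply: (qp_span Qs) => F b m qb; rewrite iter_divT; apply: (subspaceZ Qs).
  have wb := wt_divT m qb.1.
  have [e|e] := eqVneq (F + 2 * m%:Z) D'.
    exists (divT b m); split; [by rewrite -e|by rewrite subrr linear0 (ip0r kp)|].
    by move=> u _; rewrite subrr (ip0r (vipP W)).
  exists 0; split; first exact: wt0.
    rewrite subr0 (matrix _ _ qa qb) ifF//; apply/negbTE; apply: contra e.
    by move=> /andP[/eqP <- /eqP <-].
  by move=> u wu; rewrite subr0; apply: (wt_orth wu wb); rewrite eq_sym.
move=> [v' [wv' xv o]].
have h : wip v' v' = 0.
  have := o v' wv'; rewrite (ipBr (vipP W)) (wt_orth wv' wv) ?sub0r; last by rewrite eq_sym.
  by move/eqP; rewrite oppr_eq0 => /eqP.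
by move: xv; rewrite (ip_eq0 (vipP W) h) subr0.
Qed.

Lemma ex_phi : exists phi : V -> W, forall v, iK (phi v) = Phi (iH v).
Proof.
suff /choice[phi h] : forall v, exists w, iK w = Phi (iH v) by exists phi.
pose Q v := exists w, iK w = Phi (iH v).
have Qs : subspace Q.
  split=> [|c u v [w1 h1] [w2 h2]]; first by exists 0; rewrite !linear0 (Phi0 iso).
  by exists (c *: w1 + w2); rewrite !linearP h1 h2 (PhiD iso) (PhiZ iso).
move=> v; apply: (qp_span Qs) => D a n qa; rewrite iter_divT; apply: (subspaceZ Qs).
by have [w _ h] := Phi_divT n qa; exists w.
Qed.

Lemma net_iso_sym : net_iso Psi Phi.
Proof.
split; [exact: Psi_lin iso| | | |].
- by split; [exact: PsiK iso|exact: PhiK iso].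
- exact: Psi_ip iso.
- by rewrite -(Phi_vac iso) (PhiK iso).
- move=> I iI; apply/seteqP; split=> [A HA|_ [B HB <-]].
    exists (Phi \o A \o Psi); first by apply/(net_conj iso iI); exists A.
    by apply/funext => u; rewrite /= !(PhiK iso).
  have /(net_conj iso iI)[C HC E] := HB.
  suff -> : Psi \o B \o Phi = C by [].
  by apply/funext => u; rewrite E /= !(PhiK iso).
Qed.

Lemma iota_inj (X : unitaryVosa R) (L : completion X) : injective (iota_ L).
Proof.
move=> u v h; apply/eqP; rewrite -subr_eq0; apply/eqP; apply: (nm_eq0 (vipP X)).
by rewrite -(iota_nm L) linearB h subrr (nm0 hipP).
Qed.

Section Phi.
Variable phi : V -> W.
Hypothesis phiE : forall v, iK (phi v) = Phi (iH v).
Let vp := vosaP V.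
Let wp := vosaP W.

Lemma phi_lin : linear phi.
Proof. by move=> c u v; apply: (@iota_inj W K); rewrite linearP !phiE linearP (PhiD iso) (PhiZ iso). Qed.

Lemma phi0 : phi 0 = 0.
Proof. by apply: (@iota_inj W K); rewrite phiE !linear0 (Phi0 iso). Qed.

Lemma phiZ (c : R[i]) v : phi (c *: v) = c *: phi v.
Proof. by have := phi_lin c v 0; rewrite phi0 !addr0. Qed.

Lemma phi_sub (P : V -> V) (Q : W -> W) : linear P -> linear Q ->
  subspace [set v | phi (P v) = Q (phi v)].
Proof.
move=> lP lQ; have P0 : P 0 = 0 by have := lP (-1) 0 0; rewrite scaler0 addr0 scaleN1r addNr.
have Q0 : Q 0 = 0 by have := lQ (-1) 0 0; rewrite scaler0 addr0 scaleN1r addNr.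
split=> [|c u v /= hu hv]; first by rewrite /= P0 phi0 Q0.
by rewrite /= lP !phi_lin lQ hu hv.
Qed.

(** Against [T^m b], L_1 becomes one more [T], and [matrix] gives 0 because the indices 0 and
    [m + 1] differ. *)
Lemma phi_quasi D a : quasi D a -> quasi D (phi a).
Proof.
move=> qa; split.
  have [w ww h] := Phi_divT 0 qa; rewrite mulr0 addr0 in ww.
  suff -> : phi a = w by []. 
  by apply: (@iota_inj W K); rewrite phiE -h divT0.
apply: (ip_eq0 (vipP W)); move: {2}(Lop 1 (phi a)) => c.
pose Q c := wip (Lop 1 (phi a)) c = 0.
have Qs : subspace Q.
  split=> [|k u v h1 h2]; rewrite /Q ?(ip0r (vipP W))//.
  by rewrite (ipDr (vipP W)) (ipZr (vipP W)) h1 h2 mulr0 addr0.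
apply: (qp_span Qs) => E b m qb; rewrite /Q L_adj -(translE wp) -iterS iter_divT (ipZr (vipP W)).
rewrite -(iota_ip K) phiE; have := matrix 0 m.+1 qa qb; rewrite divT0 => ->.
by rewrite mulr0.
Qed.

(** Both vectors have the same pairings with all [b^m]: [matrix] computes one side and [gram_full]
    the other. *)
Lemma phi_divT D a n : quasi D a -> phi (divT a n) = divT (phi a) n.
Proof.
move=> qa; have qa' := phi_quasi qa; apply/eqP; rewrite -subr_eq0; apply/eqP.
apply: (ip_eq0 (vipP W)); move: {2}(_ - _) => c.
pose Q c := wip (phi (divT a n) - divT (phi a) n) c = 0.
have Qs : subspace Q.
  split=> [|k u v h1 h2]; rewrite /Q ?(ip0r (vipP W))//.
  by rewrite (ipDr (vipP W)) (ipZr (vipP W)) h1 h2 mulr0 addr0.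
apply: (qp_span Qs) => E b m qb; rewrite iter_divT; apply: (subspaceZ Qs).
rewrite /Q (ipBl (vipP W)) (gram_full _ _ qa' qb) -!(iota_ip K) !phiE (matrix _ _ qa qb).
by rewrite subrr.
Qed.

Lemma phi_iter D a n : quasi D a -> phi (iter n TV a) = iter n TW (phi a).
Proof. by move=> qa; rewrite !iter_divT phiZ (phi_divT _ qa). Qed.

Lemma phi_T v : phi (TV v) = TW (phi v).
Proof.
apply: (qp_span (phi_sub (P := TV) (Q := TW) _ _)) => [c x y|c x y|D a n qa]; rewrite ?linearP//=.
by rewrite -iterS !(phi_iter _ qa).
Qed.

Lemma wt_iter_phi D a n : quasi D a -> wt (D + 2 * n%:Z) (phi (iter n TV a)).
Proof. by move=> qa; rewrite (phi_iter _ qa); apply: wt_transl (phi_quasi qa).1. Qed.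

Lemma Lop_lin (X : vosaData R) (k : int) : linear (@Lop R X k).
Proof. by move=> c u v; rewrite LopD LopZ. Qed.

Lemma phi_L0 v : phi (Lop 0 v) = Lop 0 (phi v).
Proof.
apply: (qp_span (phi_sub (@Lop_lin V 0) (@Lop_lin W 0))) => D a n qa /=.
by rewrite (wt_transl vp n qa.1) phiZ (wt_iter_phi n qa).
Qed.

Lemma phi_L1 v : phi (Lop 1 v) = Lop 1 (phi v).
Proof.
apply: (qp_span (phi_sub (@Lop_lin V 1) (@Lop_lin W 1))) => D a n qa /=.
have qa' := phi_quasi qa; rewrite (phi_iter _ qa).
case: n => [|n]; first by rewrite /= qa.2 qa'.2 phi0.
by rewrite (L1_transl vp _ qa.1 qa.2) (L1_transl wp _ qa'.1 qa'.2) phiZ (phi_iter _ qa).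
Qed.

Lemma phi_Gam v : phi (Gam v) = Gam (phi v).
Proof.
apply: (qp_span (phi_sub (P := Gam) (Q := Gam) _ _)) => [c x y|c x y|D a n qa]; rewrite ?linearP//=.
have w1 := wt_parity vp (wt_transl vp n qa.1).
have w2 := wt_parity wp (wt_iter_phi n qa).
by rewrite w1 phiZ w2.
Qed.

Lemma phi_wt D v : wt D v -> wt D (phi v).
Proof. by move=> wv; rewrite /wt -phi_L0 wv phiZ. Qed.

(** For every angle [t], [FJ_smeared] and [FJ_transport] carry the field smeared with a bump at [t]
    from [H] to [K]. The difference of the two mode expansions is then a trigonometric series in [t]
    with sum 0 on the whole circle, so each term vanishes. *)
Lemma phi_hmode D a (m : int) v : quasi D a -> phi (hmode D a m v) = hmode D (phi a) m (phi v).
Proof.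
move=> qa; have qa' := phi_quasi qa.
have [D0|D0] := lerP 0 D; last by rewrite (wt_neg D0 qa.1) phi0 !hmode0 phi0.
move: v; apply: (wt_span vp) => [|u v hu hv|E v wv].
- have h0 (X : unitaryVosa R) (c : X) : hmode D c m 0 = 0.
    by have := hmodeP D c m (-1) 0 0; rewrite scaler0 addr0 scaleN1r addNr.
  by rewrite phi0 !h0 phi0.
- have hD (X : unitaryVosa R) (c u' v' : X) : hmode D c m (u' + v') = hmode D c m u' + hmode D c m v'.
    by have := hmodeP D c m 1 u' v'; rewrite !scale1r.
  have pD (u' v' : V) : phi (u' + v') = phi u' + phi v' by have := phi_lin 1 u' v'; rewrite !scale1r.
  by rewrite hD !pD hD hu hv.
have [pm|pm] := boolP (iodd m == iodd D); last first.
  have md : iodd (m + D) by rewrite ioddD; case: (iodd m) (iodd D) pm => [] [].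
  by rewrite /hmode md phi0.
pose jj (i : int) := ((i - (iodd D)%:Z) %/ 2)%Z.
have jjE i : iodd i == iodd D -> i = 2 * jj i + (iodd D)%:Z.
  move=> h; have /ioddP[k hk] : iodd (i - (iodd D)%:Z) = false.
    by rewrite ioddD (eqP h); case: (iodd D).
  by rewrite /jj hk mulKz//; lia.
have d2 : 0 < 2^-1 :> R by rewrite invr_gt0.
(* Width at most 1/2 keeps the bump inside the arc of radius 1, and the coefficient of the mode [m]
   can be divided out. *)
have [e [ee e1 eb]] := bcoef_neq0 (jj m) d2.
pose diff (i : int) := iK (phi (mode a i v) - mode (phi a) i (phi v)).
pose w (i : int) : K := if iodd i == iodd D then bcoef e (jj i) *: diff i else 0.
have p2 := @pi_ge2 R; have /andP[ep _] := ee.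
have sf t : smooth_par (iodd D) (bump (iodd D) e t) by exact: smooth_par_bump.
have smE t i : Phi (smterm H (iodd D) a (bump (iodd D) e t) v i) -
    smterm K (iodd D) (phi a) (bump (iodd D) e t) (phi v) i = expi (- ((jj i)%:~R * t)) *: w i.
  rewrite /smterm /w; case: ifP => [ip|_]; last by rewrite (Phi0 iso) subrr scaler0.
  rewrite (PhiZ iso) -phiE -scalerBr -linearB scalerA; congr (_ *: _).
  by rewrite {1}(jjE i ip) fourier_bump.
have [C1 [k1 [C10 H1]]] := smterm_decay H Heb a (sf 0).
have [C2 [k2 [C20 H2]]] := smterm_decay K Keb (phi a) (sf 0).
pose B1 := C1 * (`|E|.+1)%:R ^+ k1 * ipnorm (sprod (vdot V)) v.
pose B2 := C2 * (`|E|.+1)%:R ^+ k2 * ipnorm wip (phi v).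
have wB i : nm (w i) * (`|i|.+1)%:R ^+ 2 <= B1 + B2.
  have := smE 0 i; rewrite mulr0 oppr0 expi0 scale1r => <-.
  rewrite (le_trans (ler_wpM2r _ (nmB kp _ _)))// ?exprn_ge0// mulrDl (Phi_nm iso) lerD//.
    exact: H1.
  exact: (H2 _ _ (phi_wt wv)).
have B0 : 0 <= B1 + B2 by apply: le_trans (wB 0); rewrite mulr_ge0 ?nm_ge0 ?exprn_ge0.
have wn i : w i != 0 -> iodd i == iodd D by rewrite /w; case: ifP => //; rewrite eqxx.
have h : w m = 0.
  apply: (@ssum_unique R K kip kp w jj (B1 + B2) B0 wB) => [i /wn/jjE|i i' /wn/jjE h1 /wn/jjE h2 h3|t].
  - by move: (jj i) => k; clear => ->; case: (iodd D); lia.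
  - by rewrite h1 h3 -h2.
  have d1 : 0 < (1 : R) < pi by rewrite ltr01; lra.
  have iI := interval_oarc t d1.
  have [y [yl ys]] := smeared_ex H Heb a v (sf t).
  have [z [zl zs]] := smeared_ex K Keb (phi a) (phi v) (sf t).
  have fI : supp (bump (iodd D) e t) `<=` oarc t 1.
    by move=> x /(supp_bump ep); apply: carc_oarc; lra.
  have FH := FJ_smeared Hsgl iI D0 qa (sf t) fI.
  have FK := FJ_smeared Ksgl iI D0 qa' (sf t) fI.
  rewrite -FH in ys.
  have aa n : Phi (iH (divT a n)) = iK (divT (phi a) n) by rewrite -phiE (phi_divT _ qa).
  have := FJ_transport iso Hsgl Ksgl iI aa qa qa' (sf t) ys; rewrite FK -phiE => ys'.
  have zy := smeared_single Keb qa' (sf t) zs ys'.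
  have := cvsD kp (Phi_cvs iso yl) (cvsZ kp (-1) zl); rewrite zy scaleN1r subrr.
  apply: cvs_ext => N; rewrite /= scaleN1r /ssum (big_morph Phi (PhiD iso) (Phi0 iso)) -sumrB.
  by apply: eq_bigr => i _; rewrite -smE.
move: h; rewrite /w pm => /eqP; rewrite scaler_eq0 (negbTE eb) /= => /eqP h.
have := @iota_inj W K (phi (mode a m v) - mode (phi a) m (phi v)) 0.
rewrite linear0 => /(_ h) /eqP; rewrite subr_eq0 => /eqP.
by rewrite (modeE _ _ qa.1) (modeE _ _ qa'.1).
Qed.

Lemma phi_nprod_quasi D a (k : int) v : quasi D a -> phi (nprod a k v) = nprod (phi a) k (phi v).
Proof.
move=> qa; have := phi_hmode (2 * (k + 1) - D) v qa; rewrite /hmode subrK iodd_double mulKz//.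
by rewrite addrK.
Qed.

(** [nprod_transl] extends the quasi-primary case to the vectors [T^n b], which span. *)
Lemma phi_nprod a (k : int) v : phi (nprod a k v) = nprod (phi a) k (phi v).
Proof.
pose Q a := forall (k : int) v, phi (nprod a k v) = nprod (phi a) k (phi v).
suff h : Q a by exact: h.
have Qs : subspace Q.
  split=> [|c u u' h1 h2] i x; first by rewrite phi0 (nprod0l vp) (nprod0l wp) phi0.
  by rewrite phi_lin !(nprod_linear vp, nprod_linear wp) phi_lin h1 h2.
apply: (qp_span Qs) => D b n qb; elim: n => [|n IH] i x; first exact: phi_nprod_quasi qb.
by rewrite iterS phi_T (nprod_transl vp) (nprod_transl wp) -scaleNr -scaleNr phiZ IH.
Qed.

(** The product of index 1 with [nu - phi nu] vanishes because [phi] is onto and intertwines L_0;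
    this is the decisive assumption of [nu_unique]. *)
Lemma phi_nu (psi : W -> V) : cancel psi phi -> phi nu = nu.
Proof.
move=> psiK; apply/eqP; rewrite eq_sym -subr_eq0; apply/eqP.
apply: (nu_unique wp).
- by rewrite /parity linearB -phi_Gam (nu_even vp) (nu_even wp) expr0 !scale1r.
- by apply: wtB; [exact: wt_nu|apply: phi_wt; exact: wt_nu].
- by rewrite LopB -phi_L1 (L1_nu vp) (L1_nu wp) phi0 subrr.
- move=> b; rewrite (nprodBl wp) -[b]psiK -phi_nprod.
  by have := phi_L0 (psi b); rewrite /Lop add0r => ->; rewrite subrr.
- by move=> u; exact: wt0_T.
- by move=> D u; exact: wt_neg.
Qed.

End Phi.
End Intertwining.

Theorem net_iso_vosa_iso (R : realType) (V W : unitaryVosa R) (H : completion V) (K : completion W)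
    (Phi : H -> K) (Psi : K -> H) :
  net_iso Phi Psi -> strongly_graded_local H -> strongly_graded_local K ->
  exists phi : V -> W, vosa_iso phi /\ forall a : V, iota_ K (phi a) = Phi (iota_ H a).
Proof.
move=> iso Hs Ks; have iso' := net_iso_sym iso.
have [phi phiE] := ex_phi iso Hs Ks; have [psi psiE] := ex_phi iso' Ks Hs.
have k1 : cancel phi psi by move=> v; apply: (@iota_inj _ V H); rewrite psiE phiE (PhiK iso).
have k2 : cancel psi phi by move=> v; apply: (@iota_inj _ W K); rewrite phiE psiE (PsiK iso).
exists phi; split=> //; split; [by move=> c u v; apply: (phi_lin iso phiE)|by exists psi|split].
- exact: (phi_Gam iso Hs Ks phiE).
- by apply: (@iota_inj _ W K); rewrite phiE (Phi_vac iso).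
- exact: (phi_T iso Hs Ks phiE).
- exact: (phi_nprod iso Hs Ks phiE).
- exact: (phi_nu iso Hs Ks phiE k2).
Qed.

Theorem theorem8p8 (R : realType) (V : unitaryVosa R) (H : completion V)
    (Vsimple : simple_vosa V) (Vsgl : strongly_graded_local H) :
  (forall (D : int) (a : V), quasi_primary D a ->
   forall p : bool, parity p a ->
   forall I : set R[i], interval_S1 I ->
   forall f : R[i] -> R[i], smooth_par p f -> supp f `<=` I ->
     FJ H I D a f = smeared H p a f) /\
  range (iota_ H) = Hfin H /\
  (forall (W : unitaryVosa R) (K : completion W),
   simple_vosa W -> strongly_graded_local K ->
   forall (Phi : H -> K) (Psi : K -> H), net_iso Phi Psi ->
   exists phi : V -> W, vosa_iso phi /\
     forall a : V, iota_ K (phi a) = Phi (iota_ H a)).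
Proof.
split=> [D a [[a0 wa] a1] p pa I iI f sf fI|].
  have pD : p = iodd D by exact: parity_unique pa (wt_parity (vosaP V) wa) a0.
  rewrite pD in pa sf *.
  exact: (FJ_smeared Vsgl iI (wt_ge0 wa a0) (conj wa a1) sf fI).
split; first exact: range_iota.
by move=> W K _ Wsgl Phi Psi iso; exact: net_iso_vosa_iso iso Vsgl Wsgl.
Qed.
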